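(* Let $(M,g)$ be a compact $\mathcal{X}$-conformally flat Lorentzian surface equipped with a Spin structure $(Q,f)$. Let $\delta_+=\dim\mathfrak{H}_+$ and $\tau_-=\dim\mathfrak{T}_-$ be the dimensions of the spaces of positive harmonic spinors and negative twistor spinors. Then $\delta_+=\tau_-$, and the only possible values of $\delta_+$ are $0$, $1$ and $+\infty$. These cases are characterized as follows: (i) $\delta_+\le 1$ if and only if at least one of the following holds: (a) there exists a dense $\mathcal{X}$-line on $M$, in which case $\delta_+=0$ for the non-trivial Spin structures; (b) $M$ is non-resonant; (c) there exists no $\mathcal{X}$-trivial resonant cylinder on $M$. Furthermore, in this case one has $\delta_+=1$ for the trivial Spin structure. (ii) $\delta_+=+\infty$ if and only if there exists an $\mathcal{X}$-trivial resonant cylinder on $M$. In this case $\delta_+=+\infty$ for every Spin structure.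
   Context: A Lorentzian surface $(M,g)$ is a smooth connected oriented $2$-manifold with a metric of signature $(1,1)$; in an orthonormal basis $(s_1,s_2)$ the vector $s_1$ is timelike ($g(s_1,s_1)=-1$) and $s_2$ is spacelike ($g(s_2,s_2)=1$). The light cone consists of two one-dimensional lightlike distributions $\mathcal{X},\mathcal{Y}$: a lightlike vector $v$ lies in $\mathcal{X}$ iff there is a lightlike $w$ such that $(v,w)$ is an oriented basis and $v+w$ is spacelike; the other distribution is $\mathcal{Y}$. For an oriented orthonormal frame $s=(s_1,s_2)$ put $X_s=s_1+s_2$ (in $\mathcal{X}$) and $Y_s=-s_1+s_2$ (in $\mathcal{Y}$). An $\mathcal{X}$-line is a maximal integral curve of $\mathcal{X}$. $(M,g)$ is time-orientable if it admits a nowhere vanishing timelike vector field (equivalently a global orthonormal frame). A time-orientable $(M,g)$ is $\mathcal{X}$-conformally flat if there is a global orthonormal frame $s$ with $\mathrm{div}(X_s)=0$. A compact Lorentzian surface is a torus, and each $\mathcal{X}$-line is either dense, closed (homeomorphic to $S^1$ and not null-homotopic), or an asymptotic of a closed $\mathcal{X}$-line (a non-closed line accumulating on a closed one). For closed $\mathcal{X}$-lines $l_1,l_2$, the connected components of $M\setminus(l_1\cup l_2)$ are open cylinders, denoted $C_{l_1l_2}$, with closure $C_{l_1l_2}\cup l_1\cup l_2$; if $l_1=l_2$ the closure is all of $M$, so that $M$ itself is viewed as a closed cylinder. A cylinder $C_{l_1l_2}$ is non-resonant if for any two closed $\mathcal{X}$-lines $\tilde l_1,\tilde l_2$ in the closure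 of $C_{l_1l_2}$ there is an asymptotic $\mathcal{X}$-line in $C_{\tilde l_1\tilde l_2}$; $M$ is non-resonant if it is so when viewed as such a cylinder. A closed cylinder $R_{l_1l_2}=\overline{C_{l_1l_2}}$ not consisting of a single $\mathcal{X}$-line is resonant if the $\mathcal{X}$-line through each of its points is closed. $Q$ is $\mathcal{X}$-trivial along a closed $\mathcal{X}$-line $l$ if parallel transport in $Q$ (with respect to the lifted Levi-Civita connection) once around $l$ is the identity on each fibre over $l$. A resonant cylinder $R$ is $\mathcal{X}$-trivial if $Q$ is $\mathcal{X}$-trivial along every closed $\mathcal{X}$-line in $R$. Spin structures $(Q,f)$ are lifts of the oriented orthonormal frame bundle $P$ to the Spin group; for time-orientable $M$ the trivial Spin structure is $M\times Spin_+(1,1)$ with $f_0=\mathrm{id}\times\lambda$, relative to a trivialization $P\cong M\times SO_+(1,1)$ given by a global frame; a Spin structure is non-trivial if it is not isomorphic to this one. The spinor bundle $S=Q\times_{Spin}\Delta_{1,1}$, $\Delta_{1,1}=\mathbb{C}^2$, uses the Clifford representation $e_1\mapsto\begin{pmatrix}0&i\\-i&0\end{pmatrix}$, $e_2\mapsto\begin{pmatrix}0&i\\i&0\end{pmatrix}$ (so $v\cdot v=-g(v,v)$). $S^{+}$ and $S^{-}$ are the eigenbundles of $\omega=s_1\cdot s_2$ for the eigenvalues $-1$ and $+1$ respectively. With $\nabla^S$ the spinor connection induced by the Levi-Civita connection, the Dirac operator is $D\varphi=-s_1\cdot\nabla^S_{s_1}\varphi+s_2\cdot\nabla^S_{s_2}\varphi$.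 A spinor $\varphi$ is harmonic if $D\varphi=0$, and twistor if $\nabla^S_V\varphi=-\tfrac12V\cdot D\varphi$ for all vector fields $V$. $\mathfrak{H}_\pm$ and $\mathfrak{T}_\pm$ are the complex vector spaces of smooth harmonic, respectively twistor, sections of $S^\pm$.
   Formalization: ''In this case δ₊=+∞ for every Spin structure'' and ''in this case δ₊=1 for the trivial Spin structure'' are stated for each Spin structure that itself satisfies the case; carrying the case over from another Spin structure fails on a flat torus with closed X-lines. *)

(* Defs.v *)
From HB Require Import structures.
From mathcomp Require Import all_boot all_order all_algebra.
From mathcomp Require Import all_classical all_reals all_analysis.
From mathcomp.real_closed Require Import complex.

Set Implicit Arguments.
Unset Strict Implicit.
Unset Printing Implicit Defensive.

Import Order.TTheory GRing.Theory Num.Theory.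
Import numFieldNormedType.Exports.

Local Open Scope classical_set_scope.
Local Open Scope ring_scope.

(** * Smooth maps between normed spaces *)

Section Smooth.
Context (R : realType) (E F : normedModType R).

Fixpoint iterD (vs : seq E) (f : E -> F) : E -> F :=
  if vs is v :: vs' then fun x => 'D_v (iterD vs' f) x else f.

(* Used for E = R and E = R^2 and for open U, where the existence and
   continuity of all iterated directional derivatives is C^oo. *)
Definition smooth_on (U : set E) (f : E -> F) : Prop :=
  forall (vs : seq E) (x : E), U x ->
    {for x, continuous (iterD vs f)} /\ forall v, derivable (iterD vs f) x v.
End Smooth.

(** * Oriented surfaces *)

(* The oriented atlas is indexed by the points of the surface: [chart p] is a
   chart around p, with domain [dom p] and inverse [chart_inv p]. *)
Record surface (R : realType) := Surface {
  pt :> topologicalType;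
  dom : pt -> set pt;
  chart : pt -> pt -> 'rV[R]_2;
  chart_inv : pt -> 'rV[R]_2 -> pt;
  surface_nonempty : [set: pt] !=set0;
  surface_hausdorff : hausdorff_space pt;
  surface_second_countable : @second_countable pt;
  surface_connected : connected [set: pt];
  dom_open : forall p, open (dom p);
  dom_self : forall p, dom p p;
  chart_continuous : forall p, {within dom p, continuous (chart p)};
  chart_image_open : forall p, open (chart p @` dom p);
  chart_inv_continuous :
    forall p, {within chart p @` dom p, continuous (chart_inv p)};
  chartK : forall p x, dom p x -> chart_inv p (chart p x) = x;
  transition_smooth : forall p q,
    smooth_on (chart p @` (dom p `&` dom q)) (chart q \o chart_inv p);
  transition_oriented : forall p q x, dom p x -> dom q x ->
    0 < \det (\matrix_(i < 2, j < 2)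
      ('D_(delta_mx 0 i) (chart q \o chart_inv p) (chart p x)) 0 j)
}.

Section Calculus.
Context (R : realType) (M : surface R).

(* A vector of T_p M is given by its coordinates in the chart [chart p].
   [trans a b x v] is the vector of T_x M with coordinates v in [chart a],
   read in [chart b]. *)
Definition tangent : Type := 'rV[R]_2.

Definition trans (a b x : M) (v : tangent) : tangent :=
  'D_v (chart b \o chart_inv a) (chart a x).

Definition smoothM (F : normedModType R) (W : set M) (f : M -> F) : Prop :=
  forall p, smooth_on (chart p @` (W `&` dom p)) (f \o chart_inv p).

Definition dM (f : M -> R) (p : M) (v : tangent) : R :=
  'D_v (f \o chart_inv p) (chart p p).

Definition smooth_vf (U : set M) (V : M -> tangent) : Prop :=
  forall (W : set M) (f : M -> R), open W -> W `<=` U -> smoothM (F := R^o) W f ->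
    smoothM (F := R^o) W (fun p => dM f p (V p)).

(* the local vector field near p with constant coordinates v in [chart p] *)
Definition ext (p : M) (v : tangent) : M -> tangent :=
  fun q => trans p q q v.

Definition coord (p : M) (i : 'I_2) : M -> R := fun q => chart p q 0 i.

Definition lie (V W : M -> tangent) (p : M) : tangent :=
  \row_i (dM (fun q => dM (coord p i) q (W q)) p (V p)
          - dM (fun q => dM (coord p i) q (V q)) p (W p)).

Definition oriented_basis (v w : tangent) : Prop := 0 < \det (col_mx v w : 'M[R]_2).

Definition smooth_curve (c : R -> M) : Prop :=
  continuous c /\
  forall p, smooth_on (c @^-1` dom p : set R^o)
                      (chart p \o c : R^o -> 'rV[R]_2).

Definition velocity (c : R -> M) (t : R) : tangent :=
  'D_1 (chart (c t) \o c : R^o -> 'rV[R]_2) t.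
End Calculus.

(** * Lorentzian metrics *)

Definition mdot (R : realType) (G : 'M[R]_2) (v w : 'rV[R]_2) : R :=
  (v *m G *m w^T) 0 0.

(* The signature of a symmetric 2 x 2 form is (1,1) iff its determinant is
   negative. *)
Record lorentz_metric (R : realType) (M : surface R) := LorentzMetric {
  gram :> M -> 'M[R]_2;
  gram_sym : forall p, (gram p)^T = gram p;
  gram_lorentz : forall p, \det (gram p) < 0;
  gram_smooth : forall (U : set M) (V W : M -> tangent R), open U ->
    smooth_vf U V -> smooth_vf U W ->
    smoothM (F := R^o) U (fun p => mdot (gram p) (V p) (W p))
}.

Section Metric.
Context (R : realType) (M : surface R) (g : lorentz_metric M).
Local Notation TM := (tangent R).

Definition timelike (p : M) (v : TM) : Prop := mdot (g p) v v < 0.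
Definition spacelike (p : M) (v : TM) : Prop := 0 < mdot (g p) v v.
Definition lightlike (p : M) (v : TM) : Prop := v <> 0 /\ mdot (g p) v v = 0.

(* Koszul's formula for g(nabla_v W, z) at p *)
Definition koszul (p : M) (v : TM) (W : M -> TM) (z : TM) : R :=
  let V := ext p v in let Z := ext p z in
  let gf A B := fun q => mdot (g q) (A q) (B q) in
  2^-1 * (dM (gf W Z) p v + dM (gf V Z) p (W p) - dM (gf V W) p z
          + mdot (g p) (lie V W p) z
          - mdot (g p) (lie V Z p) (W p)
          - mdot (g p) (lie W Z p) v).

(* the Levi-Civita derivative (nabla_v W)(p) *)
Definition nabla (p : M) (v : TM) (W : M -> TM) : TM :=
  (\row_j koszul p v W (delta_mx 0 j)) *m invmx (g p).

Definition divergence (V : M -> TM) (p : M) : R :=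
  \sum_(i < 2) (nabla p (delta_mx 0 i) V) 0 i.

(* w t is a vector of T_(c t) M; the equation is D w / dt = 0, computed in the
   chart around c t. *)
Definition parallel_along (c : R -> M) (w : R -> TM) : Prop :=
  forall t, is_derive (t : R^o) 1
    (fun u : R^o => trans (c u) (c t) (c u) (w u))
    (- nabla (c t) (velocity c t) (ext (c t) (w t))).

Definition frame : Type := ('rV[R]_2 * 'rV[R]_2)%type.

Definition onframe (p : M) (s : frame) : Prop :=
  [/\ mdot (g p) s.1 s.1 = -1, mdot (g p) s.2 s.2 = 1,
      mdot (g p) s.1 s.2 = 0 & oriented_basis (s.1 : TM) s.2].

Definition smooth_frame (U : set M) (s : M -> frame) : Prop :=
  [/\ smooth_vf U (fun p => (s p).1), smooth_vf U (fun p => (s p).2)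
    & forall p, U p -> onframe p (s p)].

Definition X_conformally_flat : Prop :=
  exists2 s : M -> frame, smooth_frame setT s &
    forall p, divergence (fun q => (s q).1 + (s q).2) p = 0.

(** * X-lines *)

Definition in_X (p : M) (v : TM) : Prop :=
  lightlike p v /\
  exists w : TM, [/\ lightlike p w, oriented_basis v w & spacelike p (v + w)].

Definition X_curve (c : R -> M) : Prop :=
  smooth_curve c /\ forall t, in_X (c t) (velocity c t).

(* Every interval of definition of an integral curve can be reparametrized to
   R, so that X-lines are the maximal images of X-curves. *)
Definition X_line (l : set M) : Prop :=
  exists c, [/\ X_curve c, range c = l &
    forall c', X_curve c' -> l `<=` range c' -> range c' = l].

(* c runs once around l, which is thus homeomorphic to R / Z *)
Definition loop_param (l : set M) (c : R -> M) : Prop :=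
  [/\ X_curve c, range c = l, forall t, c (t + 1) = c t &
    forall t u : R, 0 <= t < 1 -> 0 <= u < 1 -> c t = c u -> t = u].

Definition null_homotopic (c : R -> M) : Prop :=
  exists H : R * R -> M,
    [/\ {within `[0, 1] `*` `[0, 1], continuous H},
        forall t, 0 <= t <= 1 -> H (t, 0) = c t,
        forall u, 0 <= u <= 1 -> H (0, u) = H (1, u)
      & forall t, 0 <= t <= 1 -> H (t, 1) = H (0, 1)].

Definition closed_line (l : set M) : Prop :=
  X_line l /\ exists2 c, loop_param l c & ~ null_homotopic c.

Definition dense_line (l : set M) : Prop := X_line l /\ closure l = setT.

Definition asymptotic_line (l : set M) : Prop :=
  [/\ X_line l, ~ closed_line l & exists2 l0, closed_line l0 & l0 `<=` closure l].

(** * Cylinders *)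

Definition cylinder (l1 l2 C : set M) : Prop :=
  [/\ closed_line l1, closed_line l2 &
    exists2 x, (~` (l1 `|` l2)) x & C = connected_component (~` (l1 `|` l2)) x].

Definition nonresonant (C : set M) : Prop :=
  forall l1 l2 C', closed_line l1 -> closed_line l2 ->
    l1 `<=` closure C -> l2 `<=` closure C -> cylinder l1 l2 C' -> C' `<=` C ->
    exists2 l, asymptotic_line l & l `<=` C'.

(* M itself viewed as a (closed) cylinder *)
Definition nonresonant_surface : Prop := nonresonant setT.

Definition resonant_cylinder (A : set M) : Prop :=
  [/\ exists l1 l2 C, cylinder l1 l2 C /\ A = closure C, ~ X_line A &
    forall p l, A p -> X_line l -> l p -> closed_line l].
End Metric.

(** * Spin structures *)

(* (a, b) stands for a + b e_1 e_2 in the Clifford algebra, in which e_1^2 = 1,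
   e_2^2 = -1 and (e_1 e_2)^2 = 1. *)
Definition Spin11 (R : realType) : set (R * R) :=
  [set x | x.1 ^+ 2 - x.2 ^+ 2 = 1].

Definition spin_mul (R : realType) (x y : R * R) : R * R :=
  (x.1 * y.1 + x.2 * y.2, x.1 * y.2 + x.2 * y.1).

(* s . lambda(x), where lambda(x) is the matrix of v |-> x v x^-1 in the basis
   (e_1, e_2) *)
Definition frame_act (R : realType) (s : frame R) (x : R * R) : frame R :=
  let A := x.1 ^+ 2 + x.2 ^+ 2 in let B := 2 * x.1 * x.2 in
  (A *: s.1 - B *: s.2, - B *: s.1 + A *: s.2).

Record time_orientation (R : realType) (M : surface R) (g : lorentz_metric M) :=
  TimeOrientation {
    tvf :> M -> tangent R;
    tvf_smooth : smooth_vf setT tvf;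
    tvf_timelike : forall p, timelike g p (tvf p)
  }.

(* The SO_+(1,1)-bundle P of oriented and time-oriented orthonormal frames *)
Definition in_P (R : realType) (M : surface R) (g : lorentz_metric M)
    (T : time_orientation g) (p : M) (s : frame R) : Prop :=
  onframe g p s /\ mdot (g p) s.1 (T p) < 0.

(* (Phi, Psi) is an isomorphism of the trivial Spin structure U x Spin_+(1,1),
   id x lambda, relative to the frame s over U, with the restriction to U of Q,
   act, q |-> (spin_proj q, fr q). *)
Definition spin_trivialization (R : realType) (M : surface R)
    (g : lorentz_metric M) (T : time_orientation g)
    (Q : topologicalType) (spin_proj : Q -> M) (fr : Q -> frame R)
    (act : Q -> R * R -> Q) (U : set M) (s : M -> frame R)
    (Phi : M * (R * R) -> Q) (Psi : Q -> R * R) : Prop :=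
  [/\ smooth_frame g U s /\ (forall p, U p -> in_P T p (s p)),
      {within U `*` @Spin11 R, continuous Phi} /\
      {within spin_proj @^-1` U, continuous Psi},
      forall p x, U p -> Spin11 x ->
        [/\ spin_proj (Phi (p, x)) = p, fr (Phi (p, x)) = frame_act (s p) x
          & Psi (Phi (p, x)) = x],
      forall q, U (spin_proj q) -> Spin11 (Psi q) /\ Phi (spin_proj q, Psi q) = q
    & forall p x y, U p -> Spin11 x -> Spin11 y ->
        act (Phi (p, x)) y = Phi (p, spin_mul x y)].

(* A Spin_+(1,1)-principal bundle Q over M together with the equivariant map
   f = (spin_proj, fr) : Q -> P. The smooth structure of Q is the pullback by the
   double covering f of that of P. *)
Record spin_structure (R : realType) (M : surface R) (g : lorentz_metric M)
    (T : time_orientation g) := SpinStructure {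
  spinQ :> topologicalType;
  spin_proj : spinQ -> M;
  fr : spinQ -> frame R;
  act : spinQ -> R * R -> spinQ;
  spin_proj_continuous : continuous spin_proj;
  locally_trivial : forall p : M, exists U s Phi Psi,
    [/\ open U, U p & spin_trivialization T spin_proj fr act U s Phi Psi]
}.

Section Spinors.
Context (R : realType) (M : surface R) (g : lorentz_metric M).
Context (T : time_orientation g) (Q : spin_structure T).
Local Notation C := (complex R).

Definition spin_trivial : Prop :=
  exists s Phi Psi,
    spin_trivialization T (@spin_proj _ _ _ _ Q) (@fr _ _ _ _ Q) (@act _ _ _ _ Q)
      setT s Phi Psi.

Definition horizontal_lift (c : R -> M) (q : R -> Q) : Prop :=
  [/\ continuous q, forall t, spin_proj (q t) = c t,
      parallel_along g c (fun t => (fr (q t)).1 : tangent R) &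
      parallel_along g c (fun t => (fr (q t)).2 : tangent R)].

Definition X_trivial_along (l : set M) : Prop :=
  forall c q, loop_param g l c -> horizontal_lift c q -> q 1 = q 0.

Definition X_trivial_resonant (A : set M) : Prop :=
  resonant_cylinder g A /\
  forall l, closed_line g l -> l `<=` A -> X_trivial_along l.

Definition e1 : 'M[C]_2 :=
  \matrix_(i, j) (if i == j then 0
                  else if i == 0 then Complex 0 1 else Complex 0 (-1)).

Definition e2 : 'M[C]_2 :=
  \matrix_(i, j) (if i == j then 0 else Complex 0 1).

Definition rscale (a : R) (m n : nat) (A : 'M[C]_(m, n)) : 'M[C]_(m, n) :=
  Complex a 0 *: A.

Definition spin_rep (x : R * R) : 'M[C]_2 :=
  rscale x.1 1%:M + rscale x.2 (e1 *m e2).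

(* a smooth local section of Q over U *)
Definition local_section (U : set M) (sg : M -> Q) : Prop :=
  [/\ open U, {within U, continuous sg}, forall p, U p -> spin_proj (sg p) = p
    & smooth_frame g U (fun p => fr (sg p))].

Definition spinor_field : Type := Q -> 'cV[C]_2.

(* Sections of Q x_Spin Delta are the equivariant functions on Q. *)
Definition smooth_spinor (phi : spinor_field) : Prop :=
  (forall q x, Spin11 x -> phi q = spin_rep x *m phi (act q x)) /\
  (forall U sg, local_section U sg -> forall k,
     smoothM (F := R^o) U (fun p => complex.Re (phi (sg p) k 0)) /\
     smoothM (F := R^o) U (fun p => complex.Im (phi (sg p) k 0))).

(* e_1 e_2 acts in the frame f(q) as omega = s_1 . s_2 *)
Definition positive (phi : spinor_field) : Prop :=
  forall q, (e1 *m e2) *m phi q = - phi q.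

Definition negative (phi : spinor_field) : Prop :=
  forall q, (e1 *m e2) *m phi q = phi q.

Definition dspinor (f : M -> 'cV[C]_2) (p : M) (v : tangent R) : 'cV[C]_2 :=
  \col_k Complex (dM (fun x => complex.Re (f x k 0)) p v)
                 (dM (fun x => complex.Im (f x k 0)) p v).

(* The coordinates with respect to sg p of the derivative of phi at p in the
   direction v. With s = f o sg, the connection matrix is
     1/2 sum_(i < j) eps_i eps_j g(nabla_v s_i, s_j) e_i e_j,
   where eps_1 eps_2 = -1. *)
Definition nablaS (sg : M -> Q) (phi : spinor_field) (p : M) (v : tangent R) :
    'cV[C]_2 :=
  let s1 : M -> tangent R := fun q => (fr (sg q)).1 in
  let s2 : M -> tangent R := fun q => (fr (sg q)).2 in
  dspinor (fun x => phi (sg x)) p v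
  - rscale (2^-1 * mdot (g p) (nabla g p v s1) (s2 p))
           ((e1 *m e2) *m phi (sg p)).

Definition dirac_op (sg : M -> Q) (phi : spinor_field) (p : M) : 'cV[C]_2 :=
  - (e1 *m nablaS sg phi p (fr (sg p)).1) + e2 *m nablaS sg phi p (fr (sg p)).2.

(* Clifford multiplication by v = - g(v, s_1) s_1 + g(v, s_2) s_2 *)
Definition clifford (p : M) (s : frame R) (v : tangent R) : 'M[C]_2 :=
  rscale (- mdot (g p) v s.1) e1 + rscale (mdot (g p) v s.2) e2.

Definition harmonic (phi : spinor_field) : Prop :=
  forall U sg p, local_section U sg -> U p -> dirac_op sg phi p = 0.

Definition twistor (phi : spinor_field) : Prop :=
  forall U sg p v, local_section U sg -> U p ->
    nablaS sg phi p v =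
    - rscale 2^-1 (clifford p (fr (sg p)) v *m dirac_op sg phi p).

Definition positive_harmonic : set spinor_field :=
  [set phi | [/\ smooth_spinor phi, positive phi & harmonic phi]].

Definition negative_twistor : set spinor_field :=
  [set phi | [/\ smooth_spinor phi, negative phi & twistor phi]].

Definition lin_indep (n : nat) (B : 'I_n -> spinor_field) : Prop :=
  forall a : 'I_n -> C, (forall q, \sum_i a i *: B i q = 0) -> forall i, a i = 0.

(* complex dimension of a linear subspace, with values in N u {+oo} *)
Definition dimC (S : set spinor_field) : \bar R :=
  ereal_sup [set n%:R%:E | n in
    [set n | exists2 B : 'I_n -> spinor_field, lin_indep B & forall i, S (B i)]].

Definition delta_plus : \bar R := dimC positive_harmonic.
Definition tau_minus : \bar R := dimC negative_twistor.
End Spinors.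

(* Main.v *)
(* Let X = s_1 + s_2 and Y = - s_1 + s_2 for the given frame s. Since div X = 0,
   nabla_X X = 0 and the form alpha = g(X, .) is closed. Local primitives of
   alpha are transverse coordinates of flow boxes of X, which are therefore
   glued by translations; X has a global flow F by compactness, and the holonomy
   of F is a translation in these coordinates. Hence a closed orbit has a
   neighbourhood of closed orbits (a tube).
   For a frame q in Q write X_q = lambda(q) X with lambda > 0. Positive harmonic
   spinors are (lambda^(-1/2) v, 0) and negative twistor spinors are
   (0, lambda^(1/2) v), where v : Q -> C is smooth, X v = 0 and
   v(q . y) = sign(y_1 + y_2) v(q). Thus both dimensions are that of the space of
   such v.
   If v^2 is constant for each real v, any two complex v are proportional, and
   v <> 0 trivializes Q by the lifts of s on which v > 0. Otherwise h = v^2 has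
   Y h <> 0 at some x; by recurrence and the translation holonomy the orbit of x
   is closed, a tube around it consists of closed X-lines, and v is a nonzero
   function with constant square along horizontal lifts, so that the tube is
   X-trivial. Conversely, over an X-trivial tube s lifts to Q, and bump functions
   of the transverse coordinate give infinitely many independent v. *)
From HB Require Import structures.
From mathcomp Require Import all_boot all_order all_algebra.
From mathcomp Require Import all_classical all_reals all_analysis.
From mathcomp.real_closed Require Import complex.
From mathcomp Require Import ring lra zify.
Require Import Defs.
Set Implicit Arguments.
Unset Strict Implicit.
Unset Printing Implicit Defensive.
Import Order.TTheory GRing.Theory Num.Theory.
Import numFieldNormedType.Exports.
Local Open Scope classical_set_scope.
Local Open Scope ring_scope.

(** * Unique continuation of local solutions on the plane *)

(** Closed lines must carry loops that are not null-homotopic, and no hypothesis says that the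
    surface is a torus. Instead of classifying surfaces, the form g(X, .) is given a primitive along
    a homotopy, and the homotopy is pushed towards level 0 until it lies in a tube, where an integer
    winding number prevents the contraction. The square [h = v^2] is used because [v] is defined on
    [M] only up to sign; its zeros are critical, so Y h <> 0 at a point gives h <> 0 there.
    Recurrence closes an orbit because Y h is invariant under the flow: at a limit point of the
    orbit, h is still injective on the transversal, and all returns have the same value of h, so two
    of them lie on one plaque. Smoothness is given through iterated directional derivatives, so
    chain rules and symmetry of second derivatives come from mean value theorems; the flow is built
    from primitives and inverse functions instead of an existence theorem for differential
    equations. *)

Section Clopen.
Context {R : realType}.

(** The points near which [P] holds and those near which it fails form relatively open sets of the
    segment, so connectedness leaves one of them empty. Most uniqueness arguments below run through
    this lemma. *)
Lemma lc_segment (P : R -> Prop) (a b : R) : a <= b ->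
  (forall t, a <= t <= b ->
    \forall u \near t, a <= u <= b -> (P u <-> P t)) ->
  P a -> P b.
Proof.
move=> ab lc Pa.
have cn := @segment_connected R a b.
pose C := [set t : R | \forall u \near t, a <= u <= b -> P u].
pose C' := [set t : R | \forall u \near t, a <= u <= b -> ~ P u].
have inE' t : `[a, b]%classic t = (a <= t <= b) by rewrite /= in_itv.
have: [set t | a <= t <= b /\ P t] = `[a, b]%classic.
  apply: cn.
  - by exists a; split; rewrite ?lexx.
  - exists C; first exact: open_interior.
    rewrite predeqE => t; split=> [[tab Pt]|[]].
      split; first by rewrite inE'.
      by rewrite /C /=; apply: filterS (lc _ tab) => u Hu /Hu ->.
    by rewrite inE' => tab Ct; split=> //; apply: nbhs_singleton Ct tab.
  - exists (~` C'); first by apply: open_closedC; exact: open_interior.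
    rewrite predeqE => t; split=> [[tab Pt]|[]].
      split; first by rewrite inE'.
      by move=> /nbhs_singleton /(_ tab).
    rewrite inE' => tab C't; split=> //; apply: contrapT => nPt.
    by apply: C't; apply: filterS (lc _ tab) => u Hu /Hu ->.
by rewrite predeqE => /(_ b) [_]; case=> //; rewrite inE' ab lexx.
Qed.

(** The case [t <= s] applies the segment version to the negation of [P], which is locally constant
    as well. *)
Lemma lc_convex (I P : set R) (s t : R) :
  (forall x y z, I x -> I z -> x <= y <= z -> I y) ->
  (forall u, I u -> \forall v \near u, I v -> (P v <-> P u)) ->
  I s -> I t -> P s -> P t.
Proof.
move=> cvx lc Is It Ps; have [st|/ltW ts] := leP s t.
  apply: (@lc_segment P s t) => // u ust.
  by apply: filterS (lc _ (cvx _ _ _ Is It ust)) => v Iv /(cvx _ _ _ Is It)/Iv.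
apply: contrapT => nPt.
suff : ~ P s by [].
apply: (@lc_segment (fun u => ~ P u) t s) => // u uts.
apply: filterS (lc _ (cvx _ _ _ It Is uts)) => v Iv /(cvx _ _ _ It Is)/Iv.
by move=> ->.
Qed.
End Clopen.

Section Lifting.
Context {R : realType} {Y : Type}.
Local Notation D := (R * R)%type.
Variable S : (D -> Y) -> D -> Prop.
Hypothesis S_near : forall f g z, (\forall w \near z, f w = g w) -> S f z -> S g z.
Hypothesis S_rigid : forall f g z, S f z -> S g z ->
  (\forall w \near z, f w = g w) \/ (\forall w \near z, f w <> g w).

Definition seg2 (z w : D) (t : R) : D :=
  (z.1 + t * (w.1 - z.1), z.2 + t * (w.2 - z.2)).

Definition convex2 (O : set D) :=
  forall z w t, O z -> O w -> 0 <= t <= 1 -> O (seg2 z w t).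

(** [S f z] is read as: the germ of [f] at [z] is a solution. Only the value at [z] is prescribed;
    by [S_rigid] it determines the germ. The scheme serves for primitives along a map, for time
    coordinates in a tube and for lifts of a frame to a Spin structure. *)
Definition extends_germs (O : set D) := forall z f, O z -> S f z ->
  exists g, (forall w, O w -> S g w) /\ g z = f z.

Lemma seg2_continuous z w : continuous (seg2 z w).
Proof.
have affine (a b : R) : continuous (fun t : R => a + t * b).
  move=> t; apply: cvgD; first exact: cvg_cst.
  by apply: cvgM; [exact: cvg_id|exact: cvg_cst].
by move=> t; exact: (cvg_pair (affine _ _ t) (affine _ _ t)).
Qed.

Lemma seg20 z w : seg2 z w 0 = z.
Proof. by rewrite /seg2 !mul0r !addr0; case: z. Qed.

Lemma seg21 z w : seg2 z w 1 = w.
Proof. by rewrite /seg2 !mul1r !(addrC z.1) !(addrC z.2) !subrK; case: w. Qed.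

(** Along the segment from [z] to [w], agreement of two solutions is locally constant by
    rigidity. *)
Lemma germs_unique (O : set D) f g z : convex2 O ->
  (forall w, O w -> S f w) -> (forall w, O w -> S g w) -> O z -> f z = g z ->
  forall w, O w -> f w = g w.
Proof.
move=> cO Sf Sg Oz fg w Ow.
rewrite -(seg21 z w); rewrite -(seg20 z w) in fg.
apply: (@lc_segment R (fun t => f (seg2 z w t) = g (seg2 z w t)) 0 1 _ _ fg) => //.
move=> t t01; have Ot := cO _ _ _ Oz Ow t01.
have sc := @seg2_continuous z w t.
case: (S_rigid (Sf _ Ot) (Sg _ Ot)) => H; have H' := nbhs_singleton H.
  have {}H : \forall u \near t, f (seg2 z w u) = g (seg2 z w u) := sc _ H.
  by apply: filterS H => u -> _.
have {}H : \forall u \near t, f (seg2 z w u) <> g (seg2 z w u) := sc _ H.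
by apply: filterS H => u ? _.
Qed.

(** The intersection is convex, so solutions that agree at one of its points agree on all of it and
    can be glued. *)
Lemma extends_germsU (O1 O2 : set D) : open O1 -> open O2 ->
  convex2 O1 -> convex2 O2 -> (O1 `&` O2) !=set0 ->
  extends_germs O1 -> extends_germs O2 -> extends_germs (O1 `|` O2).
Proof.
move=> o1 o2 c1 c2 [w [w1 w2]] e1 e2.
have c12 : convex2 (O1 `&` O2).
  by move=> z z' t [z1 z2] [z1' z2'] t01; split; [exact: c1|exact: c2].
have glue g1 g2 : (forall z, O1 z -> S g1 z) -> (forall z, O2 z -> S g2 z) ->
    g1 w = g2 w -> exists g, [/\ forall z, (O1 `|` O2) z -> S g z,
      forall z, O1 z -> g z = g1 z & forall z, O2 z -> g z = g2 z].
  move=> S1 S2 gw.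
  have E : forall z, (O1 `&` O2) z -> g1 z = g2 z.
    by apply: (germs_unique c12 _ _ _ gw) => // z [z1 z2]; [exact: S1|exact: S2].
  pose g z := if pselect (O1 z) then g1 z else g2 z.
  have gE1 z : O1 z -> g z = g1 z by rewrite /g; case: pselect.
  have gE2 z : O2 z -> g z = g2 z.
    by rewrite /g; case: pselect => // z1 z2; exact: E.
  exists g; split=> // z [zO|zO].
    by apply: S_near (S1 _ zO); near=> u; rewrite gE1//; near: u; exact: open_nbhs_nbhs.
  by apply: S_near (S2 _ zO); near=> u; rewrite gE2//; near: u; exact: open_nbhs_nbhs.
move=> z f [zO|zO] Sf.
  have [g1 [S1 g1z]] := e1 _ _ zO Sf.
  have [g2 [S2 g2w]] := e2 _ _ w2 (S1 _ w1).
  have [g [Sg E1 _]] := glue _ _ S1 S2 (esym g2w).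
  by exists g; split=> //; rewrite E1.
have [g2 [S2 g2z]] := e2 _ _ zO Sf.
have [g1 [S1 g1w]] := e1 _ _ w1 (S2 _ w2).
have [g [Sg _ E2]] := glue _ _ S1 S2 g1w.
by exists g; split=> //; rewrite E2.
Unshelve. all: by end_near.
Qed.

Lemma extends_germsS (O O' : set D) : O' `<=` O ->
  extends_germs O -> extends_germs O'.
Proof.
move=> sO eO z f Oz Sf; have [g [Sg gz]] := eO _ _ (sO _ Oz) Sf.
by exists g; split=> // w /sO; exact: Sg.
Qed.

Definition rect (a b c d : R) : set D :=
  [set z | (a < z.1 < b) /\ (c < z.2 < d)].

Lemma rect_open a b c d : open (rect a b c d).
Proof.
rewrite openE => z [z1 z2]; exists (`]a, b[%classic, `]c, d[%classic).
  by split; apply: open_nbhs_nbhs; split=> //=; rewrite ?in_itv//=;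
    exact: interval_open.
by move=> [u v] [] /=; rewrite !in_itv.
Qed.

Lemma rect_convex a b c d : convex2 (rect a b c d).
Proof.
have H (x y u v t : R) : u < x < v -> u < y < v -> 0 <= t <= 1 -> u < x + t * (y - x) < v.
  move=> /andP[ux xv] /andP[uy yv] /andP[t0 t1].
  have -> : x + t * (y - x) = (1 - t) * x + t * y by ring.
  have [t0'|t0'] := eqVneq t 0; first by rewrite t0'; apply/andP; split; lra.
  have tp : 0 < t by rewrite lt_def t0'.
  apply/andP; split.
    have A : (1 - t) * u <= (1 - t) * x by rewrite ler_wpM2l// ?subr_ge0// ltW.
    have B : t * u < t * y by rewrite ltr_pM2l.
    by lra.
  have A : (1 - t) * x <= (1 - t) * v by rewrite ler_wpM2l// ?subr_ge0// ltW.
  have B : t * y < t * v by rewrite ltr_pM2l.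
  by lra.
by move=> z w t [z1 z2] [w1 w2] t01; split; exact: H.
Qed.

Hypothesis S_local : forall z, exists2 e : R, 0 < e &
  extends_germs (rect (z.1 - e) (z.1 + e) (z.2 - e) (z.2 + e)).

(** Compactness gives one radius valid at all points of the closed square. Overlapping small squares
    are joined into rows and the rows are joined in turn, each time as a union of two convex
    rectangles. *)
Lemma extends_germs_square L : 0 < L -> extends_germs (rect (- L) L (- L) L).
Proof.
move=> L0.
pose K : set D := `[- L, L]%classic `*` `[- L, L]%classic.
have cK : compact K by apply: compact_setX; exact: segment_compact.
have [e e0 He] : exists2 e : R, 0 < e & forall z, K z ->
    extends_germs (rect (z.1 - e) (z.1 + e) (z.2 - e) (z.2 + e)).
  pose P (e : R) (z : D) := extends_germs (rect (z.1 - e) (z.1 + e) (z.2 - e) (z.2 + e)).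
  have : \forall e \near 0^'+, K `<=` P e.
    apply: (compact_near_coveringP K).1 => // z Kz.
    have [e e0 eO] := S_local z.
    exists (ball z (e / 2), [set x | 0 < x < e / 2]).
      split; first by apply: nbhsx_ballx; rewrite divr_gt0.
      by near=> x; apply/andP; split; near: x;
        [exact: nbhs_right_gt|apply: nbhs_right_lt; rewrite divr_gt0].
    move=> [z' x] /= [[]]; rewrite /ball /= => b1 b2 /andP[x0 xe].
    apply: extends_germsS eO => w [].
    move: b1 b2; rewrite !ltr_norml => /andP[? ?] /andP[? ?] /andP[? ?] /andP[? ?].
    by split; apply/andP; split; lra.
  move=> H; near (0 : R)^'+ => e; exists e; near: e; [exact: nbhs_right_gt|exact: H].
have [n n0 nL] : exists2 n : nat, (0 < n)%N & L / n%:R < e.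
  exists (Num.trunc (L / e)).+1 => //.
  rewrite ltr_pdivrMr// mulrC -ltr_pdivrMr//.
  exact: truncnS_gt.
set h := L / n%:R in nL.
have h0 : 0 < h by rewrite divr_gt0// ltr0n.
have hn : h * n%:R = L by rewrite /h mulfVK// pnatr_eq0 -lt0n.
(* The centres have spacing [h] and the squares have half-side [h < e], so neighbours overlap and
   the outer ones reach beyond the boundary of the large square. *)
pose x (k : nat) := - L + k%:R * h.
have xS k : x k.+1 = x k + h by rewrite /x -natr1; ring.
have xL k : (k <= n + n)%N -> - L <= x k <= L.
  move=> kn; rewrite /x lerDl mulr_ge0 ?ler0n ?(ltW h0)//=.
  have : k%:R * h <= (n + n)%:R * h by rewrite ler_wpM2r ?(ltW h0)// ler_nat.
  by rewrite natrD mulrDl ![_ * h]mulrC hn; lra.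
have x2n : x (n + n)%N = L by rewrite /x natrD mulrDl ![_ * h]mulrC hn; lra.
have x0 : x 0%N = - L by rewrite /x mul0r addr0.
have cell k j : (k <= n + n)%N -> (j <= n + n)%N ->
    extends_germs (rect (x k - h) (x k + h) (x j - h) (x j + h)).
  move=> kn jn.
  have Kkj : K (x k, x j) by split; rewrite /= in_itv /=; exact: xL.
  apply: extends_germsS (He _ Kkj) => w [/andP[? ?] /andP[? ?]] /=.
  by split; apply/andP; split; lra.
have row j k : (j <= n + n)%N -> (k <= n + n)%N ->
    extends_germs (rect (x 0%N - h) (x k + h) (x j - h) (x j + h)).
  move=> jn; elim: k => [|k IH] kn; first exact: cell.
  have kn' := ltnW kn.
  have /andP[xk0 _] := xL _ kn'.
  have U := extends_germsU (@rect_open _ _ _ _) (@rect_open _ _ _ _)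
    (@rect_convex _ _ _ _) (@rect_convex _ _ _ _) _ (IH kn') (cell _ _ kn jn).
  apply: extends_germsS (U _).
    move=> w [/andP[w1 w2] w3]; have [?|?] := ltP w.1 (x k + h); [left|right];
      by split=> //; apply/andP; split=> //; rewrite xS in w2 *; lra.
  exists (x k + h / 2, x j); split; split; apply/andP; split; rewrite ?xS/=; lra.
have all k : (k <= n + n)%N ->
    extends_germs (rect (x 0%N - h) (x (n + n)%N + h) (x 0%N - h) (x k + h)).
  elim: k => [|k IH] kn; first exact: row.
  have kn' := ltnW kn.
  have /andP[xk0 _] := xL _ kn'.
  have U := extends_germsU (@rect_open _ _ _ _) (@rect_open _ _ _ _)
    (@rect_convex _ _ _ _) (@rect_convex _ _ _ _) _ (IH kn') (row _ _ kn (leqnn _)).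
  apply: extends_germsS (U _).
    move=> w [w3 /andP[w1 w2]]; have [?|?] := ltP w.2 (x k + h); [left|right];
      by split=> //; apply/andP; split=> //; rewrite xS in w2 *; lra.
  exists (x 0%N, x k + h / 2); split; split; apply/andP; split; rewrite ?xS/=; lra.
apply: extends_germsS (all _ (leqnn _)) => w [/andP[? ?] /andP[? ?]].
by split; apply/andP; split; rewrite ?x2n ?x0; lra.
Unshelve. all: by end_near.
Qed.

Lemma global_solution f : S f (0, 0) ->
  exists g, (forall z, S g z) /\ g (0, 0) = f (0, 0).
Proof.
move=> Sf.
have O0 n : rect (- n.+1%:R) n.+1%:R (- n.+1%:R) n.+1%:R (0, 0).
  by split; rewrite /= oppr_lt0 ltr0Sn.
have [G HG] := choice (fun n => extends_germs_square (ltr0Sn R n) (O0 n) Sf).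
(* [N z] is the index of a square of the exhaustion containing [z]. The solutions [G n] all take the
   value [f (0, 0)] at the origin, hence are compatible. *)
pose N (z : D) := Num.trunc (Num.max `|z.1| `|z.2|).
have sqN n z : (N z <= n)%N -> rect (- n.+1%:R) n.+1%:R (- n.+1%:R) n.+1%:R z.
  move=> Nn.
  have : Num.max `|z.1| `|z.2| < n.+1%:R.
    by apply: lt_le_trans (truncnS_gt _) _; rewrite ler_nat.
  by rewrite gt_max !ltr_norml => /andP[].
have sub m n : (m <= n)%N -> rect (- m.+1%:R) m.+1%:R (- m.+1%:R) m.+1%:R `<=`
    rect (- n.+1%:R) n.+1%:R (- n.+1%:R) n.+1%:R.
  move=> mn z [/andP[? ?] /andP[? ?]].
  have : m.+1%:R <= n.+1%:R :> R by rewrite ler_nat.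
  by move=> ?; split; apply/andP; split; lra.
have GE m n z : (m <= n)%N -> rect (- m.+1%:R) m.+1%:R (- m.+1%:R) m.+1%:R z ->
    G m z = G n z.
  move=> mn; apply: (germs_unique (@rect_convex _ _ _ _) (HG m).1 _ (O0 m)).
    by move=> w /(sub _ _ mn); exact: (HG n).1.
  by rewrite (HG m).2 (HG n).2.
have GNE n z : rect (- n.+1%:R) n.+1%:R (- n.+1%:R) n.+1%:R z -> G (N z) z = G n z.
  move=> zn; have [nN|/ltnW nN] := leqP n (N z); first by rewrite -(GE _ _ _ nN).
  by apply: GE => //; exact: sqN.
exists (fun z => G (N z) z); split; last by rewrite (GNE 0%N) ?(HG 0%N).2.
move=> z; apply: S_near ((HG (N z)).1 _ (sqN _ _ (leqnn _))).
near=> w; rewrite (GNE (N z))//; near: w.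
by apply: open_nbhs_nbhs; split; [exact: rect_open|exact: sqN].
Unshelve. all: by end_near.
Qed.
End Lifting.

(** * Continuity at a point *)

Section ContinuityAt.
Context {T U V W : topologicalType}.

Lemma near_image (f : T -> U) (x : T) (P : U -> Prop) :
  {for x, continuous f} -> (\forall y \near f x, P y) -> \forall z \near x, P (f z).
Proof. by move=> cf; exact: cf. Qed.

Lemma continuous_pair_for (f : T -> U) (g : T -> V) (x : T) :
  {for x, continuous f} -> {for x, continuous g} ->
  {for x, continuous (fun y => (f y, g y))}.
Proof. by move=> cf cg; exact: (cvg_pair cf cg). Qed.

Lemma continuous_comp2_for (f : T -> U) (g : T -> V) (h : U -> V -> W) (x : T) :
  {for x, continuous f} -> {for x, continuous g} ->
  {for (f x, g x), continuous (fun z : U * V => h z.1 z.2)} ->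
  {for x, continuous (fun y => h (f y) (g y))}.
Proof.
move=> cf cg ch.
exact: (continuous_comp (f := fun y => (f y, g y)) (g := fun z : U * V => h z.1 z.2)
  (continuous_pair_for cf cg) ch).
Qed.

Lemma near_eq_continuous (f g : T -> U) (x : T) :
  (\forall y \near x, f y = g y) -> {for x, continuous f} -> {for x, continuous g}.
Proof.
move=> fg cf; rewrite /prop_for /continuous_at -(nbhs_singleton fg) => A /cf nA.
have {}nA : \forall y \near x, A (f y) by [].
by apply: filterS2 fg nA => y ->.
Qed.
End ContinuityAt.

(** * Flows from atlases of flow boxes *)

Section FlowAtlas.
Context {R : realType} {N : topologicalType}.

Lemma near_shift0 (P : R -> Prop) (u : R) :
  (\forall s \near (0 : R), P (u + s)) -> \forall v \near u, P v.
Proof.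
move=> H; have c : (fun v => v - u) @ u --> (0 : R).
  rewrite -[X in _ --> X](subrr u); apply: cvgB; [exact: cvg_id|exact: cvg_cst].
have {}H : \forall v \near u, P (u + (v - u)) := c _ H.
by apply: filterS H => v; rewrite addrC subrK.
Qed.

Lemma near_neq (U : topologicalType) (f g : U -> N) (u : U) :
  hausdorff_space N -> {for u, continuous f} -> {for u, continuous g} ->
  f u <> g u -> \forall v \near u, f v <> g v.
Proof.
move=> hN cf cg /eqP fg; have := hN; rewrite open_hausdorff => /(_ _ _ fg).
move=> [[A B] /= [fA gB] [oA oB AB]].
have nA : \forall v \near u, A (f v).
  by apply: cf; apply: open_nbhs_nbhs; split=> //; exact: set_mem.
have nB : \forall v \near u, B (g v).
  by apply: cg; apply: open_nbhs_nbhs; split=> //; exact: set_mem.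
apply: filterS2 nA nB => v Av Bv E.
have : (A `&` B) (f v) by split=> //; rewrite E.
by rewrite (eqP AB).
Qed.

(** The flow is meant to move [btime] at unit speed and to keep [bheight], so the sets of constant
    height in a box are its plaques. *)
Record box := Box {
  bdom : set N; btime : N -> R; bheight : N -> R; bmap : R -> R -> N; brad : R }.

Record is_box (B : box) : Prop := IsBox {
  brad_gt0 : 0 < brad B;
  bdom_open : open (bdom B);
  btime_continuous : forall y, bdom B y -> {for y, continuous (btime B)};
  bheight_continuous : forall y, bdom B y -> {for y, continuous (bheight B)};
  bmap_continuous : forall s r, `|s| < brad B -> `|r| < brad B ->
    {for (s, r), continuous (fun z : R * R => bmap B z.1 z.2)};
  btime_lt : forall y, bdom B y -> `|btime B y| < brad B;
  bheight_lt : forall y, bdom B y -> `|bheight B y| < brad B;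
  bmapK : forall y, bdom B y -> bmap B (btime B y) (bheight B y) = y;
  bdom_bmap : forall s r, `|s| < brad B -> `|r| < brad B -> bdom B (bmap B s r);
  btime_bmap : forall s r, `|s| < brad B -> `|r| < brad B ->
    btime B (bmap B s r) = s;
  bheight_bmap : forall s r, `|s| < brad B -> `|r| < brad B ->
    bheight B (bmap B s r) = r }.

(** Changes of box are locally translations in height and have unit speed in time. The condition on
    heights is the trace of the closed form g(X, .), of which heights are primitives; it is what
    makes the holonomy a translation. *)
Record flow_atlas (bx : N -> box) : Prop := FlowAtlas {
  fa_box : forall p, is_box (bx p);
  fa_center : forall p, [/\ bdom (bx p) p, btime (bx p) p = 0 & bheight (bx p) p = 0];
  fa_height : forall p q y, bdom (bx p) y -> bdom (bx q) y ->
    \forall z \near y, bheight (bx q) z - bheight (bx p) z =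
                       bheight (bx q) y - bheight (bx p) y;
  fa_time : forall p q y, bdom (bx p) y -> bdom (bx q) y ->
    \forall s \near (0 : R),
      btime (bx q) (bmap (bx p) (btime (bx p) y + s) (bheight (bx p) y)) =
      btime (bx q) y + s }.

Variable bx : N -> box.
Hypothesis fa : flow_atlas bx.
Hypothesis hN : hausdorff_space N.

Local Notation dm p := (bdom (bx p)).
Local Notation tm p := (btime (bx p)).
Local Notation ht p := (bheight (bx p)).
Local Notation rd p := (brad (bx p)).
Local Notation mp p := (bmap (bx p)).
Let isb p := fa_box fa p.

Definition local_flow p s y := mp p (tm p y + s) (ht p y).
Local Notation lf := local_flow.

Lemma near_norm_lt (U : topologicalType) (f : U -> R) (u : U) (d : R) :
  {for u, continuous f} -> `|f u| < d -> \forall v \near u, `|f v| < d.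
Proof.
move=> cf fd; have : `|f v| @[v --> u] --> `|f u| by apply: cvg_norm; exact: cf.
by move=> /cvgr_lt; exact.
Qed.

Lemma near_bdom p y : dm p y -> \forall z \near y, dm p z.
Proof. by move=> py; apply: open_nbhs_nbhs; split=> //; exact: (bdom_open (isb p)). Qed.

Lemma local_flow_dom p s y : dm p y -> `|tm p y + s| < rd p ->
  [/\ dm p (lf p s y), tm p (lf p s y) = tm p y + s & ht p (lf p s y) = ht p y].
Proof.
move=> py sp; have h := bheight_lt (isb p) py; split.
- exact: (bdom_bmap (isb p)).
- exact: (btime_bmap (isb p)).
- exact: (bheight_bmap (isb p)).
Qed.

Lemma local_flow0 p y : dm p y -> lf p 0 y = y.
Proof. by move=> py; rewrite /lf addr0 (bmapK (isb p)). Qed.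

Lemma local_flowD p s u y : dm p y -> `|tm p y + u| < rd p ->
  lf p s (lf p u y) = lf p (u + s) y.
Proof.
by move=> py up; have [_ t h] := local_flow_dom py up; rewrite /lf t h addrA.
Qed.

Lemma local_flow_continuous p s y : dm p y -> `|tm p y + s| < rd p ->
  {for (s, y), continuous (fun z : R * N => lf p z.1 z.2)}.
Proof.
move=> py sp; have h := bheight_lt (isb p) py.
have ct : {for (s, y), continuous (fun z : R * N => tm p z.2 + z.1)}.
  apply: cvgD; last exact: cvg_fst.
  by apply: (cvg_comp _ _ (@cvg_snd _ _ _ _ _)); exact: (btime_continuous (isb p)).
have ch : {for (s, y), continuous (fun z : R * N => ht p z.2)}.
  by apply: (cvg_comp _ _ (@cvg_snd _ _ _ _ _)); exact: (bheight_continuous (isb p)).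
exact: (continuous_comp2_for ct ch (bmap_continuous (isb p) sp h)).
Qed.

Lemma local_flow_continuous_t p s y : dm p y -> `|tm p y + s| < rd p ->
  {for s, continuous (fun s => lf p s y)}.
Proof.
move=> py sp.
apply: (continuous_comp2_for (f := id) (g := cst y) (h := lf p)).
- exact: cvg_id.
- exact: cvg_cst.
- exact: local_flow_continuous.
Qed.

Lemma addr_convex (a d : R) x y z :
  `|a + x| < d -> `|a + z| < d -> x <= y <= z -> `|a + y| < d.
Proof. rewrite !ltr_norml => /andP[? ?] /andP[? ?] /andP[? ?]; apply/andP; split; lra. Qed.

Lemma near_addr_lt (a d u : R) : `|a + u| < d -> \forall v \near u, `|a + v| < d.
Proof.
apply: (near_norm_lt (f := fun v => a + v)).
by apply: cvgD; [exact: cvg_cst|exact: cvg_id].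
Qed.

(** Agreement propagates because heights differ locally by a constant and times run at the same
    speed, so both curves follow one plaque; disagreement propagates because the space is
    Hausdorff. *)
Lemma local_flow_eq p q y s : dm p y -> dm q y ->
  `|tm p y + s| < rd p -> `|tm q y + s| < rd q -> lf p s y = lf q s y.
Proof.
move=> py qy ps qs.
pose I : set R := [set u | `|tm p y + u| < rd p /\ `|tm q y + u| < rd q].
apply: (@lc_convex R I (fun s => lf p s y = lf q s y) 0 s) => //.
- by move=> a b c [a1 a2] [c1 c2] abc; split; apply: addr_convex abc.
- move=> u [pu qu]; have [E|E] := pselect (lf p u y = lf q u y); last first.
    apply: filterS (near_neq hN (local_flow_continuous_t py pu)
      (local_flow_continuous_t qy qu) E) => v vE _.
    by split.
  have [pz tz hz] := local_flow_dom py pu.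
  have [qz tz' hz'] := local_flow_dom qy qu.
  set z := lf p u y in E pz tz hz; rewrite -/z -E in qz tz' hz'.
  have p0 : `|tm p z + 0| < rd p by rewrite addr0 tz.
  have cz : {for 0, continuous (fun s => lf p s z)} := local_flow_continuous_t pz p0.
  have N1 : \forall s \near (0 : R), dm q (lf p s z).
    by apply: (near_image cz); rewrite local_flow0//; exact: near_bdom.
  have N2 : \forall s \near (0 : R), ht q (lf p s z) - ht p (lf p s z) = ht q z - ht p z.
    apply: (near_image (P := fun w => ht q w - ht p w = _) cz).
    by rewrite local_flow0//; exact: (fa_height fa pz qz).
  have N3 := fa_time fa pz qz.
  have N4 := near_addr_lt p0.
  apply: near_shift0; near=> w.
  have pw : `|tm p z + w| < rd p by near: w.
  have [_ _ hw] := local_flow_dom pz pw.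
  move=> [_]; split=> // _; rewrite -local_flowD// -/z.
  rewrite -[RHS]local_flowD// -E -[LHS](bmapK (isb q)); last by near: w.
  congr (mp q _ _); first by near: w.
  have : ht q (lf p w z) - ht p (lf p w z) = ht q z - ht p z by near: w.
  by rewrite hw => /addIr.
- by split; rewrite addr0; [exact: (btime_lt (isb p))|exact: (btime_lt (isb q))].
- by rewrite !local_flow0.
Unshelve. all: by end_near.
Qed.

Hypothesis cN : compact [set: N].

Lemma flow_radius : exists2 d : R, 0 < d &
  forall y, exists2 p, dm p y & `|tm p y| + d < rd p.
Proof.
pose P (d : R) y := exists2 p, dm p y & `|tm p y| + d < rd p.
have : \forall d \near 0^'+, [set: N] `<=` P d.
  apply: (compact_near_coveringP _).1 => // y _.
  have [yd y0 _] := fa_center fa y.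
  have r0 := brad_gt0 (isb y).
  exists ([set z | dm y z /\ `|tm y z| < rd y / 2], [set d | d < rd y / 2]).
    split=> /=; last by apply: nbhs_right_lt; rewrite divr_gt0.
    apply: filterI; first exact: near_bdom.
    apply: near_norm_lt; first exact: (btime_continuous (isb y)).
    by rewrite y0 normr0 divr_gt0.
  by move=> [z d] /= [[? ?] ?]; exists y => //; lra.
move=> H; near (0 : R)^'+ => d; exists d; first by near: d; exact: nbhs_right_gt.
by move=> y; apply: (near H d).
Unshelve. all: by end_near.
Qed.

(** A step shorter than the uniform radius [d] can be made in any suitable box; a time [t] is cut
    into [n] equal steps of that kind. Two subdivisions are compared through a common multiple. *)
Lemma global_flow : exists F : R -> N -> N,
  [/\ forall y, F 0 y = y, forall s t y, F s (F t y) = F (s + t) y,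
      continuous (fun z : R * N => F z.1 z.2) &
      forall p y s, dm p y -> `|tm p y + s| < rd p -> F s y = lf p s y].
Proof.
have [d d0 Hd] := flow_radius.
have Hd' y : exists p, dm p y /\ `|tm p y| + d < rd p by have [p ? ?] := Hd y; exists p.
have [k0 Hk] := choice Hd'.
have kd y s : `|s| < d -> `|tm (k0 y) y + s| < rd (k0 y).
  by move=> sd; have [_] := Hk y; have := ler_normD (tm (k0 y) y) s; lra.
pose phi s y := lf (k0 y) s y.
have phiE p y s : dm p y -> `|s| < d -> `|tm p y + s| < rd p -> phi s y = lf p s y.
  move=> py sd ps; apply: local_flow_eq => //; first by case: (Hk y).
  exact: kd.
have phi0 y : phi 0 y = y by rewrite /phi local_flow0//; case: (Hk y).
have phiD s u y : `|s| < d -> `|u| < d -> `|s + u| < d -> phi s (phi u y) = phi (s + u) y.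
  move=> sd ud sud; have [py _] := Hk y.
  have [pz tz hz] := local_flow_dom py (kd _ _ ud).
  rewrite {2}/phi (phiE (k0 y))//; last by rewrite tz -addrA (addrC u) kd.
  by rewrite local_flowD ?kd// addrC.
have phi_cont s y : `|s| < d -> {for (s, y), continuous (fun z : R * N => phi z.1 z.2)}.
  move=> sd; have [py _] := Hk y; have ps := kd y s sd.
  apply: near_eq_continuous (local_flow_continuous py ps).
  have N1 : \forall z \near (s, y), `|z.1| < d.
    by apply: (near_norm_lt (f := fun z : R * N => z.1)); [exact: cvg_fst|].
  have N2 : \forall z \near (s, y), dm (k0 y) z.2.
    by apply: (near_image (f := fun z : R * N => z.2)); [exact: cvg_snd|exact: near_bdom].
  have N3 : \forall z \near (s, y), `|tm (k0 y) z.2 + z.1| < rd (k0 y).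
    apply: (near_norm_lt (f := fun z : R * N => tm (k0 y) z.2 + z.1)) => //.
    apply: cvgD; last exact: cvg_fst.
    by apply: (cvg_comp _ _ (@cvg_snd _ _ _ _ _)); exact: (btime_continuous (isb _)).
  by apply: filterS3 N1 N2 N3 => z ? ? ?; rewrite (phiE (k0 y)).
have small (n k : nat) (t : R) : (0 < n)%N -> (k <= n)%N -> `|t| < d -> `|k%:R * (t / n%:R)| < d.
  move=> n0 kn td; apply: le_lt_trans td.
  rewrite mulrCA normrM ler_piMr// ger0_norm ?divr_ge0//.
  by rewrite ler_pdivrMr ?ltr0n// mul1r ler_nat.
have iter_sub n t y : (0 < n)%N -> `|t| < d -> iter n (phi (t / n%:R)) y = phi t y.
  move=> n0 td.
  have H k : (k <= n)%N -> iter k (phi (t / n%:R)) y = phi (k%:R * (t / n%:R)) y.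
    elim: k => [|k IH] kn; first by rewrite mul0r phi0.
    rewrite iterS IH ?(ltnW kn)// phiD.
    + by rewrite -natr1 mulrDl mul1r addrC.
    + by have := small n 1%N t n0 n0 td; rewrite mul1r.
    + by apply: small => //; exact: ltnW.
    + by rewrite -[X in X + _]mul1r -mulrDl addrC natr1; exact: small.
  by rewrite H// mulrCA mulfV ?mulr1// pnatr_eq0 -lt0n.
pose fine n (t : R) := (0 < n)%N /\ `|t / n%:R| < d.
have fine_mul n m t y : fine n t -> (0 < m)%N ->
    iter (m * n) (phi (t / (m * n)%:R)) y = iter n (phi (t / n%:R)) y.
  move=> [n0 nt] m0.
  have -> : t / (m * n)%:R = t / n%:R / m%:R by rewrite natrM invfM; ring.
  elim: n {n0} (t / n%:R) nt => [|n IH] u ud; first by rewrite muln0.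
  by rewrite mulnS ssrnat.iterD IH// iter_sub.
have fineE n m t y : fine n t -> fine m t ->
    iter n (phi (t / n%:R)) y = iter m (phi (t / m%:R)) y.
  move=> fn fm; rewrite -(fine_mul n m)//; last by case: fm.
  by rewrite mulnC (fine_mul m n)//; case: fn.
have fine_ex (C : R) : exists2 n, (0 < n)%N & forall t, `|t| <= C -> fine n t.
  exists (Num.trunc (C / d)).+1 => // t tC; split=> //.
  rewrite normrM normfV normr_nat ltr_pdivrMr ?ltr0n// mulrC.
  apply: le_lt_trans tC _; rewrite -ltr_pdivrMr//; exact: truncnS_gt.
have fine_ex1 t : exists n, fine n t.
  by have [n _ H] := fine_ex `|t|; exists n; exact: H.
have [K HK] := choice fine_ex1.
pose F t y := iter (K t) (phi (t / (K t)%:R)) y.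
have FE n t y : fine n t -> F t y = iter n (phi (t / n%:R)) y by move=> ?; exact: fineE.
have Fphi t y : `|t| < d -> F t y = phi t y.
  by move=> td; rewrite (FE 1%N) /fine ?divr1.
have FD s t y : F s (F t y) = F (s + t) y.
  have [n n0 H] := fine_ex (`|s| + `|t|).
  have ns : fine n s by apply: H; rewrite lerDl.
  have nt : fine n t by apply: H; rewrite lerDr.
  have nst : fine n (s + t) by apply: H; exact: ler_normD.
  rewrite (FE n s)// (FE n t)// (FE n (s + t))// mulrDl.
  move: ns nt nst => [_ sd] [_ td] [_]; rewrite mulrDl.
  move: sd td; set a := s / _; set b := t / _ => ad bd abd.
  (* Short steps commute because their durations add up in either order; this regroups [n] steps of
     each kind into [n] steps of the sum. *)
  have comm k z : iter k (phi a) (phi b z) = phi b (iter k (phi a) z).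
    by elim: k => //= k ->; rewrite phiD// addrC -phiD// addrC.
  elim: n {H n0 a b} (a) (b) ad bd abd comm => // n IH a b ad bd abd comm.
  by rewrite iterS [iter n.+1 (phi b) y]iterS comm phiD// IH.
have Fc : continuous (fun z : R * N => F z.1 z.2).
  move=> [t y]; have [n n0 H] := fine_ex (`|t| + 1).
  have nt : fine n t by apply: H; rewrite lerDl.
  have ck k : {for (t, y), continuous (fun z : R * N => iter k (phi (z.1 / n%:R)) z.2)}.
    elim: k => [|k IH]; first exact: cvg_snd.
    apply: (continuous_comp2_for (f := fun z : R * N => z.1 / n%:R)) => //.
      by apply: cvgM; [exact: cvg_fst|exact: cvg_cst].
    by apply: phi_cont; case: nt.
  apply: near_eq_continuous (ck n).
  have N1 : \forall z \near (t, y), `|z.1| < `|t| + 1.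
    apply: (near_norm_lt (f := fun z : R * N => z.1)); first exact: cvg_fst.
    by rewrite ltrDl.
  by apply: filterS N1 => z zt; rewrite (FE n)//; apply: H; exact: ltW.
exists F; split=> //.
- by move=> y; rewrite Fphi ?normr0.
- move=> p y s py ps.
  pose I : set R := [set u | `|tm p y + u| < rd p].
  have Ft u : {for u, continuous (fun s => F s y)}.
    apply: (continuous_comp2_for (f := id) (g := cst y) (h := F)).
    + exact: cvg_id.
    + exact: cvg_cst.
    + exact: Fc.
  (* A box may last longer than [d]. The identity, known for short times, is continued along the
     interval of times spent in the box. *)
  apply: (@lc_convex R I (fun s => F s y = lf p s y) 0 s) => //.
  + by move=> a b c a1 c1; exact: addr_convex.
  + move=> u pu; have [E|E] := pselect (F u y = lf p u y); last first.
      apply: filterS (near_neq hN (Ft u) (local_flow_continuous_t py pu) E) => v vE _.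
      by split.
    have [pz tz hz] := local_flow_dom py pu.
    have N1 : \forall w \near (0 : R), `|w| < d.
      by apply: (near_norm_lt (f := id)); [exact: cvg_id|rewrite normr0].
    have p0 : `|tm p (lf p u y) + 0| < rd p by rewrite addr0 tz.
    have N2 := near_addr_lt p0.
    apply: near_shift0; apply: filterS2 N1 N2 => w wd pw _; split=> // _.
    by rewrite addrC -FD E Fphi// (phiE p)// addrC local_flowD// addrC.
  + by rewrite /I /= addr0; exact: (btime_lt (isb p)).
  + by rewrite local_flow0// Fphi ?normr0.
Qed.
End FlowAtlas.

(** * Holonomy, transversals and periodic orbits *)

Section Flow.
Context {R : realType} {N : topologicalType}.
Variable bx : N -> @box R N.
Variable F : R -> N -> N.

Record flow_structure : Prop := FlowStructure {
  fs_atlas : flow_atlas bx;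
  fs_hausdorff : hausdorff_space N;
  fs_compact : compact [set: N];
  fs_0 : forall y, F 0 y = y;
  fs_D : forall s t y, F s (F t y) = F (s + t) y;
  fs_continuous : continuous (fun z : R * N => F z.1 z.2);
  fs_local : forall p y s, bdom (bx p) y -> `|btime (bx p) y + s| < brad (bx p) ->
    F s y = local_flow bx p s y }.

Hypothesis fl : flow_structure.
Let fa := fs_atlas fl.
Let hN := fs_hausdorff fl.
Let F0 := fs_0 fl.
Let FD := fs_D fl.
Let Fc := fs_continuous fl.
Let FL := fs_local fl.

Local Notation dm p := (bdom (bx p)).
Local Notation tm p := (btime (bx p)).
Local Notation ht p := (bheight (bx p)).
Local Notation rd p := (brad (bx p)).
Local Notation mp p := (bmap (bx p)).
Let isb p := fa_box fa p.

Lemma flow_continuous (U : topologicalType) (t : U -> R) (y : U -> N) (u : U) :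
  {for u, continuous t} -> {for u, continuous y} ->
  {for u, continuous (fun v => F (t v) (y v))}.
Proof. by move=> ct cy; apply: (continuous_comp2_for ct cy); exact: Fc. Qed.

Lemma flow_continuous_t y : continuous (fun t => F t y).
Proof. by move=> t; apply: flow_continuous; [exact: cvg_id|exact: cvg_cst]. Qed.

Lemma flow_continuous_y t : continuous (F t).
Proof. by move=> y; apply: flow_continuous; [exact: cvg_cst|exact: cvg_id]. Qed.

Lemma flowK s y : F (- s) (F s y) = y.
Proof. by rewrite FD addNr F0. Qed.

Lemma flow_box p y s : dm p y -> `|tm p y + s| < rd p ->
  [/\ dm p (F s y), tm p (F s y) = tm p y + s & ht p (F s y) = ht p y].
Proof. by move=> py ps; rewrite (FL py ps); exact: (local_flow_dom fa). Qed.

Lemma plaque p y z : dm p y -> dm p z -> ht p y = ht p z -> z = F (tm p z - tm p y) y.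
Proof.
move=> py pz h; have E : tm p y + (tm p z - tm p y) = tm p z by rewrite addrC subrK.
rewrite (FL (p := p)) ?E//; last exact: (btime_lt (isb p)).
by rewrite /local_flow E h (bmapK (isb p)).
Qed.

Lemma center_dom p : dm p p. Proof. by case: (fa_center fa p). Qed.
Lemma center_time p : tm p p = 0. Proof. by case: (fa_center fa p). Qed.
Lemma center_height p : ht p p = 0. Proof. by case: (fa_center fa p). Qed.
Lemma rad_gt0 p : 0 < rd p. Proof. exact: (brad_gt0 (isb p)). Qed.

Lemma near_height p q y : dm p y -> dm q y ->
  \forall z \near y, ht q z = ht p z + (ht q y - ht p y).
Proof.
move=> py qy; apply: filterS (fa_height fa py qy) => z H.
by rewrite -H addrC subrK.
Qed.

Lemma near_small (d : R) : 0 < d -> \forall s \near (0 : R), `|s| < d.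
Proof. by move=> d0; apply: (near_norm_lt (f := id)); [exact: cvg_id|rewrite normr0]. Qed.

Definition holonomy_at i x T := forall j, dm j (F T x) ->
  \forall y \near x, ht j (F T y) = ht i y + (ht j (F T x) - ht i x).

(* The height is a first integral of the flow up to additive constants, so that
   the holonomy along an orbit is a translation in the height coordinate. *)
Lemma holonomy i x T : dm i x -> holonomy_at i x T.
Proof.
move=> ix.
pose H T j := \forall y \near x, ht j (F T y) = ht i y + (ht j (F T x) - ht i x).
have switch u p j : dm p (F u x) -> dm j (F u x) -> H u p -> H u j.
  move=> px jx Hp.
  have N1 : \forall y \near x, ht j (F u y) = ht p (F u y) + (ht j (F u x) - ht p (F u x)).
    apply: (near_image (P := fun z => ht j z = ht p z + (ht j (F u x) - ht p (F u x)))
      (@flow_continuous_y u x)).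
    exact: near_height.
  by apply: filterS2 N1 Hp => y -> ->; ring.
have core u s : let q := F u x in `|s| < rd q -> dm q (F (u + s) x) /\
    (\forall y \near x, ht q (F (u + s) y) = ht q (F u y)).
  move=> q sd.
  have E y : F (u + s) y = F s (F u y) by rewrite FD addrC.
  have qs : `|tm q (F u x) + s| < rd q by rewrite center_time add0r.
  have N1 : \forall y \near x, dm q (F u y).
    by apply: (near_image (@flow_continuous_y u x)); apply: (near_bdom fa); exact: center_dom.
  have N2 : \forall y \near x, `|tm q (F u y) + s| < rd q.
    apply: near_norm_lt => //; apply: cvgD; last exact: cvg_cst.
    apply: (continuous_comp (@flow_continuous_y u x)).
    exact: (btime_continuous (isb q) (center_dom q)).
  split; first by rewrite E; case: (flow_box (center_dom q) qs).
  by apply: filterS2 N1 N2 => y qy qys; rewrite E; case: (flow_box qy qys).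
have qq u : dm (F u x) (F u x) by exact: center_dom.
suff HT : H T (F T x) by move=> j jx; exact: (switch _ _ _ (qq T) jx HT).
(* In the box of [F u x] a short flow keeps the height of all nearby points, so the property at time
   [u] is equivalent to the property at [u + s]. *)
apply: (@lc_convex R setT (fun T => H T (F T x)) 0) => // [u _|]; last first.
  apply: (switch 0 i) => //; first by rewrite F0.
  by near=> y; rewrite !F0; ring.
have N1 := near_small (rad_gt0 (F u x)).
apply: near_shift0; apply: filterS N1 => s sd _.
have [ds cs] := core u s sd; have cs' := nbhs_singleton cs.
split=> Hu.
  have {}Hu := switch _ _ _ (qq _) ds Hu.
  by rewrite /H -cs'; apply: filterS2 cs Hu => y <-.
apply: (switch (u + s) (F u x)) => //.
by rewrite /H cs'; apply: filterS2 cs Hu => y ->.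
Unshelve. all: by end_near.
Qed.

Definition slice x r := mp x 0 r.
(** The flow-out of the transversal through [x], a local homeomorphism from a strip of the plane.
    Around a closed orbit, and for small [r], it is the universal covering of a tube. *)
Definition sheet x t r := F t (slice x r).

Lemma sheetE x t r : sheet x t r = F t (slice x r).
Proof. by []. Qed.

Lemma slice_box x r : `|r| < rd x ->
  [/\ dm x (slice x r), tm x (slice x r) = 0 & ht x (slice x r) = r].
Proof.
move=> rx; have x0 : `|0 : R| < rd x by rewrite normr0 rad_gt0.
split; [exact: (bdom_bmap (isb x))|exact: (btime_bmap (isb x))|exact: (bheight_bmap (isb x))].
Qed.

Lemma slice0 x : slice x 0 = x.
Proof. have := bmapK (isb x) (center_dom x).
by rewrite center_time center_height. Qed.

Lemma slice_continuous x r : `|r| < rd x -> {for r, continuous (slice x)}.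
Proof.
move=> rx; have x0 : `|0 : R| < rd x by rewrite normr0 rad_gt0.
apply: (continuous_comp2_for (f := cst 0) (g := id) (h := mp x)).
- exact: cvg_cst.
- exact: cvg_id.
- exact: (bmap_continuous (isb x)).
Qed.

Lemma sheet_continuous x t r : `|r| < rd x ->
  {for (t, r), continuous (fun z : R * R => sheet x z.1 z.2)}.
Proof.
move=> rx; apply: flow_continuous; first exact: cvg_fst.
apply: (continuous_comp (f := snd) (g := slice x)); first exact: cvg_snd.
exact: slice_continuous.
Qed.

Lemma sheetD x s t r : F s (sheet x t r) = sheet x (s + t) r.
Proof. by rewrite /sheet FD. Qed.

(** Holonomy settles the variation of [r] at the fixed time [t]; a short extra flow then stays in
    the box and keeps the height. *)
Lemma sheet_height x t r : `|r| < rd x -> forall p, dm p (sheet x t r) ->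
  \forall z \near (t, r), dm p (sheet x z.1 z.2) /\
    ht p (sheet x z.1 z.2) = ht p (sheet x t r) + (z.2 - r).
Proof.
move=> rx p pE; have [xr _ hr] := slice_box rx.
have N1 : \forall r' \near r, ht p (sheet x t r') = ht x (slice x r') + (ht p (sheet x t r) - r).
  apply: (near_image (P := fun y => ht p (F t y) = ht x y + (ht p (sheet x t r) - r)) (slice_continuous rx)).
  by have := holonomy (T := t) xr pE; rewrite hr.
have N2 : \forall r' \near r, `|r'| < rd x.
  by apply: (near_norm_lt (f := id)) => //; exact: cvg_id.
have N3 : \forall r' \near r, ht p (sheet x t r') = ht p (sheet x t r) + (r' - r).
  apply: filterS2 N1 N2 => r' -> r'x.
  by have [_ _ ->] := slice_box r'x; ring.
have N4 : \forall z \near (t, r), ht p (sheet x t z.2) = ht p (sheet x t r) + (z.2 - r).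
  have cs : {for (t, r), continuous (fun z : R * R => z.2)} by exact: cvg_snd.
  exact: (near_image (P := fun r' => ht p (sheet x t r') = ht p (sheet x t r) + (r' - r)) cs N3).
have ct : {for (t, r), continuous (fun z : R * R => sheet x t z.2)}.
  apply: (continuous_comp (f := fun z : R * R => (t, z.2)) (g := fun z => sheet x z.1 z.2)).
    by apply: continuous_pair_for; [exact: cvg_cst|exact: cvg_snd].
  exact: sheet_continuous.
have N5 : \forall z \near (t, r), dm p (sheet x t z.2).
  by apply: (near_image ct); exact: (near_bdom fa).
have N6 : \forall z \near (t, r), `|tm p (sheet x t z.2) + (z.1 - t)| < rd p.
  apply: near_norm_lt; last by rewrite subrr addr0; exact: (btime_lt (isb p)).
  apply: cvgD; last by apply: cvgB; [exact: cvg_fst|exact: cvg_cst].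
  by apply: (continuous_comp ct); exact: (btime_continuous (isb p)).
near=> z.
have p1 : dm p (sheet x t z.2) by near: z.
have p2 : `|tm p (sheet x t z.2) + (z.1 - t)| < rd p by near: z.
have := flow_box p1 p2; rewrite sheetD subrK => -[? _ ->]; split=> //.
by near: z.
Unshelve. all: by end_near.
Qed.

(* The inverse of the local homeomorphism [sheet x] near [sheet x t r]. *)
Lemma sheet_inverse x t r : `|r| < rd x -> let p := sheet x t r in
  \forall y \near p, y = sheet x (t + (tm p y - tm p (sheet x t (r + ht p y)))) (r + ht p y).
Proof.
move=> rx p; have pp := center_dom p.
have ch : {for p, continuous (fun y => r + ht p y)}.
  by apply: cvgD; [exact: cvg_cst|exact: (bheight_continuous (isb p))].
have cg : {for p, continuous (fun y => (t, r + ht p y))}.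
  by apply: continuous_pair_for => //; exact: cvg_cst.
have N1 : \forall y \near p, dm p (sheet x t (r + ht p y)) /\
    ht p (sheet x t (r + ht p y)) = ht p (sheet x t r) + (r + ht p y - r).
  apply: (near_image (P := fun z => dm p (sheet x z.1 z.2) /\ ht p (sheet x z.1 z.2) = ht p (sheet x t r) + (z.2 - r)) cg).
  have -> : r + ht p p = r by rewrite center_height addr0.
  exact: (sheet_height rx pp).
apply: filterS2 N1 (near_bdom fa pp) => y [p1 h1] py.
rewrite addrC -sheetD; apply: plaque => //.
by rewrite h1 -/p center_height; ring.
Qed.

Definition orbit x := range (fun t => F t x).

Lemma minimal_period x : (exists2 T, 0 < T & F T x = x) ->
  exists T, [/\ 0 < T, F T x = x & forall t, F t x = x -> exists k : int, t = k%:~R * T].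
Proof.
move=> [T0 T00 T0x]; pose A := [set t | 0 < t /\ F t x = x].
have sep t : 0 < t -> t < rd x -> F t x <> x.
  move=> t0 tx E; have xt : `|tm x x + t| < rd x by rewrite center_time add0r gtr0_norm.
  have [_ + _] := flow_box (center_dom x) xt.
  by rewrite E center_time add0r => tE; rewrite -tE ltxx in t0.
have A0 : A !=set0 by exists T0.
have iA : has_inf A by split=> //; exists 0 => t [/ltW].
(* A period within [rd x] of the infimum is already minimal: a smaller one would leave a difference
   that is a positive period below [rd x], which [sep] excludes. *)
have /(inf_adherent (rad_gt0 x)) [T [T1 T2] TI] := iA.
have minT t : 0 < t -> F t x = x -> T <= t.
  move=> t1 t2; rewrite leNgt; apply/negP => tT.
  have It : inf A <= t by apply: ge_inf; [by case: iA|].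
  apply: (sep (T - t)); rewrite ?subr_gt0//; first by lra.
  by rewrite -{1}t2 FD subrK.
exists T; split=> // t tx; exists (Num.floor (t / T)).
have per (n : nat) : F (n%:R * T) x = x.
  by elim: n => [|n IH]; rewrite ?mul0r ?F0// -natr1 mulrDl mul1r -FD T2.
have perz (k : int) : F (k%:~R * T) x = x.
  case: k => n; first exact: per.
  by rewrite NegzE mulrNz mulNr -{1}(per n.+1) flowK.
set k := Num.floor _.
have /andP[k1 k2] := Num.Theory.floor_itv (t / T).
have kt : k%:~R * T <= t by rewrite -ler_pdivlMr.
have kt' : t - k%:~R * T < T.
  have : t < (k + 1)%:~R * T by rewrite -ltr_pdivrMr.
  by rewrite intrD mulrDl mul1r; lra.
have perd : F (t - k%:~R * T) x = x by rewrite -[X in F _ X](perz k) FD subrK.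
apply/eqP; rewrite -subr_eq0 eq_le subr_ge0 kt andbT leNgt; apply/negP => d0.
by have := minT _ d0 perd; rewrite leNgt kt'.
Qed.

Lemma periodZ x T (k : int) : F T x = x -> F (k%:~R * T) x = x.
Proof.
move=> T2.
have per (n : nat) : F (n%:R * T) x = x.
  by elim: n => [|n IH]; rewrite ?mul0r ?F0// -natr1 mulrDl mul1r -FD T2.
case: k => n; first exact: per.
by rewrite NegzE mulrNz mulNr -{1}(per n.+1) flowK.
Qed.

(** A neighbourhood of a closed orbit made of closed orbits, [tau r] being the least period at
    height [r]. The bound on [tau] makes the closed tubes compact. *)
Record tube (x : N) (e : R) (tau : R -> R) : Prop := Tube {
  tube_gt0 : 0 < e;
  tube_rad : e < rd x;
  tube_per_gt0 : forall r, `|r| < e -> 0 < tau r;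
  tube_per_bounded : exists L, forall r, `|r| < e -> tau r <= L;
  tube_per_continuous : forall r, `|r| < e -> {for r, continuous tau};
  tube_per : forall r, `|r| < e -> F (tau r) (slice x r) = slice x r;
  tube_inj : forall r r' t, `|r| < e -> `|r'| < e -> F t (slice x r) = slice x r' ->
    r = r' /\ exists k : int, t = k%:~R * tau r }.

Lemma tubeS x e tau e' : tube x e tau -> 0 < e' -> e' <= e -> tube x e' tau.
Proof.
case=> ? er H1 [L HL] H2 H3 H4 ? ee; have lt r : `|r| < e' -> `|r| < e by move=> ?; lra.
split=> //; first lra; try by move=> r /lt; auto.
  by exists L => r /lt; auto.
by move=> r r' t /lt ? /lt ?; exact: H4.
Qed.

Lemma near_triple (t : R) (A : R -> R -> R -> Prop) :
  (\forall z \near (t, (0 : R, 0 : R)), A z.1 z.2.1 z.2.2) ->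
  \forall t' \near t & e \near 0^'+, forall r r', `|r| < e -> `|r'| < e -> A t' r r'.
Proof.
move=> [[U V] /= [Ut [[V1 V2] [/= n1 n2] sV]] sU].
have [d1 /= d10 H1] := n1; have [d2 /= d20 H2] := n2.
exists (U, [set e | e < Num.min d1 d2]).
  by split=> //=; apply: nbhs_right_lt; rewrite lt_min d10.
move=> [t' e] /= [Ut' ed] r r' re r'e; apply: (sU (t', (r, r'))); split=> //=.
move: ed; rewrite lt_min => /andP[ed1 ed2].
apply: sV; split=> /=; [apply: H1|apply: H2]; rewrite /= sub0r normrN; lra.
Qed.

Lemma near_radius (B : R -> Prop) :
  (\forall r \near (0 : R), B r) -> \forall e \near 0^'+, forall r, `|r| < e -> B r.
Proof.
move=> [d /= d0 H]; apply: filterS (nbhs_right_lt d0) => e ed r re.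
by apply: H; rewrite /= sub0r normrN; lra.
Qed.

Lemma near_prod_snd (U V : Type) (G : set_system U) (H : set_system V) (B : V -> Prop) :
  Filter G -> (\forall e \near H, B e) -> \forall t \near G & e \near H, B e.
Proof. by move=> FG HB; exists (setT, B); [split=> //; exact: filterT|case=> ? ? []]. Qed.

(** The return map is a translation in height and it fixes [x], so it preserves all small heights;
    what remains is to adjust the return time. *)
Lemma periodic_tube x : (exists2 T, 0 < T & F T x = x) -> exists e tau, tube x e tau.
Proof.
move=> /minimal_period [T [T0 Tx Tm]].
have x0 : `|0 : R| < rd x by rewrite normr0 rad_gt0.
pose G r := F T (slice x r).
have G0 : G 0 = x by rewrite /G slice0.
have cG r : `|r| < rd x -> {for r, continuous G}.
  move=> rx; apply: (continuous_comp (slice_continuous rx)); exact: flow_continuous_y.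
have xG : dm x (G 0) by rewrite G0; exact: center_dom.
have N1 : \forall r \near (0 : R), dm x (G r).
  by apply: (near_image (cG _ x0)); exact: (near_bdom fa).
have N2 : \forall r \near (0 : R), ht x (G r) = r.
  have : \forall z \near (T, 0), dm x (sheet x z.1 z.2) /\
      ht x (sheet x z.1 z.2) = ht x (sheet x T 0) + (z.2 - 0) := sheet_height x0 xG.
  move=> /(near_image (f := fun r : R => (T, r)) (x := 0)) H.
  have {}H : \forall r \near (0 : R), dm x (sheet x T r) /\ ht x (sheet x T r) = ht x (sheet x T 0) + (r - 0).
    by apply: H; apply: continuous_pair_for; [exact: cvg_cst|exact: cvg_id].
  apply: filterS H => r [_]; rewrite /sheet -/(G r) => ->.
  by rewrite -/(G 0) G0 center_height subr0 add0r.
(* [G r] and [slice x r] have the same height, hence lie on one plaque; removing the time coordinate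
   of [G r] gives an exact return. *)
pose tau r := T - tm x (G r).
have ctau r : `|r| < rd x -> dm x (G r) -> {for r, continuous tau}.
  move=> rx Gr; apply: cvgB; first exact: cvg_cst.
  by apply: (continuous_comp (cG _ rx)); exact: (btime_continuous (isb x)).
have tau0 : tau 0 = T by rewrite /tau G0 center_time subr0.
have c0 : tau r @[r --> 0] --> T by rewrite -tau0; exact: ctau.
have N3 : \forall r \near (0 : R), 0 < tau r by exact: (cvgr_gt _ c0).
have N4 : \forall r \near (0 : R), tau r < 2 * T.
  by apply: (cvgr_lt _ c0); lra.
have per r : `|r| < rd x -> dm x (G r) -> ht x (G r) = r -> F (tau r) (slice x r) = slice x r.
  move=> rx Gr hr; have [sx s0 sr] := slice_box rx.
  rewrite /tau addrC -FD -/(G r) [RHS](plaque Gr sx) ?sr// s0 sub0r //.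
have NN : \forall r \near (0 : R), (`|r| < rd x /\ dm x (G r) /\ ht x (G r) = r) /\ 0 < tau r < 2 * T.
  have N5 := near_small (rad_gt0 x).
  near=> r; split; last by apply/andP; split; near: r.
  by split; [near: r|split; near: r].
(* Returns during [0, 2T] are controlled by compactness. Away from the multiples of [T] the orbit
   stays off the transversal near [x]; near [n T] the time is compared with [n] times [tau r] inside
   the box of [x]. *)
pose P (e : R) (t : R) := forall r r', `|r| < e -> `|r'| < e -> F t (slice x r) = slice x r' ->
  r = r' /\ exists k : int, t = k%:~R * tau r.
have : \forall e \near 0^'+, `[0, 2 * T]%classic `<=` P e.
  apply: (compact_near_coveringP _).1; first exact: segment_compact.
  move=> t _; have [[n tn]|nt] := pselect (exists k : int, t = k%:~R * T).
    have N5 : \forall z \near (t, (0 : R, 0 : R)), `|z.1 - n%:~R * tau z.2.1| < rd x.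
      apply: (near_norm_lt (f := fun z : R * (R * R) => z.1 - n%:~R * tau z.2.1)); last first.
        by rewrite /= tau0 tn subrr.
      apply: cvgB; first exact: cvg_fst.
      apply: cvgM; first exact: cvg_cst.
      apply: (continuous_comp (f := fun z : R * (R * R) => z.2.1) (g := tau)).
        apply: (continuous_comp (f := snd) (g := fst)); [exact: cvg_snd|exact: cvg_fst].
      exact: ctau.
    have := near_triple (A := fun t r r' => `|t - n%:~R * tau r| < rd x) N5.
    apply: filterS2 (near_prod_snd _ (near_radius NN)) => -[t' e] /= H1 H2 r r' re r'e.
    have [[rx [Gr hr]] _] := H1 _ re; have [[rx' _] _] := H1 _ r'e.
    have {H2} := H2 _ _ re r'e; set u := t' - _ => ux E.
    have t'E : t' = u + n%:~R * tau r by rewrite /u subrK.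
    have [sx s0 sr] := slice_box rx; have [sx' s0' sr'] := slice_box rx'.
    have ux' : `|tm x (slice x r) + u| < rd x by rewrite s0 add0r.
    have [_ tE hE] := flow_box sx ux'.
    move: E; rewrite t'E -FD periodZ ?per// => E.
    rewrite E s0' s0 add0r in tE; rewrite E sr sr' in hE.
    by rewrite -tE add0r hE; split=> //; exists n.
  have nE : F t x <> x by move=> /Tm.
  have c1 : {for (t, (0 : R, 0 : R)), continuous (fun z : R * (R * R) => slice x z.2.1)}.
    apply: (continuous_comp (f := fun z : R * (R * R) => z.2.1) (g := slice x)).
      apply: (continuous_comp (f := snd) (g := fst)); [exact: cvg_snd|exact: cvg_fst].
    exact: slice_continuous.
  have c2 : {for (t, (0 : R, 0 : R)), continuous (fun z : R * (R * R) => slice x z.2.2)}.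
    apply: (continuous_comp (f := fun z : R * (R * R) => z.2.2) (g := slice x)).
      apply: (continuous_comp (f := snd) (g := snd)); exact: cvg_snd.
    exact: slice_continuous.
  have c3 : {for (t, (0 : R, 0 : R)), continuous (fun z : R * (R * R) => F z.1 (slice x z.2.1))}.
    by apply: flow_continuous; [exact: cvg_fst|].
  have N5 : \forall z \near (t, (0 : R, 0 : R)), F z.1 (slice x z.2.1) <> slice x z.2.2.
    by apply: near_neq => //=; rewrite slice0.
  have := near_triple (A := fun t r r' => F t (slice x r) <> slice x r') N5.
  by apply: filterS => -[t' e] /= H r r' re r'e /(H _ _ re r'e).
move=> H; have NR := near_radius NN.
near (0 : R)^'+ => e.
have e0 : 0 < e by near: e; exact: nbhs_right_gt.
have He : `[0, 2 * T]%classic `<=` P e by near: e.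
have NE : forall r, `|r| < e -> (`|r| < rd x /\ dm x (G r) /\ ht x (G r) = r) /\ 0 < tau r < 2 * T.
  by near: e.
exists e, tau; split=> //.
- by near: e; exact: nbhs_right_lt (rad_gt0 x).
- by move=> r /NE[_ /andP[]].
- by exists (2 * T) => r /NE[_ /andP[_ /ltW]].
- by move=> r /NE[[? [? _]] _]; exact: ctau.
- by move=> r /NE[[? [? ?]] _]; exact: per.
move=> r r' t re r'e E.
have [[rx [Gr hr]] /andP[tp t2]] := NE _ re.
have /andP[k1 k2] := Num.Theory.floor_itv (t / tau r); set k := Num.floor _ in k1 k2.
have kt : k%:~R * tau r <= t by rewrite -ler_pdivlMr.
have kt' : t - k%:~R * tau r < tau r.
  have : t < (k + 1)%:~R * tau r by rewrite -ltr_pdivrMr.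
  by rewrite intrD mulrDl mul1r; lra.
(* As [tau r] is below 2T, subtracting a multiple of the period brings any time into [0, 2T]. *)
have t02 : `[0, 2 * T]%classic (t - k%:~R * tau r) by rewrite /= in_itv /=; apply/andP; split; lra.
have [] := He _ t02 r r' re r'e.
  rewrite -E -[in RHS](subrK (k%:~R * tau r) t) -[RHS]FD periodZ//; exact: per.
move=> rr [m mE]; split=> //; exists (m + k).
by rewrite intrD mulrDl -mE subrK.
Unshelve. all: by end_near.
Qed.

End Flow.

(** * Recurrence, closed curves and tubes *)

Section FlowMore.
Context {R : realType} {N : topologicalType}.
Variables (bx : N -> @box R N) (F : R -> N -> N).
Hypothesis fl : flow_structure bx F.
Let fa := fs_atlas fl.
Let hN := fs_hausdorff fl.
Let F0 := fs_0 fl.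
Let FD := fs_D fl.
Let isb p := fa_box fa p.

Local Notation dm p := (bdom (bx p)).
Local Notation tm p := (btime (bx p)).
Local Notation ht p := (bheight (bx p)).
Local Notation rd p := (brad (bx p)).
Local Notation mp p := (bmap (bx p)).
Local Notation slice := (slice bx).
Local Notation sheet := (sheet bx F).
Local Notation orbit := (orbit F).
Local Notation tube := (tube bx F).

Lemma in_orbit s x : orbit x (F s x). Proof. by exists s. Qed.

Lemma orbit_refl x : orbit x x. Proof. by exists 0 => //; rewrite F0. Qed.

Lemma orbit_eq x y : orbit x y -> orbit y = orbit x.
Proof.
move=> [s _ <-]; rewrite predeqE => z; split=> [[t _ <-]|[t _ <-]].
  by rewrite FD; exists (t + s).
by exists (t - s) => //; rewrite FD subrK.
Qed.

Lemma orbit_sym x y : orbit x y -> orbit y x.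
Proof. by move=> H; rewrite (orbit_eq H); exact: orbit_refl. Qed.

Lemma orbit_trans x y z : orbit x y -> orbit y z -> orbit x z.
Proof. by move=> /orbit_eq <-. Qed.

Lemma orbit_connected x : connected (orbit x).
Proof.
have -> : orbit x = \bigcup_(t in [set: R]) ((fun u => F (u * t) x) @` `[0, 1]).
  rewrite predeqE => y; split=> [[t _ <-]|[t _ [u _ <-]]]; last exact: in_orbit.
  by exists t => //; exists 1; rewrite ?mul1r//= in_itv /= ler01 lexx.
apply: bigcup_connected.
  by exists x => t _; exists 0; rewrite ?mul0r ?F0//= in_itv /= ler01 lexx.
move=> t _; apply: connected_continuous_connected; first exact: segment_connected.
have H : continuous (fun u : R => F (u * t) x).
  move=> u; apply: (flow_continuous fl (t := fun u : R => u * t) (y := cst x)); last exact: cvg_cst.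
  by apply: cvgM; [exact: cvg_id|exact: cvg_cst].
exact: continuous_subspaceT.
Qed.

Lemma near_plaque (U : topologicalType) (f : U -> N) (u : U) p :
  {for u, continuous f} -> dm p (f u) ->
  (\forall v \near u, ht p (f v) = ht p (f u)) ->
  \forall v \near u, f v = F (tm p (f v) - tm p (f u)) (f u).
Proof.
move=> cf pf h; have N1 : \forall v \near u, dm p (f v).
  by apply: (near_image cf); exact: (near_bdom fa).
by apply: filterS2 N1 h => v pv hv; exact: (plaque fl).
Qed.

Lemma near_slice x r : `|r| < rd x ->
  \forall s \near (0 : R), orbit (slice (slice x r) s) (slice x (r + s)).
Proof.
move=> rx; have [xz tz hz] := slice_box fl rx; set z := slice x r in xz tz hz *.
have z0 : `|0 : R| < rd z by rewrite normr0 (rad_gt0 fl).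
have N1 := near_small (rad_gt0 fl z).
have cz : {for 0, continuous (slice z)} by apply: (slice_continuous fl).
have N2 : \forall s \near (0 : R), ht x (slice z s) = ht z (slice z s) + (ht x z - ht z z).
  apply: (near_image (P := fun y => ht x y = ht z y + (ht x z - ht z z)) cz).
  by rewrite (slice0 fl); apply: (near_height fl) => //; exact: (center_dom fl).
have N3 : \forall s \near (0 : R), dm x (slice z s).
  by apply: (near_image cz); rewrite (slice0 fl); exact: (near_bdom fa).
have N4 := near_addr_lt (a := r) (u := 0) (d := rd x).
rewrite addr0 in N4; have {}N4 := N4 rx.
near=> s.
have rs : `|r + s| < rd x by near: s.
have sz : `|s| < rd z by near: s.
have [xs ts hs] := slice_box fl rs.
have [zs ts' hs'] := slice_box fl sz.
rewrite (plaque fl (p := x) (y := slice z s) (z := slice x (r + s))).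
- exact: in_orbit.
- by near: s.
- by [].
rewrite hs.
have -> : ht x (slice z s) = ht z (slice z s) + (ht x z - ht z z) by near: s.
by rewrite hs' hz (center_height fl) subr0 addrC.
Unshelve. all: by end_near.
Qed.

Lemma near_slice_flow x t : \forall r \near (0 : R), orbit (slice x r) (slice (F t x) r).
Proof.
set q := F t x.
have x0 : `|0 : R| < rd x by rewrite normr0 (rad_gt0 fl).
have E0 : sheet x t 0 = q by rewrite sheetE (slice0 fl).
have qq : dm q (sheet x t 0) by rewrite E0; exact: (center_dom fl).
have N1 : \forall r \near (0 : R), dm q (sheet x t r) /\ ht q (sheet x t r) = ht q (sheet x t 0) + (r - 0).
  have := sheet_height fl x0 qq.
  move=> /(near_image (f := fun r : R => (t, r)) (x := 0)); apply.
  by apply: continuous_pair_for; [exact: cvg_cst|exact: cvg_id].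
have N2 := near_small (rad_gt0 fl q).
apply: filterS2 N1 N2 => r [qr hr] rq.
have [qs ts hs] := slice_box fl rq.
rewrite (plaque fl (p := q) (y := sheet x t r) (z := slice q r))//.
  by rewrite sheetE FD; exact: in_orbit.
by rewrite hs hr E0 (center_height fl) subr0 add0r.
Qed.

Section Recurrence.
Variables h f : N -> R.
Hypothesis h_cont : continuous h.
Hypothesis f_cont : continuous f.
Hypothesis h_inv : forall t y, h (F t y) = h y.
Hypothesis h_deriv : forall p, is_derive (0 : R) 1 (fun r => h (slice p r)) (f p).

Let h_orbit x y : orbit x y -> h y = h x.
Proof. by move=> [t _ <-]. Qed.

(** The transversals through [x] and [F t x] meet the same orbits at the same small heights, so the
    two functions of [r] coincide near 0. *)
Lemma transverse_derivative_inv t x : f (F t x) = f x.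
Proof.
have Ns := near_slice_flow x t.
have E : \forall r \near (0 : R), h (slice x r) = h (slice (F t x) r).
  by apply: filterS Ns => r /h_orbit.
have [_ <-] := h_deriv (F t x).
by have [_ <-] := h_deriv x; apply/esym; exact: near_eq_derive.
Qed.

(** Up to the flow, the transversal through [slice x r] is the one through [x] with heights shifted
    by [r]. *)
Lemma slice_derivative (x : N) (r : R) : `|r| < rd x ->
  is_derive r 1 (fun r => h (slice x r)) (f (slice x r)).
Proof.
move=> rx; set z := slice x r.
have H : is_derive (r - r) 1 (fun s => h (slice z s)) (f z).
  by rewrite subrr; exact: h_deriv.
have H1 : is_derive r 1 (fun v => h (slice z (v - r))) (f z).
  apply: is_derive_eq.
    apply: (@is_derive1_comp _ (fun s => h (slice z s)) (fun v => v - r)).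
  by rewrite /GRing.scale /= subr0 mulr1.
apply: near_eq_is_derive H1 => //; apply: near_shift0.
apply: filterS (near_slice rx) => s /h_orbit ->.
by rewrite addrAC subrr add0r.
Qed.

Lemma recurrent_periodic x : f x != 0 -> exists2 T, 0 < T & F T x = x.
Proof.
move=> fx0.
have fxt t : f (F t x) = f x by exact: transverse_derivative_inv.
(* A limit point of the orbit. By invariance and continuity [f y = f x] is nonzero, so [h] is
   injective on a piece of the transversal through [y]. *)
have [y [_ cy]] : [set: N] `&` cluster ((fun n : nat => F n%:R x) @ \oo) !=set0.
  by apply: (fs_compact fl); exact: filterT.
have clus (A : N -> Prop) (m : nat) : (\forall z \near y, A z) ->
    exists2 n : nat, (m <= n)%N & A (F n%:R x).
  move=> nA; have M : ((fun n : nat => F n%:R x) @ \oo) [set F n%:R x | n in [set n | (m <= n)%N]].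
    by exists m => // n mn; exists n.
  by have [z [[n mn <-] Az]] := cy _ _ M nA; exists n.
have fy : f y = f x.
  apply: contrapT => ne.
  have {}ne : \forall z \near y, f z <> f x.
    exact: (near_neq (@norm_hausdorff R R^o) (@f_cont y) (@cvg_cst _ _ _ _ _ : {for y, continuous (cst (f x))}) ne).
  by have [n _] := clus _ 0%N ne; rewrite fxt.
have hy : h y = h x.
  apply: contrapT => ne.
  have {}ne : \forall z \near y, h z <> h x.
    exact: (near_neq (@norm_hausdorff R R^o) (@h_cont y) (@cvg_cst _ _ _ _ _ : {for y, continuous (cst (h x))}) ne).
  by have [n _] := clus _ 0%N ne; rewrite h_inv.
have y0 : `|0 : R| < rd y by rewrite normr0 (rad_gt0 fl).
have N1 : \forall r \near (0 : R), f (slice y r) != 0.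
  have c : {for 0, continuous (f \o slice y)}.
    by apply: continuous_comp; [exact: (slice_continuous fl)|exact: f_cont].
  have ne : (f \o slice y) 0 <> cst 0 (0 : R).
    by rewrite /= (slice0 fl) fy; exact/eqP.
  have N1 : \forall r \near (0 : R), (f \o slice y) r <> cst 0 r.
    exact: (near_neq (@norm_hausdorff R R^o) c (@cvg_cst _ _ _ _ _ : {for 0, continuous (cst 0)}) ne).
  by apply: filterS N1 => r /eqP.
have [e [e0 [ey fe]]] : exists e, 0 < e /\ e < rd y /\ forall r, `|r| < e -> f (slice y r) != 0.
  near (0 : R)^'+ => e; exists e; split; first by near: e; exact: nbhs_right_gt.
  split; first by near: e; exact: nbhs_right_lt (rad_gt0 fl y).
  by near: e; exact: near_radius.
have inj r1 r2 : `|r1| < e -> `|r2| < e -> r1 < r2 -> h (slice y r1) <> h (slice y r2).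
  move=> r1e r2e r12 E.
  have In r : r1 <= r <= r2 -> `|r| < e.
    move: r1e r2e; rewrite !ltr_norml => /andP[? ?] /andP[? ?] /andP[? ?].
    by apply/andP; split; lra.
  have D r : r1 <= r <= r2 -> is_derive r 1 (fun r => h (slice y r)) (f (slice y r)).
    by move=> /In re; apply: slice_derivative; apply: lt_trans re ey.
  have [] := @MVT R (fun r => h (slice y r)) (fun r => f (slice y r)) r1 r2 r12.
  - by move=> r; rewrite in_itv /= => /andP[? ?]; apply: D; apply/andP; split; exact: ltW.
  - apply: derivable_within_continuous => r; rewrite in_itv /= => rr.
    by have [] := D r rr.
  move=> c; rewrite in_itv /= => /andP[c1 c2]; rewrite E subrr => /esym/eqP.
  rewrite mulf_eq0 subr_eq0 (gt_eqF r12) orbF; apply/negP/fe/In.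
  by apply/andP; split; exact: ltW.
(* Two visits at integer times [n < m] have the same value of [h], hence the same height, hence lie
   on one plaque. The bound 1/4 keeps the shift along the plaque below 1, so the return time
   [m - n - s] is positive. *)
pose A z := [/\ dm y z, `|tm y z| < 4^-1 & `|ht y z| < e].
have NA : \forall z \near y, A z.
  have yy := center_dom fl y.
  have n1 := near_bdom fa yy.
  have n2 : \forall z \near y, `|tm y z| < 4^-1.
    apply: near_norm_lt; first exact: (btime_continuous (isb y)).
    by rewrite (center_time fl) normr0 invr_gt0.
  have n3 : \forall z \near y, `|ht y z| < e.
    apply: near_norm_lt; first exact: (bheight_continuous (isb y)).
    by rewrite (center_height fl) normr0.
  by apply: filterS3 n1 n2 n3.
have [n _ [yn tn hn]] := clus A 0%N NA.
have [m nm [ym tmm hm]] := clus A n.+1 NA.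
have hA k : dm y (F k%:R x) -> `|ht y (F k%:R x)| < e -> h (slice y (ht y (F k%:R x))) = h x.
  move=> yk hk; have ky : `|ht y (F k%:R x)| < rd y by apply: lt_trans hk ey.
  have [ys _ hs] := slice_box fl ky.
  by rewrite (plaque fl yk ys) ?hs// !h_inv.
have E : ht y (F n%:R x) = ht y (F m%:R x).
  case: (ltgtP (ht y (F n%:R x)) (ht y (F m%:R x))) => [ab|ab|//].
    by case: (inj _ _ hn hm ab); rewrite !hA.
  by case: (inj _ _ hm hn ab); rewrite !hA.
have := plaque fl yn ym E; set s := _ - _ => Fs.
exists (m%:R - n%:R - s).
  have : n%:R + 1 <= m%:R :> R by rewrite natr1 ler_nat.
  have : `|s| < 1 by apply: le_lt_trans (ler_normB _ _) _; move: tn tmm; lra.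
  by rewrite ltr_norml => /andP[_ +]; lra.
have -> : m%:R - n%:R - s = - n%:R + (- s + m%:R) :> R by ring.
by rewrite -!FD Fs (flowK fl) (flowK fl).
Unshelve. all: by end_near.
Qed.
End Recurrence.

Lemma curve_in_orbit (c : R -> N) : continuous c ->
  (forall t0, \forall t \near t0, ht (c t0) (c t) = 0) -> forall t, orbit (c 0) (c t).
Proof.
move=> cc hc t; apply: (@lc_convex R setT (fun t => orbit (c 0) (c t)) 0 t) => //; last exact: orbit_refl.
move=> u _; have N1 : \forall v \near u, c v = F (tm (c u) (c v) - tm (c u) (c u)) (c u).
  apply: near_plaque; [exact: cc|exact: (center_dom fl)|].
  by rewrite (center_height fl); exact: hc.
apply: filterS N1 => v E _; have Ov : orbit (c u) (c v) by rewrite E; exact: in_orbit.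
by split=> H; apply: orbit_trans H _ => //; exact: orbit_sym.
Qed.

(** On an aperiodic orbit the flow time is a continuous function of the parameter that vanishes at 0
    and at 1. It takes half of its midpoint value on both sides of 1/2, against injectivity. *)
Lemma closed_curve_periodic (c : R -> N) : continuous c ->
  (forall t0, \forall t \near t0, ht (c t0) (c t) = 0) -> c 1 = c 0 ->
  (forall t u, 0 <= t < 1 -> 0 <= u < 1 -> c t = c u -> t = u) ->
  exists2 T, 0 < T & F T (c 0) = c 0.
Proof.
move=> cc hc c1 cinj; apply: contrapT => np; set x := c 0 in np.
have aper s t : F s x = F t x -> s = t.
  move=> E; apply: contrapT => /eqP; rewrite neq_lt => /orP[st|st]; apply: np.
    by exists (t - s); rewrite ?subr_gt0// addrC -FD -E (flowK fl).
  by exists (s - t); rewrite ?subr_gt0// addrC -FD E (flowK fl).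
have ex t : exists s, F s x = c t.
  by have [s _ E] := curve_in_orbit cc hc t; exists s.
have [theta th] := choice ex.
have cth : continuous theta.
  move=> u; have N1 : \forall v \near u, c v = F (tm (c u) (c v) - tm (c u) (c u)) (c u).
    apply: near_plaque; [exact: cc|exact: (center_dom fl)|].
    by rewrite (center_height fl); exact: hc.
  apply: (near_eq_continuous (f := fun v => tm (c u) (c v) + theta u)).
    apply: filterS N1 => v E; apply: aper.
    by rewrite -FD !th [RHS]E (center_time fl) subr0.
  apply: cvgD; last exact: cvg_cst.
  by apply: (continuous_comp (cc u)); apply: (btime_continuous (isb _)); exact: (center_dom fl).
have th0 : theta 0 = 0 by apply: aper; rewrite th F0.
have th1 : theta 1 = 0 by apply: aper; rewrite th F0 c1.
pose m := theta 2^-1.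
have m0 : m != 0.
  apply/eqP => E; have H : 0 = 2^-1 :> R.
    by apply: cinj; rewrite -?th ?th0 -/m ?E ?lexx ?ltr01//; apply/andP; split; lra.
  by have : 0 < 2^-1 :> R by []; rewrite -H ltxx.
have [t1] : exists2 t, t \in `[0, 2^-1] & theta t = m / 2.
  apply: IVT; [by rewrite invr_ge0|exact: continuous_subspaceT|].
  rewrite th0 -/m; case: (leP 0 m) => ?; apply/andP; split; lra.
rewrite in_itv /= => /andP[t10 t11] E1.
have [t2] : exists2 t, t \in `[2^-1, 1] & theta t = m / 2.
  apply: IVT; [lra|exact: continuous_subspaceT|].
  rewrite th1 -/m; case: (leP m 0) => ?; apply/andP; split; lra.
rewrite in_itv /= => /andP[t20 t21] E2.
have t2n : t2 != 1 by apply/eqP => E; move: E2; rewrite E th1 => /eqP; rewrite eq_sym mulf_eq0 (negPf m0) invr_eq0 pnatr_eq0.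
have {}t21 : t2 < 1 by rewrite lt_neqAle t2n.
have t12 : t1 = t2.
  by apply: cinj; [apply/andP; split; lra|apply/andP; split; lra|rewrite -!th E1 E2].
have t1h : t1 = 2^-1 by apply/eqP; rewrite eq_le t11 t12.
move: E1; rewrite t1h -/m => E1.
have {E1} : m = 0 by lra.
exact/eqP.
Qed.

Section Tube.
Variables (x : N) (e : R) (tau : R -> R).
Hypothesis tb : tube x e tau.

Definition tube_set d : set N := [set y | exists t r, `|r| < d /\ y = sheet x t r].
Definition tube_core d : set N := [set y | exists t r, `|r| <= d /\ y = sheet x t r].

Let e_rd (r : R) : `|r| < e -> `|r| < rd x.
Proof. by move=> re; apply: lt_trans re (tube_rad tb). Qed.

Lemma sheet_inj t t' r r' : `|r| < e -> `|r'| < e -> sheet x t r = sheet x t' r' ->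
  r = r' /\ exists k : int, t = t' + k%:~R * tau r.
Proof.
move=> re r'e E.
have [|rr [k kE]] := tube_inj tb (t := t - t') re r'e.
  by rewrite addrC -FD -/(sheet x t r) E (flowK fl).
by split=> //; exists k; rewrite -kE addrC subrK.
Qed.

Lemma sheet_period t r : `|r| < e -> sheet x (t + tau r) r = sheet x t r.
Proof. by move=> re; rewrite sheetE -FD (tube_per tb). Qed.

Lemma sheet_reduce t r : `|r| < e ->
  exists2 u, 0 <= u < tau r & sheet x t r = sheet x u r.
Proof.
move=> re; have tp := tube_per_gt0 tb re.
have /andP[k1 k2] := Num.Theory.floor_itv (t / tau r); set k := Num.floor _ in k1 k2.
have kt : k%:~R * tau r <= t by rewrite -ler_pdivlMr.
have kt' : t - k%:~R * tau r < tau r.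
  have : t < (k + 1)%:~R * tau r by rewrite -ltr_pdivrMr.
  by rewrite intrD mulrDl mul1r; lra.
exists (t - k%:~R * tau r); first by rewrite subr_ge0 kt.
have -> : sheet x t r = F (t - k%:~R * tau r) (F (k%:~R * tau r) (slice x r)).
  by rewrite FD subrK.
by rewrite (periodZ fl) ?(tube_per tb).
Qed.

Lemma tube_nbhs t r d : `|r| < d -> d <= e ->
  \forall y \near sheet x t r, tube_set d y.
Proof.
move=> rd de; have re : `|r| < e by lra.
have N1 := sheet_inverse fl t (e_rd re).
set p := sheet x t r in N1 *.
have N2 : \forall y \near p, `|r + ht p y| < d.
  apply: near_norm_lt; last by rewrite (center_height fl) addr0.
  by apply: cvgD; [exact: cvg_cst|exact: (bheight_continuous (isb p) (center_dom fl p))].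
by apply: filterS2 N1 N2 => y E yd; rewrite E; do 2!eexists; split; [exact: yd|].
Qed.

Lemma tube_open d : d <= e -> open (tube_set d).
Proof.
by move=> de; rewrite openE => y [t [r [rd ->]]]; exact: tube_nbhs.
Qed.

(** Times can be reduced modulo the period, which is bounded on the tube, so the core is the image
    of a compact rectangle. *)
Lemma core_compact d : d < e -> compact (tube_core d).
Proof.
move=> de; have [L HL] := tube_per_bounded tb.
pose K := (`[0, L]%classic `*` `[- d, d]%classic) : set (R * R).
have -> : tube_core d = (fun z : R * R => sheet x z.1 z.2) @` K.
  rewrite predeqE => y; split=> [[t [r [rd ->]]]|[z [_ /= zd] <-]]; last first.
    by exists z.1, z.2; split=> //; rewrite ler_norml; move: zd; rewrite in_itv.
  have re : `|r| < e by lra.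
  have [u /andP[u0 u1] ->] := sheet_reduce t re.
  exists (u, r) => //; split; rewrite /= in_itv /= -?ler_norml//.
  by rewrite u0/=; have := HL r re; lra.
apply: continuous_compact; last by apply: compact_setX; exact: segment_compact.
apply: continuous_in_subspaceT => z; rewrite inE => -[_ /=]; rewrite in_itv /= => zd.
case: z zd => t r /= zd; apply: (sheet_continuous fl); apply: e_rd.
by apply: le_lt_trans de; rewrite ler_norml.
Qed.

Lemma core_closed d : d < e -> closed (tube_core d).
Proof. by move=> de; exact: (compact_closed hN (core_compact de)). Qed.

(** Single-valued on the tube by [sheet_inj]; the default 0 is taken elsewhere. *)
Definition tube_height (y : N) : R :=
  xget 0 [set r | `|r| < e /\ exists t, y = sheet x t r].

Lemma tube_heightE t r : `|r| < e -> tube_height (sheet x t r) = r.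
Proof.
move=> re; rewrite /tube_height; case: xgetP => [r' _ [r'e [t' E]]|/(_ r)].
  by have [->] := sheet_inj re r'e E.
by case; split=> //; exists t.
Qed.

Lemma tube_height_near y p : tube_set e y -> dm p y ->
  \forall z \near y, tube_set e z /\ tube_height z = ht p z + (tube_height y - ht p y).
Proof.
move=> [t [r [re ->]]] py; have N1 := sheet_inverse fl t (e_rd re).
set q := sheet x t r in N1 py *.
have N2 : \forall y \near q, `|r + ht q y| < e.
  apply: near_norm_lt; last by rewrite (center_height fl) addr0.
  by apply: cvgD; [exact: cvg_cst|exact: (bheight_continuous (isb q) (center_dom fl q))].
have N3 := near_height fl (center_dom fl q) py.
have N4 := tube_nbhs t re (lexx e).
near=> z; split; first by near: z.
have zE : z = sheet x (t + (tm q z - tm q (sheet x t (r + ht q z)))) (r + ht q z) by near: z.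
have zd : `|r + ht q z| < e by near: z.
have -> : ht p z = ht q z + (ht p q - ht q q) by near: z.
by rewrite {1}zE tube_heightE// (tube_heightE t re) (center_height fl); ring.
Unshelve. all: by end_near.
Qed.

Lemma orbit_sheet t r : orbit (slice x r) (sheet x t r).
Proof. by exists t. Qed.

Lemma tube_set_connected d : 0 < d -> d <= e -> connected (tube_set d).
Proof.
move=> d0 de.
have -> : tube_set d = \bigcup_(r in [set r | `|r| < d])
    ((slice x @` [set u | `|u| < d]) `|` orbit (slice x r)).
  rewrite predeqE => y; split=> [[t [r [rd ->]]]|[r rd [[u ud <-]|[t _ <-]]]].
  - by exists r => //; right; exact: orbit_sheet.
  - by exists 0, u; split=> //; rewrite sheetE F0.
  - by exists t, r.
apply: bigcup_connected.
  by exists x => r _; left; exists 0; rewrite ?(slice0 fl)//= normr0.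
move=> r rd; apply: connectedU.
- by exists (slice x r); split; [exists r|exact: orbit_refl].
- apply: connected_continuous_connected.
    have -> : [set u : R | `|u| < d] = `]- d, d[%classic.
      by rewrite predeqE => u; rewrite /= in_itv /= ltr_norml.
    by apply/connected_intervalP; exact: interval_is_interval.
  apply: continuous_in_subspaceT => u; rewrite inE => ud.
  by apply: (slice_continuous fl); apply: e_rd; apply: lt_le_trans de.
- exact: orbit_connected.
Qed.

Lemma sheet_notin d t r : `|r| < e -> `|d| < e -> r <> d -> ~ orbit (slice x d) (sheet x t r).
Proof. by move=> re de rd [t' _ /esym E]; have [] := sheet_inj re de E. Qed.

(** A point at height [r] is the limit of the points with the same time and heights [(1 - m) r]. *)
Lemma tube_core_closure d : 0 < d -> d < e -> closure (tube_set d) = tube_core d.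
Proof.
move=> d0 de; apply/seteqP; split.
  rewrite [X in _ `<=` X]((closure_id _).1 (core_closed de)).
  by apply: closureS => y [t [r [rd ->]]]; exists t, r; split=> //; exact: ltW.
move=> y [t [r [rd ->]]].
have c : {for 1, continuous (fun u : R => sheet x t (u * r))}.
  apply: (flow_continuous fl (t := cst t) (y := fun u : R => slice x (u * r))); first exact: cvg_cst.
  apply: (continuous_comp (f := fun u : R => u * r)).
    by apply: cvgM; [exact: cvg_id|exact: cvg_cst].
  by apply: (slice_continuous fl); apply: e_rd; rewrite mul1r; lra.
move=> A nA; have {nA}nA : \forall u \near (1 : R), A (sheet x t (u * r)).
  by apply: (near_image c); rewrite mul1r.
have [d' /= d'0 HA] := nA.
pose m := Num.min (d' / 2) 2^-1.
have m0 : 0 < m by rewrite lt_min divr_gt0//= invr_gt0.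
have md : m < d' by rewrite gt_min; apply/orP; left; lra.
have m1 : m <= 2^-1 by rewrite ge_min lexx orbT.
exists (sheet x t ((1 - m) * r)); split; last first.
  by apply: HA => /=; rewrite opprB addrC subrK gtr0_norm.
exists t, ((1 - m) * r); split=> //.
rewrite normrM gtr0_norm; last by lra.
have [->|r0] := eqVneq r 0; first by rewrite normr0 mulr0.
apply: lt_le_trans rd; rewrite gtr_pMl ?normr_gt0//; lra.
Qed.

(** The open tube is connected. In the complement of its two boundary orbits it is open and is also
    the trace of the closed core, so it is a whole component. *)
Lemma tube_component d : 0 < d -> d < e ->
  tube_set d = connected_component (~` (orbit (slice x (- d)) `|` orbit (slice x d))) x.
Proof.
move=> d0 de; set A := ~` _.
have de' : `|d| < e by rewrite gtr0_norm.
have de'' : `|- d| < e by rewrite normrN.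
have sA : tube_set d `<=` A.
  move=> y [t [r [rd ->]]]; have re : `|r| < e by lra.
  move: rd; rewrite ltr_norml => /andP[r1 r2].
  by move=> [|]; apply: sheet_notin => // E; move: r1 r2; rewrite E ltxx.
have xC : tube_set d x by exists 0, 0; rewrite normr0 sheetE F0 (slice0 fl).
have xA : A x := sA _ xC.
have coreA : tube_core d `&` A = tube_set d.
  apply/seteqP; split=> [y [[t [r [rd ->]]] Ay]|y Cy].
    exists t, r; split=> //; rewrite lt_neqAle rd andbT; apply/eqP => E; apply: Ay.
    have [r0|r0] := leP 0 r; [right|left]; move: E.
      by rewrite ger0_norm// => <-; exact: orbit_sheet.
    by rewrite ltr0_norm// => <-; rewrite opprK; exact: orbit_sheet.
  by split; [case: Cy => t [r [rd ->]]; exists t, r; split=> //; exact: ltW|exact: sA].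
apply/seteqP; split.
  by apply: connected_component_max => //; apply: tube_set_connected => //; exact: ltW.
move=> y [B [Bx BA cB] By].
have : B `&` tube_set d = B.
  apply: cB.
  - by exists x.
  - by exists (tube_set d) => //; apply: tube_open; exact: ltW.
  - exists (tube_core d); first exact: core_closed.
    by rewrite -coreA; apply/seteqP; split=> z [Bz]; [case|split=> //; split=> //; exact: BA].
by move=> E; rewrite -E in By; case: By.
Qed.

End Tube.

(** Boxes make the space locally connected: a small square of a box is a union of plaques attached
    to one transversal. *)
Lemma component_open (A : set N) y : open A -> open (connected_component A y).
Proof.
move=> oA; rewrite openE => z Cz; have Az : A z by exact: connected_component_sub Cz.
have zz := center_dom fl z; have z0 : `|0 : R| < rd z by rewrite normr0 (rad_gt0 fl).
have c : {for (0, 0), continuous (fun w : R * R => mp z w.1 w.2)}.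
  exact: (bmap_continuous (isb z) z0 z0).
have mz : mp z 0 0 = z by rewrite -[RHS](bmapK (isb z) zz) (center_time fl) (center_height fl).
have N1 : \forall w \near (0 : R, 0 : R), A (mp z w.1 w.2).
  by apply: (near_image c); rewrite /= mz; exact: open_nbhs_nbhs.
have [d [d0 [dr dA]]] : exists d, 0 < d /\ d < rd z /\ forall s r, `|s| < d -> `|r| < d -> A (mp z s r).
  have [[U V] /= [[d1 /= d10 H1] [d2 /= d20 H2]] sUV] := N1.
  pose d := Num.min (rd z / 2) (Num.min d1 d2).
  exists d; split; first by rewrite !lt_min d10 d20 divr_gt0// (rad_gt0 fl).
  split; first by rewrite gt_min; apply/orP; left; have := rad_gt0 fl z; lra.
  move=> s r; rewrite !lt_min => /andP[_ /andP[s1 _]] /andP[_ /andP[_ r2]].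
  by apply: (sUV (s, r)); split; [apply: H1|apply: H2]; rewrite /= sub0r normrN.
pose K := (fun w : R * R => mp z w.1 w.2) @` [set w | `|w.1| < d /\ `|w.2| < d].
have cK : connected K.
  have -> : K = \bigcup_(r in [set r : R | `|r| < d])
    ((mp z 0 @` [set u | `|u| < d]) `|` ((fun s => mp z s r) @` [set u | `|u| < d])).
    rewrite predeqE => w; split=> [[[s r] /= [sd rd] <-]|[r rd [[u ud <-]|[s sd <-]]]].
    - by exists r => //; right; exists s.
    - by exists (0, u) => //=; rewrite normr0.
    - by exists (s, r).
  have cI : connected [set u : R | `|u| < d].
    have -> : [set u : R | `|u| < d] = `]- d, d[%classic.
      by rewrite predeqE => u; rewrite /= in_itv /= ltr_norml.
    by apply/connected_intervalP; exact: interval_is_interval.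
  apply: bigcup_connected.
    by exists z => r _; left; exists 0; rewrite //= normr0.
  move=> r rd; apply: connectedU.
  - by exists (mp z 0 r); split; [exists r|exists 0; rewrite //= normr0].
  - apply: connected_continuous_connected => //; apply: continuous_in_subspaceT => u.
    rewrite inE => /= ud; apply: (continuous_comp2_for (f := cst 0) (g := id) (h := mp z)).
    + exact: cvg_cst.
    + exact: cvg_id.
    + by apply: (bmap_continuous (isb z)) => //; exact: lt_trans dr.
  - apply: connected_continuous_connected => //; apply: continuous_in_subspaceT => u.
    rewrite inE => /= ud; apply: (continuous_comp2_for (f := id) (g := cst r) (h := mp z)).
    + exact: cvg_id.
    + exact: cvg_cst.
    + by apply: (bmap_continuous (isb z)); apply: lt_trans dr.
have KA : K `<=` A by move=> w [[s r] /= [sd rd] <-]; exact: dA.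
have zK : K z by exists (0, 0); rewrite //= normr0.
have KC : K `<=` connected_component A y.
  move=> w Kw; have [B [By BA cB] Bz] := Cz.
  exists (B `|` K); last by right.
  split; [by left|by move=> v [/BA|/KA]|].
  by apply: connectedU => //; exists z.
apply: (filterS KC).
have N2 := near_bdom fa zz.
have N3 : \forall w \near z, `|tm z w| < d.
  by apply: near_norm_lt; [exact: (btime_continuous (isb z))|rewrite (center_time fl) normr0].
have N4 : \forall w \near z, `|ht z w| < d.
  by apply: near_norm_lt; [exact: (bheight_continuous (isb z))|rewrite (center_height fl) normr0].
by apply: filterS3 N2 N3 N4 => w zw tw hw; exists (tm z w, ht z w) => //=; rewrite (bmapK (isb z)).
Qed.
End FlowMore.

(** * Closed orbits are not null-homotopic *)

Section Homotopy.
Context {R : realType} {N : topologicalType}.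
Variables (bx : N -> @box R N) (F : R -> N -> N).
Hypothesis fl : flow_structure bx F.
Let fa := fs_atlas fl.
Let hN := fs_hausdorff fl.
Let F0 := fs_0 fl.
Let FD := fs_D fl.
Let isb p := fa_box fa p.

Local Notation dm p := (bdom (bx p)).
Local Notation tm p := (btime (bx p)).
Local Notation ht p := (bheight (bx p)).
Local Notation rd p := (brad (bx p)).
Local Notation mp p := (bmap (bx p)).
Local Notation slice := (slice bx).
Local Notation sheet := (sheet bx F).
Local Notation orbit := (orbit F).
Local Notation tube := (tube bx F).

Definition clamp (a b t : R) := Num.max a (Num.min b t).

Lemma clamp_itv a b t : a <= b -> a <= clamp a b t <= b.
Proof. by move=> ab; rewrite /clamp le_max lexx ge_max ab ge_min lexx. Qed.

Lemma clamp_id a b t : a <= t <= b -> clamp a b t = t.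
Proof. by move=> /andP[? ?]; rewrite /clamp min_r// max_r. Qed.

Lemma clamp_continuous_for (U : topologicalType) (a b t : U -> R) (u : U) :
  {for u, continuous a} -> {for u, continuous b} -> {for u, continuous t} ->
  {for u, continuous (fun v => clamp (a v) (b v) (t v))}.
Proof.
move=> ca cb ct.
exact: (continuous_max (f := a) (g := b \min t) ca (continuous_min (f := b) (g := t) cb ct)).
Qed.

Lemma continuous_within_comp (U V W : topologicalType) (A : set V) (f : V -> W) (g : U -> V) :
  {within A, continuous f} -> continuous g -> (forall u, A (g u)) -> continuous (f \o g).
Proof.
move=> /subspace_continuousP cf cg Ag u B nB.
have := cf _ (Ag u) B nB; rewrite /= nbhs_filterE /= => H.
have {}H : \forall v \near g u, A v -> B (f v) by exact: H.
have := near_image (@cg u) H.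
by apply: filterS => v; exact.
Qed.

Lemma int_valued_const (c : R -> R) : continuous c ->
  (forall t, exists k : int, c t = k%:~R) -> forall t, c t = c 0.
Proof.
move=> cc ci t; apply: (@lc_convex R setT (fun t => c t = c 0) 0 t) => // u _.
have N1 : \forall v \near u, `|c v - c u| < 1.
  apply: near_norm_lt; last by rewrite subrr normr0.
  by apply: cvgB; [exact: cc|exact: cvg_cst].
apply: filterS N1 => v; have [k ->] := ci v; have [m ->] := ci u.
rewrite -intrB -intr_norm -[X in _ < X]/(1%:~R) ltr_int => H _.
suff -> : k = m by [].
by lia.
Qed.

Section Push.
Variable p : N.

(** The largest allowed displacement, at most the room left in the half-size box: a push stays in
    the box and is the identity near its boundary. *)
Definition bump_push (y : N) : R :=
  if pselect (dm p y) then Num.max 0 (rd p / 2 - Num.max `|tm p y| `|ht p y|) else 0.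

Definition push_amount (y : N) (h : R) := clamp (- bump_push y) (bump_push y) h.

(** Acts on pairs of a point and the value there of a primitive of the closed form. The point moves
    across the plaques and the value changes by the same amount, towards 0 and never beyond; pairs
    with value 0 are fixed. *)
Definition push (z : N * R) : N * R :=
  (if pselect (dm p z.1) then mp p (tm p z.1) (ht p z.1 - push_amount z.1 z.2) else z.1,
   z.2 - push_amount z.1 z.2).

Lemma bump_push_ge0 y : 0 <= bump_push y.
Proof. by rewrite /bump_push; case: pselect => [?|?] //=; rewrite le_max lexx. Qed.

Lemma push_amountE y h : `|push_amount y h| <= bump_push y /\
  `|h - push_amount y h| <= `|h| /\ (0 < bump_push y -> h != 0 -> `|h - push_amount y h| < `|h|).
Proof.
have := bump_push_ge0 y; rewrite /push_amount /clamp; set b := bump_push y => b0.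
case: (leP b h) => bh.
  rewrite max_r; last lra.
  have h0 : 0 <= h by lra.
  rewrite (ger0_norm h0) (ger0_norm b0) ger0_norm; last lra.
  by split=> //; split=> *; lra.
case: (leP (- b) h) => bh'.
  rewrite subrr normr0; split; first by rewrite ler_norml; apply/andP; split; lra.
  by split=> [|_ h0]; rewrite ?normr_gt0.
have h0 : h < 0 by lra.
rewrite normrN (ger0_norm b0) (ltr0_norm h0) ler0_norm; last lra.
by split=> //; split=> *; lra.
Qed.

Lemma push_amount0 y h : bump_push y = 0 \/ h = 0 -> push_amount y h = 0.
Proof.
have b0 := bump_push_ge0 y.
rewrite /push_amount => -[->|->]; last by rewrite clamp_id//; apply/andP; split; lra.
by rewrite /clamp oppr0; case: (leP 0 h) => ?; rewrite ?maxxx ?max_l//; lra.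
Qed.

Lemma push_height y h : dm p y -> `|ht p y - push_amount y h| < rd p.
Proof.
move=> py; have [m1 _] := push_amountE y h.
have hy := bheight_lt (isb p) py; have r0 := rad_gt0 fl p.
move: m1; rewrite /bump_push; case: pselect => [?|?] //=.
set M := Num.max `|tm p y| _ => m1.
have hM : `|ht p y| <= M by rewrite le_max lexx orbT.
have := ler_normB (ht p y) (push_amount y h).
case: (leP 0 (rd p / 2 - M)) m1 => ? m1; lra.
Qed.

Lemma push_dom y h : dm p y -> [/\ dm p (push (y, h)).1,
  tm p (push (y, h)).1 = tm p y & ht p (push (y, h)).1 = ht p y - push_amount y h].
Proof.
move=> py; rewrite /push /=; case: pselect => [?|?] //=.
have t := btime_lt (isb p) py; have m := push_height h py.
split; [exact: (bdom_bmap (isb p))|exact: (btime_bmap (isb p))|exact: (bheight_bmap (isb p))].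
Qed.

(** The closed half-size box is compact, hence closed, so its complement is a neighbourhood of every
    point outside the box. *)
Lemma push_out y : ~ dm p y -> \forall z \near y, bump_push z = 0.
Proof.
move=> py; pose K := (fun w : R * R => mp p w.1 w.2) @`
  (`[- (rd p / 2), rd p / 2]%classic `*` `[- (rd p / 2), rd p / 2]%classic).
have r0 := rad_gt0 fl p.
have sm s : `[- (rd p / 2), rd p / 2]%classic s -> `|s| < rd p.
  by rewrite /= in_itv /= => H; apply: (@le_lt_trans _ _ (rd p / 2)); [rewrite ler_norml|lra].
have cK : compact K.
  apply: continuous_compact; last by apply: compact_setX; exact: segment_compact.
  apply: continuous_in_subspaceT => -[s r]; rewrite inE => -[/sm s1 /sm r1].
  exact: (bmap_continuous (isb p)).
have oK : open (~` K) by apply: closed_openC; exact: (compact_closed hN cK).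
have yK : (~` K) y.
  by move=> [[s r] [/sm s1 /sm r1] E]; apply: py; rewrite -E; exact: (bdom_bmap (isb p)).
have N1 : \forall z \near y, ~ K z by exact: open_nbhs_nbhs.
apply: filterS N1 => z zK; rewrite /bump_push; case: pselect => // pz.
rewrite max_l// subr_le0 leNgt; apply/negP; rewrite gt_max => /andP[z1 z2]; apply: zK.
exists (tm p z, ht p z); last by rewrite /= (bmapK (isb p)).
by split; rewrite /= in_itv /= -ler_norml ltW.
Qed.

Lemma bump_push_continuous : continuous bump_push.
Proof.
move=> y; have [py|py] := pselect (dm p y); last first.
  apply: (near_eq_continuous (f := cst 0)); last exact: cvg_cst.
  by apply: filterS (push_out py).
have N1 := near_bdom fa py.
apply: (near_eq_continuous (f := cst 0 \max (fun y => rd p / 2 - Num.max `|tm p y| `|ht p y|))).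
  by apply: filterS N1 => z pz; rewrite /bump_push; case: pselect.
apply: continuous_max; first exact: cvg_cst.
apply: cvgB; first exact: cvg_cst.
apply: (continuous_max (f := fun y => `|tm p y|) (g := fun y => `|ht p y|)).
  by apply: cvg_norm; exact: (btime_continuous (isb p)).
by apply: cvg_norm; exact: (bheight_continuous (isb p)).
Qed.

Lemma push_amount_continuous : continuous (fun z : N * R => push_amount z.1 z.2).
Proof.
move=> z; have cb : {for z, continuous (fun z : N * R => bump_push z.1)}.
  by apply: (continuous_comp (f := fst)); [exact: cvg_fst|exact: bump_push_continuous].
apply: (clamp_continuous_for (a := fun z : N * R => - bump_push z.1)
  (b := fun z => bump_push z.1) (t := snd)); [exact: (cvgN cb)|exact: cb|exact: cvg_snd].
Qed.

Lemma push_continuous : continuous push.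
Proof.
move=> [y h].
have c2 : {for (y, h), continuous (fun z : N * R => z.2 - push_amount z.1 z.2)}.
  by apply: cvgB; [exact: cvg_snd|exact: push_amount_continuous].
suff c1 : {for (y, h), continuous (fun z : N * R => if pselect (dm p z.1)
    then mp p (tm p z.1) (ht p z.1 - push_amount z.1 z.2) else z.1)}.
  exact: (continuous_pair_for c1 c2).
have [py|py] := pselect (dm p y); last first.
  have N1 : \forall z \near (y, h), bump_push z.1 = 0.
    apply: (near_image (f := fst) (P := fun y => bump_push y = 0) (x := (y, h))); first exact: cvg_fst.
    exact: push_out.
  apply: (near_eq_continuous (f := fst)); last exact: cvg_fst.
  apply: filterS N1 => z bz /=; case: pselect => // pz.
  by rewrite push_amount0 ?subr0 ?(bmapK (isb p))//; left.
have N1 : \forall z \near (y, h), dm p z.1.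
  apply: (near_image (f := fst) (P := dm p) (x := (y, h))); first exact: cvg_fst.
  exact: (near_bdom fa).
apply: (near_eq_continuous (f := fun z : N * R => mp p (tm p z.1) (ht p z.1 - push_amount z.1 z.2))).
  by apply: filterS N1 => z pz /=; case: pselect.
apply: (continuous_comp2_for (f := fun z : N * R => tm p z.1)
    (g := fun z => ht p z.1 - push_amount z.1 z.2) (h := mp p)).
- apply: (continuous_comp (f := fst) (g := tm p)); first exact: cvg_fst.
  exact: (btime_continuous (isb p)).
- apply: cvgB; last exact: push_amount_continuous.
  apply: (continuous_comp (f := fst) (g := ht p)); first exact: cvg_fst.
  exact: (bheight_continuous (isb p)).
- by apply: (bmap_continuous (isb p)); [exact: (btime_lt (isb p))|exact: push_height].
Qed.

Lemma push_le z : `|(push z).2| <= `|z.2|.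
Proof. by case: (push_amountE z.1 z.2) => _ []. Qed.

Lemma push_lt z : 0 < bump_push z.1 -> z.2 != 0 -> `|(push z).2| < `|z.2|.
Proof. by case: (push_amountE z.1 z.2) => _ [_]; exact. Qed.

Lemma push_id z : bump_push z.1 = 0 \/ z.2 = 0 -> push z = z.
Proof.
case: z => y h /= H; rewrite /push /= push_amount0// !subr0.
by case: pselect => // py; rewrite (bmapK (isb p)).
Qed.

End Push.

(** [h] is a primitive of the pullback by [H] of the closed form whose local primitives are the
    heights. *)
Definition primitive_along (H : R * R -> N) (h : R * R -> R) (z : R * R) :=
  forall p, dm p (H z) -> \forall w \near z, h w - ht p (H w) = h z - ht p (H z).

Lemma primitive_along1 H h z p : {for z, continuous H} -> dm p (H z) ->
  (\forall w \near z, h w - ht p (H w) = h z - ht p (H z)) -> primitive_along H h z.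
Proof.
move=> cH pz Hp q qz; have N1 := near_image cH (near_height fl pz qz).
by apply: filterS2 N1 Hp => w; lra.
Qed.

Lemma primitive_along_continuous H h z : {for z, continuous H} ->
  primitive_along H h z -> {for z, continuous h}.
Proof.
move=> cH /(_ _ (center_dom fl (H z))) N1; set p := H z in N1 *.
apply: (near_eq_continuous (f := fun w => ht p (H w) + (h z - ht p p))).
  by apply: filterS N1 => w; lra.
apply: cvgD; last exact: cvg_cst.
by apply: (continuous_comp cH); apply: (bheight_continuous (isb p)); exact: (center_dom fl).
Qed.

(** A push subtracts the same amount from [h] and from the height in the box [p]; near points
    outside that box it is the identity. *)
Lemma push_primitive p H h z : {for z, continuous H} -> primitive_along H h z ->
  primitive_along (fun w => (push p (H w, h w)).1) (fun w => (push p (H w, h w)).2) z.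
Proof.
move=> cH pH; have ch := primitive_along_continuous cH pH.
have cP : {for z, continuous (fun w => push p (H w, h w))}.
  by apply: (continuous_comp (continuous_pair_for cH ch)); exact: push_continuous.
have cP1 : {for z, continuous (fun w => (push p (H w, h w)).1)}.
  by apply: (continuous_comp cP); exact: cvg_fst.
have [pz|pz] := pselect (dm p (H z)).
  have N1 : \forall w \near z, dm p (H w) by apply: (near_image cH); exact: (near_bdom fa).
  have [pz' _ hz'] := push_dom (h z) pz.
  apply: (primitive_along1 cP1 pz').
  apply: filterS2 N1 (pH _ pz) => w pw.
  by have [_ _ ->] := push_dom (h w) pw; rewrite hz' /=; lra.
have N1 : \forall w \near z, bump_push p (H w) = 0.
  by apply: (near_image (P := fun y => bump_push p y = 0) cH); exact: push_out.
have E w : bump_push p (H w) = 0 -> push p (H w, h w) = (H w, h w).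
  by move=> b0; rewrite push_id//; left.
move=> q; rewrite (E z (nbhs_singleton N1)) => qz.
by apply: filterS2 N1 (pH _ qz) => w b0; rewrite E.
Qed.

Definition sweep (ps : seq N) (z : N * R) := foldl (fun z p => push p z) z ps.

Lemma sweep_continuous ps : continuous (sweep ps).
Proof.
elim: ps => [|p ps IH] z /=; first exact: cvg_id.
by apply: (continuous_comp (f := push p) (g := sweep ps)); [exact: push_continuous|exact: IH].
Qed.

Lemma sweep_le ps z : `|(sweep ps z).2| <= `|z.2|.
Proof.
by elim: ps z => //= p ps IH z; apply: le_trans (IH _) (push_le _ _).
Qed.

Lemma sweep_lt ps z : (exists2 p, p \in ps & 0 < bump_push p z.1) -> z.2 != 0 ->
  `|(sweep ps z).2| < `|z.2|.
Proof.
elim: ps z => [|p ps IH] z [q]; first by rewrite in_nil.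
rewrite inE => qp q0 z0 /=.
have [b0|b0] := eqVneq (bump_push p z.1) 0.
  rewrite push_id; last by left.
  apply: IH => //; exists q => //; move: qp => /predU1P[qp|//].
  by rewrite qp b0 ltxx in q0.
apply: le_lt_trans (sweep_le _ _) _; apply: push_lt => //.
by rewrite lt_def b0 bump_push_ge0.
Qed.

Lemma sweep0 ps y : sweep ps (y, 0) = (y, 0).
Proof. by elim: ps => //= p ps IH; rewrite push_id//; right. Qed.

Lemma sweep_primitive ps (H : R * R -> N) h : continuous H ->
  (forall z, primitive_along H h z) ->
  continuous (fun w => (sweep ps (H w, h w)).1) /\
  forall z, primitive_along (fun w => (sweep ps (H w, h w)).1) (fun w => (sweep ps (H w, h w)).2) z.
Proof.
elim: ps H h => [|p ps IH] H h cH pH //=.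
have cP : continuous (fun w => (push p (H w, h w)).1).
  move=> z; have ch := primitive_along_continuous (@cH z) (pH z).
  apply: (continuous_comp (f := fun w => push p (H w, h w)) (g := fst)); last exact: cvg_fst.
  by apply: (continuous_comp (continuous_pair_for (@cH z) ch)); exact: push_continuous.
have pP z := push_primitive (p := p) (@cH z) (pH z).
have E w : push p (H w, h w) = ((push p (H w, h w)).1, (push p (H w, h w)).2).
  by case: (push _ _).
have [c1 p1] := IH _ _ cP pP.
have EE : (fun w => sweep ps ((push p (H w, h w)).1, (push p (H w, h w)).2)) =
          (fun w => sweep ps (push p (H w, h w))).
  by apply/funext => w; rewrite -E.
have E1 : (fun w => (sweep ps ((push p (H w, h w)).1, (push p (H w, h w)).2)).1) =
          (fun w => (sweep ps (push p (H w, h w))).1).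
  by apply/funext => w; rewrite -E.
have E2 : (fun w => (sweep ps ((push p (H w, h w)).1, (push p (H w, h w)).2)).2) =
          (fun w => (sweep ps (push p (H w, h w))).2).
  by apply/funext => w; rewrite -E.
by rewrite E1 E2 in c1 p1.
Qed.

Lemma sweep_cover : exists ps : seq N, forall y, exists2 p, p \in ps & 0 < bump_push p y.
Proof.
(* The filter of the lists containing some given list turns compactness into a finite choice of
   centres. *)
pose G : set_system (seq N) :=
  [set A : set (seq N) | exists s0 : seq N, forall s : seq N, {subset s0 <= s} -> A s].
have FG : Filter G.
  split.
  - by exists [::].
  - move=> A B [s1 H1] [s2 H2]; exists (s1 ++ s2) => s ss; split; [apply: H1|apply: H2];
      by move=> q qs; apply: ss; rewrite mem_cat qs ?orbT.
  - by move=> A B AB [s0 H]; exists s0 => s /H /AB.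
have : \forall s \near G, [set: N] `<=` (fun y => exists2 p, p \in s & 0 < bump_push p y).
  apply: ((compact_near_coveringP _).1 (fs_compact fl)) => // y _.
  have N1 : \forall z \near y, 0 < bump_push y z.
    apply: (cvgr_gt _ (@bump_push_continuous y y)).
    rewrite /bump_push; case: pselect => [?|ny] /=; last by case: (ny (center_dom fl y)).
    rewrite (center_time fl) (center_height fl) normr0 maxxx subr0 lt_max.
    by rewrite divr_gt0 ?orbT// (rad_gt0 fl).
  exists ([set z | 0 < bump_push y z], [set s : seq N | y \in s]).
    by split=> //=; exists [:: y] => s; apply; rewrite inE.
  by move=> [z s] /= [? ?]; exists y.
by move=> [s0 H]; exists s0 => y; apply: H.
Qed.

(** A sweep never raises the absolute value of the second component. Where this value lies between
    [d] and [B], compactness gives a uniform decrease [m], so slightly more than [B / m] sweeps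
    suffice. *)
Lemma iter_sweep_small (B d : R) : 0 < d ->
  exists ps : seq N, forall z, `|z.2| <= B -> `|(sweep ps z).2| < d.
Proof.
move=> d0; have [ps Hps] := sweep_cover.
pose K : set (N * R) := [set: N] `*` ([set h | d <= `|h|] `&` `[- B, B]%classic).
have cK : compact K.
  apply: compact_setX; first exact: (fs_compact fl).
  rewrite setIC; apply: compact_closedI; first exact: segment_compact.
  have -> : [set h : R | d <= `|h|] = (fun h : R => `|h|) @^-1` [set u | d <= u] by [].
  apply: closed_comp; last exact: closed_ge.
  by move=> h _; apply: cvg_norm; exact: cvg_id.
pose P (m : R) (z : N * R) := m < `|z.2| - `|(sweep ps z).2|.
have : \forall m \near 0^'+, K `<=` P m.
  apply: ((compact_near_coveringP _).1 cK) => // z [_ [/= zd _]].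
  have z0 : z.2 != 0 by rewrite -normr_gt0; lra.
  have gt0 : 0 < `|z.2| - `|(sweep ps z).2| by rewrite subr_gt0; exact: sweep_lt.
  set a := _ - _ in gt0.
  have N1 : \forall w \near z, a / 2 < `|w.2| - `|(sweep ps w).2|.
    have c : `|w.2| - `|(sweep ps w).2| @[w --> z] --> a.
      apply: cvgB; apply: cvg_norm; first exact: cvg_snd.
      by apply: (continuous_comp (f := sweep ps) (g := snd)); [exact: sweep_continuous|exact: cvg_snd].
    by apply: (cvgr_gt _ c); lra.
  exists ([set w | a / 2 < `|w.2| - `|(sweep ps w).2|], [set m | m < a / 2]).
    by split=> //=; apply: nbhs_right_lt; rewrite divr_gt0.
  by move=> [w m] /= [? ?]; rewrite /P; lra.
move=> H; near (0 : R)^'+ => m.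
have m0 : 0 < m by near: m; exact: nbhs_right_gt.
have Hm : K `<=` P m by near: m.
pose n := (Num.trunc (B / m)).+1.
have nB : B < n%:R * m by rewrite -ltr_pdivrMr//; exact: truncnS_gt.
have step k z : `|z.2| <= B -> `|(iter k (sweep ps) z).2| < d \/
    `|(iter k (sweep ps) z).2| <= B - k%:R * m.
  move=> zB; elim: k => [|k [IH|IH]]; first by right; rewrite mul0r subr0.
    by left; apply: le_lt_trans IH; exact: sweep_le.
  have [lt|ge] := ltP `|(iter k (sweep ps) z).2| d.
    by left; apply: le_lt_trans lt; exact: sweep_le.
  right; rewrite iterS -natr1 mulrDl mul1r.
  have km : 0 <= k%:R * m by rewrite mulr_ge0// ltW.
  have : P m (iter k (sweep ps) z).
    by apply: Hm; split=> //; split=> //=; rewrite in_itv /= -ler_norml; lra.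
  by rewrite /P; lra.
exists (flatten (nseq n ps)) => z zB.
have -> : sweep (flatten (nseq n ps)) z = iter n (sweep ps) z.
  elim: n {nB step} z {zB} => //= k IH z.
  by rewrite /sweep foldl_cat -/(sweep ps z) -/(sweep _ (sweep ps z)) IH -iterSr.
by have [//|] := step n z zB; have := normr_ge0 (iter n (sweep ps) z).2; lra.
Unshelve. all: by end_near.
Qed.
End Homotopy.

Section Essential.
Context {R : realType} {N : topologicalType}.
Variables (bx : N -> @box R N) (F : R -> N -> N).
Hypothesis fl : flow_structure bx F.
Let fa := fs_atlas fl.
Let hN := fs_hausdorff fl.
Let F0 := fs_0 fl.
Let FD := fs_D fl.
Let isb p := fa_box fa p.

Local Notation dm p := (bdom (bx p)).
Local Notation tm p := (btime (bx p)).
Local Notation ht p := (bheight (bx p)).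
Local Notation rd p := (brad (bx p)).
Local Notation mp p := (bmap (bx p)).
Local Notation slice := (slice bx).
Local Notation sheet := (sheet bx F).
Local Notation orbit := (orbit F).
Local Notation tube := (tube bx F).

Lemma primitive_near (h h' : R * R -> R) (H : R * R -> N) z :
  (\forall w \near z, h w = h' w) -> primitive_along bx H h z -> primitive_along bx H h' z.
Proof.
move=> E pr p pz; have E0 := nbhs_singleton E.
by apply: filterS2 E (pr _ pz) => w <-; rewrite -E0.
Qed.

Lemma open_rect (P : R * R -> Prop) (z : R * R) : (\forall w \near z, P w) ->
  exists2 e : R, 0 < e & forall w, rect (z.1 - e) (z.1 + e) (z.2 - e) (z.2 + e) w -> P w.
Proof.
move=> [[U V] /= [[d1 /= d10 H1] [d2 /= d20 H2]] sUV].
exists (Num.min d1 d2); first by rewrite lt_min d10.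
move=> w [/andP[a1 a2] /andP[b1 b2]].
have m1 : Num.min d1 d2 <= d1 by rewrite ge_min lexx.
have m2 : Num.min d1 d2 <= d2 by rewrite ge_min lexx orbT.
by apply: sUV; split=> /=; [apply: H1|apply: H2] => /=; rewrite ltr_norml; apply/andP; split; lra.
Qed.

Lemma rect_near (a b c d : R) (z : R * R) : rect a b c d z -> \forall w \near z, rect a b c d w.
Proof. by move=> zr; apply: open_nbhs_nbhs; split=> //; exact: rect_open. Qed.

Lemma primitive_exists (H : R * R -> N) : continuous H ->
  exists h : R * R -> R, (forall z, primitive_along bx H h z) /\ h (0, 0) = 0.
Proof.
move=> cH.
have rig f g z : primitive_along bx H f z -> primitive_along bx H g z ->
    (\forall w \near z, f w = g w) \/ (\forall w \near z, f w <> g w).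
  move=> pf pg; have pz := center_dom fl (H z).
  have [E|E] := pselect (f z = g z); [left|right]; apply: filterS2 (pf _ pz) (pg _ pz) => w.
    by rewrite E; lra.
  by move=> F1 F2 fg; apply: E; lra.
have loc z0 : exists2 e : R, 0 < e &
    extends_germs (primitive_along bx H) (rect (z0.1 - e) (z0.1 + e) (z0.2 - e) (z0.2 + e)).
  set p := H z0.
  have [e e0 He] : exists2 e : R, 0 < e & forall w,
      rect (z0.1 - e) (z0.1 + e) (z0.2 - e) (z0.2 + e) w -> dm p (H w).
    apply: open_rect; apply: (near_image (@cH z0)); apply: (near_bdom fa); exact: (center_dom fl).
  exists e => // z f zr pf; exists (fun w => ht p (H w) + (f z - ht p (H z))); split; last by ring.
  move=> w wr; apply: (primitive_along1 fl (@cH w) (He _ wr)).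
  by near=> v; ring.
have S0 : primitive_along bx H (fun w => ht (H (0, 0)) (H w)) (0, 0).
  apply: (primitive_along1 fl (@cH _) (center_dom fl _)).
  by near=> v; ring.
have [h [ph h0]] := global_solution (fun f g z => @primitive_near f g H z) rig loc S0.
exists h; split=> //; by rewrite h0 (center_height fl).
Unshelve. all: by end_near.
Qed.

Section Tube.
Variables (x : N) (e : R) (tau : R -> R).
Hypothesis tb : tube x e tau.
Variables (H : R * R -> N) (h : R * R -> R) (d : R).
Hypothesis cH : continuous H.
Hypothesis ph : forall z, primitive_along bx H h z.
Hypothesis de : d < e.
Hypothesis hd : forall z, `|h z| <= d.

Let ch : continuous h.
Proof. by move=> z; exact: (primitive_along_continuous fl (@cH z) (@ph z)). Qed.

Let he z : `|h z| < e. Proof. by apply: le_lt_trans de. Qed.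

Let hrd z : `|h z| < rd x. Proof. by apply: lt_trans (tube_rad tb). Qed.

(** The property is locally constant. Where it holds, [sheet_inverse] continues it. Where it fails,
    either the point is off the compact core, or its tube height differs from [h] by a nonzero,
    locally constant amount. *)
Lemma homotopy_in_tube : (exists t, H (0, 0) = sheet x t (h (0, 0))) ->
  forall z, exists t, H z = sheet x t (h z).
Proof.
move=> H0 z; rewrite -(seg20 (0, 0) z) in H0; rewrite -(seg21 (0, 0) z).
apply: (@lc_segment R (fun u => exists t, H (seg2 (0, 0) z u) = sheet x t (h (seg2 (0, 0) z u))) 0 1 _ _ H0) => //.
move=> u _; set z0 := seg2 (0, 0) z u.
suff : \forall w \near z0, (exists t, H w = sheet x t (h w)) <-> exists t, H z0 = sheet x t (h z0).
  move=> N1; have := near_image (@seg2_continuous R (0, 0) z u) N1.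
  by apply: filterS => v E _; exact: E.
have [Hz|Hz] := pselect (exists t, H z0 = sheet x t (h z0)).
  case: Hz => t Hz; have N1 := sheet_inverse fl t (@hrd z0); rewrite -Hz in N1.
  have {}N1 := near_image (@cH z0) N1.
  have N2 := ph (center_dom fl (H z0)).
  apply: filterS2 N1 N2 => w E hw; split=> _; first by exists t.
  have -> : h w = h z0 + ht (H z0) (H w) by have := center_height fl (H z0); lra.
  by eexists; exact: E.
have nP w : ~ (exists t, H w = sheet x t (h w)) ->
    (exists t, H w = sheet x t (h w)) <-> (exists t, H z0 = sheet x t (h z0)) by [].
have [/[dup] Hc [t [r [rd E]]]|Hc] := pselect (tube_core bx F x d (H z0)); last first.
  have N1 : \forall w \near z0, ~ tube_core bx F x d (H w).
    apply: (near_image (P := fun y => ~ tube_core bx F x d y) (@cH z0)).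
    by apply: open_nbhs_nbhs; split=> //; apply: closed_openC; exact: (core_closed fl tb).
  apply: filterS N1 => w nc; apply: nP => -[t E]; apply: nc.
  by exists t, (h w).
have re : `|r| < e by apply: le_lt_trans de.
have ne : tube_height bx F x e (H z0) <> h z0.
  by rewrite E (tube_heightE fl tb)// => rh; apply: Hz; exists t; rewrite E rh.
have tz : tube_set bx F x e (H z0) by exists t, r.
have N1 := tube_height_near fl tb tz (center_dom fl (H z0)).
have {}N1 := near_image (@cH z0) N1.
have N2 := ph (center_dom fl (H z0)).
apply: filterS2 N1 N2 => w [_ E1] E2; apply: nP => -[t' E'].
apply: ne; have : tube_height bx F x e (H w) = h w by rewrite E' (tube_heightE fl tb).
by move: E1 E2; rewrite (center_height fl); lra.
Qed.

(** A lift of [H] through the covering of the tube by [sheet x], with [h] as second coordinate. *)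
Definition time_lift (f : R * R -> R) (z : R * R) :=
  {for z, continuous f} /\ \forall w \near z, H w = sheet x (f w) (h w).

(** Two lifts differ by an integer multiple of the period, and near a point of agreement by less
    than one period. *)
Lemma time_lift_rigid f g z : time_lift f z -> time_lift g z ->
  (\forall w \near z, f w = g w) \/ (\forall w \near z, f w <> g w).
Proof.
move=> [cf Hf] [cg Hg]; have [E|E] := pselect (f z = g z); last first.
  by right; exact: (near_neq (@norm_hausdorff R R^o) cf cg E).
left; have N1 : \forall w \near z, `|f w - g w| < tau (h w).
  have c : {for z, continuous (fun w => tau (h w) - `|f w - g w|)}.
    apply: cvgB; last by apply: cvg_norm; apply: cvgB.
    by apply: (continuous_comp (@ch z)); exact: (tube_per_continuous tb).
  have : \forall w \near z, 0 < tau (h w) - `|f w - g w|.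
    apply: (cvgr_gt _ c); rewrite E subrr normr0 subr0.
    exact: (tube_per_gt0 tb).
  by apply: filterS => w; rewrite subr_gt0.
apply: filterS3 N1 Hf Hg => w lt E1 E2.
rewrite E1 in E2; have [_ [k kE]] := sheet_inj fl tb (@he w) (@he w) E2.
have tp := tube_per_gt0 tb (@he w).
move: lt; rewrite kE addrC addKr normrM (gtr0_norm tp) gtr_pMl// -intr_norm.
rewrite -[X in _ < X]/(1%:~R) ltr_int => k1.
have -> : k = 0 by lia.
by rewrite mul0r addr0.
Qed.

Lemma time_lift_local z0 : (exists t, H z0 = sheet x t (h z0)) -> forall t0,
  H z0 = sheet x t0 (h z0) ->
  exists2 e' : R, 0 < e' & exists2 th : R * R -> R, th z0 = t0 &
    forall w, rect (z0.1 - e') (z0.1 + e') (z0.2 - e') (z0.2 + e') w -> time_lift th w.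
Proof.
move=> _ t0 Hz0; set q := H z0.
pose th w := t0 + (tm q (H w) - tm q (sheet x t0 (h w))).
pose good w := dm q (H w) /\ dm q (sheet x t0 (h w)).
have cs z : {for z, continuous (fun w => sheet x t0 (h w))}.
  apply: (continuous_comp (f := fun w => (t0, h w)) (g := fun z : R * R => sheet x z.1 z.2)).
    by apply: continuous_pair_for; [exact: cvg_cst|exact: ch].
  exact: (sheet_continuous fl).
have Ng : \forall w \near z0, good w.
  apply: filterI.
    by apply: (near_image (@cH z0)); apply: (near_bdom fa); exact: (center_dom fl).
  by apply: (near_image (cs z0)); rewrite -Hz0; apply: (near_bdom fa); exact: (center_dom fl).
have N1 := sheet_inverse fl t0 (@hrd z0); rewrite -Hz0 -/q in N1.
have {}N1 := near_image (@cH z0) N1.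
have N2 := ph (center_dom fl q).
have N3 : \forall w \near z0, H w = sheet x (th w) (h w).
  apply: filterS2 N1 N2 => w E hw.
  have hE : h w = h z0 + ht q (H w) by have := center_height fl q; rewrite -/q in hw *; lra.
  by rewrite /th hE.
have [e' e'0 He'] := open_rect (filterI Ng N3).
exists e' => //; exists th.
  by rewrite /th -Hz0 subrr addr0.
move=> w wr; split.
  have [[g1 g2] _] := He' _ wr.
  apply: cvgD; first exact: cvg_cst.
  apply: cvgB.
    by apply: (continuous_comp (@cH w)); exact: (btime_continuous (isb q)).
  by apply: (continuous_comp (cs w)); exact: (btime_continuous (isb q)).
by apply: filterS (rect_near wr) => v /He' [].
Qed.

Lemma time_lift_exists t00 : H (0, 0) = sheet x t00 (h (0, 0)) ->
  exists k : R * R -> R, [/\ continuous k, forall z, H z = sheet x (k z) (h z) & k (0, 0) = t00].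
Proof.
move=> H0; have HT := homotopy_in_tube (ex_intro _ _ H0).
have near_germ f g z : (\forall w \near z, f w = g w) -> time_lift f z -> time_lift g z.
  move=> E [cf Hf]; split; first exact: near_eq_continuous E cf.
  by apply: filterS2 E Hf => w ->.
have loc z0 : exists2 e : R, 0 < e &
    extends_germs time_lift (rect (z0.1 - e) (z0.1 + e) (z0.2 - e) (z0.2 + e)).
  have [t0 Ht0] := HT z0; have [e' e'0 [th _ Hth]] := time_lift_local (HT z0) Ht0.
  exists e' => // z f zr [cf Hf].
  have [_ Hz] := Hth _ zr; have fz := nbhs_singleton Hf; have tz := nbhs_singleton Hz.
  rewrite fz in tz; have [_ [k kE]] := sheet_inj fl tb (@he z) (@he z) tz.
  (* Other initial values are reached by adding [k] periods, which depend continuously on the height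
     [h w]. *)
  exists (fun w => th w + k%:~R * tau (h w)); split=> // w wr; have [cw Hw] := Hth _ wr; split.
    apply: cvgD => //; apply: cvgM; first exact: cvg_cst.
    by apply: (continuous_comp (@ch w)); exact: (tube_per_continuous tb).
  apply: filterS Hw => v ->; rewrite !sheetE -FD (periodZ fl)//.
  exact: (tube_per tb).
have [e' e'0 [th th0 Hth]] := time_lift_local (HT (0, 0)) H0.
have S0 : time_lift th (0, 0).
  by apply: Hth; split; rewrite /= sub0r add0r oppr_lt0 e'0.
have [k [Hk k0]] := global_solution near_germ time_lift_rigid loc S0.
exists k; split; last by rewrite k0.
- by move=> z; case: (Hk z).
- by move=> z; have [_ /nbhs_singleton] := Hk z.
Qed.
End Tube.

Lemma line_continuous (H : R * R -> R) (a b : R -> R) : continuous H -> continuous a ->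
  continuous b -> continuous (fun t => H (a t, b t)).
Proof.
move=> cH ca cb t; apply: (continuous_comp (f := fun t => (a t, b t)) (g := H)).
  by apply: continuous_pair_for; [exact: ca|exact: cb].
exact: cH.
Qed.

(* If the loop bounded a homotopy, pushing the homotopy along the transverse
   direction towards the level of the loop would contract the loop inside a
   tubular neighbourhood of the orbit, where the time coordinate obstructs it. *)
Theorem periodic_orbit_essential x T (H0 : R * R -> N) : 0 < T -> F T x = x ->
  {within `[0, 1]%classic `*` `[0, 1]%classic, continuous H0} ->
  (forall t, 0 <= t <= 1 -> H0 (t, 0) = F (T * t) x) ->
  (forall u, 0 <= u <= 1 -> H0 (0, u) = H0 (1, u)) ->
  (forall t, 0 <= t <= 1 -> H0 (t, 1) = H0 (0, 1)) -> False.
Proof.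
move=> T0 Tx cH0 Hb Hs Ht.
(* Clamping extends the homotopy from the square to the plane, where the lifting scheme applies. *)
pose cl (t : R) := clamp 0 1 t.
have cl01 t : 0 <= cl t <= 1 by exact: clamp_itv.
have cl0 : cl 0 = 0 by apply: clamp_id; rewrite lexx ler01.
have cl1 : cl 1 = 1 by apply: clamp_id; rewrite lexx ler01.
have clK t : cl (cl t) = cl t by exact: clamp_id.
have ccl : continuous cl.
  by move=> t; apply: (clamp_continuous_for (a := cst 0) (b := cst 1) (t := id));
    [exact: cvg_cst|exact: cvg_cst|exact: cvg_id].
pose c2 (z : R * R) := (cl z.1, cl z.2).
have cc2 : continuous c2.
  move=> z; have e1 : {for z, continuous (fun z : R * R => cl z.1)}.
    by apply: (continuous_comp (f := fst)); [exact: cvg_fst|exact: ccl].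
  have e2 : {for z, continuous (fun z : R * R => cl z.2)}.
    by apply: (continuous_comp (f := snd)); [exact: cvg_snd|exact: ccl].
  exact: (continuous_pair_for e1 e2).
have c2K z : c2 (c2 z) = c2 z by rewrite /c2 /= !clK.
pose H1 := H0 \o c2.
have H1E a b : H1 (a, b) = H0 (cl a, cl b) by [].
have cH1 : continuous H1.
  apply: (continuous_within_comp cH0 cc2) => z.
  by split; rewrite /= in_itv /=; exact: cl01.
have [h [ph h00]] := primitive_exists cH1.
(* Composition with the clamp makes the primitive factor through the square, which will bound it. *)
pose h1 := h \o c2.
have ph1 z : primitive_along bx H1 h1 z.
  move=> p pz; have E w : H1 (c2 w) = H1 w by rewrite /H1 /= c2K.
  have := ph (c2 z) p; rewrite E => /(_ pz) N1.
  by have := near_image (@cc2 z) N1; apply: filterS => w; rewrite E.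
have h1c z : h1 (c2 z) = h1 z by rewrite /h1 /= c2K.
have ch1 : continuous h1.
  by move=> z; exact: (primitive_along_continuous fl (@cH1 z) (@ph1 z)).
have near_along (a b : R -> R) (P : R * R -> Prop) u : continuous a -> continuous b ->
    (\forall w \near (a u, b u), P w) -> \forall v \near u, P (a v, b v).
  move=> ca cb; apply: (near_image (f := fun v => (a v, b v))).
  by apply: continuous_pair_for; [exact: ca|exact: cb].
have ccst (a : R) : continuous (fun _ : R => a) by move=> ?; exact: cvg_cst.
have cid : continuous (fun t : R => t) by move=> ?; exact: cvg_id.
(* The bottom side runs along an orbit, on which heights are constant. *)
have h1b t : h1 (t, 0) = 0.
  have h1z : h1 (0, 0) = 0 by rewrite /h1 /c2 /= cl0.
  apply: (@lc_convex R setT (fun t => h1 (t, 0) = 0) 0 t) => // u _.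
  set q := H1 (u, 0); have qE : q = F (T * cl u) x by rewrite /q H1E cl0 Hb.
  have N1 : \forall v \near u, h1 (v, 0) - ht q (H1 (v, 0)) = h1 (u, 0) - ht q q.
    exact: (near_along id (cst 0) (fun w => h1 w - ht q (H1 w) = h1 (u, 0) - ht q q) u
      cid (ccst 0) (@ph1 (u, 0) q (center_dom fl q))).
  have N2 : \forall v \near u, `|T * (cl v - cl u)| < rd q.
    apply: near_norm_lt; last by rewrite subrr mulr0 normr0 (rad_gt0 fl).
    apply: cvgM; first exact: cvg_cst.
    by apply: cvgB; [exact: ccl|exact: cvg_cst].
  apply: filterS2 N1 N2 => v E vr _.
  have vr' : `|tm q q + T * (cl v - cl u)| < rd q by rewrite (center_time fl) add0r.
  have [_ _] := flow_box fl (center_dom fl q) vr'.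
  have -> : F (T * (cl v - cl u)) q = H1 (v, 0).
    by rewrite qE FD H1E cl0 Hb// -mulrDr subrK.
  by move: E => /[swap] ->; move=> E; split; lra.
have h1s u : h1 (0, u) = h1 (1, u).
  have Hs' v : H1 (0, v) = H1 (1, v) by rewrite !H1E ?cl0 cl1 Hs.
  suff : h1 (0, u) - h1 (1, u) = 0 by lra.
  apply: (@lc_convex R setT (fun u => h1 (0, u) - h1 (1, u) = 0) 0 u) => //; last by rewrite !h1b subrr.
  move=> v _; set q := H1 (0, v).
  have N1 := near_along (cst 0) id (fun w => h1 w - ht q (H1 w) = h1 (0, v) - ht q (H1 (0, v))) v
    (ccst 0) cid (@ph1 (0, v) q (center_dom fl q)).
  have q1 : dm q (H1 (1, v)) by rewrite -Hs'; exact: (center_dom fl).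
  have N2 := near_along (cst 1) id (fun w => h1 w - ht q (H1 w) = h1 (1, v) - ht q (H1 (1, v))) v
    (ccst 1) cid (@ph1 (1, v) q q1).
  apply: filterS2 N1 N2 => w /=; rewrite !Hs' => E1 E2 _; split; lra.
have h1t t : h1 (t, 1) = h1 (0, 1).
  have Ht' v : H1 (v, 1) = H1 (0, 1) by rewrite !H1E ?cl0 cl1 Ht.
  apply: (@lc_convex R setT (fun t => h1 (t, 1) = h1 (0, 1)) 0 t) => // v _.
  set q := H1 (0, 1); have q1 : dm q (H1 (v, 1)) by rewrite Ht'; exact: (center_dom fl).
  have N1 := near_along id (cst 1) (fun w => h1 w - ht q (H1 w) = h1 (v, 1) - ht q (H1 (v, 1))) v
    cid (ccst 1) (@ph1 (v, 1) q q1).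
  by apply: filterS N1 => w /=; rewrite !Ht' => E1 _; split; lra.
have [e [tau tb]] := periodic_tube fl (ex_intro2 _ _ T T0 Tx).
have e0 := tube_gt0 tb.
have [B HB] : exists B, forall z, `|h1 z| <= B.
  pose K := (`[0, 1]%classic `*` `[0, 1]%classic) : set (R * R).
  have cK : compact K by apply: compact_setX; exact: segment_compact.
  have K0 : K !=set0 by exists (0, 0); split; rewrite /= in_itv /= lexx ler01.
  have cn : {within K, continuous (fun z => `|h1 z|)}.
    by apply: continuous_subspaceT => z; apply: cvg_norm; exact: ch1.
  have [c _ Hc] := compact_EVT_max K0 cK cn.
  exists `|h1 c| => z; rewrite -h1c; apply: Hc.
  by rewrite inE; split; rewrite /= in_itv /=; exact: cl01.
have e2 : 0 < e / 2 by rewrite divr_gt0.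
have [ps Hps] := iter_sweep_small fl B e2.
have [cH3 ph3] := sweep_primitive fl ps cH1 ph1.
set H3 := (fun w => (sweep bx ps (H1 w, h1 w)).1) in cH3 ph3.
set h3 := (fun w => (sweep bx ps (H1 w, h1 w)).2) in ph3.
have hd z : `|h3 z| <= e / 2 by apply/ltW/Hps/HB.
have de : e / 2 < e by lra.
have bot t : H3 (t, 0) = F (T * cl t) x /\ h3 (t, 0) = 0.
  by rewrite /H3 /h3 h1b (sweep0 fl) H1E cl0 Hb.
have H30 : H3 (0, 0) = sheet x 0 (h3 (0, 0)).
  by have [-> ->] := bot 0; rewrite cl0 mulr0 sheetE (slice0 fl).
have [k [ck Hk k0]] := time_lift_exists tb cH3 ph3 de hd H30.
have he z : `|h3 z| < e by apply: le_lt_trans de.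
have ch3 : continuous h3.
  by move=> z; exact: (primitive_along_continuous fl (@cH3 z) (@ph3 z)).
have per a b a' b' : H3 (a, b) = H3 (a', b') -> h3 (a, b) = h3 (a', b') ->
    exists m : int, (k (a, b) - k (a', b')) / tau (h3 (a', b')) = m%:~R.
  move=> E hE; rewrite (Hk (a, b)) (Hk (a', b')) hE in E.
  have [_ [m ->]] := sheet_inj fl tb (he _) (he _) E; exists m.
  by rewrite addrC addKr mulfK// gt_eqF// (tube_per_gt0 tb).
have tau0 : 0 < tau 0 by apply: (tube_per_gt0 tb); rewrite normr0.
have kb t : k (t, 0) = T * cl t.
  have : (k (t, 0) - T * cl t) / tau 0 = (k (0, 0) - T * cl 0) / tau 0.
    apply: (int_valued_const (c := fun t => (k (t, 0) - T * cl t) / tau 0)).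
      move=> u; apply: cvgM; last exact: cvg_cst.
      apply: cvgB; first by apply: (line_continuous ck cid (ccst 0)).
      by apply: cvgM; [exact: cvg_cst|exact: ccl].
    move=> u; have [E1 E2] := bot u; have := Hk (u, 0); rewrite E1 E2.
    have -> : F (T * cl u) x = sheet x (T * cl u) 0 by rewrite sheetE (slice0 fl).
    have e0' : `|0 : R| < e by rewrite normr0.
    move=> /esym /(sheet_inj fl tb e0' e0') [_ [m ->]]; exists m.
    by rewrite addrC addKr mulfK// gt_eqF.
  rewrite k0 cl0 mulr0 subrr mul0r => /eqP; rewrite mulf_eq0 invr_eq0 (gt_eqF tau0) orbF.
  by rewrite subr_eq0 => /eqP.
(* The time gained from the left side to the right side, counted in periods, is an integer depending
   continuously on [u], hence constant. It is [T / tau 0] at the bottom, whereas the top side is a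
   point and makes it 0. *)
have side : (k (1, 1) - k (0, 1)) / tau (h3 (0, 1)) = (k (1, 0) - k (0, 0)) / tau (h3 (0, 0)).
  apply: (int_valued_const (c := fun u => (k (1, u) - k (0, u)) / tau (h3 (0, u)))).
    move=> u; apply: cvgM; last first.
      apply: cvgV; first by rewrite gt_eqF// (tube_per_gt0 tb).
      apply: (continuous_comp (f := fun u => h3 (0, u)) (g := tau)).
        exact: (line_continuous ch3 (ccst 0) cid).
      exact: (tube_per_continuous tb).
    by apply: cvgB; [exact: (line_continuous ck (ccst 1) cid)|exact: (line_continuous ck (ccst 0) cid)].
  move=> u; apply: per; rewrite /H3 /h3 h1s.
    by congr (sweep bx ps (_, _)).1; rewrite !H1E ?cl0 cl1 Hs.
  by congr (sweep bx ps (_, _)).2; rewrite !H1E ?cl0 cl1 Hs.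
have top : (k (1, 1) - k (0, 1)) / tau (h3 (0, 1)) = (k (0, 1) - k (0, 1)) / tau (h3 (0, 1)).
  apply: (int_valued_const (c := fun t => (k (t, 1) - k (0, 1)) / tau (h3 (0, 1)))).
    move=> u; apply: cvgM; last exact: cvg_cst.
    by apply: cvgB; [exact: (line_continuous ck cid (ccst 1))|exact: cvg_cst].
  move=> u; apply: per; rewrite /H3 /h3 h1t.
    by congr (sweep bx ps (_, _)).1; rewrite !H1E ?cl0 cl1 Ht.
  by congr (sweep bx ps (_, _)).2; rewrite !H1E ?cl0 cl1 Ht.
move: side; rewrite top subrr mul0r !kb cl0 cl1 mulr0 mulr1 subr0.
have [_ ->] := bot 0; move=> /esym/eqP.
by rewrite mulf_eq0 invr_eq0 (gt_eqF T0) (gt_eqF tau0).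
Qed.
End Essential.

Lemma is_deriveP (R : realType) (E F : normedModType R) (f : E -> F) x v l :
  (h^-1 *: (f (h *: v + x) - f x) @[h --> (0 : R)^'] --> l) <-> is_derive x v f l.
Proof.
split=> [H|[df <-]]; last exact: df.
by apply: DeriveDef; [apply/cvg_ex; exists l|exact: cvg_lim H].
Qed.

(** * Calculus in the plane *)

Section DirectionalDerivative.
Context {R : realType} {E F : normedModType R}.

Lemma is_derive_line (f : E -> F) x v (s : R) : derivable f (s *: v + x) v ->
  is_derive s 1 (fun t : R => f (t *: v + x)) ('D_v f (s *: v + x)).
Proof.
move=> df; apply/is_deriveP; have /is_deriveP H : is_derive (s *: v + x) v f ('D_v f (s *: v + x)).
  exact: derivableP.
apply: cvg_trans H; apply: near_eq_cvg; near=> h.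
by rewrite scalerDl -addrA [h *: 1]mulr1.
Unshelve. all: by end_near.
Qed.

Lemma derivable_scale (f : E -> F) x v (k : R) : derivable f x v ->
  is_derive x (k *: v) f (k *: 'D_v f x).
Proof.
have [->|k0] := eqVneq k 0; first by rewrite !scale0r => _; exact: is_derive0.
move=> df; apply/is_deriveP; have /is_deriveP H : is_derive x v f ('D_v f x) by exact: derivableP.
have c : (fun h : R => h * k) @ 0^' --> (0 : R)^'.
  move=> A nA; have N : \forall h \near (0 : R), h * k != 0 -> A (h * k).
    apply: (near_image (f := fun h : R => h * k) (P := fun u : R => u != 0 -> A u) (x := 0)).
      by apply: cvgM; [exact: cvg_id|exact: cvg_cst].
    by rewrite mul0r; exact: nA.
  by apply: filterS N => h Nh h0; apply: Nh; rewrite mulf_neq0.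
have H1 := cvg_comp _ _ c H.
have H2 := cvgZl_tmp (k := k) H1.
have {}H2 := H2 (@dnbhs_filter _ _).
apply: cvg_trans H2; apply: near_eq_cvg; near=> h => /=.
have h0 : h != 0 by near: h; exact: nbhs_dnbhs_neq.
by rewrite !scalerA invfM mulrCA mulfV// mulr1.
Unshelve. all: by end_near.
Qed.
End DirectionalDerivative.

Section MeanValue.
Context {R : realType} {E : normedModType R}.

Lemma mean_value_line (f : E -> R) x v (s : R) :
  (forall t : R, `|t| <= `|s| -> derivable f (t *: v + x) v) ->
  exists2 t : R, `|t| <= `|s| & f (s *: v + x) - f x = s * 'D_v f (t *: v + x).
Proof.
move=> df; pose g (t : R) := f (t *: v + x).
have dg (t : R) : `|t| <= `|s| -> is_derive t 1 g ('D_v f (t *: v + x)).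
  by move=> ts; apply: is_derive_line; exact: df.
have g0 : g 0 = f x by rewrite /g scale0r add0r.
have [s0|s0|->] := ltgtP s 0; last first.
- by exists 0; rewrite // scale0r add0r subrr mul0r.
- have [||c] := @MVT_segment R g (fun t => 'D_v f (t *: v + x)) 0 s (ltW s0).
  + by move=> c; rewrite in_itv /= => /andP[? ?]; apply: dg; rewrite !gtr0_norm// ltW.
  + apply: derivable_within_continuous => c; rewrite in_itv /= => /andP[c0 cs].
    have cs' : `|c| <= `|s| by rewrite ger0_norm// gtr0_norm.
    by have [] := dg _ cs'.
  rewrite in_itv /= => /andP[c0 cs] H; exists c; first by rewrite ger0_norm// gtr0_norm.
  by rewrite -/(g s) -g0 H subr0 mulrC.
have [||c] := @MVT_segment R g (fun t => 'D_v f (t *: v + x)) s 0 (ltW s0).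
- by move=> c; rewrite in_itv /= => /andP[? ?]; apply: dg; rewrite !ltr0_norm// lerN2 ltW.
- apply: derivable_within_continuous => c; rewrite in_itv /= => /andP[cs c0].
  have cs' : `|c| <= `|s| by rewrite ler0_norm// ltr0_norm// lerN2.
  by have [] := dg _ cs'.
rewrite in_itv /= => /andP[cs c0] H; exists c; first by rewrite ler0_norm// ltr0_norm// lerN2.
by rewrite -/(g s) -g0 -opprB H sub0r mulrN opprK mulrC.
Qed.
End MeanValue.

Section Plane.
Context {R : realType}.
Local Notation V2 := 'rV[R]_2.
Local Notation e_ i := (delta_mx 0 i : V2).

Definition pt2 (p : V2) (a b : R) : V2 := b *: e_ 1 + (a *: e_ 0 + p).

Lemma pt20 p : pt2 p 0 0 = p.
Proof. by rewrite /pt2 !scale0r !add0r. Qed.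

Lemma rV2E (v : V2) : v = v 0 0 *: e_ 0 + v 0 1 *: e_ 1.
Proof.
apply/rowP => i; rewrite !mxE.
by case: i => [[|[|//]] Hi]; rewrite -!val_eqE /= ?mulr1 ?mulr0 ?addr0 ?add0r;
  congr (v _ _); exact: val_inj.
Qed.

Lemma pt2E (p q : V2) : q = pt2 p ((q - p) 0 0) ((q - p) 0 1).
Proof. by rewrite /pt2 addrA (addrC (_ *: e_ 1)) -rV2E subrK. Qed.

Lemma scalev_continuous (v : V2) : continuous (fun a : R => a *: v).
Proof. by move=> a; apply: cvgZr_tmp; exact: cvg_id. Qed.

Lemma pt2_continuous (p : V2) : continuous (fun z : R * R => pt2 p z.1 z.2).
Proof.
move=> z; have c1 : {for z, continuous (fun z : R * R => z.2 *: e_ 1)}.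
  by apply: (continuous_comp (f := snd) (g := fun a : R => a *: e_ 1)); [exact: cvg_snd|exact: scalev_continuous].
have c2 : {for z, continuous (fun z : R * R => z.1 *: e_ 0)}.
  by apply: (continuous_comp (f := fst) (g := fun a : R => a *: e_ 0)); [exact: cvg_fst|exact: scalev_continuous].
have c3 : {for z, continuous (fun z : R * R => z.1 *: e_ 0 + p)}.
  by apply: cvgD; [exact: c2|exact: cvg_cst].
exact: (cvgD c1 c3).
Qed.

Definition C1_at (g : V2 -> R) (p : V2) :=
  (\forall y \near p, forall i, derivable g y (e_ i)) /\
  forall i, {for p, continuous ('D_(e_ i) g)}.

Lemma C1_at_nbhs (g : V2 -> R) (p : V2) : C1_at g p ->
  exists2 e : R, 0 < e & forall a b, `|a| < e -> `|b| < e -> forall i, derivable g (pt2 p a b) (e_ i).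
Proof.
move=> [dg _].
have c : {for (0, 0), continuous (fun z : R * R => pt2 p z.1 z.2)} by exact: pt2_continuous.
have := near_image (P := fun y => forall i, derivable g y (e_ i)) c; rewrite /= pt20 => /(_ dg).
move=> [[U V] /= [[d1 /= d10 H1] [d2 /= d20 H2]] sUV].
exists (Num.min d1 d2); first by rewrite lt_min d10.
move=> a b; rewrite !lt_min => /andP[a1 _] /andP[_ b2].
by apply: (sUV (a, b)); split; [apply: H1|apply: H2]; rewrite /= sub0r normrN.
Qed.

Lemma squeeze_cvg0 (T : Type) (G : set_system T) (f g : T -> R) : Filter G ->
  (\forall t \near G, `|f t| <= `|g t|) -> g t @[t --> G] --> (0 : R) -> f t @[t --> G] --> (0 : R).
Proof.
move=> FG fg g0; apply/cvgr0Pnorm_lt => e e0.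
have /cvgr0Pnorm_lt/(_ _ e0) H := g0.
by apply: filterS2 fg H => t; exact: le_lt_trans.
Qed.

(* Only directional derivatives along the axes enter the hypothesis on [g]; the
   two increments are compared by the mean value theorem. *)
Lemma is_derive_comp2 (E : normedModType R) (phi : E -> V2) (g : V2 -> R) (x v : E) (w : V2) :
  is_derive x v phi w -> C1_at g (phi x) ->
  is_derive x v (g \o phi : E -> R^o) (w 0 0 * 'D_(e_ 0) g (phi x) + w 0 1 * 'D_(e_ 1) g (phi x)).
Proof.
move=> /is_deriveP Hphi Cg; set p := phi x in Cg *.
have [e e0 dg] := C1_at_nbhs Cg; have [_ cg] := Cg.
pose D (i : 'I_2) (h : R) := (phi (h *: v + x) - p) 0 i.
have DH i : h^-1 * D i h @[h --> (0 : R)^'] --> w 0 i.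
  have H := cvg_comp _ _ Hphi (@coord_continuous R 1 2 0 i w).
  by apply: cvg_trans H; apply: near_eq_cvg; near=> h; rewrite /D /= !mxE.
have D0 i : D i h @[h --> (0 : R)^'] --> 0.
  have H : h * (h^-1 * D i h) @[h --> (0 : R)^'] --> 0 * w 0 i.
    by apply: cvgM; [exact: cvg_within|exact: DH].
  rewrite mul0r in H; apply: cvg_trans H; apply: near_eq_cvg; near=> h.
  by rewrite mulVKf//; near: h; exact: nbhs_dnbhs_neq.
have De i : \forall h \near (0 : R)^', `|D i h| < e by have /cvgr0Pnorm_lt/(_ _ e0) := D0 i.
have mv0 h : exists t : R, `|D 0 h| < e ->
    `|t| <= `|D 0 h| /\ g (pt2 p (D 0 h) 0) - g p = D 0 h * 'D_(e_ 0) g (pt2 p t 0).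
  have [De0|De0] := boolP (`|D 0 h| < e); last by exists 0 => De0'; case/negP: De0.
  have [|t td tE] := @mean_value_line R _ g p (e_ 0) (D 0 h).
    move=> t tD; have := @dg t 0; rewrite /pt2 scale0r add0r normr0; apply=> //.
    exact: le_lt_trans De0.
  by exists t => _; rewrite /pt2 !scale0r !add0r.
have mv1 h : exists t : R, `|D 0 h| < e -> `|D 1 h| < e ->
    `|t| <= `|D 1 h| /\ g (pt2 p (D 0 h) (D 1 h)) - g (pt2 p (D 0 h) 0) =
      D 1 h * 'D_(e_ 1) g (pt2 p (D 0 h) t).
  have [De0|De0] := boolP (`|D 0 h| < e); last by exists 0 => De0'; case/negP: De0.
  have [De1|De1] := boolP (`|D 1 h| < e); last by exists 0 => _ De1'; case/negP: De1.
  have [|t td tE] := @mean_value_line R _ g (pt2 p (D 0 h) 0) (e_ 1) (D 1 h).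
    move=> t tD; have := @dg (D 0 h) t De0; rewrite {2}/pt2 scale0r add0r; apply=> //.
    exact: le_lt_trans De1.
  by exists t => _ _; split=> //; move: tE; rewrite /pt2 !scale0r !add0r.
have [t0 Ht0] := choice mv0; have [t1 Ht1] := choice mv1.
have t0c : t0 h @[h --> (0 : R)^'] --> 0.
  by apply: squeeze_cvg0 (D0 0); apply: filterS (De 0) => h /Ht0 [].
have t1c : t1 h @[h --> (0 : R)^'] --> 0.
  by apply: squeeze_cvg0 (D0 1); apply: filterS2 (De 0) (De 1) => h De0 /(Ht1 _ De0) [].
have ptc (a b : R -> R) i : a h @[h --> (0 : R)^'] --> 0 -> b h @[h --> (0 : R)^'] --> 0 ->
    'D_(e_ i) g (pt2 p (a h) (b h)) @[h --> (0 : R)^'] --> 'D_(e_ i) g p.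
  move=> ca cb; have c : (fun z : R * R => 'D_(e_ i) g (pt2 p z.1 z.2)) z @[z --> (0, 0)] --> 'D_(e_ i) g p.
    have := @pt2_continuous p (0, 0); rewrite /continuous_at /= pt20 => H.
    exact: (cvg_comp _ _ H (cg i)).
  exact: (cvg_comp2 (h := fun a b => 'D_(e_ i) g (pt2 p a b)) ca cb c).
apply/is_deriveP.
have lim : h^-1 * D 0 h * 'D_(e_ 0) g (pt2 p (t0 h) 0) +
    h^-1 * D 1 h * 'D_(e_ 1) g (pt2 p (D 0 h) (t1 h)) @[h --> (0 : R)^'] -->
    w 0 0 * 'D_(e_ 0) g p + w 0 1 * 'D_(e_ 1) g p.
  apply: cvgD; apply: cvgM; try exact: DH.
    by apply: (ptc t0 (cst 0)); [exact: t0c|exact: cvg_cst].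
  by apply: (ptc (D 0) t1); [exact: D0|exact: t1c].
apply: cvg_trans lim; apply: near_eq_cvg; near=> h.
have De0 : `|D 0 h| < e by near: h; exact: De.
have De1 : `|D 1 h| < e by near: h; exact: De.
have [_ E0] := Ht0 _ De0; have [_ E1] := Ht1 _ De0 De1.
rewrite -!mulrA -E0 -E1 -mulrDr /= -/p.
have -> : phi (h *: v + x) = pt2 p (D 0 h) (D 1 h) by rewrite [LHS](pt2E p).
by congr (_ * _); ring.
Unshelve. all: by end_near.
Qed.
End Plane.

(** * Classes of finite smoothness *)

Section Cn.
Context {R : realType} {E F : normedModType R}.

(** The finite stages of [smooth_on], recursive in the order so that closure properties can be
    proved by induction. *)
Fixpoint Cn (n : nat) (U : set E) (f : E -> F) : Prop :=
  (forall x, U x -> {for x, continuous f}) /\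
  if n is m.+1 then (forall x v, U x -> derivable f x v) /\ forall v, Cn m U ('D_v f)
  else True.

Lemma Cn_continuous n U f : Cn n U f -> forall x, U x -> {for x, continuous f}.
Proof. by case: n => [|n] []. Qed.

Lemma Cn_derivable n U f : Cn n.+1 U f -> forall x v, U x -> derivable f x v.
Proof. by case=> _ []. Qed.

Lemma Cn_derive n U f v : Cn n.+1 U f -> Cn n U ('D_v f).
Proof. by case=> _ [_]; exact. Qed.

Lemma CnI n U f : (forall x, U x -> {for x, continuous f}) ->
  (forall x v, U x -> derivable f x v) -> (forall v, Cn n U ('D_v f)) -> Cn n.+1 U f.
Proof. by []. Qed.

Lemma iterD_cat (us vs : seq E) (f : E -> F) : iterD (us ++ vs) f = iterD us (iterD vs f).
Proof. by elim: us => //= u us ->. Qed.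

(** [iterD] applies the last direction of the list first, hence the induction from the right end in
    the converse. *)
Lemma smooth_onP (U : set E) (f : E -> F) : smooth_on U f <-> forall n, Cn n U f.
Proof.
split=> [sf n|Cf vs].
  elim: n f sf => [|n IH] f sf /=; first by split=> // x /(sf [::] x) [].
  split; first by move=> x /(sf [::] x) [].
  split; first by move=> x v /(sf [::] x) [].
  move=> v; apply: IH => vs x Ux.
  by have := sf (vs ++ [:: v]) x Ux; rewrite iterD_cat.
elim/last_ind: vs f Cf => [|vs v IH] f Cf x Ux.
  by split; [exact: Cn_continuous (Cf 0%N) _ Ux|move=> v; exact: Cn_derivable (Cf 1%N) _ _ Ux].
rewrite -cats1 iterD_cat; apply: IH => // n; exact: Cn_derive (Cf n.+1).
Qed.

Lemma CnS n U f : Cn n.+1 U f -> Cn n U f.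
Proof.
elim: n f => [|n IH] f [c [d D]]; split=> //; split=> // v; exact: IH.
Qed.

Lemma CnW n (U U' : set E) f : U' `<=` U -> Cn n U f -> Cn n U' f.
Proof.
move=> s; elim: n f => [|n IH] f Cf; first by split=> // x /s; exact: Cn_continuous Cf _.
apply: CnI => [x /s|x v /s|v]; first exact: Cn_continuous Cf _.
  exact: Cn_derivable Cf _ _.
by apply: IH; exact: Cn_derive.
Qed.

Lemma near_open (U : set E) (P : E -> Prop) x : open U -> (forall y, U y -> P y) -> U x ->
  \forall y \near x, P y.
Proof.
move=> oU UP Ux; have N : \forall y \near x, U y by exact: open_nbhs_nbhs.
by apply: filterS N => y /UP.
Qed.

Lemma Cn_eq n U f g : open U -> (forall x, U x -> f x = g x) -> Cn n U f -> Cn n U g.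
Proof.
move=> oU; elim: n f g => [|n IH] f g fg Cf; first split=> // x Ux.
  by apply: near_eq_continuous (Cn_continuous Cf Ux); exact: near_open fg Ux.
apply: CnI => [x Ux|x v Ux|v].
- by apply: near_eq_continuous (Cn_continuous Cf Ux); exact: near_open fg Ux.
- by apply: (near_eq_derivable (f := f)); [exact: near_open fg Ux|exact: Cn_derivable Cf _ _ Ux].
apply: (IH ('D_v f)); last exact: Cn_derive.
by move=> x Ux; apply: near_eq_derive; exact: near_open fg Ux.
Qed.

Lemma Cn_cst n U (a : F) : Cn n U (cst a).
Proof.
elim: n a => [|n IH] a; split=> //; try by move=> x _; exact: cvg_cst.
split=> [x v _|v]; first exact: derivable_cst.
suff -> : 'D_v (cst a) = cst 0 :> (E -> F) by [].
by apply/funext => x; exact: derive_cst.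
Qed.

Lemma CnD n U f g : open U -> Cn n U f -> Cn n U g -> Cn n U (fun x => f x + g x).
Proof.
move=> oU; elim: n f g => [|n IH] f g [cf df] [cg dg]; split=> //;
  try by move=> x Ux; apply: cvgD; [exact: cf|exact: cg].
case: df dg => [df Df] [dg Dg]; split=> [x v Ux|v].
  by apply: derivableD; [exact: df|exact: dg].
apply: (Cn_eq oU _ (IH _ _ (Df v) (Dg v))) => x Ux.
by rewrite deriveD//; [exact: df|exact: dg].
Qed.

Lemma CnZ n U (a : R) f : open U -> Cn n U f -> Cn n U (fun x => a *: f x).
Proof.
move=> oU; elim: n f => [|n IH] f [cf df]; split=> //;
  try by move=> x Ux; apply: cvgZl_tmp; exact: cf.
case: df => [df Df]; split=> [x v Ux|v]; first by apply: derivableZ; exact: df.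
apply: (Cn_eq oU _ (IH _ (Df v))) => x Ux.
by rewrite deriveZ//; exact: df.
Qed.
End Cn.

Section CnReal.
Context {R : realType} {E : normedModType R}.
Implicit Types (U : set E) (f g : E -> R^o).

Lemma CnM n U f g : open U -> Cn n U f -> Cn n U g -> Cn n U (fun x => f x * g x : R^o).
Proof.
move=> oU; elim: n f g => [|n IH] f g [cf df] [cg dg]; split=> //;
  try by move=> x Ux; apply: cvgM; [exact: cf|exact: cg].
have Cf : Cn n U f by exact: CnS.
have Cg : Cn n U g by exact: CnS.
case: df dg => [df Df] [dg Dg]; split=> [x v Ux|v].
  by apply: derivableM; [exact: df|exact: dg].
apply: (Cn_eq oU _ (CnD oU (IH _ _ Cf (Dg v)) (IH _ _ Cg (Df v)))) => x Ux.
by rewrite deriveM//; [exact: df|exact: dg].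
Qed.

Lemma CnB n U f g : open U -> Cn n U f -> Cn n U g -> Cn n U (fun x => f x - g x : R^o).
Proof.
move=> oU Cf Cg; apply: (Cn_eq oU _ (CnD oU Cf (CnZ (-1) oU Cg))) => x _.
by rewrite scaleN1r.
Qed.

Lemma is_derive_comp1 (phi : E -> R) (g : R -> R) (x v : E) (a b : R) :
  is_derive x v (phi : E -> R^o) a -> is_derive (phi x) 1 g b ->
  is_derive x v (g \o phi : E -> R^o) (b * a).
Proof.
move=> dphi dg; apply/is_deriveP.
have /is_deriveP H : is_derive (0 : R) 1 (g \o (fun h : R => phi (h *: v + x))) (b * a).
  apply: is_derive1_comp; first by rewrite scale0r add0r.
  apply/is_deriveP; move: dphi => /is_deriveP H; apply: cvg_trans H; apply: near_eq_cvg; near=> h.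
  by rewrite scale0r add0r addr0 [h *: 1]mulr1.
apply: cvg_trans H; apply: near_eq_cvg; near=> h.
by rewrite /= scale0r add0r addr0 [h *: 1]mulr1.
Unshelve. all: by end_near.
Qed.

Lemma Cn_comp1 n U (V : set R^o) (phi : E -> R^o) (g : R^o -> R^o) : open U ->
  (forall x, U x -> V (phi x)) -> Cn n U phi -> Cn n V g -> Cn n U (g \o phi).
Proof.
move=> oU UV; elim: n g => [|n IH] g Cp Cg.
  by split=> // x Ux; apply: continuous_comp; [exact: Cn_continuous Cp _ Ux|exact: Cn_continuous Cg _ (UV _ Ux)].
have Cp' := CnS Cp.
have D x v : U x -> is_derive x v (g \o phi) ('D_1 g (phi x) * 'D_v phi x).
  move=> Ux; apply: is_derive_comp1; apply: derivableP.
    exact: Cn_derivable Cp _ _ Ux.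
  exact: Cn_derivable Cg _ _ (UV _ Ux).
apply: CnI => [x Ux|x v Ux|v].
- by apply: continuous_comp; [exact: Cn_continuous Cp _ Ux|exact: Cn_continuous Cg _ (UV _ Ux)].
- by have [] := D x v Ux.
have C : Cn n U (fun x => 'D_1 g (phi x) * 'D_v phi x : R^o).
  exact: (CnM oU (IH _ Cp' (Cn_derive (1 : R^o) Cg)) (Cn_derive v Cp)).
apply: (Cn_eq oU _ C) => x Ux.
by have [_ ->] := D x v Ux.
Qed.

(** [r] is the inverse square root of [f]. Its derivative [- r^3 f' / 2] is built from [r] and [f'],
    so the order can be raised by induction. *)
Lemma Cn_rsqrt n U (f r : E -> R^o) : open U -> (forall x, U x -> 0 < r x) ->
  (forall x, U x -> r x ^+ 2 * f x = 1) -> Cn n U f -> Cn n U r.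
Proof.
move=> oU r0 rf Cf.
have rE x : U x -> r x = (Num.sqrt (f x))^-1.
  move=> Ux; have fE : f x = (r x)^-1 ^+ 2.
    have := rf _ Ux; have : r x != 0 by rewrite gt_eqF// r0.
    move=> rn H; rewrite -[LHS]mul1r -[in LHS](mulVf (expf_neq0 2 rn)) -mulrA H mulr1.
    by rewrite exprVn.
  by rewrite fE sqrtr_sqr gtr0_norm ?invrK// invr_gt0 r0.
have f0 x : U x -> 0 < f x.
  by move=> Ux; have := rf _ Ux; rewrite -(pmulr_rgt0 (f x) (exprn_gt0 2 (r0 _ Ux))) => ->.
suff H : Cn n U (fun x => (Num.sqrt (f x))^-1 : R^o).
  by apply: Cn_eq H => // x Ux; rewrite rE.
have D x v (Ux : U x) : derivable f x v ->
    is_derive x v (fun x => (Num.sqrt (f x))^-1 : R^o) (- 2^-1 * (r x) ^+ 3 * 'D_v f x).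
  move=> df; apply: (is_derive_comp1 (g := fun y => (Num.sqrt y)^-1) (phi := f)).
    exact: derivableP.
  have s0 : Num.sqrt (f x) != 0 by rewrite gt_eqF// sqrtr_gt0 f0.
  have ds := is_derive1_sqrt (f0 _ Ux).
  have := is_deriveV s0 ds.
  suff -> : - Num.sqrt (f x) ^- 2 *: (2 * Num.sqrt (f x))^-1 = - 2^-1 * r x ^+ 3 by [].
  by rewrite rE// /GRing.scale /=; field.
elim: n Cf => [|n IH] Cf; split=> //.
- move=> x Ux; apply: cvgV; first by rewrite gt_eqF// sqrtr_gt0 f0.
  by apply: (continuous_comp (Cn_continuous Cf Ux)); exact: sqrt_continuous.
- move=> x Ux; apply: cvgV; first by rewrite gt_eqF// sqrtr_gt0 f0.
  by apply: (continuous_comp (Cn_continuous Cf Ux)); exact: sqrt_continuous.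
have IH' := IH (CnS Cf).
have df x v : U x -> derivable f x v by move=> Ux; exact: Cn_derivable Cf _ _ Ux.
split=> [x v Ux|v]; first by have [] := D x v Ux (df _ _ Ux).
have C3 := CnM oU (CnM oU IH' IH') IH'.
apply: (Cn_eq oU _ (CnM oU (CnZ (- 2^-1) oU C3) (Cn_derive v Cf))) => x Ux.
have [_ ->] := D x v Ux (df _ _ Ux).
by rewrite rE// /GRing.scale /=; ring.
Qed.
End CnReal.

Section CnPlane.
Context {R : realType}.
Local Notation V2 := 'rV[R]_2.
Local Notation e_ i := (delta_mx 0 i : V2).

Lemma Cn_coord (E : normedModType R) n (U : set E) (phi : E -> V2) i :
  open U -> Cn n U phi -> Cn n U (fun x => phi x 0 i : R^o).
Proof.
move=> oU; elim: n phi => [|n IH] phi Cp.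
  by split=> // x Ux; exact: (continuous_comp (Cn_continuous Cp Ux) (@coord_continuous R 1 2 0 i _)).
have dp x v : U x -> derivable phi x v by move=> Ux; exact: Cn_derivable Cp _ _ Ux.
apply: CnI => [x Ux|x v Ux|v].
- exact: (continuous_comp (Cn_continuous Cp Ux) (@coord_continuous R 1 2 0 i _)).
- exact: ((derivable_mxP phi x v).1 (dp _ _ Ux)).
apply: (Cn_eq oU _ (IH _ (Cn_derive v Cp))) => x Ux.
by rewrite (derive_mx (dp _ _ Ux)) mxE.
Qed.

Lemma Cn_row (E : normedModType R) n (U : set E) (phi : E -> V2) :
  open U -> (forall i, Cn n U (fun x => phi x 0 i : R^o)) -> Cn n U phi.
Proof.
move=> oU; elim: n phi => [|n IH] phi Cp.
  split=> // x Ux; have c i := Cn_continuous (Cp i) Ux.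
  have : {for x, continuous (fun x => phi x 0 0 *: e_ 0 + phi x 0 1 *: e_ 1)}.
    by apply: cvgD; [exact: (continuous_comp (c 0) (@scalev_continuous R (e_ 0) _))|
      exact: (continuous_comp (c 1) (@scalev_continuous R (e_ 1) _))].
  by apply: near_eq_continuous; near=> y; rewrite -rV2E.
have C0 := IH _ (fun i => CnS (Cp i)).
have dp x v : U x -> derivable phi x v.
  by move=> Ux; apply/derivable_mxP => i j; rewrite ord1; exact: Cn_derivable (Cp j) _ _ Ux.
split; first exact: Cn_continuous C0.
split=> // v; apply: IH => i; apply: (Cn_eq oU _ (Cn_derive v (Cp i))) => x Ux.
by rewrite (derive_mx (dp _ _ Ux)) mxE.
Unshelve. all: by end_near.
Qed.

Lemma Cn_C1_at n (V : set V2) (g : V2 -> R^o) p : open V -> V p -> Cn n.+1 V g -> C1_at g p.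
Proof.
move=> oV Vp Cg; split=> [|i]; last exact: Cn_continuous (Cn_derive (e_ i) Cg) _ Vp.
by apply: near_open oV _ Vp => y Vy i; exact: Cn_derivable Cg _ _ Vy.
Qed.

Lemma Cn_comp2 (E : normedModType R) n (U : set E) (V : set V2) (phi : E -> V2) (g : V2 -> R^o) :
  open U -> open V -> (forall x, U x -> V (phi x)) -> Cn n U phi -> Cn n V g -> Cn n U (g \o phi).
Proof.
move=> oU oV UV; elim: n g => [|n IH] g Cp Cg.
  by split=> // x Ux; apply: continuous_comp; [exact: Cn_continuous Cp _ Ux|exact: Cn_continuous Cg _ (UV _ Ux)].
have Cp' := CnS Cp.
have D x v : U x -> is_derive x v (g \o phi)
    ('D_v phi x 0 0 * 'D_(e_ 0) g (phi x) + 'D_v phi x 0 1 * 'D_(e_ 1) g (phi x)).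
  move=> Ux; apply: is_derive_comp2; last exact: Cn_C1_at oV (UV _ Ux) Cg.
  by apply: derivableP; exact: Cn_derivable Cp _ _ Ux.
apply: CnI => [x Ux|x v Ux|v].
- by apply: continuous_comp; [exact: Cn_continuous Cp _ Ux|exact: Cn_continuous Cg _ (UV _ Ux)].
- by have [] := D x v Ux.
have C i : Cn n U (fun x => 'D_v phi x 0 i * 'D_(e_ i) g (phi x) : R^o).
  apply: CnM => //; first by apply: Cn_coord => //; exact: Cn_derive.
  exact: (IH _ Cp' (Cn_derive (e_ i) Cg)).
apply: (Cn_eq oU _ (CnD oU (C 0) (C 1))) => x Ux.
by have [_ ->] := D x v Ux.
Qed.

Lemma derive_linear (V : set V2) (g : V2 -> R^o) p w : open V -> V p -> Cn 1 V g ->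
  'D_w g p = w 0 0 * 'D_(e_ 0) g p + w 0 1 * 'D_(e_ 1) g p.
Proof.
move=> oV Vp Cg; have Cp := Cn_C1_at oV Vp Cg.
have : is_derive p w (id : V2 -> V2) w by exact: is_derive_id.
by move=> H; have [_ <-] := is_derive_comp2 H Cp.
Qed.

Lemma Cn_primitive n (V : set V2) (f a b : V2 -> R^o) : open V ->
  (forall x v, V x -> is_derive x v f (v 0 0 * a x + v 0 1 * b x)) ->
  Cn n V a -> Cn n V b -> (forall x, V x -> {for x, continuous f}) -> Cn n.+1 V f.
Proof.
move=> oV D Ca Cb cf; apply: CnI => // [x v Vx|v]; first by have [] := D x v Vx.
apply: (Cn_eq oV _ (CnD oV (CnZ (v 0 0) oV Ca) (CnZ (v 0 1) oV Cb))) => x Vx.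
by have [_ ->] := D x v Vx.
Qed.

(* Solutions of autonomous equations are as smooth as the vector field. *)
Lemma Cn_integral_curve (U : set R^o) (V : set V2) (c : R^o -> V2) (X : V2 -> V2) :
  open U -> open V -> (forall t, U t -> V (c t)) ->
  (forall t, U t -> is_derive t 1 c (X (c t))) ->
  (forall n, Cn n V X) -> forall n, Cn n U c.
Proof.
move=> oU oV UV D CX; elim=> [|n IH].
  split=> // t Ut; have [d _] := D t Ut.
  by apply: differentiable_continuous; exact/derivable1_diffP.
split; first exact: Cn_continuous IH.
have Dv t v : U t -> is_derive t v c (v *: X (c t)).
  move=> Ut; have [d <-] := D t Ut.
  by have := derivable_scale v d; rewrite [v *: 1]mulr1.
split=> [t v Ut|v]; first by have [] := Dv t v Ut.
apply: (Cn_eq oU (f := fun t => v *: X (c t))); first by move=> t Ut; have [_ ->] := Dv t v Ut.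
apply: CnZ => //; apply: Cn_row => // i.
by apply: (Cn_comp2 (g := fun x => X x 0 i) oU oV UV IH); exact: Cn_coord.
Qed.
End CnPlane.

(** * Symmetry of mixed derivatives and locally constant functions *)

Section Schwarz.
Context {R : realType}.
Local Notation V2 := 'rV[R]_2.

Lemma affine2_continuous (E : normedModType R) (x v w : E) :
  continuous (fun z : R * R => z.1 *: v + (z.2 *: w + x)).
Proof.
have sc (u : E) : continuous (fun a : R => a *: u) by move=> a; apply: cvgZr_tmp; exact: cvg_id.
move=> z; have c1 : {for z, continuous (fun z : R * R => z.1 *: v)}.
  by apply: (continuous_comp (f := fst) (g := fun a : R => a *: v)); [exact: cvg_fst|exact: sc].
have c2 : {for z, continuous (fun z : R * R => z.2 *: w)}.
  by apply: (continuous_comp (f := snd) (g := fun a : R => a *: w)); [exact: cvg_snd|exact: sc].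
have c3 : {for z, continuous (fun z : R * R => z.2 *: w + x)}.
  by apply: cvgD; [exact: c2|exact: cvg_cst].
exact: (cvgD c1 c3).
Qed.

Lemma near00 (P : R * R -> Prop) : (\forall z \near (0 : R, 0 : R), P z) ->
  exists2 e : R, 0 < e & forall a b, `|a| < e -> `|b| < e -> P (a, b).
Proof.
move=> [[U V] /= [[d1 /= d10 H1] [d2 /= d20 H2]] sUV].
exists (Num.min d1 d2); first by rewrite lt_min d10.
move=> a b; rewrite !lt_min => /andP[a1 _] /andP[_ b2].
by apply: (sUV (a, b)); split; [apply: H1|apply: H2]; rewrite /= sub0r normrN.
Qed.

(* The mixed second difference divided by [h^2] is, by two applications of the
   mean value theorem, a value of the iterated derivative near [x]. *)
Lemma second_difference (E : normedModType R) (U : set E) (f : E -> R^o) x v w (d : R) :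
  open U -> U x -> Cn 2 U f -> 0 < d ->
  exists2 e : R, 0 < e & forall h, 0 < h < e ->
    `|(f (h *: v + (h *: w + x)) - f (h *: v + x) - f (h *: w + x) + f x) / (h * h)
      - 'D_w ('D_v f) x| < d.
Proof.
move=> oU Ux Cf d0.
have c := @affine2_continuous E x v w (0, 0).
have E0 : (((0 : R), (0 : R)).1 *: v + (((0 : R), (0 : R)).2 *: w + x)) = x by rewrite /= !scale0r !add0r.
have CD := Cn_derive v Cf.
have CDD : {for x, continuous ('D_w ('D_v f))} by exact: Cn_continuous (Cn_derive w CD) _ Ux.
have N1 : \forall z \near (0 : R, 0 : R), U (z.1 *: v + (z.2 *: w + x)).
  by apply: (near_image c); rewrite E0; exact: open_nbhs_nbhs.
have N2 : \forall z \near (0 : R, 0 : R), `|'D_w ('D_v f) (z.1 *: v + (z.2 *: w + x)) - 'D_w ('D_v f) x| < d.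
  apply: (near_image (P := fun y => `|'D_w ('D_v f) y - 'D_w ('D_v f) x| < d) c); rewrite E0.
  apply: near_norm_lt; last by rewrite subrr normr0.
  by apply: cvgB; [exact: CDD|exact: cvg_cst].
have [e e0 He] := near00 (filterI N1 N2).
exists e => // h /andP[h0 he].
have hn : `|h| < e by rewrite gtr0_norm.
have z0 : `|0 : R| < e by rewrite normr0.
have [s sh E1] : exists2 s : R, `|s| <= `|h| &
    (f (h *: v + (h *: w + x)) - f (h *: v + x)) - (f (h *: w + x) - f x) =
    h * ('D_v f (s *: v + (h *: w + x)) - 'D_v f (s *: v + x)).
  pose g y := f (y + h *: w) - f y.
  have ge y : f (y + h *: w) = (f \o shift (h *: w)) y by [].
  have dg t : `|t| <= `|h| -> is_derive (t *: v + x) v (g : E -> R^o)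
      ('D_v f (t *: v + (h *: w + x)) - 'D_v f (t *: v + x)).
    move=> th; have te : `|t| < e by apply: le_lt_trans hn.
    have Ut : U (t *: v + x).
      by have [Ut0 _] := He t 0 te z0; move: Ut0; rewrite /= scale0r add0r.
    have Uth : U (t *: v + (h *: w + x)) by have [] := He t h te hn.
    have d1 : is_derive (t *: v + x) v (fun y => f (y + h *: w)) ('D_v f (t *: v + (h *: w + x))).
      have dd : derivable f (t *: v + (h *: w + x)) v by exact: Cn_derivable Cf _ _ Uth.
      have /is_deriveP H := derivableP dd.
      apply/is_deriveP; apply: cvg_trans H; apply: near_eq_cvg; near=> k.
      by rewrite /= -!addrA (addrC x).
    have d2 : is_derive (t *: v + x) v f ('D_v f (t *: v + x)).
      by apply: derivableP; exact: Cn_derivable Cf _ _ Ut.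
    exact: is_deriveB.
  have [|s sh E1] := @mean_value_line R E g x v h.
    by move=> t /dg [].
  exists s => //; have [_ <-] := dg s sh.
  move: E1; rewrite /g => <-.
  by rewrite -!addrA (addrC x); ring.
have [t th E2] : exists2 t : R, `|t| <= `|h| &
    'D_v f (h *: w + (s *: v + x)) - 'D_v f (s *: v + x) = h * 'D_w ('D_v f) (t *: w + (s *: v + x)).
  apply: (@mean_value_line R E ('D_v f) (s *: v + x) w h) => t th.
  have Ut : U (t *: w + (s *: v + x)).
    by rewrite addrCA; have [] := He s t (le_lt_trans sh hn) (le_lt_trans th hn).
  exact: Cn_derivable CD _ _ Ut.
have hh : h * h != 0 by rewrite mulf_neq0// gt_eqF.
have -> : (f (h *: v + (h *: w + x)) - f (h *: v + x) - f (h *: w + x) + f x) / (h * h) =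
    'D_w ('D_v f) (s *: v + (t *: w + x)).
  have -> : f (h *: v + (h *: w + x)) - f (h *: v + x) - f (h *: w + x) + f x =
    (f (h *: v + (h *: w + x)) - f (h *: v + x)) - (f (h *: w + x) - f x) by ring.
  rewrite E1 (addrCA (s *: v)) E2 (addrCA (t *: w)).
  have alg (k A : R) : k * k != 0 -> k * (k * A) / (k * k) = A by move=> kk; rewrite mulrA mulrAC mulfV// mul1r.
  exact: alg hh.
by have [] := He s t (le_lt_trans sh hn) (le_lt_trans th hn).
Unshelve. all: by end_near.
Qed.

Lemma half_dist_absurd (a b c : R) :
  `|c - b| < `|a - b| / 2 -> `|c - a| < `|a - b| / 2 -> False.
Proof. by have := ler_distD c a b; rewrite (distrC a c); lra. Qed.

(** The second difference is symmetric in [v] and [w]. For a common small [h] it would be within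
    half of the supposed gap of both mixed derivatives. *)
Lemma schwarz (E : normedModType R) (U : set E) (f : E -> R^o) x v w :
  open U -> U x -> Cn 2 U f -> 'D_w ('D_v f) x = 'D_v ('D_w f) x.
Proof.
move=> oU Ux Cf; apply: contrapT => /eqP; rewrite -subr_eq0 -normr_gt0 => d0.
set a := 'D_w _ _ in d0 *; set b := 'D_v _ _ in d0 *.
have d2 : 0 < `|a - b| / 2 by rewrite divr_gt0.
have [e1 e10 H1] := second_difference v w oU Ux Cf d2.
have [e2 e20 H2] := second_difference w v oU Ux Cf d2.
pose h := Num.min e1 e2 / 2.
have m1 : Num.min e1 e2 <= e1 by rewrite ge_min lexx.
have m2 : Num.min e1 e2 <= e2 by rewrite ge_min lexx orbT.
have m0 : 0 < Num.min e1 e2 by rewrite lt_min e10.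
have he1 : 0 < h < e1 by rewrite /h; apply/andP; split; lra.
have he2 : 0 < h < e2 by rewrite /h; apply/andP; split; lra.
have := H1 _ he1; have := H2 _ he2; rewrite -/a -/b addrCA.
set X := f (h *: v + (h *: w + x)); set Y := f (h *: v + x); set Z := f (h *: w + x).
have -> : X - Z - Y + f x = X - Y - Z + f x by ring.
set q := _ / _ => qb qa.
exact: (half_dist_absurd qb qa).
Qed.

Lemma zero_derive_near (U : set V2) (f : V2 -> R) x : open U -> U x ->
  (forall y v, U y -> is_derive y v (f : V2 -> R^o) 0) -> \forall y \near x, f y = f x.
Proof.
move=> oU Ux D.
have [e e0 He] : exists2 e : R, 0 < e & forall a b, `|a| < e -> `|b| < e -> U (pt2 x a b).
  have c := @pt2_continuous R x (0, 0).
  have N1 : \forall z \near (0 : R, 0 : R), U (pt2 x z.1 z.2).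
    by apply: (near_image c); rewrite /= pt20; exact: open_nbhs_nbhs.
  have [e e0 He] := near00 N1; exists e => // a b ae be; exact: (He a b).
have cc (i : 'I_2) : {for x, continuous (fun y : V2 => (y - x) 0 i)}.
  have c1 : {for x, continuous (fun y : V2 => y - x)} by apply: (@cvgB R V2 V2 (nbhs x) _ id (cst x) x x); [exact: cvg_id|exact: cvg_cst].
  exact: (continuous_comp c1 (@coord_continuous R 1 2 0 i _)).
have Ni i : \forall y \near x, `|(y - x) 0 i| < e.
  by apply: near_norm_lt; [exact: cc|rewrite subrr mxE normr0].
apply: filterS2 (Ni 0) (Ni 1) => y y0 y1; rewrite (pt2E x y).
set a := (y - x) 0 0 in y0 *; set b := (y - x) 0 1 in y1 *.
have z0 : `|0 : R| < e by rewrite normr0.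
have [|t tb E1] := @mean_value_line R _ f (pt2 x a 0) (delta_mx 0 1) b.
  move=> t tb; have Ut : U (pt2 x a t) by apply: He => //; exact: le_lt_trans tb y1.
  by have [d _] := D _ (delta_mx 0 1) Ut; rewrite /pt2 scale0r add0r.
have [|s sa E2] := @mean_value_line R _ f x (delta_mx 0 0) a.
  move=> r ta; have Ut : U (pt2 x r 0) by apply: He => //; exact: le_lt_trans ta y0.
  by have [d _] := D _ (delta_mx 0 0) Ut; move: d; rewrite /pt2 scale0r add0r.
have Ut : U (pt2 x a t) by apply: He => //; exact: le_lt_trans tb y1.
have Us : U (pt2 x s 0) by apply: He => //; exact: le_lt_trans sa y0.
have [_ D1] := D _ (delta_mx 0 1) Ut; have [_ D2] := D _ (delta_mx 0 0) Us.
move: E1 E2 D1 D2; rewrite /pt2 !scale0r !add0r => E1 E2 D1 D2.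
by move: E1 E2; rewrite D1 D2 !mulr0; lra.
Qed.
End Schwarz.

(** * Smooth bump functions *)

Section Bump.
Context {R : realType}.

(** The derivatives of [exp (- 1 / x)], extended by 0, are linear combinations of these functions;
    smoothness of the whole family reduces to computing one derivative. *)
Definition flat (k : nat) (x : R) : R := if 0 < x then x^-1 ^+ k * expR (- x^-1) else 0.

Lemma flat0 k x : x <= 0 -> flat k x = 0.
Proof. by rewrite /flat leNgt => /negbTE ->. Qed.

Lemma flat_ge0 k x : 0 <= flat k x.
Proof.
rewrite /flat; case: ifP => // x0.
by apply: mulr_ge0; [apply: exprn_ge0; rewrite invr_ge0 ltW|exact: expR_ge0].
Qed.

(** One term of the exponential series gives this quadratic bound, hence a zero derivative at 0. *)
Lemma flat_le k x : flat k x <= (k.+2)`!%:R * x ^+ 2.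
Proof.
have [x0|x0] := ltP 0 x; last by rewrite flat0// mulr_ge0// exprn_even_ge0.
rewrite /flat x0; set y := x^-1.
have y0 : 0 < y by rewrite invr_gt0.
have n0 : 0 < (k.+2)`!%:R :> R by rewrite ltr0n fact_gt0.
have H : y ^+ k.+2 <= (k.+2)`!%:R * expR y.
  have := expR_ge1Dxn k.+1 (ltW y0) => E.
  have : y ^+ k.+2 / (k.+2)`!%:R <= expR y by apply: le_trans E; rewrite lerDr.
  by rewrite ler_pdivrMr// mulrC.
have xE : x = y^-1 by rewrite /y invrK.
clearbody y; rewrite expRN xE exprVn -(ler_pM2r (expR_gt0 y)) mulfVK ?gt_eqF ?expR_gt0//.
rewrite [_ / _ * _]mulrAC -(ler_pM2r (exprn_gt0 2 y0)) mulfVK ?expf_neq0 ?gt_eqF//.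
by rewrite -exprD addn2.
Qed.

Lemma flat_derive k (x : R) : is_derive x 1 (flat k) (- k%:R * flat k.+1 x + flat k.+2 x).
Proof.
have [x0|x0|->] := ltgtP x 0.
- rewrite !flat0 ?ltW// mulr0 addr0.
  have N : \forall y \near x, (cst 0 : R -> R) y = flat k y.
    have P : \forall y \near x, y < 0 by exact: lt_nbhsl.
    by apply: filterS P => y y0; rewrite /= flat0// ltW.
  by apply: near_eq_is_derive N _; exact: is_derive_cst.
- have N : \forall y \near x, ((fun z : R => z^-1) ^+ k * (expR \o (fun z : R => - z^-1))) y = flat k y.
    have P : \forall y \near x, 0 < y by exact: lt_nbhsr.
    by apply: filterS P => y y0; rewrite /flat y0 /= exprfctE.
  have xn : x != 0 by rewrite gt_eqF.
  apply: near_eq_is_derive N _.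
  have dV : is_derive x 1 (fun z : R => z^-1) (- x ^- 2).
    apply: is_derive_eq; first by apply: (is_deriveV (f := id)) => //.
    by rewrite /GRing.scale /= mulr1.
  have dE : is_derive x 1 (expR \o (fun z : R => - z^-1)) (expR (- x^-1) * x ^- 2).
    have d1 : is_derive x 1 (fun z : R => - z^-1) (x ^- 2) by rewrite -[x ^- 2]opprK; apply: is_deriveN.
    exact: (is_derive_comp1 d1 (is_derive_expR _)).
  apply: is_derive_eq.
  rewrite /GRing.scale /= exprfctE /flat x0 /= -exprVn; set y := x^-1; set e := expR _.
  by case: k => [|k]; rewrite ?expr0 /= ?exprS; ring.
- rewrite !flat0// mulr0 addr0; apply/is_deriveP.
  set C : R := (k.+2)`!%:R.
  apply: (@squeeze_cvg0 R _ _ _ (fun h : R => C * h)).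
    near=> h; rewrite addr0 /GRing.scale /= mulr1 (@flat0 k 0)// subr0 !normrM normfV.
    have h0 : 0 < `|h| by rewrite normr_gt0; near: h; exact: nbhs_dnbhs_neq.
    rewrite ler_pdivrMl// (ger0_norm (flat_ge0 _ _)); apply: le_trans (flat_le _ _) _.
    by rewrite -(real_normK (num_real h)) -/C (@ger0_norm _ C) ?ler0n// expr2 mulrCA.
  have c : {for 0, continuous (fun h : R => C * h)} by apply: mulrl_continuous.
  have : C * h @[h --> (0 : R)] --> C * 0 by exact: c.
    by rewrite mulr0 => H A /H nA; apply: (@filterS R (nbhs (0 : R)) _ _ _ _ nA) => t At _.
Unshelve. all: by end_near.
Qed.

Lemma flat_Cn n k : Cn n setT (flat k : R^o -> R^o).
Proof.
elim: n k => [|n IH] k.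
  by split=> // x _; have [d _] := flat_derive k x; exact/differentiable_continuous/derivable1_diffP.
apply: CnI.
- by move=> x _; have [d _] := flat_derive k x; exact/differentiable_continuous/derivable1_diffP.
- by move=> x v _; have [d _] := flat_derive k x; have := derivable_scale v d; rewrite /GRing.scale /= mulr1 => -[].
move=> v; have -> : 'D_v (flat k : R^o -> R^o) = (fun x => v *: ((- k%:R) *: flat k.+1 x + flat k.+2 x)).
  apply/funext => x; have [d D] := flat_derive k x.
  by have := derivable_scale v d; rewrite /GRing.scale /= mulr1 D => -[].
apply: (@CnZ R R^o R^o); first exact: openT.
apply: (@CnD R R^o R^o); [exact: openT| |exact: IH].
by apply: (@CnZ R R^o R^o); [exact: openT|exact: IH].
Qed.

Definition bump (a w x : R) : R := flat 0 (x - a + w) * flat 0 (w - (x - a)).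

Lemma bump_Cn n a w : Cn n setT (bump a w : R^o -> R^o).
Proof.
have oT : open [set: R^o] by exact: openT.
have id1 m : Cn m setT (id : R^o -> R^o).
  case: m => [|m]; first by split=> // x _; exact: cvg_id.
  apply: CnI => [x _|x v _|v]; [exact: cvg_id|exact: derivable_id|].
  by have -> : 'D_v (id : R^o -> R^o) = cst v; [apply/funext => x; rewrite derive_id|exact: Cn_cst].
apply: CnM => //; apply: (Cn_comp1 (V := setT)) => //; try exact: flat_Cn.
  apply: (@CnD R R^o R^o) => //; last exact: Cn_cst.
  by apply: CnB => //; exact: Cn_cst.
apply: CnB => //; first exact: Cn_cst.
by apply: CnB => //; exact: Cn_cst.
Qed.

Lemma bump_out a w x : w <= `|x - a| -> bump a w x = 0.
Proof.
rewrite /bump => H; have [xa|xa] := leP 0 (x - a).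
  by rewrite (@flat0 0 (w - (x - a))) ?mulr0//; rewrite ger0_norm in H; lra.
by rewrite (@flat0 0 (x - a + w)) ?mul0r//; rewrite ltr0_norm in H; lra.
Qed.

Lemma bump_center a w : 0 < w -> bump a w a != 0.
Proof.
by move=> w0; rewrite /bump subrr add0r subr0 mulf_neq0// /flat w0 expr0 mul1r gt_eqF// expR_gt0.
Qed.
End Bump.

(** * Flow boxes of closed forms in the plane *)

Section PlaneCalculus.
Context {R : realType}.
Implicit Types (f g : R -> R) (a b x y : R).

Lemma mean_value1 f (f' : R -> R) x h :
  (forall t, `|t| <= `|h| -> is_derive (t + x) 1 f (f' (t + x))) ->
  exists2 t, `|t| <= `|h| & f (h + x) - f x = h * f' (t + x).
Proof.
move=> D; have [|t th E] := @mean_value_line R R^o f x 1 h.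
  by move=> t /D; rewrite /GRing.scale /= mulr1 => -[].
exists t => //; have [_ <-] := D _ th.
by move: E; rewrite /GRing.scale /= !mulr1.
Qed.

Lemma is_derive1_continuous f x l : is_derive x 1 f l -> {for x, continuous f}.
Proof. by move=> [d _]; exact/differentiable_continuous/derivable1_diffP. Qed.

Lemma constant_derive1 f x e l : (forall t, `|t| < e -> is_derive (t + x) 1 f l) ->
  forall h, `|h| < e -> f (h + x) - f x = h * l.
Proof.
move=> D h he; have [|t _ ->] // := @mean_value1 f (cst l) x h.
by move=> t th; apply: D; exact: le_lt_trans he.
Qed.

(** Continuity along a compact segment is uniform in the transverse variable; this replaces
    differentiation under the integral below. *)
Lemma tube_uniform (f : R * R -> R) (B y0 d : R) : 0 < d ->
  (forall t : R, `|t| <= B -> {for (t, y0), continuous f}) ->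
  \forall y \near y0, forall t, `|t| <= B -> `|f (t, y) - f (t, y0)| < d.
Proof.
move=> d0 cf.
pose P (y t : R) : Prop := `|f (t, y) - f (t, y0)| < d.
have : \forall y \near y0, `[- B, B]%classic `<=` P y.
  apply: ((compact_near_coveringP _).1 (@segment_compact R (- B) B) R (nbhs y0) P).
  move=> t; rewrite /= in_itv /= -ler_norml => tB.
  have d2 : 0 < d / 2 by rewrite divr_gt0.
  have N1 : \forall z \near (t, y0), `|f z - f (t, y0)| < d / 2.
    apply: near_norm_lt; last by rewrite subrr normr0.
    by apply: cvgB; [exact: cf|exact: cvg_cst].
  have N2 : \forall t' \near t, `|f (t', y0) - f (t, y0)| < d / 2.
    have c : {for t, continuous (fun t' : R => (t', y0))}.
      by apply: continuous_pair_for; [exact: cvg_id|exact: cvg_cst].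
    exact: (near_image c N1).
  move: N1 => [[U V] /= [nU nV] sUV]; exists ([set t' | U t' /\ `|f (t', y0) - f (t, y0)| < d / 2], V).
    by split => //=; exact: filterI.
  move=> [t' y] [/= [Ut' H] Vy]; have /= := sUV (t', y) (conj Ut' Vy).
  rewrite /P distrC in H *; have := ler_distD (f (t, y0)) (f (t', y)) (f (t', y0)); lra.
by apply: filterS => y H t tB; apply: (H t); rewrite /= in_itv /= -ler_norml.
Qed.

Lemma antiderivative f B : 0 < B -> continuous f ->
  exists2 P : R -> R, P 0 = 0 & forall x, `|x| < B -> is_derive x 1 P (f x).
Proof.
move=> B0 cf.
(* Integrating from [- B] lets the fundamental theorem apply at negative [x] too; the value at 0 is
   subtracted afterwards. *)
pose I x := (\int[@lebesgue_measure R]_(t in `[- B, x]) f t)%R.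
exists (fun x => I x - I 0); first by rewrite subrr.
move=> x; rewrite ltr_norml => /andP[x1 x2].
have int : (@lebesgue_measure R).-integrable `[- B, B] (EFin \o f).
  by apply: continuous_compact_integrable; [exact: segment_compact|exact: continuous_subspaceT].
have [d D] := @continuous_FTC1 R f (BLeft (- B)) x B x2 int x1 (cf x).
have dI : is_derive x 1 I (f x) by rewrite -D derive1E; exact: derivableP.
by rewrite -[f x]subr0; apply: is_deriveB.
Qed.

(** Clamping both arguments makes the integrand continuous on the whole plane and leaves it
    unchanged on the half-size square. Joint continuity follows from [tube_uniform]. *)
Lemma param_primitive (f : R * R -> R) (B : R) : 0 < B ->
  (forall x y : R, `|x| < B -> `|y| < B -> {for (x, y), continuous f}) ->
  exists P : R -> R -> R, forall x y, `|x| < B / 2 -> `|y| < B / 2 ->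
    [/\ P 0 y = 0, is_derive x 1 (P^~ y) (f (x, y)) &
      {for (x, y), continuous (fun z : R * R => P z.1 z.2)}].
Proof.
move=> B0 cf; pose k := clamp (- (B / 2)) (B / 2).
have B2 : 0 < B / 2 by rewrite divr_gt0.
have kB t : `|k t| < B.
  have := @clamp_itv R (- (B / 2)) (B / 2) t; rewrite -ler_norml -/(k t) => H.
  by apply: le_lt_trans (H _) _; lra.
have ck (U : topologicalType) (u : U) (t : U -> R) : {for u, continuous t} -> {for u, continuous (fun v => k (t v))}.
  by move=> ct; apply: clamp_continuous_for => //; exact: cvg_cst.
have kid t : `|t| < B / 2 -> k t = t.
  by rewrite ltr_norml => /andP[? ?]; apply: clamp_id; rewrite !ltW.
pose h z := f (k z.1, k z.2).
have ch : continuous h.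
  move=> z; apply: (continuous_comp (f := fun z : R * R => (k z.1, k z.2)) (g := f)); last exact: cf.
  by apply: continuous_pair_for; apply: ck; [exact: cvg_fst|exact: cvg_snd].
have ch1 y : continuous (fun x => h (x, y)).
  move=> x; apply: (continuous_comp (f := fun x => (x, y)) (g := h)); last exact: ch.
  by apply: continuous_pair_for; [exact: cvg_id|exact: cvg_cst].
have ex y : exists P : R -> R, P 0 = 0 /\ forall x, `|x| < B / 2 -> is_derive x 1 P (h (x, y)).
  by have [P P0 DP] := antiderivative B2 (ch1 y); exists P.
have [Q HQ] := choice ex.
exists (fun x y => Q y x) => x y xB yB; have [Q0 DQ] := HQ y; split=> //.
  by have := DQ x xB; rewrite /h /= !kid.
rewrite /prop_for /continuous_at /=; apply/cvgrPdist_lt => d d0.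
have d2 : 0 < d / 2 by rewrite divr_gt0.
have c1 : {for x, continuous (Q y)} by exact: is_derive1_continuous (DQ x xB).
have N1 : \forall x' \near x, `|Q y x' - Q y x| < d / 2.
  apply: near_norm_lt; last by rewrite subrr normr0.
  by apply: cvgB; [exact: c1|exact: cvg_cst].
have e0 : 0 < d / 2 / B by rewrite divr_gt0.
have N2 := tube_uniform (B := B) e0 (fun t _ => ch (t, y)).
have N3 : \forall x' \near x, `|x'| < B / 2.
  by apply: near_norm_lt => //; exact: cvg_id.
exists ([set x' | `|Q y x' - Q y x| < d / 2 /\ `|x'| < B / 2],
  [set y' | forall t, `|t| <= B -> `|h (t, y') - h (t, y)| < d / 2 / B]).
  by split => //=; exact: filterI.
move=> [x' y'] [/= [H1 x'B] H2].
have [t tx E] : exists2 t, `|t| <= `|x'| & Q y' x' - Q y x' = x' * (h (t, y') - h (t, y)).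
  have [|t tx] := @mean_value1 (fun x => Q y' x - Q y x) (fun t => h (t, y') - h (t, y)) 0 x'.
    move=> t tx; rewrite !addr0; have tB : `|t| < B / 2 by apply: le_lt_trans x'B.
    by apply: is_deriveB; [exact: (HQ y').2|exact: DQ].
  by rewrite !addr0 (HQ y').1 Q0 subrr subr0 => ?; exists t.
have tB : `|t| <= B by apply: le_trans tx _; lra.
have E1 : `|Q y' x' - Q y x'| <= d / 2.
  rewrite E normrM; have -> : d / 2 = B * (d / 2 / B) by rewrite [RHS]mulrC divfK// gt_eqF.
  by apply: ler_pM => //; [lra|exact/ltW/H2].
rewrite distrC; have := ler_distD (Q y x') (Q y' x') (Q y x); lra.
Qed.

Section ClosedForm.
Variables (a b c : R * R -> R) (B : R).
Hypothesis B0 : 0 < B.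
Hypothesis ca : forall x y, `|x| < B -> `|y| < B -> {for (x, y), continuous a}.
Hypothesis cb : forall x y, `|x| < B -> `|y| < B -> {for (x, y), continuous b}.
Hypothesis cc : forall x y, `|x| < B -> `|y| < B -> {for (x, y), continuous c}.
Hypothesis da : forall x y, `|x| < B -> `|y| < B -> is_derive y 1 (fun y => a (x, y)) (c (x, y)).
Hypothesis db : forall x y, `|x| < B -> `|y| < B -> is_derive x 1 (fun x => b (x, y)) (c (x, y)).

Lemma continuous_swap (f : R * R -> R) x y : {for (x, y), continuous f} ->
  {for (y, x), continuous (fun z => f (z.2, z.1))}.
Proof.
move=> cf; apply: (continuous_comp (f := fun z : R * R => (z.2, z.1)) (g := f)); last exact: cf.
by apply: continuous_pair_for; [exact: cvg_snd|exact: cvg_fst].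
Qed.

Lemma closed_primitive : exists F : R * R -> R, F (0, 0) = 0 /\
  forall x y, `|x| < B / 2 -> `|y| < B / 2 ->
  [/\ is_derive x 1 (fun x => F (x, y)) (a (x, y)),
      is_derive y 1 (fun y => F (x, y)) (b (x, y)) & {for (x, y), continuous F}].
Proof.
have z0 : `|0 : R| < B by rewrite normr0.
have [P HP] := param_primitive B0 (fun x y xB yB => continuous_swap (cb yB xB)).
have [A HA] := param_primitive (f := fun z => a (z.1, 0)) B0
  (fun x y xB yB => continuous_comp (f := fun z : R * R => (z.1, 0)) (g := a) (x := (x, y))
     (continuous_pair_for (cvg_fst : {for (x, y), continuous fst}) (@cvg_cst _ _ _ _ _)) (ca xB z0)).
have h0 : `|0 : R| < B / 2 by rewrite normr0 divr_gt0.
have lB (t : R) : `|t| < B / 2 -> `|t| < B.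
  by move=> H; apply: lt_trans H _; rewrite ltr_pdivrMr// mulr_natr mulr2n ltrDl.
(* The integral along the axis, then vertically. The derivative in [y] is immediate. For the one in
   [x], a mean value in [y] leaves an increment of [b] in [x], which a second mean value turns into
   [h] times a value of [c]. *)
pose F z := A z.1 0 + P z.2 z.1.
exists F; split.
  by have [A0 _ _] := HA 0 0 h0 h0; have [P0 _ _] := HP 0 0 h0 h0; rewrite /F A0 P0 addr0.
move=> x y xB yB; split.
- apply/is_deriveP; apply/cvgrPdist_lt => d d0.
  have e0 : 0 < d / 2 / B by rewrite divr_gt0 ?divr_gt0.
  have yB' (t : R) : `|t| <= `|y| -> `|t| < B / 2 by move=> ty; apply: le_lt_trans yB.
  have N1 := tube_uniform (B := `|y|) e0 (fun t ty => continuous_swap (cc (lB _ xB) (lB _ (yB' _ ty)))).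
  have N2 : \forall x' \near x, `|x'| < B / 2 by apply: near_norm_lt => //; exact: cvg_id.
  have [r /= r0 Hr] := filterI N1 N2.
  have [_ /is_deriveP dA _] := HA x 0 xB h0; move/cvgrPdist_lt: dA => /(_ (d / 2)) dA.
  have d2 : 0 < d / 2 by rewrite divr_gt0.
  have N3 : \forall h \near (0 : R)^', `|h| < r.
    by apply: (@filterS R (nbhs (0 : R)) _ _ _ _ (near_small r0)) => h ? _.
  near=> h.
  have hr : `|h| < r by near: h.
  have hn : h != 0 by near: h; exact: nbhs_dnbhs_neq.
  have Hh (k : R) : `|k| <= `|h| -> (forall t, `|t| <= `|y| -> `|c (k + x, t) - c (x, t)| < d / 2 / B) /\ `|k + x| < B / 2.
    by move=> kh; apply: Hr; rewrite /= opprD addrCA subrr addr0 normrN; exact: le_lt_trans hr.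
  have xhB := (Hh h (lexx _)).2.
  have [|t ty E] := @mean_value1 (fun y => P y (h + x) - P y x - h * a (x, y))
      (fun t => b (h + x, t) - b (x, t) - h * c (x, t)) 0 y.
    move=> t ty; rewrite !addr0; have tB := yB' _ ty.
    have [_ D1 _] := HP t (h + x) tB xhB; have [_ D2 _] := HP t x tB xB.
    apply: is_deriveB; first by apply: is_deriveB.
    by have := da (lB _ xB) (lB _ tB) => D3; exact: (is_deriveZ h D3).
  have tB := yB' _ ty.
  have [|s sh E2] := @mean_value1 (fun x => b (x, t)) (fun x => c (x, t)) x h.
    by move=> s /Hh[_ sB]; exact: db (lB _ sB) (lB _ tB).
  move: E; rewrite !addr0 E2; have [-> _ _] := HP 0 (h + x) h0 xhB; have [-> _ _] := HP 0 x h0 xB.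
  rewrite !sub0r => E.
  have [Hc _] := Hh _ sh; have Hc' := Hc t ty.
  have EF : h^-1 *: (F (h *: 1 + x, y) - F (x, y)) - a (x, y) =
     (h^-1 *: (A (h *: 1 + x) 0 - A x 0) - a (x, 0)) + y * (c (s + x, t) - c (x, t)).
    rewrite /F /GRing.scale /= !mulr1.
    have -> : P y (h + x) = P y x + h * a (x, y) - h * a (x, 0) + h * (y * (c (s + x, t) - c (x, t))).
      by move: E; lra.
    by field.
  rewrite distrC EF.
  have N4 : `|h^-1 *: (A (h *: 1 + x) 0 - A x 0) - a (x, 0)| < d / 2.
    by rewrite distrC; near: h; exact: dA.
  have N5 : `|y * (c (s + x, t) - c (x, t))| <= d / 2.
    rewrite normrM; have -> : d / 2 = B * (d / 2 / B) by rewrite [RHS]mulrC divfK// gt_eqF.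
    by apply: ler_pM => //; [exact: ltW (lB _ yB)|exact: ltW].
  by apply: le_lt_trans (ler_normD _ _) _; lra.
- have [_ D _] := HP y x yB xB; rewrite -[b _]add0r.
  exact: (is_deriveD (is_derive_cst (A x 0 : R^o) (y : R^o) (1 : R^o)) D).
have [_ _ c1] := HA x 0 xB h0; have [_ _ c2] := HP y x yB xB.
apply: cvgD; last exact: continuous_swap c2.
apply: (continuous_comp (f := fun z : R * R => (z.1, 0)) (g := fun z : R * R => A z.1 z.2)); last exact: c1.
by apply: continuous_pair_for; [exact: cvg_fst|exact: cvg_cst].
Unshelve. all: by end_near.
Qed.
End ClosedForm.
End PlaneCalculus.

(** * Inverses of monotone families of functions *)

Section MonotoneFamily.
Context {R : realType}.
Variables (H : R * R -> R) (D : R * R -> R) (B m : R).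
Hypothesis B0 : 0 < B.
Hypothesis m0 : 0 < m.
Hypothesis cH : forall x y : R, `|x| < B -> `|y| < B -> {for (x, y), continuous H}.
Hypothesis dH : forall x y : R, `|x| < B -> `|y| < B -> is_derive x 1 (fun x => H (x, y)) (D (x, y)).
Hypothesis mD : forall x y : R, `|x| < B -> `|y| < B -> m <= D (x, y).

Lemma family_slope x x' y : `|x| < B -> `|x'| < B -> `|y| < B -> x <= x' ->
  m * (x' - x) <= H (x', y) - H (x, y).
Proof.
rewrite le_eqVlt => xB x'B yB /orP[/eqP->|xx']; first by rewrite !subrr mulr0.
have inB t : x <= t <= x' -> `|t| < B.
  by move=> /andP[? ?]; move: xB x'B; rewrite !ltr_norml => /andP[? ?] /andP[? ?]; apply/andP; split; lra.
have [||c cI ->] := @MVT R (fun x => H (x, y)) (fun x => D (x, y)) x x' xx'.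
- by move=> t /itvP tI; apply: dH => //; apply: inB; rewrite !tI.
- apply: derivable_within_continuous => t; rewrite in_itv /= => tI.
  by have [] := dH (inB t tI) yB.
rewrite ler_pM2r ?subr_gt0//; apply: mD => //; apply: inB.
by move: cI; rewrite in_itv /= => /andP[? ?]; rewrite !ltW.
Qed.

Lemma family_lt x x' y : `|x| < B -> `|x'| < B -> `|y| < B -> x < x' -> H (x, y) < H (x', y).
Proof.
move=> xB x'B yB xx'; rewrite -subr_gt0; apply: lt_le_trans (family_slope xB x'B yB (ltW xx')).
by rewrite mulr_gt0// subr_gt0.
Qed.

Lemma family_inj x x' y : `|x| < B -> `|x'| < B -> `|y| < B -> H (x, y) = H (x', y) -> x = x'.
Proof.
move=> xB x'B yB E; apply/eqP; rewrite eq_le !leNgt; apply/andP; split; apply/negP => lt.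
  by have := family_lt x'B xB yB lt; rewrite E ltxx.
by have := family_lt xB x'B yB lt; rewrite E ltxx.
Qed.

Lemma family_continuous_y x y : `|x| < B -> `|y| < B -> {for y, continuous (fun y => H (x, y))}.
Proof.
move=> xB yB; apply: (continuous_comp (f := fun y => (x, y)) (g := H)); last exact: cH.
by apply: continuous_pair_for; [exact: cvg_cst|exact: cvg_id].
Qed.

Lemma family_inverse : H (0, 0) = 0 -> exists rho, [/\ 0 < rho, rho <= B & exists k : R * R -> R,
  forall z y : R, `|z| < rho -> `|y| < rho ->
  [/\ `|k (z, y)| < B, H (k (z, y), y) = z, {for (z, y), continuous k} &
    is_derive z 1 (fun z => k (z, y)) (D (k (z, y), y))^-1]].
Proof.
move=> H0; have B0' : 0 < B := B0; have m0' : 0 < m := m0; have z0 : `|0 : R| < B by rewrite normr0.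
have mB : 0 < m * B / 4 by rewrite !mulr_gt0.
have BB : `|B / 2| < B by rewrite gtr0_norm; lra.
have BBN : `|- (B / 2)| < B by rewrite normrN.
have [d /= d0 Hd] : \forall y \near (0 : R), `|H (0, y)| < m * B / 4.
  by apply: near_norm_lt; [exact: family_continuous_y|rewrite H0 normr0].
(* From 0 to either end [B / 2], [- B / 2] the function varies by at least [m B / 2]: one half of
   this absorbs its value at 0, the other half the target [z]. *)
pose rho := Num.min (Num.min d B) (m * B / 4).
have r1 : rho <= d by rewrite /rho !ge_min lexx.
have r2 : rho <= B by rewrite /rho !ge_min lexx orbT.
have r3 : rho <= m * B / 4 by rewrite /rho !ge_min lexx !orbT.
exists rho; split=> //; first by rewrite /rho !lt_min d0 B0 mB.
have bnd z y : `|z| < rho -> `|y| < rho -> `|y| < B /\ H (- (B / 2), y) < z < H (B / 2, y).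
  move=> zr yr; have yB : `|y| < B by apply: lt_le_trans r2.
  split=> //; have /= := Hd y; rewrite sub0r normrN => /(_ (lt_le_trans yr r1)).
  have B2 : 0 <= B / 2 by lra.
  have B2' : - (B / 2) <= 0 by lra.
  have := family_slope z0 BB yB B2; have := family_slope BBN z0 yB B2'.
  have := lt_le_trans zr r3; rewrite !ltr_norml subr0 sub0r opprK => /andP[? ?] ? ? /andP[? ?].
  by apply/andP; split; lra.
have ex (w : R * R) : exists x, `|w.1| < rho -> `|w.2| < rho -> `|x| < B /\ H (x, w.2) = w.1.
  have [[w1 w2]|nw] := pselect (`|w.1| < rho /\ `|w.2| < rho); last by exists 0 => ? ?; case: nw.
  have [yB /andP[lo hi]] := bnd _ _ w1 w2.
  have [|||x xI E] := @IVT R (fun x => H (x, w.2)) (- (B / 2)) (B / 2) w.1.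
  - lra.
  - apply: derivable_within_continuous => t; rewrite in_itv /= => /andP[t1 t2].
    by have [] // := @dH t w.2 _ yB; rewrite ltr_norml; apply/andP; split; lra.
  - by rewrite ge_min le_max (ltW lo) (ltW hi) orbT.
  exists x => _ _; split=> //; move: xI; rewrite in_itv /= => /andP[? ?].
  by rewrite ltr_norml; apply/andP; split; lra.
have [k Hk] := choice ex; exists k => z y zr yr.
have [/= kB kE] := Hk (z, y) zr yr; have [yB _] := bnd _ _ zr yr.
have nr (u : R) : `|u| < rho -> \forall u' \near u, `|u'| < rho.
  by move=> ur; apply: near_norm_lt => //; exact: cvg_id.
have ck : {for (z, y), continuous k}.
  set x := k (z, y) in kB kE *; suff key (e : R) : 0 < e -> \forall w \near (z, y), `|x - k w| < e.
    by rewrite /prop_for /continuous_at; apply/cvgrPdist_lt => e e0; exact: key.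
  move=> e0.
  (* Monotonicity traps [k w] between [x - e'] and [x + e'] as soon as the values there enclose
     [w.1]. The choice of [e'] also keeps both abscissas in the domain. *)
  pose e' := Num.min e ((B - `|x|) / 2) / 2.
  have m1 : Num.min e ((B - `|x|) / 2) <= e by rewrite ge_min lexx.
  have m2 : Num.min e ((B - `|x|) / 2) <= (B - `|x|) / 2 by rewrite ge_min lexx orbT.
  have m3 : 0 < Num.min e ((B - `|x|) / 2) by rewrite lt_min e0 divr_gt0// subr_gt0.
  have e'0 : 0 < e' by rewrite divr_gt0.
  have e'e : e' < e by rewrite /e'; lra.
  have e'x : e' + `|x| < B by rewrite /e'; lra.
  have x1B : `|x - e'| < B by apply: le_lt_trans (ler_normB _ _) _; rewrite (gtr0_norm e'0) addrC.
  have x2B : `|x + e'| < B by apply: le_lt_trans (ler_normD _ _) _; rewrite (gtr0_norm e'0) addrC.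
  have lo : H (x - e', y) < z by rewrite -[z]kE; apply: family_lt => //; lra.
  have hi : z < H (x + e', y) by rewrite -[z]kE; apply: family_lt => //; lra.
  have c1 (u : R) : `|u| < B -> {for (z, y), continuous (fun w : R * R => H (u, w.2))}.
    move=> uB; apply: (continuous_comp (f := fun w : R * R => (u, w.2)) (g := H)); last exact: cH.
    by apply: continuous_pair_for; [exact: cvg_cst|exact: cvg_snd].
  have c2 : {for (z, y), continuous (fun w : R * R => w.1)} by exact: cvg_fst.
  have c3 : {for (z, y), continuous (fun w : R * R => w.2)} by exact: cvg_snd.
  have N1 : \forall w \near (z, y), 0 < w.1 - H (x - e', w.2).
    apply: (near_image (f := fun w : R * R => w.1 - H (x - e', w.2)) (P := fun v => 0 < v)).
      exact: (cvgB c2 (c1 _ x1B)).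
    by apply: lt_nbhsr; rewrite subr_gt0.
  have N2 : \forall w \near (z, y), 0 < H (x + e', w.2) - w.1.
    apply: (near_image (f := fun w : R * R => H (x + e', w.2) - w.1) (P := fun v => 0 < v)).
      exact: (cvgB (c1 _ x2B) c2).
    by apply: lt_nbhsr; rewrite subr_gt0.
  have N3 : \forall w \near (z, y), `|w.1| < rho.
    exact: (near_image (P := fun v => `|v| < rho) c2 (nr _ zr)).
  have N4 : \forall w \near (z, y), `|w.2| < rho.
    exact: (near_image (P := fun v => `|v| < rho) c3 (nr _ yr)).
  near=> w.
  have w1 : 0 < w.1 - H (x - e', w.2) by near: w.
  have w2 : 0 < H (x + e', w.2) - w.1 by near: w.
  have w3 : `|w.1| < rho by near: w.
  have w4 : `|w.2| < rho by near: w.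
  have [wB wE] := Hk w w3 w4.
  have w4B : `|w.2| < B by apply: lt_le_trans r2.
  have k1 : x - e' < k w.
    rewrite ltNge; apply/negP => le; have := family_slope wB x1B w4B le.
    rewrite wE => H1; have : 0 <= m * (x - e' - k w) by rewrite mulr_ge0 ?subr_ge0// ltW.
    by move: H1 w1; clear; lra.
  have k2 : k w < x + e'.
    rewrite ltNge; apply/negP => le; have := family_slope x2B wB w4B le.
    rewrite wE => H1; have : 0 <= m * (k w - (x + e')) by rewrite mulr_ge0 ?subr_ge0// ltW.
    by move: H1 w2; clear; lra.
  by apply: lt_trans e'e; rewrite distrC ltr_distl k1 k2.
split=> //.
have DE : D (k (z, y), y) != 0 by rewrite gt_eqF//; apply: lt_le_trans m0 (mD kB yB).
have nB (x : R) : `|x| < B -> \forall x' \near x, `|x'| < B.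
  by move=> xB; apply: near_norm_lt => //; exact: cvg_id.
have dk := dH kB yB.
have := @is_derive_inverse R (fun x => H (x, y)) (fun z => k (z, y)) (D (k (z, y), y)) (k (z, y)).
rewrite kE; apply=> //.
- have c := is_derive1_continuous dk.
  have N1 : \forall x \near k (z, y), `|H (x, y)| < rho.
    by apply: near_norm_lt => //; rewrite kE.
  apply: filterS2 N1 (nB _ kB) => x xr xB.
  by have [kB' kE'] := Hk (H (x, y), y) xr yr; exact: family_inj kB' xB yB kE'.
by apply: filterS (nB _ kB) => x xB; exact: is_derive1_continuous (dH xB yB).
Unshelve. all: by end_near.
Qed.
End MonotoneFamily.

(** * Straightening along the levels of a primitive *)

Section FlowBox.
Context {R : realType}.

Lemma near_pt (P : R * R -> Prop) (x y : R) : (\forall z \near (x, y), P z) ->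
  exists2 e : R, 0 < e & forall u v : R, `|u - x| < e -> `|v - y| < e -> P (u, v).
Proof.
move=> [[U V] /= [[d1 /= d10 H1] [d2 /= d20 H2]] sUV].
exists (Num.min d1 d2); first by rewrite lt_min d10.
move=> u v; rewrite !lt_min => /andP[u1 _] /andP[_ v2].
by apply: (sUV (u, v)); split; [apply: H1|apply: H2]; rewrite /= distrC.
Qed.

Lemma near_dist (T : topologicalType) (f : T -> R) (x : T) (d : R) : 0 < d ->
  {for x, continuous f} -> \forall y \near x, `|f y - f x| < d.
Proof.
move=> d0 cf; apply: near_norm_lt; last by rewrite subrr normr0.
by apply: cvgB; [exact: cf|exact: cvg_cst].
Qed.

(** The increment of [F] is split along a horizontal leg and a vertical one, with a mean value on
    each; continuity of [phi] makes the intermediate points converge to the base point. *)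
Lemma implicit_derive (F a b : R * R -> R) (phi : R -> R) (x0 B h : R) :
  (forall x y : R, `|x| < B -> `|y| < B -> is_derive x 1 (fun x => F (x, y)) (a (x, y))) ->
  (forall x y : R, `|x| < B -> `|y| < B -> is_derive y 1 (fun y => F (x, y)) (b (x, y))) ->
  {for (x0, phi x0), continuous a} -> {for (x0, phi x0), continuous b} ->
  b (x0, phi x0) != 0 -> `|x0| < B -> `|phi x0| < B -> {for x0, continuous phi} ->
  (\forall x \near x0, F (x, phi x) = h) ->
  is_derive x0 1 phi (- a (x0, phi x0) / b (x0, phi x0)).
Proof.
set y0 := phi x0 => dFa dFb ca cb b0 x0B y0B cphi Fh; set a0 := a (x0, y0); set b0' := b (x0, y0) in b0 *.
apply/is_deriveP; apply/cvgrPdist_lt => d d0.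
have cq : {for (a0, b0'), continuous (fun z : R * R => - z.1 / z.2)}.
  apply: cvgM; first by apply: cvgN; exact: cvg_fst.
  by apply: cvgV => //; exact: cvg_snd.
have [d1 d10 H1] : exists2 e : R, 0 < e & forall u v : R, `|u - a0| < e -> `|v - b0'| < e ->
    `|- u / v - (- a0 / b0')| < d /\ v != 0.
  apply: (@near_pt (fun z => `|- z.1 / z.2 - (- a0 / b0')| < d /\ z.2 != 0)); apply: filterI.
    exact: (near_dist d0 cq).
  apply: (near_image (f := fun z : R * R => z.2) (P := fun v => v != 0)); first exact: cvg_snd.
  have bp : 0 < `|b0'| by rewrite normr_gt0.
  have N := near_dist (x := b0') (f := id) bp cvg_id.
  by apply: filterS N => v; apply: contraTneq => /= ->; rewrite sub0r normrN ltxx.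
have near_f (f : R * R -> R) : {for (x0, y0), continuous f} -> exists2 e : R, 0 < e &
    forall u v : R, `|u - x0| < e -> `|v - y0| < e -> `|f (u, v) - f (x0, y0)| < d1.
  move=> cf; apply: (@near_pt (fun z => `|f z - f (x0, y0)| < d1)).
  apply: near_norm_lt; last by rewrite subrr normr0.
  by apply: cvgB; [exact: cf|exact: cvg_cst].
have [d2 d20 H2] := near_f a ca; have [d3 d30 H3] := near_f b cb.
pose e := Num.min (Num.min d2 d3) (Num.min ((B - `|x0|)) ((B - `|y0|))).
have e2 : e <= d2 by rewrite /e !ge_min lexx.
have e3 : e <= d3 by rewrite /e !ge_min lexx orbT.
have ex : e <= B - `|x0| by rewrite /e !ge_min lexx !orbT.
have ey : e <= B - `|y0| by rewrite /e !ge_min lexx !orbT.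
have e0 : 0 < e by rewrite /e !lt_min d20 d30 !subr_gt0 x0B.
have inB (u z : R) : `|z| < B -> e <= B - `|z| -> `|u - z| < e -> `|u| < B.
  move=> zB ez uz; rewrite -[u](subrK z); apply: le_lt_trans (ler_normD _ _) _; lra.
have N1 : \forall x \near x0, `|phi x - y0| < e.
  apply: near_norm_lt; last by rewrite subrr normr0.
  by apply: cvgB; [exact: cphi|exact: cvg_cst].
have N2 : \forall x \near x0, `|x - x0| < e.
  apply: near_norm_lt; last by rewrite subrr normr0.
  by apply: cvgB; [exact: cvg_id|exact: cvg_cst].
have [r /= r0 Hr] := filterI (filterI N1 N2) Fh.
have N3 : \forall k \near (0 : R)^', `|k| < r.
  by apply: (@filterS R (nbhs (0 : R)) _ _ _ _ (near_small r0)) => k ? _.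
near=> k.
have kr : `|k| < r by near: k.
have kn : k != 0 by near: k; exact: nbhs_dnbhs_neq.
rewrite /GRing.scale /= mulr1.
have [[pk xk] Fk] : (`|phi (k + x0) - y0| < e /\ `|k + x0 - x0| < e) /\ F (k + x0, phi (k + x0)) = h.
  by apply: Hr; rewrite /= opprD addrCA subrr addr0 normrN.
have kB := inB _ _ x0B ex xk; have pB := inB _ _ y0B ey pk.
move: xk; rewrite addrK => ke.
set p := phi (k + x0) in pk Fk pB *.
have [|t tk E1] := @mean_value1 R (fun x => F (x, p)) (fun x => a (x, p)) x0 k.
  by move=> t tk; apply: dFa => //; apply: (inB _ x0) => //; rewrite addrK; exact: le_lt_trans ke.
have [|s sk E2] := @mean_value1 R (fun y => F (x0, y)) (fun y => b (x0, y)) y0 (p - y0).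
  by move=> s sk; apply: dFb => //; apply: (inB _ y0) => //; rewrite addrK; exact: le_lt_trans pk.
move: E2; rewrite subrK => E2; have F0 := nbhs_singleton Fh.
have pk2 : `|p - y0| < d2 by apply: lt_le_trans e2.
have ta : `|a (t + x0, p) - a0| < d1.
  by apply: H2 => //; rewrite addrK; apply: le_lt_trans tk (lt_le_trans ke e2).
have sb : `|b (x0, s + y0) - b0'| < d1.
  by apply: H3; rewrite ?addrK ?subrr ?normr0//; apply: le_lt_trans sk (lt_le_trans pk e3).
have [H bn] := H1 _ _ ta sb; rewrite distrC.
have -> : k^-1 * (p - y0) = - a (t + x0, p) / b (x0, s + y0); last exact: H.
have : k * a (t + x0, p) + (p - y0) * b (x0, s + y0) = 0.
  by rewrite -E1 -E2 Fk F0; ring.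
move=> E; apply: (mulfI kn); rewrite mulrA mulfV// mul1r; apply: (mulIf bn).
by rewrite -mulrA divfK//; move: E; lra.
Unshelve. all: by end_near.
Qed.

Variables (a b c X1 X2 : R * R -> R) (B m L : R).
Hypothesis B0 : 0 < B.
Hypothesis m0 : 0 < m.
Hypothesis ca : forall x y : R, `|x| < B -> `|y| < B -> {for (x, y), continuous a}.
Hypothesis cb : forall x y : R, `|x| < B -> `|y| < B -> {for (x, y), continuous b}.
Hypothesis cc : forall x y : R, `|x| < B -> `|y| < B -> {for (x, y), continuous c}.
Hypothesis cX : forall x y : R, `|x| < B -> `|y| < B -> {for (x, y), continuous X1}.
Hypothesis da : forall x y : R, `|x| < B -> `|y| < B -> is_derive y 1 (fun y => a (x, y)) (c (x, y)).
Hypothesis db : forall x y : R, `|x| < B -> `|y| < B -> is_derive x 1 (fun x => b (x, y)) (c (x, y)).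
Hypothesis mb : forall x y : R, `|x| < B -> `|y| < B -> m <= b (x, y).
Hypothesis mX : forall x y : R, `|x| < B -> `|y| < B -> m <= X1 (x, y) <= L.
Hypothesis aX : forall x y : R, `|x| < B -> `|y| < B -> a (x, y) * X1 (x, y) + b (x, y) * X2 (x, y) = 0.

(* [F] is a primitive of the closed form [a dx + b dy]; for each value [h] of
   [F], [G (x, h)] is the time needed to reach abscissa [x] along [F = h]. *)
Theorem plane_flow_box : exists (F G k1 k2 : R * R -> R) (r1 r : R),
  [/\ [/\ 0 < r, r <= r1, r1 <= B / 2 & F (0, 0) = 0],
   forall x y : R, `|x| < B / 2 -> `|y| < B / 2 ->
     [/\ is_derive x 1 (fun x => F (x, y)) (a (x, y)),
         is_derive y 1 (fun y => F (x, y)) (b (x, y)) & {for (x, y), continuous F}],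
   forall x h : R, `|x| < r1 -> `|h| < r1 -> G (0, h) = 0 /\ {for (x, h), continuous G},
   forall x y : R, `|x| < r1 -> `|y| < B / 2 -> `|F (x, y)| < r1 ->
     is_derive x 1 (fun u => G (u, F (x, y))) (X1 (x, y))^-1 &
   [/\ forall s h : R, `|s| < r -> `|h| < r ->
     [/\ `|k1 (s, h)| < r1, `|k2 (s, h)| < B / 2, F (k1 (s, h), k2 (s, h)) = h &
         G (k1 (s, h), h) = s] /\
     [/\ {for (s, h), continuous k1}, {for (s, h), continuous k2},
       is_derive s 1 (fun s => k1 (s, h)) (X1 (k1 (s, h), k2 (s, h))) &
       is_derive s 1 (fun s => k2 (s, h)) (X2 (k1 (s, h), k2 (s, h)))],
   forall x y : R, `|x| < r1 -> `|y| < B / 2 -> `|F (x, y)| < r -> `|G (x, F (x, y))| < r ->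
     k1 (G (x, F (x, y)), F (x, y)) = x /\ k2 (G (x, F (x, y)), F (x, y)) = y &
   (forall h : R, `|h| < r -> k1 (0, h) = 0) /\
     k2 (0, 0) = 0 /\ is_derive (0 : R) 1 (fun h => k2 (0, h)) (b (0, 0))^-1]].
Proof.
have B0' : 0 < B := B0; have m0' : 0 < m := m0.
have [F [F0 HF]] := closed_primitive B0 ca cb cc da db.
have B2 : 0 < B / 2 by rewrite divr_gt0.
have lB (t : R) : `|t| < B / 2 -> `|t| < B by move=> H; apply: lt_trans H _; lra.
(* The variables are exchanged so that [eta (h, x)] solves [F (x, y) = h] for [y], which [b >= m]
   permits. *)
pose H (z : R * R) := F (z.2, z.1); pose D (z : R * R) := b (z.2, z.1).
have cH (x y : R) : `|x| < B / 2 -> `|y| < B / 2 -> {for (x, y), continuous H}.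
  by move=> xB yB; apply: continuous_swap; have [] := HF y x yB xB.
have dH (x y : R) : `|x| < B / 2 -> `|y| < B / 2 -> is_derive x 1 (fun x => H (x, y)) (D (x, y)).
  by move=> xB yB; have [_ ? _] := HF y x yB xB.
have mD (x y : R) : `|x| < B / 2 -> `|y| < B / 2 -> m <= D (x, y).
  by move=> /lB ? /lB ?; exact: mb.
have [rho [rho0 rhoB [eta Heta]]] := family_inverse B2 m0 cH dH mD F0.
have injH := family_inj m0 dH mD.
have lr (t : R) : `|t| < rho -> `|t| < B / 2 by move=> ?; exact: lt_le_trans rhoB.
(* Along a level the abscissa moves at speed [X1], so the elapsed time is the integral of its
   inverse. *)
pose f (z : R * R) := (X1 (z.1, eta (z.2, z.1)))^-1.
have X1n (x y : R) : `|x| < B -> `|y| < B -> 0 < X1 (x, y).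
  by move=> xB yB; have /andP[? _] := mX xB yB; exact: lt_le_trans m0 _.
have cf (x y : R) : `|x| < rho -> `|y| < rho -> {for (x, y), continuous f}.
  move=> xr yr; have [eB _ ce _] := Heta y x yr xr.
  have c1 : {for (x, y), continuous (fun z => eta (z.2, z.1))} by exact: continuous_swap.
  have xB := lB _ (lr _ xr); have eB' := lB _ eB.
  apply: cvgV; first by rewrite gt_eqF// X1n.
  apply: (continuous_comp (f := fun z : R * R => (z.1, eta (z.2, z.1))) (g := X1)); last exact: cX.
  by apply: continuous_pair_for; [exact: cvg_fst|exact: c1].
have [P HP] := param_primitive rho0 cf; pose G (z : R * R) := P z.1 z.2.
have rho2 : 0 < rho / 2 by rewrite divr_gt0.
have lr2 (t : R) : `|t| < rho / 2 -> `|t| < rho by move=> Ht; apply: lt_trans Ht _; lra.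
have cG (x y : R) : `|x| < rho / 2 -> `|y| < rho / 2 -> {for (x, y), continuous G}.
  by move=> xr yr; have [_ _ ?] := HP x y xr yr.
have dG (x y : R) : `|x| < rho / 2 -> `|y| < rho / 2 -> is_derive x 1 (fun x => G (x, y)) (f (x, y)).
  by move=> xr yr; have [_ ? _] := HP x y xr yr.
have z0 : `|0 : R| < B by rewrite normr0.
have L0 : 0 < L by have /andP[? ?] := mX z0 z0; lra.
have mf (x y : R) : `|x| < rho / 2 -> `|y| < rho / 2 -> L^-1 <= f (x, y).
  move=> /lr2 xr /lr2 yr; have [/lB eB _ _ _] := Heta y x yr xr.
  rewrite /f /= lef_pV2 ?posrE//; last by apply: X1n => //; exact/lB/lr.
  by have /andP[_ ?] := mX (lB _ (lr _ xr)) eB.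
have iL0 : 0 < L^-1 by rewrite invr_gt0.
have G0 h : `|h| < rho / 2 -> G (0, h) = 0.
  by move=> hr; have [] := HP 0 h _ hr; rewrite ?normr0.
have h0 : `|0 : R| < rho / 2 by rewrite normr0.
have [r [r0 rr [k1 Hk1]]] := family_inverse rho2 iL0 cG dG mf (G0 0 h0).
have injG := family_inj iL0 dG mf.
have lr3 (t : R) : `|t| < r -> `|t| < rho / 2 by move=> ?; exact: lt_le_trans rr.
pose k2 (z : R * R) := eta (z.2, k1 z).
have etaF x y : `|x| < rho -> `|y| < B / 2 -> `|F (x, y)| < rho -> eta (F (x, y), x) = y.
  move=> xr yB Fr; have [eB eE _ _] := Heta (F (x, y)) x Fr xr.
  by apply: injH (lr _ xr) _ => //; rewrite eE.
exists F, G, k1, k2, (rho / 2), r; split=> //.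
- by split=> //; lra.
- by move=> x h xr hr; split; [exact: G0|exact: cG].
- move=> x y xr yB Fr; have := dG x _ xr Fr; rewrite /f /= etaF //; exact: lr2.
have k10 h : `|h| < r -> k1 (0, h) = 0.
  move=> hr; have z0r : `|0 : R| < r by rewrite normr0.
  by have [kB kE _ _] := Hk1 0 h z0r hr; apply: injG kB h0 (lr3 _ hr) _; rewrite kE G0//; exact: lr3.
split.
- move=> s h sr hr; have [kB kE ck dk] := Hk1 s h sr hr.
  have hr' := lr2 _ (lr3 _ hr); have kr' := lr2 _ kB.
  have [eB eE ce de] := Heta h (k1 (s, h)) hr' kr'.
  split; first by split.
  have dk1 : is_derive s 1 (fun s => k1 (s, h)) (X1 (k1 (s, h), k2 (s, h))) by rewrite -[X1 _]invrK; exact: dk.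
  split=> //.
    apply: (continuous_comp (f := fun z : R * R => (z.2, k1 z)) (g := eta)); last exact: ce.
    by apply: continuous_pair_for; [exact: cvg_snd|exact: ck].
  have kB' := lB _ (lr _ kr'); have eB' := lB _ eB.
  have di : is_derive (k1 (s, h)) 1 (fun x => eta (h, x)) (- a (k1 (s, h), eta (h, k1 (s, h))) / b (k1 (s, h), eta (h, k1 (s, h)))).
    apply: (@implicit_derive F a b (fun x => eta (h, x)) _ (B / 2) h) => //.
    - by move=> x y xB yB; have [] := HF x y xB yB.
    - by move=> x y xB yB; have [] := HF x y xB yB.
    - exact: ca.
    - exact: cb.
    - by rewrite gt_eqF//; apply: lt_le_trans m0 (mb kB' eB').
    - exact: lr.
    - apply: (continuous_comp (f := fun x : R => (h, x)) (g := eta)); last exact: ce.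
      by apply: continuous_pair_for; [exact: cvg_cst|exact: cvg_id].
    have N : \forall x \near k1 (s, h), `|x| < rho by apply: near_norm_lt => //; exact: cvg_id.
    by apply: filterS N => x xr; have [] := Heta h x hr' xr.
  have := is_derive_comp1 dk1 di; rewrite -/(k2 (s, h)) => dc.
  have bn : b (k1 (s, h), k2 (s, h)) != 0 by rewrite gt_eqF//; apply: lt_le_trans m0 (mb kB' eB').
  (* The slope [- a / b] of the level is the slope of the field, because the form annihilates the
     field. *)
  have -> : X2 (k1 (s, h), k2 (s, h)) =
     - a (k1 (s, h), k2 (s, h)) / b (k1 (s, h), k2 (s, h)) * X1 (k1 (s, h), k2 (s, h)).
    have E := aX kB' eB'; apply: (mulfI bn); rewrite mulrA mulrCA mulfV// mulr1.
    by move: E; rewrite /k2 /=; lra.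
  exact: dc.
- move=> x y xr yB Fr Gr; have [kB kE _ _] := Hk1 _ _ Gr Fr.
  have E : k1 (G (x, F (x, y)), F (x, y)) = x by apply: injG kB xr (lr3 _ Fr) _; rewrite kE.
  by split=> //; rewrite /k2 /= E etaF//; apply: lr2 => //; exact: lr3.
split=> //.
have z0r : `|0 : R| < rho by rewrite normr0.
have z0B : `|0 : R| < B / 2 by rewrite normr0.
have e0 : eta (0, 0) = 0 by rewrite -[X in eta (X, _)]F0 etaF// F0.
have r00 : `|0 : R| < r by rewrite normr0.
split; first by rewrite /k2 /= k10.
have [_ _ _ de] := Heta 0 0 z0r z0r.
have N : \forall h \near (0 : R), eta (h, 0) = k2 (0, h).
  by apply: filterS (near_small r0) => h hr; rewrite /k2 /= k10.
by apply: near_eq_is_derive N _; move: de; rewrite /D /= e0.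
Qed.
End FlowBox.

(** * Lorentzian geometry in charts *)

Section FrameAlgebra.
Context {R : realType}.
Local Notation V2 := 'rV[R]_2.
Implicit Types (G : 'M[R]_2) (u v w : V2).

Lemma mdotE G v w : mdot G v w =
  v 0 0 * G 0 0 * w 0 0 + v 0 0 * G 0 1 * w 0 1 + v 0 1 * G 1 0 * w 0 0 + v 0 1 * G 1 1 * w 0 1.
Proof.
rewrite /mdot mxE !big_ord_recl big_ord0 !mxE !big_ord_recl !big_ord0.
have -> : lift ord0 ord0 = 1 :> 'I_2 by exact: val_inj.
have -> : ord0 = 0 :> 'I_2 by exact: val_inj.
by ring.
Qed.

Lemma mdotDl G (a b : R) u v w : mdot G (a *: u + b *: v) w = a * mdot G u w + b * mdot G v w.
Proof. by rewrite !mdotE !mxE; ring. Qed.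

Lemma mdotDr G (a b : R) u v w : mdot G w (a *: u + b *: v) = a * mdot G w u + b * mdot G w v.
Proof. by rewrite !mdotE !mxE; ring. Qed.

Lemma mdotC G v w : G^T = G -> mdot G v w = mdot G w v.
Proof.
move=> GT; have E : G 1 0 = G 0 1 by rewrite -[in LHS]GT mxE.
by rewrite !mdotE E; ring.
Qed.

Lemma sum2 (f : 'I_2 -> R) : \sum_i f i = f 0 + f 1.
Proof. by rewrite !big_ord_recl big_ord0 addr0; congr (f _ + f _); exact: val_inj. Qed.

Lemma det2 (A : 'M[R]_2) : \det A = A 0 0 * A 1 1 - A 0 1 * A 1 0.
Proof.
rewrite (expand_det_row _ 0) sum2 /cofactor !det_mx11 !mxE.
have E0 : lift 0 0 = 1 :> 'I_2 by exact: val_inj.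
have E1 : lift 1 0 = 0 :> 'I_2 by exact: val_inj.
by rewrite !E0 !E1 /= expr0 expr1; ring.
Qed.

Lemma det_rows v w : \det (col_mx v w : 'M[R]_2) = v 0 0 * w 0 1 - v 0 1 * w 0 0.
Proof.
have r0 j : (col_mx v w : 'M[R]_2) 0 j = v 0 j.
  have -> : 0 = lshift 1 (0 : 'I_1) :> 'I_2 by exact: val_inj.
  exact: (col_mxEu v w 0 j).
have r1 j : (col_mx v w : 'M[R]_2) 1 j = w 0 j.
  have -> : 1 = rshift 1 (0 : 'I_1) :> 'I_2 by exact: val_inj.
  exact: (col_mxEd v w 0 j).
by rewrite det2 !r0 !r1.
Qed.

Lemma row2P v w : v 0 0 = w 0 0 -> v 0 1 = w 0 1 -> v = w.
Proof. by move=> H0 H1; rewrite (rV2E v) (rV2E w) H0 H1. Qed.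

Lemma det_basis v w u : \det (col_mx v w : 'M[R]_2) != 0 -> exists a b : R, u = a *: v + b *: w.
Proof.
rewrite det_rows => D; set d := _ - _ in D.
exists ((u 0 0 * w 0 1 - u 0 1 * w 0 0) / d), ((v 0 0 * u 0 1 - v 0 1 * u 0 0) / d).
by apply: row2P; rewrite !mxE /d; field.
Qed.

(* A null basis, normalized as [X = s1 + s2], [Y = - s1 + s2]. *)
Record null_basis G (X Y : V2) : Prop := NullBasis {
  nb_sym : G^T = G;
  nb_XX : mdot G X X = 0;
  nb_YY : mdot G Y Y = 0;
  nb_XY : mdot G X Y = 2;
  nb_det : 0 < \det (col_mx X Y : 'M[R]_2) }.

Lemma null_expand G X Y u : null_basis G X Y ->
  u = (2^-1 * mdot G u Y) *: X + (2^-1 * mdot G u X) *: Y.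
Proof.
move=> [sG XX YY XY D]; have [a [b ->]] := det_basis u (lt0r_neq0 D).
have YX : mdot G Y X = 2 by rewrite mdotC.
by rewrite !mdotDl XX YY XY YX !mulr0 addr0 add0r; congr (_ *: _ + _ *: _); lra.
Qed.

Lemma null_basis_neq0 G X Y : null_basis G X Y -> X != 0 /\ Y != 0.
Proof.
move=> nb; have D := nb_det nb; split; apply/eqP => E; move: D; rewrite E det_rows !mxE; lra.
Qed.

Lemma null_eq0 G X Y u : null_basis G X Y -> mdot G u X = 0 -> mdot G u Y = 0 -> u = 0.
Proof. by move=> nb H1 H2; rewrite (null_expand u nb) H1 H2 !mulr0 !scale0r addr0. Qed.

Lemma null_coef G X Y (a b : R) : null_basis G X Y ->
  mdot G (a *: X + b *: Y) X = 2 * b /\ mdot G (a *: X + b *: Y) Y = 2 * a.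
Proof.
move=> [sG XX YY XY _]; have YX : mdot G Y X = 2 by rewrite mdotC.
by rewrite !mdotDl XX YY XY YX; split; ring.
Qed.

Lemma null_norm G X Y (a b : R) : null_basis G X Y ->
  mdot G (a *: X + b *: Y) (a *: X + b *: Y) = 4 * a * b.
Proof.
move=> nb; have [H1 H2] := null_coef a b nb; rewrite mdotDr H1 H2; ring.
Qed.

Lemma det_comb v w (a b c d : R) :
  \det (col_mx (a *: v + b *: w) (c *: v + d *: w) : 'M[R]_2) =
  (a * d - b * c) * \det (col_mx v w : 'M[R]_2).
Proof. by rewrite !det_rows !mxE; ring. Qed.

Lemma null_direction G X Y v : null_basis G X Y ->
  ((v <> 0 /\ mdot G v v = 0) /\ exists w : V2,
     [/\ w <> 0 /\ mdot G w w = 0, 0 < \det (col_mx v w : 'M[R]_2) & 0 < mdot G (v + w) (v + w)]) <->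
  exists2 l : R, l != 0 & v = l *: X.
Proof.
move=> nb; have D := nb_det nb; split; last first.
  move=> [l l0 ->].
  have nX : mdot G X X = 0 := nb_XX nb; have nY : mdot G Y Y = 0 := nb_YY nb.
  have [X0 Y0] := null_basis_neq0 nb.
  have E (c : R) V : mdot G (c *: V) (c *: V) = c * c * mdot G V V by rewrite !mdotE !mxE; ring.
  split; first by rewrite E nX mulr0; split=> //; apply/eqP; rewrite scaler_eq0 negb_or l0.
  exists (l *: Y); split.
  - by rewrite E nY mulr0; split=> //; apply/eqP; rewrite scaler_eq0 negb_or l0.
  - have -> : \det (col_mx (l *: X) (l *: Y) : 'M[R]_2) = l * l * \det (col_mx X Y : 'M[R]_2).
      by rewrite !det_rows !mxE; ring.
    by rewrite mulr_gt0// -expr2 exprn_even_gt0.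
  by rewrite (null_norm l l nb) -mulrA mulr_gt0// -expr2 exprn_even_gt0.
move=> [[v0 vv] [w [[w0 ww] dvw sp]]].
have [a [b Ev]] := det_basis v (lt0r_neq0 D); have [c [d Ew]] := det_basis w (lt0r_neq0 D).
move: vv ww dvw sp; rewrite Ev Ew det_comb !(null_norm _ _ nb).
have -> : a *: X + b *: Y + (c *: X + d *: Y) = (a + c) *: X + (b + d) *: Y.
  by apply: row2P; rewrite !mxE; ring.
rewrite (null_norm _ _ nb) pmulr_lgt0// => /eqP vv /eqP ww dvw sp.
move: vv; rewrite !mulf_eq0 pnatr_eq0 /= => /orP[] /eqP ab.
  move: ww; rewrite !mulf_eq0 pnatr_eq0 /= => /orP[] /eqP cd; move: dvw sp.
    by rewrite ab cd; nra.
  by rewrite ab cd; nra.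
exists a; last by rewrite ab scale0r addr0.
by apply/eqP => a0; apply: v0; rewrite Ev ab a0 !scale0r addr0.
Qed.

(** Orientation makes the determinant 1 and time orientation gives [p > 0], so the change of frame
    is a boost; [l = p + q] is its factor on the first null line. *)
Lemma frame_boost G (s s' : V2 * V2) (T : V2) : G^T = G ->
  [/\ mdot G s.1 s.1 = -1, mdot G s.2 s.2 = 1, mdot G s.1 s.2 = 0 & 0 < \det (col_mx s.1 s.2 : 'M[R]_2)] ->
  [/\ mdot G s'.1 s'.1 = -1, mdot G s'.2 s'.2 = 1, mdot G s'.1 s'.2 = 0 & 0 < \det (col_mx s'.1 s'.2 : 'M[R]_2)] ->
  mdot G T T < 0 -> mdot G s.1 T < 0 -> mdot G s'.1 T < 0 ->
  exists2 l : R, 0 < l & s'.1 + s'.2 = l *: (s.1 + s.2) /\ - s'.1 + s'.2 = l^-1 *: (- s.1 + s.2).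
Proof.
case: s s' => [s1 s2] [s1' s2'] /= sG [n1 n2 n12 D] [m1 m2 m12 D'] TT T1 T1'.
have n21 : mdot G s2 s1 = 0 by rewrite mdotC.
have norm (a b c d : R) : mdot G (a *: s1 + b *: s2) (c *: s1 + d *: s2) = - (a * c) + b * d.
  by rewrite mdotDl !mdotDr n1 n2 n12 n21; ring.
have [p [q E1]] := det_basis s1' (lt0r_neq0 D); have [r [t E2]] := det_basis s2' (lt0r_neq0 D).
have [x [y ET]] := det_basis T (lt0r_neq0 D).
have s1E : s1 = 1 *: s1 + 0 *: s2 by rewrite scale1r scale0r addr0.
move: m1 m2 m12 D' TT T1 T1'; rewrite E1 E2 ET det_comb !norm pmulr_lgt0//.
rewrite {1}s1E norm mul0r addr0 mul1r => m1 m2 m12 D' TT T1 T1'.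
have x0 : 0 < x by lra.
have [d [d0 rE tE]] : exists d : R, [/\ 0 < d, r = q * d & t = p * d].
  exists (p * t - q * r); split=> //.
    have -> : q * (p * t - q * r) = p * (q * t) - q * q * r by ring.
    have -> : q * t = p * r by lra.
    have -> : q * q = p * p - 1 by lra.
    by ring.
  have -> : p * (p * t - q * r) = p * p * t - q * (p * r) by ring.
  have -> : p * r = q * t by lra.
  have -> : p * p = q * q + 1 by lra.
  by ring.
have d1 : d = 1.
  have : d ^+ 2 = 1.
    move: m2; rewrite rE tE => m2; rewrite -m2.
    have -> : - (q * d * (q * d)) + p * d * (p * d) = d ^+ 2 * (p * p - q * q) by ring.
    have -> : p * p - q * q = 1 by lra.
    by rewrite mulr1.
  by move=> /eqP; rewrite sqrf_eq1 => /orP[/eqP//|/eqP dN]; lra.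
move: rE tE; rewrite d1 !mulr1 => -> ->.
(* Reversed Cauchy-Schwarz inequality: with [p <= 0] the vector would not pair negatively with
   [T]. *)
have p0 : 0 < p.
  rewrite ltNge; apply/negP => p0.
  have px : p * x <= 0 by nra.
  have qy : q * y < p * x by lra.
  have H1 : (p * x) ^+ 2 <= (q * y) ^+ 2 by rewrite !expr2; nra.
  have H2 : (q * y) ^+ 2 = q * q * (y * y) by ring.
  have H3 : (p * x) ^+ 2 = p * p * (x * x) by ring.
  have H4 : p * p = 1 + q * q by lra.
  have H5 : 0 <= q * q by nra.
  have H6 : 0 <= y * y by nra.
  move: H1; rewrite H2 H3 H4; nra.
have pq1 : (p + q) * (p - q) = 1.
  have -> : (p + q) * (p - q) = p * p - q * q by ring.
  by lra.
have pq0 : 0 < p + q.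
  rewrite ltNge; apply/negP => le; have : p - q <= 0 by nra.
  by lra.
exists (p + q) => //; split; first by apply: row2P; rewrite !mxE; ring.
have -> : (p + q)^-1 = p - q by apply: (mulfI (lt0r_neq0 pq0)); rewrite mulfV ?pq1// gt_eqF.
by apply: row2P; rewrite !mxE; ring.
Qed.
End FrameAlgebra.

Section RowDerivative.
Context {R : realType} {E : normedModType R}.

Lemma is_derive_coord (f : E -> 'rV[R]_2) x v l i : is_derive x v f l ->
  is_derive x v (fun y => f y 0 i : R^o) (l 0 i).
Proof.
move=> /is_deriveP D; apply/is_deriveP.
have c := cvg_comp _ (fun M : 'rV[R]_2 => M 0 i) D (@coord_continuous R 1 2 0 i l).
by apply: cvg_trans c; apply: near_eq_cvg; apply: nearW => h; rewrite /= !mxE.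
Qed.

Lemma is_derive_row (f : E -> 'rV[R]_2) x v (l : 'rV[R]_2) :
  (forall i, is_derive x v (fun y => f y 0 i : R^o) (l 0 i)) -> is_derive x v f l.
Proof.
move=> D; have D' i : is_derive x v (fun y => f y 0 i *: delta_mx 0 i : 'rV[R]_2) (l 0 i *: delta_mx 0 i).
  have /is_deriveP H := D i; apply/is_deriveP.
  have c := cvg_comp _ (fun a => a *: delta_mx 0 i) H (@scalev_continuous R (delta_mx 0 i) (l 0 i)).
  apply: cvg_trans c; apply: near_eq_cvg; apply: nearW => h.
  by rewrite /= -scalerBl scalerA.
have -> : f = (fun y => f y 0 0 *: delta_mx 0 0 + f y 0 1 *: delta_mx 0 1).
  by apply/funext => y; rewrite -rV2E.
by rewrite [l]rV2E; apply: is_deriveD.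
Qed.

Lemma Cn_local n (U : set E) (F : normedModType R) (f : E -> F) :
  (forall x, U x -> exists2 U', open U' /\ U' x & Cn n U' f) -> Cn n U f.
Proof.
elim: n f => [|n IH] f L.
  by split=> // x /L[U' [_ U'x] C]; exact: Cn_continuous C _ U'x.
apply: CnI.
- by move=> x /L[U' [_ U'x] C]; exact: Cn_continuous C _ U'x.
- by move=> x v /L[U' [_ U'x] C]; exact: Cn_derivable C _ _ U'x.
by move=> v; apply: IH => x /L[U' [oU U'x] C]; exists U' => //; exact: Cn_derive.
Qed.
End RowDerivative.

(** * Calculus in charts *)

Section Charts.
Context {R : realType} {M : surface R}.
Local Notation V2 := 'rV[R]_2.
Local Notation e_ i := (delta_mx 0 i : V2).
Local Notation tr p q := (chart q \o chart_inv p).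
Implicit Types (p q x y : M) (W U : set M) (v w : V2).

Lemma row_combE (k l : R) v w i : (k *: v + l *: w) 0 i = k * v 0 i + l * w 0 i.
Proof. by rewrite !mxE. Qed.

Definition chart_image p W : set V2 := chart p @` (W `&` dom p).

Lemma chart_imageP p W (y : V2) : chart_image p W y ->
  [/\ W (chart_inv p y), dom p (chart_inv p y) & chart p (chart_inv p y) = y].
Proof. by move=> [x [Wx px] <-]; rewrite chartK. Qed.

Lemma chart_image_in p W x : W x -> dom p x -> chart_image p W (chart p x).
Proof. by move=> Wx px; exists x. Qed.

Lemma chart_continuous_for p x : dom p x -> {for x, continuous (chart p)}.
Proof.
move=> px; have := @chart_continuous R M p; rewrite continuous_open_subspace; last exact: dom_open.
by apply; rewrite inE.
Qed.

Lemma chart_inv_continuous_for p (y : V2) : (chart p @` dom p) y -> {for y, continuous (chart_inv p)}.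
Proof.
move=> py; have := @chart_inv_continuous R M p; rewrite continuous_open_subspace; last exact: chart_image_open.
by apply; rewrite inE.
Qed.

Lemma chart_image_sub p W (y : V2) : chart_image p W y -> (chart p @` dom p) y.
Proof. by move=> [x [_ px] <-]; exists x. Qed.

Lemma chart_image_opens p W : open W -> open (chart_image p W).
Proof.
move=> oW; rewrite openE => y Wy; have [W1 p1 E] := chart_imageP Wy.
have N1 : \forall z \near y, (chart p @` dom p) z.
  by apply: open_nbhs_nbhs; split; [exact: chart_image_open|exact: chart_image_sub Wy].
have N2 : \forall z \near y, W (chart_inv p z).
  apply: (near_image (chart_inv_continuous_for (chart_image_sub Wy))).
  exact: open_nbhs_nbhs.
by rewrite /interior; apply: filterS2 N1 N2 => z [x px <-]; rewrite chartK// => Wx; exists x.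
Qed.

Lemma near_dom p x : dom p x -> \forall y \near x, dom p y.
Proof. by move=> px; apply: open_nbhs_nbhs; split=> //; exact: dom_open. Qed.

Lemma tr_Cn p q n : Cn n (chart_image p (dom q)) (tr p q).
Proof.
have := @transition_smooth R M p q; rewrite setIC => /smooth_onP; exact.
Qed.

Lemma tr_coord_Cn p q n i : Cn n (chart_image p (dom q)) (fun y : V2 => tr p q y 0 i : R^o).
Proof. by apply: (Cn_coord (phi := tr p q)); [exact/chart_image_opens/dom_open|exact: tr_Cn]. Qed.

Lemma smoothM_Cn W (f : M -> R) p n : smoothM (F := R^o) W f ->
  Cn n (chart_image p W) (f \o chart_inv p : V2 -> R^o).
Proof. by move=> /(_ p)/smooth_onP; exact. Qed.

Lemma smoothM_CnP W (f : M -> R) :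
  (forall p n, Cn n (chart_image p W) (f \o chart_inv p : V2 -> R^o)) -> smoothM (F := R^o) W f.
Proof. by move=> C p; apply/smooth_onP => n; exact: C. Qed.

(** One chart around each point suffices, the others being reached through smooth transitions. *)
Lemma smoothM_local W (f : M -> R) :
  (forall x, W x -> exists U p, [/\ open U, U x, dom p x &
     forall n, Cn n (chart_image p U) (f \o chart_inv p : V2 -> R^o)]) -> smoothM (F := R^o) W f.
Proof.
move=> L; apply: smoothM_CnP => q n; apply: Cn_local => y Wy.
have [Wx qx Ey] := chart_imageP Wy; have [U [p [oU Ux px C]]] := L _ Wx.
set x := chart_inv q y in Wx qx Ey Ux px.
have oUp : open (U `&` dom p) by apply: openI => //; exact: dom_open.
exists (chart_image q (U `&` dom p)).
  by split; [exact: chart_image_opens|rewrite -Ey; exact: chart_image_in].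
apply: (Cn_eq (f := (f \o chart_inv p : V2 -> R^o) \o tr q p)); first exact: chart_image_opens.
  by move=> z /chart_imageP[[_ pz] _ _]; rewrite /= chartK.
apply: (Cn_comp2 (V := chart_image p U)) => //; try exact: chart_image_opens.
  by move=> z /chart_imageP[[Uz pz] _ _]; exact: chart_image_in.
by apply: CnW (tr_Cn _ _ _) => z [u [[_ pu] qu] <-]; exact: chart_image_in.
Qed.

Lemma smoothMW W U (f : M -> R) : U `<=` W -> smoothM (F := R^o) W f -> smoothM (F := R^o) U f.
Proof.
move=> UW Sf; apply: smoothM_CnP => p n; apply: CnW (smoothM_Cn p n Sf).
by move=> y [x [Ux px] <-]; apply: chart_image_in => //; exact: UW.
Qed.

Lemma smoothM_eq W (f h : M -> R) : open W -> (forall x, W x -> f x = h x) ->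
  smoothM (F := R^o) W f -> smoothM (F := R^o) W h.
Proof.
move=> oW fh Sf; apply: smoothM_CnP => p n; apply: Cn_eq (smoothM_Cn p n Sf); first exact: chart_image_opens.
by move=> y /chart_imageP[Wy _ _]; exact: fh.
Qed.

Lemma smoothM_cst W (a : R) : smoothM (F := R^o) W (cst a).
Proof. by apply: smoothM_CnP => p n; exact: Cn_cst. Qed.

Lemma smoothMD W (f h : M -> R) : open W -> smoothM (F := R^o) W f -> smoothM (F := R^o) W h ->
  smoothM (F := R^o) W (fun x => f x + h x).
Proof.
by move=> oW Sf Sh; apply: smoothM_CnP => p n; apply: CnD; [exact: chart_image_opens|exact: smoothM_Cn|exact: smoothM_Cn].
Qed.

Lemma smoothMM W (f h : M -> R) : open W -> smoothM (F := R^o) W f -> smoothM (F := R^o) W h ->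
  smoothM (F := R^o) W (fun x => f x * h x).
Proof.
by move=> oW Sf Sh; apply: smoothM_CnP => p n; apply: CnM; [exact: chart_image_opens|exact: smoothM_Cn|exact: smoothM_Cn].
Qed.

Lemma smoothM_rsqrt W (f r : M -> R) : open W -> (forall x, W x -> 0 < r x) ->
  (forall x, W x -> r x ^+ 2 * f x = 1) -> smoothM (F := R^o) W f -> smoothM (F := R^o) W r.
Proof.
move=> oW r0 rf Sf; apply: smoothM_CnP => p n.
apply: (Cn_rsqrt (f := f \o chart_inv p)); first exact: chart_image_opens.
- by move=> y /chart_imageP[? _ _]; exact: r0.
- by move=> y /chart_imageP[? _ _]; exact: rf.
exact: smoothM_Cn.
Qed.

Lemma smoothM_comp1 W (f : M -> R) (h : R -> R) : open W -> smoothM (F := R^o) W f ->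
  (forall n, Cn n setT (h : R^o -> R^o)) -> smoothM (F := R^o) W (h \o f).
Proof.
move=> oW Sf Ch; apply: smoothM_CnP => p n.
by apply: (Cn_comp1 (V := setT) (phi := f \o chart_inv p) (g := h)) => //; [exact: chart_image_opens|exact: smoothM_Cn].
Qed.

Lemma smoothM_continuous W (f : M -> R) x : open W -> W x -> smoothM (F := R^o) W f ->
  {for x, continuous f}.
Proof.
move=> oW Wx Sf; have xx := dom_self x.
have c : {for chart x x, continuous (f \o chart_inv x)}.
  by apply: (Cn_continuous (smoothM_Cn x 0 Sf)); exact: chart_image_in.
have N : \forall y \near x, ((f \o chart_inv x) \o chart x) y = f y.
  by apply: filterS (near_dom xx) => y xy; rewrite /= chartK.
apply: near_eq_continuous N _.
exact: (continuous_comp (chart_continuous_for xx) c).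
Qed.

Lemma trans_is_derive p q x v : dom p x -> dom q x ->
  is_derive (chart p x) v (tr p q) (trans p q x v).
Proof.
move=> px qx; apply: derivableP.
by apply: (Cn_derivable (tr_Cn p q 1)); exact: chart_image_in.
Qed.

Lemma is_derive_chart W (f : M -> R) p x v : open W -> W x -> dom p x -> smoothM (F := R^o) W f ->
  is_derive (chart p x) v (f \o chart_inv p : V2 -> R^o) ('D_v (f \o chart_inv p : V2 -> R^o) (chart p x)).
Proof.
move=> oW Wx px Sf; apply: derivableP.
by apply: (Cn_derivable (smoothM_Cn p 1 Sf)); exact: chart_image_in.
Qed.

Lemma derive_chart_linear W (f : M -> R) p x v : open W -> W x -> dom p x -> smoothM (F := R^o) W f ->
  'D_v (f \o chart_inv p : V2 -> R^o) (chart p x) =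
  v 0 0 * 'D_(e_ 0) (f \o chart_inv p : V2 -> R^o) (chart p x) +
  v 0 1 * 'D_(e_ 1) (f \o chart_inv p : V2 -> R^o) (chart p x).
Proof.
move=> oW Wx px Sf; apply: (@derive_linear _ (chart_image p W)); last exact: smoothM_Cn.
  exact: chart_image_opens.
exact: chart_image_in.
Qed.

Lemma is_derive_change W (f : M -> R) p q x v : open W -> W x -> dom p x -> dom q x ->
  smoothM (F := R^o) W f ->
  is_derive (chart p x) v (f \o chart_inv p : V2 -> R^o)
    ('D_(trans p q x v) (f \o chart_inv q : V2 -> R^o) (chart q x)).
Proof.
move=> oW Wx px qx Sf; rewrite (derive_chart_linear _ oW Wx qx Sf).
have C1 : C1_at (f \o chart_inv q) (tr p q (chart p x)).
  rewrite /= chartK//; apply: (@Cn_C1_at _ 0 (chart_image q W)); [exact: chart_image_opens|exact: chart_image_in|].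
  exact: smoothM_Cn.
have := is_derive_comp2 (trans_is_derive v px qx) C1; rewrite /= chartK//.
apply: near_eq_is_derive.
have N : \forall y \near chart p x, chart_image p (dom q) y.
  by apply: open_nbhs_nbhs; split; [exact/chart_image_opens/dom_open|exact: chart_image_in].
by apply: filterS N => y /chart_imageP[qy _ _]; rewrite /= chartK.
Qed.

Lemma derive_change W (f : M -> R) p q x v : open W -> W x -> dom p x -> dom q x ->
  smoothM (F := R^o) W f ->
  'D_v (f \o chart_inv p : V2 -> R^o) (chart p x) =
  'D_(trans p q x v) (f \o chart_inv q : V2 -> R^o) (chart q x).
Proof. by move=> oW Wx px qx Sf; have [_ ->] := is_derive_change v oW Wx px qx Sf. Qed.

Lemma dM_chart W (f : M -> R) p x v : open W -> W x -> dom p x -> smoothM (F := R^o) W f ->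
  dM f x v = 'D_(trans x p x v) (f \o chart_inv p : V2 -> R^o) (chart p x).
Proof. by move=> oW Wx px Sf; apply: (derive_change _ oW) => //; exact: dom_self. Qed.

Lemma coord_smooth p i : smoothM (F := R^o) (dom p) (coord p i).
Proof.
apply: smoothM_CnP => q n; exact: tr_coord_Cn.
Qed.

Lemma trans_coord p q x v i : dom p x -> dom q x ->
  trans p q x v 0 i = 'D_v (coord q i \o chart_inv p : V2 -> R^o) (chart p x).
Proof.
by move=> px qx; have [_ ->] := is_derive_coord i (trans_is_derive v px qx).
Qed.

Lemma transK p x v : dom p x -> trans p p x v = v.
Proof.
move=> px; have [_ E] : is_derive (chart p x) v (tr p p) v; last exact: E.
have N : \forall y \near chart p x, id y = tr p p y.
  have N : \forall y \near chart p x, chart_image p (dom p) y.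
    by apply: open_nbhs_nbhs; split; [exact/chart_image_opens/dom_open|exact: chart_image_in].
  by apply: filterS N => y /chart_imageP[_ _ E]; rewrite /= E.
by apply: near_eq_is_derive N _; exact: is_derive_id.
Qed.

Lemma trans_trans p q r x v : dom p x -> dom q x -> dom r x ->
  trans q r x (trans p q x v) = trans p r x v.
Proof.
move=> px qx rx; apply/rowP => i; rewrite !trans_coord//.
rewrite -(derive_change v (dom_open r)) //; exact: coord_smooth.
Qed.

Lemma trans_linear p q x v : dom p x -> dom q x ->
  trans p q x v = v 0 0 *: trans p q x (e_ 0) + v 0 1 *: trans p q x (e_ 1).
Proof.
move=> px qx; apply/rowP => i; apply: (etrans (trans_coord v i px qx)).
apply: (etrans (derive_chart_linear v (dom_open q) qx px (@coord_smooth q i))).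
apply: esym; apply: (etrans (row_combE _ _ _ _ _)).
by congr (_ * _ + _ * _); exact: trans_coord.
Qed.

Lemma dM_linear W (f : M -> R) x v : open W -> W x -> smoothM (F := R^o) W f ->
  dM f x v = v 0 0 * dM f x (e_ 0) + v 0 1 * dM f x (e_ 1).
Proof. by move=> oW Wx Sf; exact: (derive_chart_linear v oW Wx (dom_self x) Sf). Qed.

Lemma dM_coord p x v i : dom p x -> dM (coord p i) x v = trans x p x v 0 i.
Proof. by move=> px; rewrite trans_coord//; exact: dom_self. Qed.

Lemma dM_ext W (f : M -> R) p x v : open W -> W x -> dom p x -> smoothM (F := R^o) W f ->
  dM f x (ext p v x) = 'D_v (f \o chart_inv p : V2 -> R^o) (chart p x).
Proof.
move=> oW Wx px Sf; rewrite (dM_chart _ oW Wx px Sf) /ext trans_trans ?transK//; exact: dom_self.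
Qed.

Lemma near_eq_dM (f h : M -> R) x v : (\forall y \near x, f y = h y) -> dM f x v = dM h x v.
Proof.
move=> fh; rewrite /dM; apply: near_eq_derive.
have c : {for chart x x, continuous (chart_inv x)}.
  by apply: chart_inv_continuous_for; exists x => //; exact: dom_self.
apply: (near_image (P := fun y => f y = h y) c); rewrite chartK//; exact: dom_self.
Qed.

Lemma is_derive_dM W (f : M -> R) x v : open W -> W x -> smoothM (F := R^o) W f ->
  is_derive (chart x x) v (f \o chart_inv x : V2 -> R^o) (dM f x v).
Proof. by move=> oW Wx Sf; exact: (is_derive_chart v oW Wx (dom_self x) Sf). Qed.

Lemma dMD W (f h : M -> R) x v : open W -> W x -> smoothM (F := R^o) W f -> smoothM (F := R^o) W h ->
  dM (fun y => f y + h y) x v = dM f x v + dM h x v.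
Proof.
move=> oW Wx Sf Sh.
by have [_ <-] := is_deriveD (is_derive_dM v oW Wx Sf) (is_derive_dM v oW Wx Sh).
Qed.

Lemma dMM W (f h : M -> R) x v : open W -> W x -> smoothM (F := R^o) W f -> smoothM (F := R^o) W h ->
  dM (fun y => f y * h y) x v = f x * dM h x v + h x * dM f x v.
Proof.
move=> oW Wx Sf Sh.
have [_] := is_deriveM (is_derive_dM v oW Wx Sf) (is_derive_dM v oW Wx Sh).
by rewrite /= chartK; last exact: dom_self.
Qed.

Lemma dM_cst (a : R) x v : dM (cst a) x v = 0.
Proof. by rewrite /dM; have -> : cst a \o chart_inv x = cst a by []; rewrite derive_cst. Qed.

Definition comp p (V : M -> tangent R) x : V2 := trans x p x (V x).

Lemma comp_self (V : M -> tangent R) x : comp x V x = V x.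
Proof. by rewrite /comp transK//; exact: dom_self. Qed.

Lemma comp_smooth U (V : M -> tangent R) p i : open U -> smooth_vf U V ->
  smoothM (F := R^o) (U `&` dom p) (fun x => comp p V x 0 i).
Proof.
move=> oU SV; have oUp : open (U `&` dom p) by apply: openI => //; exact: dom_open.
have := SV (U `&` dom p) (coord p i) oUp (@subIsetl _ _ _) (smoothMW (@subIsetr _ _ _) (@coord_smooth p i)).
by apply: smoothM_eq => // x [_ px]; rewrite dM_coord.
Qed.

Lemma extE p (V : M -> tangent R) x : dom p x -> ext p (comp p V x) x = V x.
Proof. by move=> px; rewrite /ext /comp trans_trans ?transK//; exact: dom_self. Qed.

Lemma ext_self p v : ext p v p = v.
Proof. by rewrite /ext transK//; exact: dom_self. Qed.

Lemma comp_ext p v x : dom p x -> comp p (ext p v) x = v.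
Proof. by move=> px; rewrite /ext /comp trans_trans ?transK//; exact: dom_self. Qed.

Lemma ext_smooth p v : smooth_vf (dom p) (ext p v).
Proof.
move=> W f oW Wp Sf; apply: smoothM_local => x Wx; exists W, p; split=> //; first exact: Wp.
move=> n; apply: (Cn_eq (f := 'D_v (f \o chart_inv p : V2 -> R^o))); first exact: chart_image_opens.
  by move=> y /chart_imageP[Wy py E]; rewrite /= (dM_ext v oW Wy py Sf) E.
exact/Cn_derive/smoothM_Cn.
Qed.

Lemma smooth_vfW U W (V : M -> tangent R) : U `<=` W -> smooth_vf W V -> smooth_vf U V.
Proof. by move=> UW SV O f oO OU; apply: SV => //; exact: subset_trans UW. Qed.

Lemma smooth_vf_eq U (V V' : M -> tangent R) : (forall x, U x -> V x = V' x) ->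
  smooth_vf U V -> smooth_vf U V'.
Proof.
move=> E SV W f oW WU Sf; apply: smoothM_eq (SV W f oW WU Sf) => // x Wx.
by rewrite E//; exact: WU.
Qed.

Lemma smooth_vfD U (V V' : M -> tangent R) : smooth_vf U V -> smooth_vf U V' ->
  smooth_vf U (fun x => V x + V' x).
Proof.
move=> SV SV' W f oW WU Sf; have := smoothMD oW (SV W f oW WU Sf) (SV' W f oW WU Sf).
apply: smoothM_eq => // x Wx; rewrite (dM_linear (V x) oW Wx Sf) (dM_linear (V' x) oW Wx Sf).
by rewrite (dM_linear (V x + V' x) oW Wx Sf) !mxE; ring.
Qed.

Lemma smooth_vfN U (V : M -> tangent R) : smooth_vf U V -> smooth_vf U (fun x => - V x).
Proof.
move=> SV W f oW WU Sf; have := smoothMM oW (@smoothM_cst W (-1)) (SV W f oW WU Sf).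
apply: smoothM_eq => // x Wx; rewrite (dM_linear (V x) oW Wx Sf).
by rewrite (dM_linear (- V x) oW Wx Sf) !mxE /cst; ring.
Qed.
End Charts.

(** * Koszul's formula and Christoffel symbols *)

Section Koszul.
Context {R : realType} {M : surface R} (g : lorentz_metric M).
Local Notation V2 := 'rV[R]_2.
Local Notation e_ i := (delta_mx 0 i : V2).
Implicit Types (p q x y : M) (U : set M) (v w u z : V2).

Lemma delta00 : (e_ 0) 0 0 = 1. Proof. by rewrite mxE. Qed.
Lemma delta01 : (e_ 0) 0 1 = 0. Proof. by rewrite mxE. Qed.
Lemma delta10 : (e_ 1) 0 0 = 0. Proof. by rewrite mxE. Qed.
Lemma delta11 : (e_ 1) 0 1 = 1. Proof. by rewrite mxE. Qed.

Lemma row_comb2 (a b : R) v w (A B : V2) :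
  (a *: v + b *: w) 0 0 *: A + (a *: v + b *: w) 0 1 *: B =
  a *: (v 0 0 *: A + v 0 1 *: B) + b *: (w 0 0 *: A + w 0 1 *: B).
Proof. by apply: row2P; rewrite !row_combE; ring. Qed.

Lemma scalar_comb2 (a b : R) v w (A B : R) :
  (a *: v + b *: w) 0 0 * A + (a *: v + b *: w) 0 1 * B =
  a * (v 0 0 * A + v 0 1 * B) + b * (w 0 0 * A + w 0 1 * B).
Proof. by rewrite !row_combE; ring. Qed.

Lemma mdot_row2 (G : 'M[R]_2) (a b c d : R) v w : G^T = G ->
  mdot G (a *: v + b *: w) (c *: v + d *: w) =
  a * (c * mdot G v v + d * mdot G v w) + b * (c * mdot G v w + d * mdot G w w).
Proof. by move=> sG; rewrite mdotDl !mdotDr (mdotC w v sG). Qed.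

Lemma trans_lin p q x (a b : R) v w : dom p x -> dom q x ->
  trans p q x (a *: v + b *: w) = a *: trans p q x v + b *: trans p q x w.
Proof.
move=> px qx; rewrite (trans_linear (a *: v + b *: w) px qx) (trans_linear v px qx) (trans_linear w px qx).
exact: row_comb2.
Qed.

Definition gc p v w x : R := mdot (g x) (ext p v x) (ext p w x).

Lemma gcC p v w x : gc p v w x = gc p w v x.
Proof. by apply: mdotC; exact: gram_sym. Qed.

Lemma gc_self p v w : gc p v w p = mdot (g p) v w.
Proof. by rewrite /gc !ext_self. Qed.

Lemma gc_smooth p v w : smoothM (F := R^o) (dom p) (gc p v w).
Proof. by apply: (gram_smooth g); [exact: dom_open|exact: ext_smooth|exact: ext_smooth]. Qed.

Lemma gc_row p v w x : dom p x -> gc p v w x =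
  v 0 0 * (w 0 0 * gc p (e_ 0) (e_ 0) x + w 0 1 * gc p (e_ 0) (e_ 1) x) +
  v 0 1 * (w 0 0 * gc p (e_ 0) (e_ 1) x + w 0 1 * gc p (e_ 1) (e_ 1) x).
Proof.
move=> px; have E u : ext p u x = u 0 0 *: ext p (e_ 0) x + u 0 1 *: ext p (e_ 1) x.
  by apply: trans_linear => //; exact: dom_self.
by rewrite /gc (E v) (E w); exact: (mdot_row2 _ _ _ _ _ _ (gram_sym g x)).
Qed.

Lemma gc_comp p (V W : M -> tangent R) x : dom p x ->
  mdot (g x) (V x) (W x) = gc p (comp p V x) (comp p W x) x.
Proof. by move=> px; rewrite /gc !extE. Qed.

Definition dgc p u v w : R := dM (gc p v w) p u.

Lemma dgcC p u v w : dgc p u v w = dgc p u w v.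
Proof. by rewrite /dgc; have -> : gc p v w = gc p w v by apply/funext => x; exact: gcC. Qed.

(** The ordinary derivative of the components in the chart centred at [p]. With [dgc], the
    derivative of the metric coefficients, it carries the 1-jets that enter Koszul's formula. *)
Definition dcomp p (V : M -> tangent R) u : V2 := \row_i dM (fun x => comp p V x 0 i) p u.

Lemma dcompE p (V : M -> tangent R) u i : dcomp p V u 0 i = dM (fun x => comp p V x 0 i) p u.
Proof. by rewrite mxE. Qed.

Lemma dM_eq (f : M -> R) p u (l : R) : is_derive (chart p p) u (f \o chart_inv p : V2 -> R^o) l -> dM f p u = l.
Proof. by case. Qed.

Lemma is_derive_comb (y u : V2) (f h a b : V2 -> R^o) (f' h' a' b' : R) :
  is_derive y u f f' -> is_derive y u h h' -> is_derive y u a a' -> is_derive y u b b' ->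
  is_derive y u (fun x : V2 => f x * a x + h x * b x : R^o) (f y * a' + a y * f' + (h y * b' + b y * h')).
Proof. by move=> df dh da db; apply: (is_deriveD (is_deriveM df da) (is_deriveM dh db)). Qed.

Lemma is_derive_quad (y u : V2) (a b c d k l m : V2 -> R^o) (a' b' c' d' k' l' m' : R) :
  is_derive y u a a' -> is_derive y u b b' -> is_derive y u c c' -> is_derive y u d d' ->
  is_derive y u k k' -> is_derive y u l l' -> is_derive y u m m' ->
  is_derive y u (fun x : V2 => a x * (c x * k x + d x * l x) + b x * (c x * l x + d x * m x) : R^o)
   (a y * (c y * k' + k y * c' + (d y * l' + l y * d')) + (c y * k y + d y * l y) * a' +
    (b y * (c y * l' + l y * c' + (d y * m' + m y * d')) + (c y * l y + d y * m y) * b')).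
Proof.
move=> da db dc dd dk dl dm.
exact: (is_derive_comb da db (is_derive_comb dc dd dk dl) (is_derive_comb dc dd dl dm)).
Qed.

(* [ring] and [rewrite] compare derivatives up to conversion, which is costly:
   they are generalized first. *)
Ltac gen_atoms := repeat match goal with
  | |- context [dM ?f ?p ?u] => generalize (dM f p u)
  | |- context [dgc ?p ?u ?v ?w] => generalize (dgc p u v w)
  | |- context [mdot ?G ?u ?v] => generalize (mdot G u v)
  | |- context [koszul ?G ?p ?u ?V ?v] => generalize (koszul G p u V v)
  | |- context [fun_of_matrix ?v ?i ?j] => generalize (fun_of_matrix v i j)
  end; intros.

Lemma dM_metric_coord U (V W : M -> tangent R) p u : open U -> U p -> smooth_vf U V -> smooth_vf U W ->
  dM (fun x => mdot (g x) (V x) (W x)) p u =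
  mdot (g p) (dcomp p V u) (W p) + mdot (g p) (V p) (dcomp p W u) +
  (V p 0 0 * (W p 0 0 * dgc p u (e_ 0) (e_ 0) + W p 0 1 * dgc p u (e_ 0) (e_ 1)) +
   V p 0 1 * (W p 0 0 * dgc p u (e_ 0) (e_ 1) + W p 0 1 * dgc p u (e_ 1) (e_ 1))).
Proof.
move=> oU Up SV SW; pose O := U `&` dom p.
have oO : open O by apply: openI => //; exact: dom_open.
have Op : O p by split=> //; exact: dom_self.
have pp := dom_self p.
have df (f : M -> R) : smoothM (F := R^o) O f -> is_derive (chart p p) u (f \o chart_inv p : V2 -> R^o) (dM f p u).
  by move=> Sf; exact: is_derive_dM oO Op Sf.
have dV i := df _ (comp_smooth (p := p) i oU SV).
have dW i := df _ (comp_smooth (p := p) i oU SW).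
have dg i j := df _ (smoothMW (@subIsetr _ U (dom p)) (@gc_smooth p (e_ i) (e_ j))).
pose f i x := comp p V x 0 i; pose h i x := comp p W x 0 i.
have -> : dM (fun x => mdot (g x) (V x) (W x)) p u = dM (fun x =>
    f 0 x * (h 0 x * gc p (e_ 0) (e_ 0) x + h 1 x * gc p (e_ 0) (e_ 1) x) +
    f 1 x * (h 0 x * gc p (e_ 0) (e_ 1) x + h 1 x * gc p (e_ 1) (e_ 1) x)) p u.
  apply: near_eq_dM; apply: filterS (near_dom pp) => x px.
  by rewrite (gc_comp V W px) gc_row.
have D := is_derive_quad (dV 0) (dV 1) (dW 0) (dW 1) (dg 0 0) (dg 0 1) (dg 1 1).
apply: (etrans (dM_eq D)); rewrite /= (chartK pp) !comp_self !gc_self.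
have E a b : mdot (g p) a b = a 0 0 * (b 0 0 * mdot (g p) (e_ 0) (e_ 0) + b 0 1 * mdot (g p) (e_ 0) (e_ 1)) +
    a 0 1 * (b 0 0 * mdot (g p) (e_ 0) (e_ 1) + b 0 1 * mdot (g p) (e_ 1) (e_ 1)).
  by rewrite {1}[a]rV2E {1}[b]rV2E; exact: (mdot_row2 _ _ _ _ _ _ (gram_sym g p)).
have E1 := E (dcomp p V u) (W p); have E2 := E (V p) (dcomp p W u).
have V0 := dcompE p V u 0; have V1 := dcompE p V u 1; have W0 := dcompE p W u 0; have W1 := dcompE p W u 1.
have G i j : dgc p u (e_ i) (e_ j) = dM (gc p (e_ i) (e_ j)) p u by [].
have G00 := G 0 0; have G01 := G 0 1; have G11 := G 1 1.
clear D E G dg dV dW df; move: E1 E2 V0 V1 W0 W1 G00 G01 G11; gen_atoms; subst; ring.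
Qed.

Lemma dcomp_ext p v u : dcomp p (ext p v) u = 0.
Proof.
apply/rowP => i; rewrite dcompE [RHS]mxE -[RHS](@dM_cst _ _ (v 0 i) p u); apply: near_eq_dM.
by apply: filterS (near_dom (dom_self p)) => x px; rewrite comp_ext.
Qed.

Lemma mdot0 (G : 'M[R]_2) v : mdot G 0 v = 0 /\ mdot G v 0 = 0.
Proof. by rewrite !mdotE [(0 : V2) 0 0]mxE [(0 : V2) 0 1]mxE; split; ring. Qed.

Lemma dgc_row p u v w : dgc p u v w =
  v 0 0 * (w 0 0 * dgc p u (e_ 0) (e_ 0) + w 0 1 * dgc p u (e_ 0) (e_ 1)) +
  v 0 1 * (w 0 0 * dgc p u (e_ 0) (e_ 1) + w 0 1 * dgc p u (e_ 1) (e_ 1)).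
Proof.
have H := @dM_metric_coord (dom p) (ext p v) (ext p w) p u (dom_open p) (dom_self p)
  (@ext_smooth _ _ p v) (@ext_smooth _ _ p w).
move: H; rewrite !dcomp_ext !ext_self => H; apply: (etrans H).
by rewrite (mdot0 _ _).1 (mdot0 _ _).2 !add0r.
Qed.

Lemma dgc_linear p u v w : dgc p u v w = u 0 0 * dgc p (e_ 0) v w + u 0 1 * dgc p (e_ 1) v w.
Proof. by apply: dM_linear (dom_open p) (dom_self p) _; exact: gc_smooth. Qed.

Lemma dM_metric U (V W : M -> tangent R) p u : open U -> U p -> smooth_vf U V -> smooth_vf U W ->
  dM (fun x => mdot (g x) (V x) (W x)) p u =
  mdot (g p) (dcomp p V u) (W p) + mdot (g p) (V p) (dcomp p W u) + dgc p u (V p) (W p).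
Proof. by move=> oU Up SV SW; rewrite (dgc_row p u (V p) (W p)); exact: (dM_metric_coord u oU Up SV SW). Qed.

Lemma dM_metric_ext U (V : M -> tangent R) p u z : open U -> U p -> smooth_vf U V ->
  dM (fun x => mdot (g x) (V x) (ext p z x)) p u = mdot (g p) (dcomp p V u) z + dgc p u (V p) z.
Proof.
move=> oU Up SV; have oO : open (U `&` dom p) by apply: openI => //; exact: dom_open.
have Op : (U `&` dom p) p by split=> //; exact: dom_self.
have SV' : smooth_vf (U `&` dom p) V by apply: smooth_vfW SV; exact: subIsetl.
have Sz : smooth_vf (U `&` dom p) (ext p z) by apply: smooth_vfW (@ext_smooth _ _ p z); exact: subIsetr.
have := dM_metric u oO Op SV' Sz; rewrite dcomp_ext ext_self => H; apply: (etrans H).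
by rewrite (mdot0 _ _).2 addr0.
Qed.

Lemma lieE (V W : M -> tangent R) p : lie V W p = dcomp p W (V p) - dcomp p V (W p).
Proof.
apply/rowP => i; rewrite !mxE; congr (_ - _); apply: near_eq_dM.
  by apply: filterS (near_dom (dom_self p)) => x px; rewrite dM_coord.
by apply: filterS (near_dom (dom_self p)) => x px; rewrite dM_coord.
Qed.

Lemma row_comb4 (a b c d : R) v w v' w' i :
  (1 *: (a *: v + b *: w) + 1 *: (c *: v' + d *: w')) 0 i =
  a * v 0 i + b * w 0 i + (c * v' 0 i + d * w' 0 i).
Proof. by rewrite !row_combE; ring. Qed.

Lemma mdot_comb4 (G : 'M[R]_2) (a b c d : R) v w v' w' z :
  mdot G (1 *: (a *: v + b *: w) + 1 *: (c *: v' + d *: w')) z =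
  a * mdot G v z + b * mdot G w z + (c * mdot G v' z + d * mdot G w' z).
Proof. by rewrite !mdotDl; ring. Qed.

(* The Christoffel symbols of the first kind. *)
Definition gamma p v w z : R := 2^-1 * (dgc p v w z + dgc p w v z - dgc p z v w).

Ltac gen_gamma := repeat match goal with
  | |- context [gamma ?p ?u ?v ?w] => generalize (gamma p u v w)
  end; gen_atoms.

Lemma half_sum (A B C D E F A' B' C' D' E' F' : R) :
  A = A' -> B = B' -> C = C' -> D = D' -> E = E' -> F = F' ->
  2^-1 * (A + B - C + D - E - F) = 2^-1 * (A' + B' - C' + D' - E' - F').
Proof. by move=> -> -> -> -> -> ->. Qed.

(** A derivative of components plus a Christoffel term: [ext p v] and [ext p z] have constant
    components in the chart at [p], so their own derivatives drop out. *)
Lemma koszulE U (W : M -> tangent R) p v z : open U -> U p -> smooth_vf U W ->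
  koszul g p v W z = mdot (g p) (dcomp p W v) z + gamma p v (W p) z.
Proof.
move=> oU Up SW.
have H1 := dM_metric_ext v z oU Up SW.
have H2 := dM_metric_ext (W p) z (dom_open p) (dom_self p) (@ext_smooth _ _ p v).
have H3 : dM (fun q => mdot (g q) (ext p v q) (W q)) p z = mdot (g p) (dcomp p W z) v + dgc p z (W p) v.
  apply: etrans (dM_metric_ext z v oU Up SW); congr (dM _ p z).
  by apply/funext => q; apply: mdotC; exact: gram_sym.
have sub (G : 'M[R]_2) (a b c : V2) : mdot G (a - b) c = mdot G a c - mdot G b c.
  by rewrite !mdotE !mxE; ring.
have H4 : mdot (g p) (lie (ext p v) W p) z = mdot (g p) (dcomp p W v) z.
  by rewrite lieE dcomp_ext ext_self subr0.
have H5 : mdot (g p) (lie (ext p v) (ext p z) p) (W p) = 0.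
  by rewrite lieE !dcomp_ext subr0 (mdot0 _ _).1.
have H6 : mdot (g p) (lie W (ext p z) p) v = - mdot (g p) (dcomp p W z) v.
  by rewrite lieE dcomp_ext ext_self sub (mdot0 _ _).1 sub0r.
apply: (etrans (half_sum H1 H2 H3 H4 H5 H6)).
move: H1 H2 H3 H4 H5 H6 => _ _ _ _ _ _.
rewrite dcomp_ext (mdot0 _ _).1 ext_self /gamma (dgcC p z (W p) v); gen_atoms; lra.
Qed.

Lemma gram_unit p : g p \in unitmx.
Proof. by rewrite unitmxE unitfE lt_eqF// gram_lorentz. Qed.

Lemma gamma_linear p v w z : gamma p v w z = z 0 0 * gamma p v w (e_ 0) + z 0 1 * gamma p v w (e_ 1).
Proof.
rewrite /gamma (dgc_linear p z v w) (dgc_row p v w z) (dgc_row p w v z).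
rewrite (dgc_row p v w (e_ 0)) (dgc_row p v w (e_ 1)) (dgc_row p w v (e_ 0)) (dgc_row p w v (e_ 1)).
by rewrite delta00 delta01 delta10 delta11; gen_atoms; ring.
Qed.

Lemma koszul_linear U (W : M -> tangent R) p v z : open U -> U p -> smooth_vf U W ->
  koszul g p v W z = z 0 0 * koszul g p v W (e_ 0) + z 0 1 * koszul g p v W (e_ 1).
Proof.
move=> oU Up SW; rewrite !(koszulE _ _ oU Up SW) (gamma_linear p v (W p) z).
have E a : mdot (g p) a z = z 0 0 * mdot (g p) a (e_ 0) + z 0 1 * mdot (g p) a (e_ 1).
  by rewrite {1}[z]rV2E mdotDr.
rewrite E; move: (gamma p v (W p) (e_ 0)) (gamma p v (W p) (e_ 1)); gen_atoms; ring.
Qed.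

Lemma nablaE U (W : M -> tangent R) p v z : open U -> U p -> smooth_vf U W ->
  mdot (g p) (nabla g p v W) z = koszul g p v W z.
Proof.
move=> oU Up SW; rewrite (koszul_linear v z oU Up SW) /nabla /mdot mulmxKV ?gram_unit//.
by rewrite mxE sum2 !mxE; gen_atoms; ring.
Qed.

(** Compatibility of the connection with the metric. *)
Lemma koszul_metric U (V W : M -> tangent R) p u : open U -> U p -> smooth_vf U V -> smooth_vf U W ->
  koszul g p u V (W p) + koszul g p u W (V p) = dM (fun x => mdot (g x) (V x) (W x)) p u.
Proof.
move=> oU Up SV SW; rewrite !(koszulE _ _ oU Up) // (dM_metric u oU Up SV SW) /gamma.
have := mdotC (dcomp p W u) (V p) (gram_sym g p).
have := dgcC p u (W p) (V p); have := dgcC p (W p) u (V p); have := dgcC p (V p) u (W p).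
gen_atoms; lra.
Qed.

(** Torsion-freeness, tested on fields constant in the chart: the left-hand side is the exterior
    derivative of g(V, .) at [p]. *)
Lemma koszul_torsion U (V : M -> tangent R) p u z : open U -> U p -> smooth_vf U V ->
  dM (fun x => mdot (g x) (V x) (ext p z x)) p u - dM (fun x => mdot (g x) (V x) (ext p u x)) p z =
  koszul g p u V z - koszul g p z V u.
Proof.
move=> oU Up SV; rewrite (koszulE u z oU Up SV) (koszulE z u oU Up SV) /gamma.
have := dM_metric_ext u z oU Up SV; have := dM_metric_ext z u oU Up SV.
have := dgcC p u z (V p); have := dgcC p z u (V p); have := dgcC p (V p) z u.
gen_atoms; lra.
Qed.

Lemma scale_comb (c : R) v : c *: v = c *: v + 0 *: v.
Proof. by rewrite scale0r addr0. Qed.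

Lemma smooth_vf_scale U (f : M -> R) (V : M -> tangent R) : open U -> smoothM (F := R^o) U f ->
  smooth_vf U V -> smooth_vf U (fun x => f x *: V x).
Proof.
move=> oU Sf SV W h oW WU Sh.
have := smoothMM oW (smoothMW WU Sf) (SV W h oW WU Sh).
apply: smoothM_eq => // x Wx; rewrite (dM_linear (V x) oW Wx Sh).
apply: esym (etrans (dM_linear (f x *: V x) oW Wx Sh) _).
by rewrite {1 2}(scale_comb (f x) (V x)) scalar_comb2 mul0r addr0.
Qed.

Lemma dcomp_comb U (f h : M -> R) (V W : M -> tangent R) p u : open U -> U p ->
  smoothM (F := R^o) U f -> smoothM (F := R^o) U h -> smooth_vf U V -> smooth_vf U W ->
  dcomp p (fun x => f x *: V x + h x *: W x) u =
   1 *: (dM f p u *: V p + f p *: dcomp p V u) + 1 *: (dM h p u *: W p + h p *: dcomp p W u).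
Proof.
move=> oU Up Sf Sh SV SW; pose O := U `&` dom p.
have oO : open O by apply: openI => //; exact: dom_open.
have Op : O p by split=> //; exact: dom_self.
have df (k : M -> R) : smoothM (F := R^o) O k -> is_derive (chart p p) u (k \o chart_inv p : V2 -> R^o) (dM k p u).
  by move=> Sk; exact: is_derive_dM oO Op Sk.
have Df := df _ (smoothMW (@subIsetl _ U (dom p)) Sf); have Dh := df _ (smoothMW (@subIsetl _ U (dom p)) Sh).
apply/rowP => i; apply: (etrans (dcompE _ _ _ _)).
have DV := df _ (comp_smooth (p := p) i oU SV); have DW := df _ (comp_smooth (p := p) i oU SW).
have E1 : dM (fun x => comp p (fun x0 => f x0 *: V x0 + h x0 *: W x0) x 0 i) p u =
    dM (fun x => f x * comp p V x 0 i + h x * comp p W x 0 i) p u.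
  apply: near_eq_dM; apply: filterS (near_dom (dom_self p)) => x px.
  by rewrite /comp trans_lin ?row_combE//; exact: dom_self.
apply: (etrans E1); apply: (etrans (dM_eq (is_derive_comb Df Dh DV DW))).
rewrite /= (chartK (dom_self p)) !comp_self; apply: esym (etrans (row_comb4 _ _ _ _ _ _ _ _ _) _).
have V0 := dcompE p V u i; have W0 := dcompE p W u i.
clear E1 DV DW df Df Dh; move: V0 W0; gen_atoms; subst; ring.
Qed.

Lemma koszul_comb U (f h : M -> R) (V W : M -> tangent R) p u z : open U -> U p ->
  smoothM (F := R^o) U f -> smoothM (F := R^o) U h -> smooth_vf U V -> smooth_vf U W ->
  koszul g p u (fun x => f x *: V x + h x *: W x) z =
  dM f p u * mdot (g p) (V p) z + f p * koszul g p u V z +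
  (dM h p u * mdot (g p) (W p) z + h p * koszul g p u W z).
Proof.
move=> oU Up Sf Sh SV SW.
have S : smooth_vf U (fun x => f x *: V x + h x *: W x).
  exact: (smooth_vfD (smooth_vf_scale oU Sf SV) (smooth_vf_scale oU Sh SW)).
have K1 := koszulE u z oU Up S; have K2 := koszulE u z oU Up SV; have K3 := koszulE u z oU Up SW.
move: K1; rewrite (dcomp_comb u oU Up Sf Sh SV SW) mdot_comb4 => K1.
have Gm : gamma p u (f p *: V p + h p *: W p) z = f p * gamma p u (V p) z + h p * gamma p u (W p) z.
  rewrite /gamma (dgc_linear p (f p *: V p + h p *: W p)) (dgc_linear p (V p) u z) (dgc_linear p (W p) u z).
  rewrite (dgc_row p u (f p *: V p + h p *: W p)) (dgc_row p u (V p)) (dgc_row p u (W p)).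
  rewrite (dgc_row p z u (f p *: V p + h p *: W p)) (dgc_row p z u (V p)) (dgc_row p z u (W p)).
  by rewrite !row_combE; gen_atoms; ring.
apply: (etrans K1); move: K2 K3 Gm; gen_gamma; subst; ring.
Qed.

Lemma koszul_dir U (W : M -> tangent R) p (a b : R) u v z : open U -> U p -> smooth_vf U W ->
  koszul g p (a *: u + b *: v) W z = a * koszul g p u W z + b * koszul g p v W z.
Proof.
move=> oU Up SW.
have K1 := koszulE (a *: u + b *: v) z oU Up SW; have K2 := koszulE u z oU Up SW.
have K3 := koszulE v z oU Up SW.
have Dl : dcomp p W (a *: u + b *: v) = a *: dcomp p W u + b *: dcomp p W v.
  have oO : open (U `&` dom p) by apply: openI => //; exact: dom_open.
  have Op : (U `&` dom p) p by split=> //; exact: dom_self.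
  apply/rowP => i; have S : smoothM (F := R^o) (U `&` dom p) (fun x => comp p W x 0 i) by exact: comp_smooth.
  apply: (etrans (dcompE _ _ _ _)); apply: (etrans (dM_linear (a *: u + b *: v) oO Op S)).
  apply: esym (etrans (row_combE _ _ _ _ _) _).
  have L1 := dM_linear u oO Op S; have L2 := dM_linear v oO Op S.
  have D1 := dcompE p W u i; have D2 := dcompE p W v i.
  have E := @scalar_comb2 a b u v; clear K1 K2 K3; rewrite E; clear E S.
  by move: L1 L2 D1 D2; gen_atoms; subst; ring.
have Gm : gamma p (a *: u + b *: v) (W p) z = a * gamma p u (W p) z + b * gamma p v (W p) z.
  rewrite /gamma (dgc_linear p (a *: u + b *: v)) (dgc_linear p u (W p)) (dgc_linear p v (W p)).
  rewrite (dgc_row p (W p) (a *: u + b *: v)) (dgc_row p (W p) u) (dgc_row p (W p) v).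
  rewrite (dgc_row p z (a *: u + b *: v)) (dgc_row p z u) (dgc_row p z v).
  by rewrite !row_combE; gen_atoms; ring.
move: K1; rewrite Dl mdotDl => K1.
by apply: (etrans K1); move: K2 K3 Gm; gen_gamma; subst; ring.
Qed.
End Koszul.

Ltac gen_dM := repeat match goal with
  | |- context [dM ?f ?p ?u] => generalize (dM f p u)
  | |- context [mdot ?G ?u ?v] => generalize (mdot G u v)
  | |- context [koszul ?G ?p ?u ?V ?v] => generalize (koszul G p u V v)
  | |- context [fun_of_matrix ?v ?i ?j] => generalize (fun_of_matrix v i j)
  end; intros.

(** * The null field of a flat frame and its closed form *)

Section NullFrame.
Context {R : realType} {M : surface R} (g : lorentz_metric M).
Local Notation V2 := 'rV[R]_2.
Local Notation e_ i := (delta_mx 0 i : V2).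
Variables X Y : M -> tangent R.

(* [X = s1 + s2] and [Y = - s1 + s2] for a frame [s] with [div X = 0]. *)
Record flat_null_frame : Prop := FlatNullFrame {
  fn_X : smooth_vf setT X;
  fn_Y : smooth_vf setT Y;
  fn_basis : forall p, null_basis (g p) (X p) (Y p);
  fn_div : forall p, divergence g X p = 0 }.

Hypothesis fn : flat_null_frame.

Let oT : open [set: M] := openT.

Lemma smooth_metric (V W : M -> tangent R) U : open U -> smooth_vf U V -> smooth_vf U W ->
  smoothM (F := R^o) U (fun p => mdot (g p) (V p) (W p)).
Proof. exact: gram_smooth. Qed.

Lemma koszul_XX p u : koszul g p u X (X p) = 0.
Proof.
have := koszul_metric g u oT I (fn_X fn) (fn_X fn) (p := p).
have -> : (fun x => mdot (g x) (X x) (X x)) = cst 0.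
  by apply/funext => x; exact: nb_XX (fn_basis fn x).
rewrite dM_cst; lra.
Qed.

Lemma nabla_X p u : nabla g p u X = (2^-1 * koszul g p u X (Y p)) *: X p.
Proof.
have E := null_expand (nabla g p u X) (fn_basis fn p); rewrite E.
by rewrite !(nablaE g _ _ oT I (fn_X fn)) koszul_XX mulr0 scale0r addr0.
Qed.

(** Since g(X, X) is constant, the derivative of [X] along [u] is a multiple omega(u) X. The trace
    of this endomorphism is omega(X), and it is the divergence. *)
Lemma koszul_X_X p z : koszul g p (X p) X z = 0.
Proof.
suff H : koszul g p (X p) X (Y p) = 0.
  by rewrite -(nablaE g _ _ oT I (fn_X fn)) nabla_X H mulr0 scale0r (mdot0 _ _).1.
have := fn_div fn p; rewrite /divergence sum2 !nabla_X => H.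
have E : koszul g p (X p) X (Y p) =
    X p 0 0 * koszul g p (e_ 0) X (Y p) + X p 0 1 * koszul g p (e_ 1) X (Y p).
  by rewrite {1}[X p]rV2E; exact: (koszul_dir g _ _ _ _ _ oT I (fn_X fn)).
rewrite E; move: H; rewrite ![(_ *: X p) _ _]mxE.
by move: (koszul g p (e_ 0) X (Y p)) (koszul g p (e_ 1) X (Y p)) (X p 0 0) (X p 0 1) => *; lra.
Qed.

(** As omega kills [X], it is proportional to g(X, .). The resulting expression is symmetric in [u]
    and [z], which will give the closedness of [alpha]. *)
Lemma koszul_X p u z : koszul g p u X z =
  2^-1 * mdot (g p) u (X p) * (2^-1 * koszul g p (Y p) X (Y p)) * mdot (g p) (X p) z.
Proof.
have K : koszul g p u X z = (2^-1 * koszul g p u X (Y p)) * mdot (g p) (X p) z.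
  rewrite -(nablaE g _ _ oT I (fn_X fn)) nabla_X.
  by rewrite (scale_comb _ (X p)) mdotDl mul0r addr0.
have E : koszul g p u X (Y p) = 2^-1 * mdot (g p) u (X p) * koszul g p (Y p) X (Y p).
  rewrite {1}(null_expand u (fn_basis fn p)).
  by apply: (etrans (koszul_dir g _ _ _ _ _ oT I (fn_X fn))); rewrite koszul_X_X mulr0 add0r.
by rewrite K E; ring.
Qed.

(* The form [alpha = g(X, .)] in the constant directions of [chart p]. *)
Definition alpha p (v : V2) (x : M) : R := mdot (g x) (X x) (ext p v x).

Lemma alpha_smooth p v : smoothM (F := R^o) (dom p) (alpha p v).
Proof.
apply: smooth_metric; [exact: dom_open| |exact: ext_smooth].
by apply: smooth_vfW (fn_X fn) => x _.
Qed.

Lemma alpha_lin p x (a b : R) v w : dom p x ->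
  alpha p (a *: v + b *: w) x = a * alpha p v x + b * alpha p w x.
Proof.
move=> px; rewrite /alpha /ext trans_lin//; last exact: dom_self.
exact: mdotDr.
Qed.

Lemma alpha_row p x v : dom p x -> alpha p v x = v 0 0 * alpha p (e_ 0) x + v 0 1 * alpha p (e_ 1) x.
Proof. by move=> px; rewrite {1}[v]rV2E alpha_lin. Qed.

Lemma alpha_closed_center p u z : dM (alpha p z) p u = dM (alpha p u) p z.
Proof.
have := koszul_torsion g u z oT I (fn_X fn) (p := p).
have := koszul_X p u z; have := koszul_X p z u.
have := mdotC (X p) z (gram_sym g p); have := mdotC (X p) u (gram_sym g p).
rewrite /alpha; gen_dM; subst; nra.
Qed.

Lemma alpha_change p q x v : dom p x -> dom q x ->
  alpha p v x = trans p q x v 0 0 * alpha q (e_ 0) x + trans p q x v 0 1 * alpha q (e_ 1) x.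
Proof.
move=> px qx; rewrite -(alpha_row _ qx) /alpha /ext trans_trans//; exact: dom_self.
Qed.

(** At the centre of the chart of [x] this is torsion-freeness. Reading it in the chart of [p]
    brings in second derivatives of the transition map, which cancel by their symmetry. *)
Lemma alpha_closed p x u z : dom p x ->
  'D_u (alpha p z \o chart_inv p : V2 -> R^o) (chart p x) =
  'D_z (alpha p u \o chart_inv p : V2 -> R^o) (chart p x).
Proof.
move=> px; have xx := dom_self x.
have oxp : open (dom x `&` dom p) by apply: openI; exact: dom_open.
pose O := chart_image p (dom x); have oO : open O by apply/chart_image_opens/dom_open.
have Ox : O (chart p x) by exact: chart_image_in.
pose t i := coord x i \o chart_inv p : V2 -> R^o.
have Ct n i : Cn n O (t i) by exact: tr_coord_Cn.
pose A i := alpha x (e_ i) \o chart_inv p : V2 -> R^o.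
have dA i v : is_derive (chart p x) v (A i) (dM (alpha x (e_ i)) x (trans p x x v)).
  by apply: (is_derive_change (q := x) v (dom_open x)) => //; exact: alpha_smooth.
have dt v w i : is_derive (chart p x) w ('D_v (t i)) ('D_w ('D_v (t i)) (chart p x)).
  by apply: derivableP; apply: (Cn_derivable (Cn_derive v (Ct 2%N i))).
have N v : \forall y \near chart p x, 'D_v (t 0) y * A 0 y + 'D_v (t 1) y * A 1 y = alpha p v (chart_inv p y).
  have NO : \forall y \near chart p x, O y by exact: open_nbhs_nbhs.
  apply: filterS NO => y /chart_imageP[xy py E].
  by rewrite (alpha_change v py xy) !trans_coord// E.
have D v w : 'D_w (alpha p v \o chart_inv p : V2 -> R^o) (chart p x) =
    'D_v (t 0) (chart p x) * dM (alpha x (e_ 0)) x (trans p x x w) + A 0 (chart p x) * 'D_w ('D_v (t 0)) (chart p x) +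
   ('D_v (t 1) (chart p x) * dM (alpha x (e_ 1)) x (trans p x x w) + A 1 (chart p x) * 'D_w ('D_v (t 1)) (chart p x)).
  have H := is_derive_comb (dt v w 0) (dt v w 1) (dA 0 w) (dA 1 w).
  by have [_ E1] := near_eq_is_derive (N v) H; exact: E1.
have T v w : dM (alpha x v) x w = v 0 0 * dM (alpha x (e_ 0)) x w + v 0 1 * dM (alpha x (e_ 1)) x w.
  have d i := is_derive_dM w (dom_open x) xx (@alpha_smooth x (e_ i)).
  have H := is_derive_comb (is_derive_cst (v 0 0 : R^o) (chart x x) w) (is_derive_cst (v 0 1 : R^o) (chart x x) w) (d 0) (d 1).
  have Nv : \forall y \near chart x x, v 0 0 * (alpha x (e_ 0) \o chart_inv x) y + v 0 1 * (alpha x (e_ 1) \o chart_inv x) y = (alpha x v \o chart_inv x) y.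
    have NO : \forall y \near chart x x, chart_image x setT y.
      by apply: open_nbhs_nbhs; split; [exact: chart_image_opens|exact: chart_image_in].
    by apply: filterS NO => y /chart_imageP[_ xy _]; rewrite /= (alpha_row v xy).
  have E := dM_eq (near_eq_is_derive Nv H); apply: (etrans E).
  have comb0 (a1 a2 a3 a4 a5 a6 : R) : a1 * a2 + a3 * 0 + (a4 * a5 + a6 * 0) = a1 * a2 + a4 * a5 by ring.
  exact: comb0.
have E v i : 'D_v (t i) (chart p x) = trans p x x v 0 i by rewrite trans_coord.
have S i : 'D_u ('D_z (t i)) (chart p x) = 'D_z ('D_u (t i)) (chart p x).
  exact: schwarz oO Ox (Ct 2%N i).
have C := etrans (esym (T (trans p x x z) (trans p x x u)))
  (etrans (alpha_closed_center x (trans p x x u) (trans p x x z)) (T (trans p x x u) (trans p x x z))).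
apply: (etrans (D z u)); apply: esym (etrans (D u z) _).
have S0 := S 0; have S1 := S 1.
have E0u := E u 0; have E1u := E u 1; have E0z := E z 0; have E1z := E z 1.
move: C S0 S1 E0u E1u E0z E1z; clear; gen_dM.
repeat match goal with
  | H : context [derive ?f ?y ?v] |- _ => move: H; generalize (derive f y v); intros
  | |- context [derive ?f ?y ?v] => generalize (derive f y v); intros
  | |- context [A ?i ?y] => generalize (A i y); intros
  end.
subst; lra.
Qed.

End NullFrame.

(** * Flow boxes on the surface *)

Section FlowBoxes.
Context {R : realType} {M : surface R} (g : lorentz_metric M).
Local Notation V2 := 'rV[R]_2.
Local Notation e_ i := (delta_mx 0 i : V2).
Variables X Y : M -> tangent R.
Hypothesis fn : flat_null_frame g X Y.

(** [fb_alpha] makes the height a primitive of g(X, .). [fb_time] concerns arbitrary curves so that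
    it also applies to those coming from another box. The factor 1/2 in [fb_slice] comes from g(X,
    Y) = 2. *)
Record flow_box_at (p : M) (B : @box R M) : Prop := FlowBoxAt {
  fb_box : is_box B;
  fb_center : [/\ bdom B p, btime B p = 0 & bheight B p = 0];
  fb_dom : forall y, bdom B y -> dom p y;
  fb_height : smoothM (F := R^o) (bdom B) (bheight B);
  fb_alpha : forall y v, bdom B y -> dM (bheight B) y v = mdot (g y) (X y) v;
  fb_velocity : forall s r : R, `|s| < brad B -> `|r| < brad B ->
    is_derive s 1 (fun s : R^o => chart p (bmap B s r) : V2) (comp p X (bmap B s r));
  fb_time : forall (c : R -> M) (d : R), 
    (forall s : R, `|s| < d -> bdom B (c s) /\ bheight B (c s) = bheight B (c 0)) ->
    (forall s : R, `|s| < d -> is_derive s 1 (fun s : R^o => chart p (c s) : V2) (comp p X (c s))) ->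
    forall s : R, `|s| < d -> btime B (c s) = btime B (c 0) + s;
  fb_slice : forall h : M -> R, smoothM (F := R^o) setT h ->
    is_derive (0 : R) 1 (fun r => h (bmap B 0 r)) (2^-1 * dM h p (Y p)) }.

Section AtPoint.
Variable p : M.
Let x0 := chart p p.
Let X0 : V2 := X p.
Let Y0 : V2 := Y p.
Let nb : null_basis (g p) X0 Y0 := fn_basis fn p.

(** Affine coordinates of the chart along [X p] and [Y p], with inverse [(xi, zeta)]. At the centre
    the field has components (1, 0) and the form takes the value 2 on [Y p]. *)
Definition lin_pt (z : R * R) : V2 := z.1 *: X0 + (z.2 *: Y0 + x0).
Definition xi (y : V2) : R := 2^-1 * mdot (g p) (y - x0) Y0.
Definition zeta (y : V2) : R := 2^-1 * mdot (g p) (y - x0) X0.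

Lemma lin_ptK y : lin_pt (xi y, zeta y) = y.
Proof.
rewrite /lin_pt /= addrA; have := null_expand (y - x0) nb; rewrite -/(xi y) -/(zeta y) => <-.
by rewrite subrK.
Qed.

Lemma xi_lin_pt z : xi (lin_pt z) = z.1 /\ zeta (lin_pt z) = z.2.
Proof.
have E : lin_pt z - x0 = z.1 *: X0 + z.2 *: Y0 by rewrite /lin_pt addrA addrK.
have [H1 H2] := null_coef z.1 z.2 nb.
by rewrite /xi /zeta E H1 H2 !mulrA mulVf ?pnatr_eq0// !mul1r.
Qed.

Lemma lin_pt_continuous : continuous lin_pt.
Proof. exact: affine2_continuous. Qed.

Lemma mdot_is_derive (E : normedModType R) (c : E -> V2) (u : E) (v : E) (l w : V2) :
  is_derive u v c l -> is_derive u v (fun s => 2^-1 * mdot (g p) (c s - x0) w : R^o) (2^-1 * mdot (g p) l w).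
Proof.
move=> D; have D0 := is_derive_coord 0 D; have D1 := is_derive_coord 1 D.
pose k0 := 2^-1 * (g p 0 0 * w 0 0 + g p 0 1 * w 0 1).
pose k1 := 2^-1 * (g p 1 0 * w 0 0 + g p 1 1 * w 0 1).
have -> : (fun s => 2^-1 * mdot (g p) (c s - x0) w : R^o) =
    (fun s => k0 *: (c s 0 0 : R^o) + k1 *: (c s 0 1 : R^o) - 2^-1 * mdot (g p) x0 w).
  apply/funext => s; rewrite /GRing.scale /= !mdotE /k0 /k1 !mxE; ring.
have -> : 2^-1 * mdot (g p) l w = k0 *: (l 0 0 : R^o) + k1 *: (l 0 1 : R^o) - 0.
  rewrite /GRing.scale /= !mdotE /k0 /k1; ring.
apply: is_deriveB; apply: is_deriveD; exact: is_deriveZ.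
Qed.

Lemma xi_continuous (w : V2) : continuous (fun y : V2 => 2^-1 * mdot (g p) (y - x0) w).
Proof.
move=> y.
pose k0 := 2^-1 * (g p 0 0 * w 0 0 + g p 0 1 * w 0 1).
pose k1 := 2^-1 * (g p 1 0 * w 0 0 + g p 1 1 * w 0 1).
have -> : (fun y : V2 => 2^-1 * mdot (g p) (y - x0) w) =
    (fun y : V2 => k0 * y 0 0 + k1 * y 0 1 - 2^-1 * mdot (g p) x0 w).
  apply/funext => s; rewrite !mdotE /k0 /k1 !mxE; ring.
have c (k : R) (i : 'I_2) : {for y, continuous (fun y : V2 => k * y 0 i)}.
  exact: (continuous_comp (@coord_continuous R 1 2 0 i y) (@mulrl_continuous _ k _)).
have c01 : {for y, continuous (fun y : V2 => k0 * y 0 0 + k1 * y 0 1)} by exact: (cvgD (c k0 0) (c k1 1)).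
exact: (cvgB c01 (@cvg_cst _ _ _ _ _)).
Qed.

Lemma within_one (u : R) : `|u - 2| < 1 -> 2^-1 <= u.
Proof. by rewrite ltr_norml => /andP[? ?]; lra. Qed.

Lemma within_half (u : R) : `|u - 1| < 2^-1 -> 2^-1 <= u <= 2.
Proof. by rewrite ltr_norml => /andP[? ?]; apply/andP; split; lra. Qed.

Lemma is_derive_slice0 (F : R * R -> R) (w : V2) (l : R) :
  is_derive (w 0 0) 1 (fun x => F (x, w 0 1)) l ->
  is_derive w (e_ 0) (fun w : V2 => F (w 0 0, w 0 1) : R^o) l.
Proof.
move=> /is_deriveP H; apply/is_deriveP; apply: cvg_trans H; apply: near_eq_cvg; apply: nearW => h.
by rewrite /= /GRing.scale /= !mxE /= !mulr1 mulr0 add0r.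
Qed.

Lemma is_derive_slice1 (F : R * R -> R) (w : V2) (l : R) :
  is_derive (w 0 1) 1 (fun y => F (w 0 0, y)) l ->
  is_derive w (e_ 1) (fun w : V2 => F (w 0 0, w 0 1) : R^o) l.
Proof.
move=> /is_deriveP H; apply/is_deriveP; apply: cvg_trans H; apply: near_eq_cvg; apply: nearW => h.
by rewrite /= /GRing.scale /= !mxE /= !mulr1 mulr0 add0r.
Qed.

Lemma C1_at_partials (F a b : R * R -> R) (B : R) (w : V2) :
  (forall x y : R, `|x| < B -> `|y| < B -> is_derive x 1 (fun x => F (x, y)) (a (x, y))) ->
  (forall x y : R, `|x| < B -> `|y| < B -> is_derive y 1 (fun y => F (x, y)) (b (x, y))) ->
  {for (w 0 0, w 0 1), continuous a} -> {for (w 0 0, w 0 1), continuous b} ->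
  `|w 0 0| < B -> `|w 0 1| < B ->
  C1_at (fun w : V2 => F (w 0 0, w 0 1)) w /\
  (is_derive w (e_ 0) (fun w : V2 => F (w 0 0, w 0 1) : R^o) (a (w 0 0, w 0 1)) /\
  is_derive w (e_ 1) (fun w : V2 => F (w 0 0, w 0 1) : R^o) (b (w 0 0, w 0 1))).
Proof.
move=> da db ca cb w0 w1.
have N (i : 'I_2) : `|w 0 i| < B -> nbhs w (fun u : V2 => `|u 0 i| < B).
  by move=> wi; exact: (near_norm_lt (@coord_continuous R 1 2 0 i w) wi).
have cw : {for w, continuous (fun w : V2 => (w 0 0, w 0 1))}.
  by apply: continuous_pair_for; exact: coord_continuous.
have D0 (u : V2) : `|u 0 0| < B -> `|u 0 1| < B ->
    is_derive u (e_ 0) (fun w : V2 => F (w 0 0, w 0 1) : R^o) (a (u 0 0, u 0 1)).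
  by move=> u0 u1; apply: is_derive_slice0; exact: da.
have D1 (u : V2) : `|u 0 0| < B -> `|u 0 1| < B ->
    is_derive u (e_ 1) (fun w : V2 => F (w 0 0, w 0 1) : R^o) (b (u 0 0, u 0 1)).
  by move=> u0 u1; apply: is_derive_slice1; exact: db.
have i01 (i : 'I_2) : i = 0 \/ i = 1.
  by case: i => [[|[|i]] Hi] //; [left|right]; exact: val_inj.
split; last by split; [exact: D0|exact: D1].
split.
  apply: filterS2 (N 0 w0) (N 1 w1) => u u0 u1 i; have [->|->] := i01 i.
    by have [] := D0 u u0 u1.
  by have [] := D1 u u0 u1.
move=> i; have [->|->] := i01 i.
  have E : nbhs w (fun u : V2 => a (u 0 0, u 0 1) = 'D_(e_ 0) (fun w : V2 => F (w 0 0, w 0 1) : R^o) u).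
    by apply: filterS2 (N 0 w0) (N 1 w1) => u u0 u1; have [_ ->] := D0 u u0 u1.
  exact: near_eq_continuous E (continuous_comp cw ca).
have E : nbhs w (fun u : V2 => b (u 0 0, u 0 1) = 'D_(e_ 1) (fun w : V2 => F (w 0 0, w 0 1) : R^o) u).
  by apply: filterS2 (N 0 w0) (N 1 w1) => u u0 u1; have [_ ->] := D1 u u0 u1.
exact: near_eq_continuous E (continuous_comp cw cb).
Qed.

Lemma flow_box_exists : exists B, flow_box_at p B.
Proof.
have pp := dom_self p.
pose I := chart p @` dom p.
have oI : open I by exact: chart_image_open.
have Ix0 : I x0 by exists p.
pose A (v : V2) : V2 -> R^o := alpha g X p v \o chart_inv p.
have CA v n : Cn n I (A v).
  have := smoothM_Cn p n (alpha_smooth fn (p := p) v); rewrite /chart_image setIid; exact.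
have CX i n : Cn n I (fun y => comp p X (chart_inv p y) 0 i : R^o).
  have := smoothM_Cn p n (comp_smooth (p := p) i openT (fn_X fn)); rewrite /chart_image setTI setIid; exact.
(* In the affine coordinates the form is [a dx + b dy] and the field is [(X1, X2)]; [c] is the
   common value of the cross derivatives. *)
pose a z := A X0 (lin_pt z); pose b z := A Y0 (lin_pt z).
pose c z := 'D_Y0 (A X0) (lin_pt z).
pose Xc (w : V2) z := 2^-1 * mdot (g p) (comp p X (chart_inv p (lin_pt z))) w.
pose X1 := Xc Y0; pose X2 := Xc X0.
have invI y : I y -> dom p (chart_inv p y) /\ chart p (chart_inv p y) = y.
  by move=> [x px <-]; rewrite chartK.
have cA (v : V2) z : I (lin_pt z) -> {for z, continuous (fun z => A v (lin_pt z))}.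
  by move=> Iz; exact: (continuous_comp (@lin_pt_continuous z) (Cn_continuous (CA v 0%N) Iz)).
have cXc (w : V2) z : I (lin_pt z) -> {for z, continuous (Xc w)}.
  move=> Iz; pose k0 := 2^-1 * (g p 0 0 * w 0 0 + g p 0 1 * w 0 1).
  pose k1 := 2^-1 * (g p 1 0 * w 0 0 + g p 1 1 * w 0 1).
  have -> : Xc w = (fun z => k0 * comp p X (chart_inv p (lin_pt z)) 0 0 + k1 * comp p X (chart_inv p (lin_pt z)) 0 1).
    apply/funext => s; rewrite /Xc !mdotE /k0 /k1; ring.
  have ck (k : R) (i : 'I_2) : {for z, continuous (fun z => k * comp p X (chart_inv p (lin_pt z)) 0 i)}.
    have c1 := continuous_comp (@lin_pt_continuous z) (Cn_continuous (CX i 0%N) Iz).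
    exact: (continuous_comp c1 (@mulrl_continuous _ k _)).
  exact: (cvgD (ck k0 0) (ck k1 1)).
have L0 : lin_pt (0, 0) = x0 by rewrite /lin_pt /= !scale0r !add0r.
have b0 : b (0, 0) = 2.
  by rewrite /b L0 /A /= (chartK pp) /alpha ext_self; exact: nb_XY nb.
have X10 : X1 (0, 0) = 1.
  rewrite /X1 /Xc L0 (chartK pp) comp_self; have -> : mdot (g p) (X p) Y0 = 2 by exact: nb_XY nb.
  by rewrite mulVf ?pnatr_eq0.
(* At the origin [b = 2] and [X1 = 1], so a small square has [b >= 1/2] and [1/2 <= X1 <= 2], the
   bounds required by [plane_flow_box]. *)
have [B B0 HB] : exists2 B : R, 0 < B & forall x y : R, `|x| < B -> `|y| < B ->
    [/\ I (lin_pt (x, y)), 2^-1 <= b (x, y) & 2^-1 <= X1 (x, y) <= 2].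
  have N1 : \forall z \near (0 : R, 0 : R), I (lin_pt z).
    by apply: (near_image (@lin_pt_continuous _)); rewrite L0; exact: open_nbhs_nbhs.
  have I0 : I (lin_pt (0, 0)) by rewrite L0.
  have N2 := near_dist ltr01 (cA Y0 _ I0).
  have h0 : 0 < 2^-1 :> R by rewrite invr_gt0.
  have N3 := near_dist h0 (cXc Y0 _ I0).
  have [e e0 He] := near00 (filterI N1 (filterI N2 N3)).
  exists e => // x y xe ye; have [Iz [bz Xz]] := He x y xe ye; split=> //.
    have : `|b (x, y) - b (0, 0)| < 1 by exact: bz.
    by rewrite b0; exact: within_one.
  have : `|X1 (x, y) - X1 (0, 0)| < 2^-1 by exact: Xz.
  by rewrite X10; exact: within_half.
have invA (x y : R) : `|x| < B -> `|y| < B -> [/\ dom p (chart_inv p (lin_pt (x, y))),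
    chart p (chart_inv p (lin_pt (x, y))) = lin_pt (x, y), xi (lin_pt (x, y)) = x & zeta (lin_pt (x, y)) = y].
  by move=> xB yB; have [Iz _ _] := HB x y xB yB; have [? ?] := invI _ Iz; have [? ?] := xi_lin_pt (x, y).
have h0 : 0 < 2^-1 :> R by rewrite invr_gt0.
have cc (x y : R) : `|x| < B -> `|y| < B -> {for (x, y), continuous c}.
  move=> xB yB; have [Iz _ _] := HB x y xB yB.
  have cD := Cn_continuous (Cn_derive Y0 (CA X0 1%N)) Iz.
  exact: (continuous_comp (@lin_pt_continuous _) cD).
have da (x y : R) : `|x| < B -> `|y| < B -> is_derive y 1 (fun y => a (x, y)) (c (x, y)).
  move=> xB yB; have [Iz _ _] := HB x y xB yB.
  have E (t : R) : lin_pt (x, t) = t *: Y0 + (x *: X0 + x0) by rewrite /lin_pt /= addrCA.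
  have Dv : derivable (A X0) (y *: Y0 + (x *: X0 + x0)) Y0 by rewrite -E; apply: (Cn_derivable (CA X0 1%N)).
  have H := is_derive_line Dv; rewrite /c E.
  by have -> : (fun t => a (x, t)) = (fun t : R => A X0 (t *: Y0 + (x *: X0 + x0))) by apply/funext => t; rewrite /a E.
have db (x y : R) : `|x| < B -> `|y| < B -> is_derive x 1 (fun x => b (x, y)) (c (x, y)).
  move=> xB yB; have [Iz _ _] := HB x y xB yB.
  have Dv : derivable (A Y0) (x *: X0 + (y *: Y0 + x0)) X0 by apply: (Cn_derivable (CA Y0 1%N)).
  have H := is_derive_line Dv.
  have [q qp Eq] := Iz.
  have E : 'D_X0 (A Y0) (x *: X0 + (y *: Y0 + x0)) = c (x, y).
    have := alpha_closed fn X0 Y0 qp; rewrite Eq; exact.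
  by rewrite -E.
(* The form annihilates the field because [X] is null. *)
have aX (x y : R) : `|x| < B -> `|y| < B -> a (x, y) * X1 (x, y) + b (x, y) * X2 (x, y) = 0.
  move=> xB yB; have [pz _ _ _] := invA x y xB yB.
  set q := chart_inv p (lin_pt (x, y)) in pz *.
  have E : comp p X q = X1 (x, y) *: X0 + X2 (x, y) *: Y0 by exact: (null_expand _ nb).
  have Z : alpha g X p (comp p X q) q = 0.
    by rewrite /alpha extE//; exact: nb_XX (fn_basis fn q).
  have comb (u1 u2 u3 u4 : R) : u1 * u2 + u3 * u4 = 0 -> u2 * u1 + u4 * u3 = 0 by rewrite mulrC [u3 * _]mulrC.
  by apply: comb; rewrite -Z E alpha_lin.
have [F [G [k1 [k2 [r1 [r [[r0 rr1 r1B F0] HF HG dG [Hk HkI [k10 [k200 dk2]]]]]]]]]] :=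
  plane_flow_box B0 h0 (fun x y xB yB => cA X0 (x, y) (let: And3 P _ _ := HB x y xB yB in P))
   (fun x y xB yB => cA Y0 (x, y) (let: And3 P _ _ := HB x y xB yB in P)) cc
   (fun x y xB yB => cXc Y0 (x, y) (let: And3 P _ _ := HB x y xB yB in P)) da db
   (fun x y xB yB => let: And3 _ P _ := HB x y xB yB in P)
   (fun x y xB yB => let: And3 _ _ P := HB x y xB yB in P) aX.
have lB (t : R) : `|t| < B / 2 -> `|t| < B by move=> H; apply: lt_trans H _; lra.
have l1 (t : R) : `|t| < r1 -> `|t| < B / 2 by move=> H; exact: lt_le_trans r1B.
have lr (t : R) : `|t| < r -> `|t| < r1 by move=> H; exact: lt_le_trans rr1.
pose Fh (y : V2) : R := F (xi y, zeta y).
have OI (y : V2) : `|xi y| < B / 2 -> `|zeta y| < B / 2 -> I y.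
  by move=> /lB y0 /lB y1; have [] := HB _ _ y0 y1; rewrite lin_ptK.
have dF (y v : V2) : `|xi y| < B / 2 -> `|zeta y| < B / 2 -> is_derive y v (Fh : V2 -> R^o) (A v y).
  move=> y0 y1; pose phi (y : V2) : V2 := \row_i (if i == 0 then xi y else zeta y).
  have p0 y' : phi y' 0 0 = xi y' by rewrite mxE.
  have p1 y' : phi y' 0 1 = zeta y' by rewrite mxE.
  pose l : V2 := \row_i (if i == 0 then 2^-1 * mdot (g p) v Y0 else 2^-1 * mdot (g p) v X0).
  have dphi : is_derive y v phi l.
    apply: is_derive_row => i; have [i0|i0] := eqVneq i 0.
      have -> : (fun y => phi y 0 i : R^o) = (fun y => xi y : R^o) by apply/funext => y'; rewrite mxE i0 eqxx.
      by rewrite mxE i0 eqxx; apply: mdot_is_derive; exact: is_derive_id.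
    have -> : (fun y => phi y 0 i : R^o) = (fun y => zeta y : R^o) by apply/funext => y'; rewrite mxE (negbTE i0).
    by rewrite mxE (negbTE i0); apply: mdot_is_derive; exact: is_derive_id.
  have HF1 (x z : R) (xB : `|x| < B / 2) (zB : `|z| < B / 2) : is_derive x 1 (fun x => F (x, z)) (a (x, z)) by have [P _ _] := HF x z xB zB; exact: P.
  have HF2 (x z : R) (xB : `|x| < B / 2) (zB : `|z| < B / 2) : is_derive z 1 (fun z => F (x, z)) (b (x, z)) by have [_ P _] := HF x z xB zB; exact: P.
  have Iy : I (lin_pt (phi y 0 0, phi y 0 1)) by rewrite p0 p1 lin_ptK; exact: OI.
  have y0' : `|phi y 0 0| < B / 2 by rewrite p0.
  have y1' : `|phi y 0 1| < B / 2 by rewrite p1.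
  have [C1 [[_ E0] [_ E1]]] := C1_at_partials HF1 HF2 (cA X0 _ Iy) (cA Y0 _ Iy) y0' y1'.
  have := is_derive_comp2 dphi C1; rewrite E0 E1 p0 p1 /a /b lin_ptK.
  have -> : l 0 0 * A X0 y + l 0 1 * A Y0 y = A v y.
    have [q qp Eq] := OI y y0 y1.
    rewrite [l 0 0]mxE [l 0 1]mxE /= {3}(null_expand v nb) /A /= -Eq (chartK qp).
    by rewrite alpha_lin.
  have -> : (fun w : V2 => F (w 0 0, w 0 1)) \o phi = Fh by apply/funext => y'; rewrite /= p0 p1.
  exact.
have cxi (q : M) : dom p q -> {for q, continuous (fun y => xi (chart p y))}.
  by move=> pq; exact: (continuous_comp (chart_continuous_for pq) (@xi_continuous Y0 _)).
have cze (q : M) : dom p q -> {for q, continuous (fun y => zeta (chart p y))}.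
  by move=> pq; exact: (continuous_comp (chart_continuous_for pq) (@xi_continuous X0 _)).
have cFh (q : M) : dom p q -> `|xi (chart p q)| < B / 2 -> `|zeta (chart p q)| < B / 2 ->
    {for q, continuous (fun y => Fh (chart p y))}.
  move=> pq q0 q1; have [_ _ cF] := HF _ _ q0 q1.
  exact: (continuous_comp (continuous_pair_for (cxi q pq) (cze q pq)) cF).
pose bh (y : M) : R := Fh (chart p y); pose bt (y : M) : R := G (xi (chart p y), bh y).
pose bm (s h : R) : M := chart_inv p (lin_pt (k1 (s, h), k2 (s, h))).
pose D : set M := [set y | [/\ dom p y, `|xi (chart p y)| < r1, `|zeta (chart p y)| < B / 2,
   `|bh y| < r & `|bt y| < r]].
have cbt (q : M) : D q -> {for q, continuous bt}.
  move=> [pq q0 q1 q2 q3]; have cb := cFh q pq (l1 _ q0) q1.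
  have [_ cG] := HG _ _ q0 (lr _ q2).
  exact: (continuous_comp (continuous_pair_for (cxi q pq) cb) cG).
have oD : open D.
  rewrite openE => q Dq; have [pq q0 q1 q2 q3] := Dq.
  have N0 := near_dom pq; have N1 := near_norm_lt (cxi q pq) q0; have N2 := near_norm_lt (cze q pq) q1.
  have N3 := near_norm_lt (cFh q pq (l1 _ q0) q1) q2; have N4 := near_norm_lt (cbt q Dq) q3.
  by rewrite /interior; near=> z; split; near: z.
have Hm (s h : R) : `|s| < r -> `|h| < r -> [/\ D (bm s h), chart p (bm s h) = lin_pt (k1 (s, h), k2 (s, h)),
    bt (bm s h) = s & bh (bm s h) = h].
  move=> sr hr; have [[k1r k2r Fk Gk] _] := Hk s h sr hr.
  have [d E e0 e1] := invA _ _ (lB _ (l1 _ k1r)) (lB _ k2r).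
  have E0 : bh (bm s h) = h by rewrite /bh /Fh /bm E e0 e1.
  have E1 : bt (bm s h) = s by rewrite /bt E0 /bm E e0.
  by split=> //; split; rewrite ?E0 ?E1 // /bm E ?e0 ?e1.
have bmK (y : M) : D y -> bm (bt y) (bh y) = y.
  move=> [py y0 y1 y2 y3]; have [E0 E1] := HkI _ _ y0 y1 y2 y3.
  by rewrite /bm /bt /bh E0 E1 lin_ptK chartK.
have Fhinv (y : V2) : chart_image p D y -> (bh \o chart_inv p) y = Fh y.
  by move=> [q [_ pq] <-]; rewrite /= chartK.
have DV (y : V2) : chart_image p D y -> `|xi y| < B / 2 /\ `|zeta y| < B / 2.
  by move=> [q [[_ q0 q1 _ _] pq] <-]; split=> //; exact: l1.
have Sb : smoothM (F := R^o) D bh.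
  apply: smoothM_local => y Dy; have [py _ _ _ _] := Dy; exists D, p; split=> // n.
  apply: (Cn_eq (f := Fh : V2 -> R^o)); first exact: chart_image_opens.
    by move=> z Dz; rewrite Fhinv.
  (* The partial derivatives of the height are the smooth coefficients of the form, which gives its
     smoothness at every order. *)
  apply: CnS; apply: (Cn_primitive (a := A (e_ 0)) (b := A (e_ 1))); first exact: chart_image_opens.
  + move=> z v Dz; have [z0 z1] := DV z Dz.
    have [q qp Eq] := OI z z0 z1; have := dF z v z0 z1.
    have -> : A v z = v 0 0 * A (e_ 0) z + v 0 1 * A (e_ 1) z by rewrite /A /= -Eq (chartK qp); exact: alpha_row.
    by [].
  + by apply: CnW (CA _ n) => z /DV[z0 z1]; exact: OI.
  + by apply: CnW (CA _ n) => z /DV[z0 z1]; exact: OI.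
  move=> z /DV[z0 z1]; have [_ _ cF] := HF _ _ z0 z1.
  exact: (continuous_comp (continuous_pair_for (@xi_continuous Y0 z) (@xi_continuous X0 z)) cF).
have xi0 : xi x0 = 0 /\ zeta x0 = 0 by have := xi_lin_pt (0, 0); rewrite L0.
have r00 : `|0 : R| < r by rewrite normr0.
have r10 : `|0 : R| < r1 by rewrite normr0; exact: lt_le_trans rr1.
exists (@Box R M D bt bh bm r); split.
- split=> //.
  + by move=> q [pq q0 q1 _ _]; exact: cFh pq (l1 _ q0) q1.
  + move=> s h sr hr; have [[k1r k2r _ _] [ck1 ck2 _ _]] := Hk s h sr hr.
    have [Iz _ _] := HB _ _ (lB _ (l1 _ k1r)) (lB _ k2r).
    have c1 : {for (s, h), continuous (fun z => (k1 z, k2 z))} by exact: continuous_pair_for.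
    have c2 := continuous_comp (continuous_comp c1 (@lin_pt_continuous _)) (chart_inv_continuous_for Iz).
    have -> : (fun z : R * R => bm z.1 z.2) = chart_inv p \o (lin_pt \o (fun z => (k1 z, k2 z))) by apply/funext => -[].
    exact: c2.
  + by move=> q [].
  + by move=> q [].
  + by move=> s h sr hr; have [] := Hm s h sr hr.
  + by move=> s h sr hr; have [] := Hm s h sr hr.
  + by move=> s h sr hr; have [] := Hm s h sr hr.
- have E0 : bh p = 0 by rewrite /bh /Fh -/x0 xi0.1 xi0.2.
  have E1 : bt p = 0 by rewrite /bt E0 -/x0 xi0.1; have [] := HG 0 0 r10 r10.
  split=> //; split=> //; rewrite ?E0 ?E1 // -/x0 ?xi0.1 ?xi0.2 // normr0 divr_gt0 //.
- by move=> y [].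
- exact: Sb.
- move=> y v Dy; have [py y0 y1 _ _] := Dy.
  have E := dM_chart v oD Dy py Sb; apply: (etrans E).
  have N : \forall z \near chart p y, Fh z = (bh \o chart_inv p) z.
    have NO : \forall z \near chart p y, chart_image p D z.
      by apply: open_nbhs_nbhs; split; [exact: chart_image_opens|exact: chart_image_in].
    by apply: filterS NO => z Dz; rewrite Fhinv.
  have [_ E2] := near_eq_is_derive N (dF (chart p y) (trans y p y v) (l1 _ y0) y1).
  apply: (etrans E2); rewrite /A /= (chartK py) /alpha /ext trans_trans ?transK//; exact: dom_self.
- move=> s h sr hr; have [[k1r k2r _ _] [_ _ dk1' dk2']] := Hk s h sr hr.
  have [_ Em _ _] := Hm s h sr hr.
  have N : \forall t \near s, lin_pt (k1 (t, h), k2 (t, h)) = chart p (bm t h).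
    have Ns : \forall t \near s, `|t| < r by apply: near_norm_lt => //; exact: cvg_id.
    by apply: filterS Ns => t tr; have [_ ->] := Hm t h tr hr.
  apply: near_eq_is_derive N _.
  rewrite (null_expand (comp p X (bm s h)) nb) -/(Xc Y0 (k1 (s, h), k2 (s, h))) -/(Xc X0 (k1 (s, h), k2 (s, h))).
  apply: is_derive_row => i; rewrite row_combE.
  have -> : (fun t : R => lin_pt (k1 (t, h), k2 (t, h)) 0 i : R^o) =
      (fun t : R => (X0 0 i *: (k1 (t, h) : R^o) + Y0 0 i *: (k2 (t, h) : R^o)) + x0 0 i).
    by apply/funext => t; rewrite /lin_pt /= !mxE /GRing.scale /=; ring.
  have -> : Xc Y0 (k1 (s, h), k2 (s, h)) * X0 0 i + Xc X0 (k1 (s, h), k2 (s, h)) * Y0 0 i =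
      X0 0 i *: (X1 (k1 (s, h), k2 (s, h)) : R^o) + Y0 0 i *: (X2 (k1 (s, h), k2 (s, h)) : R^o) + 0.
    by rewrite addr0 /GRing.scale /= /X1 /X2 mulrC [in RHS]mulrC; congr (_ + _); rewrite mulrC.
  apply: is_deriveD; apply: is_deriveD; exact: is_deriveZ.
- move=> c' d Hc dc s sd; have sd' := le_lt_trans (normr_ge0 s) sd.
  have d00 : `|0 : R| < d by rewrite normr0.
  have [D0 _] := Hc 0 d00.
  (* At constant height and with velocity [X], the abscissa moves at speed [X1] while [G] has slope
     [X1^-1], so time has derivative 1. *)
  have T (t : R) : `|t| < d -> is_derive (t + 0) 1 (fun t => G (xi (chart p (c' t)), bh (c' 0))) 1.
    rewrite addr0 => td; have [Dt Et] := Hc t td; have [pt t0 t1 t2 t3] := Dt.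
    have d1 := mdot_is_derive Y0 (dc t td).
    have := dG _ _ t0 t1 (lr _ t2); rewrite -/(Fh (chart p (c' t))) -/(bh (c' t)) => d2.
    have Et' : bh (c' t) = bh (c' 0) := Et; move: d2; rewrite Et' => d2.
    have := is_derive_comp1 d1 d2.
    have -> : (X1 (xi (chart p (c' t)), zeta (chart p (c' t))))^-1 * (2^-1 * mdot (g p) (comp p X (c' t)) Y0) = 1.
      have -> : 2^-1 * mdot (g p) (comp p X (c' t)) Y0 = X1 (xi (chart p (c' t)), zeta (chart p (c' t))).
        by rewrite /X1 /Xc lin_ptK chartK.
      rewrite mulVf//; have [_ _ /andP[H _]] := HB _ _ (lB _ (l1 _ t0)) (lB _ t1).
      by rewrite gt_eqF//; exact: lt_le_trans H.
    by [].
  have := constant_derive1 T sd; rewrite addr0 mulr1 => E; have [_ Es] := Hc s sd.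
  have Es' : bh (c' s) = bh (c' 0) := Es.
  by rewrite /= /bt Es' -[LHS](subrK (G (xi (chart p (c' 0)), bh (c' 0)))) E addrC.
move=> h Sh.
have dh := is_derive_dM Y0 openT (Logic.I : [set: M] p) Sh.
have dl : is_derive (0 : R) 1 (fun t : R => (h \o chart_inv p) (t *: Y0 + x0)) (dM h p Y0).
  have := @is_derive_line R V2 R^o (h \o chart_inv p) x0 Y0 0; rewrite scale0r add0r.
  by case: (dh) => d E; rewrite E => H; apply: H.
move: dl; rewrite -{1}k200 => dl.
(* Since [k1] vanishes at time 0, the transversal is the line through [x0] along [Y p], run at the
   rate [b (0, 0)^-1 = 1/2]. *)
have dk : is_derive (0 : R) 1 (fun h => k2 (0, h)) 2^-1.
  have -> : 2^-1 = (b (0, 0))^-1 by rewrite b0.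
  exact: dk2.
have := is_derive_comp1 dk dl; rewrite mulrC.
apply: near_eq_is_derive; apply: filterS (near_small r0) => t tr.
by rewrite /= /bm k10// /lin_pt /= scale0r add0r.
Unshelve. all: by end_near.
Qed.
End AtPoint.
End FlowBoxes.

(** * X-lines *)

Section XLines.
Context {R : realType} {M : surface R} (g : lorentz_metric M).
Local Notation V2 := 'rV[R]_2.
Local Notation e_ i := (delta_mx 0 i : V2).
Variables X Y : M -> tangent R.
Hypothesis fn : flat_null_frame g X Y.

Lemma locally_constant (W : set M) (f : M -> R) x : open W -> W x -> smoothM (F := R^o) W f ->
  (forall z v, W z -> dM f z v = 0) -> \forall z \near x, f z = f x.
Proof.
move=> oW Wx Sf Z; have xx := dom_self x.
have oI : open (chart_image x W) by exact: chart_image_opens.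
have N : \forall y \near chart x x, (f \o chart_inv x) y = (f \o chart_inv x) (chart x x).
  apply: (zero_derive_near oI); first exact: chart_image_in.
  move=> y v /chart_imageP[Wz xz E]; have := is_derive_chart v oW Wz xz Sf; rewrite E => -[d D].
  have E0 : 'D_v (f \o chart_inv x : V2 -> R^o) y = 0.
    by rewrite -(Z _ (ext x v (chart_inv x y)) Wz) (dM_ext v oW Wz xz Sf) E.
  exact: (DeriveDef d E0).
have N2 := near_image (chart_continuous_for xx) N.
near=> z; have xz : dom x z by near: z; exact: near_dom.
have : (f \o chart_inv x) (chart x z) = (f \o chart_inv x) (chart x x) by near: z.
by rewrite /= !chartK.
Unshelve. all: by end_near.
Qed.

Lemma smoothMB (W : set M) (f h : M -> R) : open W -> smoothM (F := R^o) W f -> smoothM (F := R^o) W h ->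
  smoothM (F := R^o) W (fun x => f x - h x).
Proof.
by move=> oW Sf Sh; apply: smoothM_CnP => p n; apply: CnB; [exact: chart_image_opens|exact: smoothM_Cn|exact: smoothM_Cn].
Qed.

Lemma dMB (W : set M) (f h : M -> R) x v : open W -> W x -> smoothM (F := R^o) W f ->
  smoothM (F := R^o) W h -> dM (fun y => f y - h y) x v = dM f x v - dM h x v.
Proof.
move=> oW Wx Sf Sh.
by have [_ <-] := is_deriveB (is_derive_dM v oW Wx Sf) (is_derive_dM v oW Wx Sh).
Qed.

Lemma velocity_change (p q : M) (c : R -> M) (s : R) (l : V2) : {for s, continuous c} ->
  dom p (c s) -> dom q (c s) -> is_derive s 1 (fun t : R^o => chart p (c t) : V2) l ->
  is_derive s 1 (fun t : R^o => chart q (c t) : V2) (trans p q (c s) l).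
Proof.
move=> cc pc qc D; apply: is_derive_row => i.
have oq := dom_open q; have C1 : C1_at (coord q i \o chart_inv p) (chart p (c s)).
  apply: (@Cn_C1_at _ 0 (chart_image p (dom q))); [exact: chart_image_opens|exact: chart_image_in|].
  exact/smoothM_Cn/coord_smooth.
have H := is_derive_comp2 D C1.
have N : \forall t \near s, ((coord q i \o chart_inv p) \o (fun t : R^o => chart p (c t))) t = chart q (c t) 0 i.
  have Np := near_image cc (near_dom pc).
  by apply: filterS Np => t pt; rewrite /= chartK.
have {}H := near_eq_is_derive N H.
have E := derive_chart_linear l oq qc pc (@coord_smooth _ _ q i).
have E2 := trans_coord l i pc qc.
have -> : trans p q (c s) l 0 i = l 0 0 * 'D_(e_ 0) (coord q i \o chart_inv p : V2 -> R^o) (chart p (c s)) +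
   l 0 1 * 'D_(e_ 1) (coord q i \o chart_inv p : V2 -> R^o) (chart p (c s)) by exact: etrans E2 E.
exact: H.
Qed.

Lemma curve_derivative (p : M) (c : R -> M) (s : R) (l : V2) (W : set M) (f : M -> R) :
  {for s, continuous c} -> dom p (c s) ->
  is_derive s 1 (fun t : R^o => chart p (c t) : V2) l ->
  open W -> W (c s) -> smoothM (F := R^o) W f ->
  is_derive s 1 (fun t => f (c t)) (dM f (c s) (ext p l (c s))).
Proof.
move=> cc pc D oW Wc Sf.
have C1 : C1_at (f \o chart_inv p) (chart p (c s)).
  apply: (@Cn_C1_at _ 0 (chart_image p W)); [exact: chart_image_opens|exact: chart_image_in|].
  exact: smoothM_Cn.
have H := is_derive_comp2 D C1.
have N : \forall t \near s, ((f \o chart_inv p) \o (fun t : R^o => chart p (c t))) t = f (c t).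
  have Np := near_image cc (near_dom pc).
  by apply: filterS Np => t pt; rewrite /= chartK.
have {}H := near_eq_is_derive N H.
have E := etrans (dM_ext l oW Wc pc Sf) (derive_chart_linear l oW Wc pc Sf).
by rewrite E; exact: H.
Qed.

Lemma comp_trans p q (V : M -> tangent R) x : dom p x -> dom q x ->
  trans p q x (comp p V x) = comp q V x.
Proof. by move=> px qx; rewrite /comp trans_trans//; exact: dom_self. Qed.

Variable bx : M -> @box R M.
Hypothesis fb : forall p, flow_box_at g X Y p (bx p).

Let isb p := fb_box (fb p).

(** Both heights are primitives of the same form g(X, .). *)
Lemma heights_differ p q y : bdom (bx p) y -> bdom (bx q) y ->
  \forall z \near y, bheight (bx q) z - bheight (bx p) z = bheight (bx q) y - bheight (bx p) y.
Proof.
move=> py qy; pose W := bdom (bx p) `&` bdom (bx q).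
have oW : open W by apply: openI; [exact: (bdom_open (isb p))|exact: (bdom_open (isb q))].
have Sp := smoothMW (@subIsetl _ _ _ : W `<=` _) (fb_height (fb p)).
have Sq := smoothMW (@subIsetr _ _ _ : W `<=` _) (fb_height (fb q)).
have Sf := smoothMB oW Sq Sp.
apply: (locally_constant oW _ Sf) => // z v Wz.
have E1 := dMB v oW Wz Sq Sp; have E3 := fb_alpha (fb p) v Wz.1; have E4 := fb_alpha (fb q) v Wz.2.
by apply: (etrans E1); rewrite E3 E4 subrr.
Qed.

Lemma bmap_near (p : M) (t r : R) : `|t| < brad (bx p) -> `|r| < brad (bx p) ->
  {for t, continuous (fun s => bmap (bx p) s r)}.
Proof.
move=> tp rp; apply: (continuous_comp (f := fun s : R => (s, r)) (g := fun z : R * R => bmap (bx p) z.1 z.2)).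
  by apply: continuous_pair_for; [exact: cvg_id|exact: cvg_cst].
exact: (bmap_continuous (isb p)).
Qed.

Lemma X_atlas : flow_atlas bx.
Proof.
split; [exact: isb|by move=> p; exact: (fb_center (fb p))|exact: heights_differ|].
move=> p q y py qy; set t := btime (bx p) y; set r := bheight (bx p) y.
have tp : `|t| < brad (bx p) by exact: (btime_lt (isb p)).
have rp : `|r| < brad (bx p) by exact: (bheight_lt (isb p)).
pose c (s : R) := bmap (bx p) (t + s) r.
have c0 : c 0 = y by rewrite /c addr0 (bmapK (isb p)).
have ct : {for (0 : R), continuous (fun s : R => t + s)} by apply: cvgD; [exact: cvg_cst|exact: cvg_id].
have cc : {for (0 : R), continuous c}.
  apply: (continuous_comp (f := fun s : R => t + s) (g := fun s => bmap (bx p) s r)) => //.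
  by rewrite addr0; exact: bmap_near.
have N1 : \forall s \near (0 : R), `|t + s| < brad (bx p) by apply: near_norm_lt => //; rewrite addr0.
have N2 : \forall s \near (0 : R), bdom (bx q) (c s) /\
    bheight (bx q) (c s) - bheight (bx p) (c s) = bheight (bx q) y - bheight (bx p) y.
  apply: (near_image (P := fun z => bdom (bx q) z /\ bheight (bx q) z - bheight (bx p) z = bheight (bx q) y - bheight (bx p) y) cc).
  rewrite c0; apply: filterI; last exact: heights_differ.
  by apply: open_nbhs_nbhs; split=> //; exact: (bdom_open (isb q)).
have [d /= d0 Hd] := filterI N1 N2.
have Hd' (s : R) : `|s| < d -> [/\ `|t + s| < brad (bx p), bdom (bx p) (c s), bheight (bx p) (c s) = r,
    bdom (bx q) (c s) & bheight (bx q) (c s) = bheight (bx q) y].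
  move=> sd; have [] := Hd s; rewrite /= ?sub0r ?normrN// => ts [qs E].
  have ps : bdom (bx p) (c s) by exact: (bdom_bmap (isb p)).
  have hs : bheight (bx p) (c s) = r by exact: (bheight_bmap (isb p)).
  by split=> //; move: E; rewrite hs -/r => /addIr.
exists d => // s /=; rewrite sub0r normrN => sd.
have -> : btime (bx q) y = btime (bx q) (c 0) by rewrite c0.
(* The integral curve of box [p] is read in box [q]: its height there is constant because heights
   differ by a constant, and its velocity is still [X]. *)
apply: (fb_time (fb q) (c := c)) sd.
  by move=> u ud; have [_ _ _ ? E] := Hd' u ud; rewrite c0.
move=> u ud; have [tu pu _ qu _] := Hd' u ud.
have du : is_derive u 1 (fun s : R^o => chart p (c s) : V2) (comp p X (c u)).
  have := fb_velocity (fb p) tu rp => /is_deriveP H; apply/is_deriveP.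
  by apply: cvg_trans H; apply: near_eq_cvg; near=> h; rewrite /c /= [in LHS]addrCA.
have cu : {for u, continuous c}.
  apply: (continuous_comp (f := fun s : R => t + s) (g := fun s => bmap (bx p) s r)); last exact: bmap_near.
  by apply: cvgD; [exact: cvg_cst|exact: cvg_id].
have pu' := fb_dom (fb p) pu; have qu' := fb_dom (fb q) qu.
by rewrite -(comp_trans X pu' qu'); exact: velocity_change.
Unshelve. all: by end_near.
Qed.

Variable F : R -> M -> M.
Hypothesis fl : flow_structure bx F.

Lemma flow_velocity y s p : dom p (F s y) ->
  is_derive s 1 (fun t : R^o => chart p (F t y) : V2) (comp p X (F s y)).
Proof.
move=> py; set z := F s y in py *; have zz := center_dom fl z.
have r0 := rad_gt0 fl z.
have N : \forall t \near s, bmap (bx z) (t - s) 0 = F t y.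
  have Ns : \forall t \near s, `|t - s| < brad (bx z).
    by apply: near_norm_lt; [apply: cvgB; [exact: cvg_id|exact: cvg_cst]|rewrite subrr normr0].
  apply: filterS Ns => t ts; have E : F t y = F (t - s) z by rewrite /z (fs_D fl) subrK.
  rewrite E (fs_local fl zz) ?(center_time fl) ?add0r//.
  by rewrite /local_flow (center_time fl) (center_height fl) add0r.
have z0 : `|0 : R| < brad (bx z) by rewrite normr0.
have D0 := fb_velocity (fb z) z0 z0.
have D1 : is_derive s 1 (fun t : R^o => chart z (F t y) : V2) (comp z X z).
  have N' : \forall t \near s, chart z (bmap (bx z) (t - s) 0) = chart z (F t y).
    by apply: filterS N => t ->.
  apply: near_eq_is_derive N' _; have S0 : bmap (bx z) 0 0 = z := slice0 fl z; move: D0; rewrite S0.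
  move=> /is_deriveP H; apply/is_deriveP; apply: cvg_trans H; apply: near_eq_cvg; near=> h.
  by rewrite /= addr0 subrr addrK.
have cz : {for s, continuous (fun t => F t y)} by exact: (flow_continuous_t fl).
have pz : dom z (F s y) by exact: (dom_self z).
by rewrite -(comp_trans X pz py); exact: (velocity_change cz pz py D1).
Unshelve. all: by end_near.
Qed.

Lemma in_XP p v : in_X g p v <-> exists2 l : R, l != 0 & v = l *: X p.
Proof. exact: (null_direction v (fn_basis fn p)). Qed.

(** The factor [T] lets a closed orbit be run once for parameters in [0, 1]; the curve inherits its
    smoothness from the field. *)
Lemma X_curve_orbit (T : R) y : T != 0 -> X_curve g (fun t => F (T * t) y).
Proof.
move=> T0; pose c (t : R) := F (T * t) y.
have cc : continuous c.
  move=> t; apply: (continuous_comp (f := fun t => T * t) (g := fun t => F t y)).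
    exact: mulrl_continuous.
  exact: (flow_continuous_t fl).
have dc (p : M) (t : R) : dom p (c t) -> is_derive t 1 (fun t : R^o => chart p (c t) : V2) (T *: comp p X (c t)).
  move=> pt; have D := flow_velocity pt.
  have Dm : is_derive t 1 (fun t : R => T * t) T.
    by have := is_deriveZ T (is_derive_id (t : R^o) (1 : R^o)); rewrite /GRing.scale /= mulr1.
  apply: is_derive_row => i; have Di := is_derive_coord i D.
  have := is_derive_comp1 Dm Di; rewrite mulrC => H.
  by rewrite mxE.
split; last first.
  move=> t; apply/in_XP; exists T => //.
  by have [_] := dc (c t) t (dom_self (c t)); rewrite comp_self.
split=> // p; apply/smooth_onP.
have oI : open (chart_image p setT) by apply: chart_image_opens; exact: openT.
have CX n : Cn n (chart_image p setT) (fun y => T *: comp p X (chart_inv p y)).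
  apply: CnZ => //; apply: Cn_row => // i.
  have := smoothM_Cn p n (comp_smooth (p := p) i openT (fn_X fn)).
  by apply: CnW => z [x [_ px] <-]; exists x.
have oU : open (c @^-1` dom p : set R^o) by apply: open_comp; [move=> t _; exact: cc|exact: dom_open].
have c1 (t : R) : dom p (c t) -> chart_image p setT (chart p (c t)) by move=> pt; exact: chart_image_in.
have c2 (t : R) : dom p (c t) -> is_derive (t : R^o) 1 (fun u : R^o => chart p (c u) : V2)
    (T *: comp p X (chart_inv p (chart p (c t)))).
  by move=> pt; rewrite (chartK pt); exact: dc.
exact: (Cn_integral_curve oU oI c1 c2 CX).
Qed.

(** The velocity is a multiple of [X], on which g(X, .) vanishes, so the height has zero
    derivative. *)
Lemma X_curve_height c : X_curve g c -> forall t0 : R, \forall t \near t0, bheight (bx (c t0)) (c t) = 0.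
Proof.
move=> [[cc sc] vc] t0; set p := c t0; have pp := center_dom fl p.
have N1 : \forall t \near t0, bdom (bx p) (c t).
  apply: (near_image (@cc t0)); apply: open_nbhs_nbhs; split=> //; exact: (bdom_open (isb p)).
have [d /= d0 Hd] := N1.
exists d => //= t td.
have D (u : R) : `|u| < d -> is_derive (u + t0) 1 (fun t => bheight (bx p) (c t)) 0.
  move=> ud; set s := u + t0; have ps : bdom (bx p) (c s).
    by apply: Hd; rewrite /= /s opprD addrCA subrr addr0 normrN.
  have qs := fb_dom (fb p) ps.
  have [_ dv] := sc p [::] s qs; pose w : V2 := 'D_1 (chart p \o c : R^o -> V2) s.
  have Dc : is_derive s 1 (fun t : R^o => chart p (c t) : V2) w by exact: derivableP (dv 1).
  have := curve_derivative (@cc s) qs Dc (bdom_open (isb p)) ps (fb_height (fb p)).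
  rewrite (fb_alpha (fb p) _ ps).
  have [l _ E] := (in_XP (c s) (velocity c s)).1 (vc s).
  have V : velocity c s = ext p w (c s).
    have ss := dom_self (c s).
    by have [_] := velocity_change (@cc s) qs ss Dc.
  by rewrite -V E [l *: _]scale_comb mdotDr mul0r addr0 (nb_XX (fn_basis fn _)) mulr0.
have td' : `|t - t0| < d by rewrite distrC.
have := constant_derive1 D td'; rewrite subrK mulr0 => /eqP; rewrite subr_eq0 => /eqP ->.
exact: (center_height fl).
Qed.

Lemma X_curve_in_orbit c : X_curve g c -> range c `<=` orbit F (c 0).
Proof. by move=> Xc _ [t _ <-]; apply: (curve_in_orbit fl Xc.1.1 (X_curve_height Xc)). Qed.

Lemma orbit_range (T : R) x : T != 0 -> range (fun t => F (T * t) x) = orbit F x.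
Proof.
move=> T0; apply/seteqP; split=> [_ [t _ <-]|_ [t _ <-]]; first by exists (T * t).
by exists (T^-1 * t) => //; rewrite mulrA mulfV// mul1r.
Qed.

(** An integral curve stays in one orbit whatever its speed, so the full orbits are exactly the
    maximal images. *)
Lemma X_lineP l : X_line g l <-> exists x, l = orbit F x.
Proof.
split=> [[c [Xc cl cmax]]|[x ->]].
  exists (c 0); have := cmax _ (X_curve_orbit (c 0) (oner_neq0 R)); rewrite orbit_range ?oner_neq0//.
  by move=> <-//; rewrite -cl; exact: X_curve_in_orbit.
exists (fun t => F (1 * t) x); split; [exact: X_curve_orbit (oner_neq0 R)|exact: orbit_range (oner_neq0 R)|].
move=> c Xc sub; have cx := X_curve_in_orbit Xc.
have Ox : orbit F (c 0) x by apply/cx/sub; exact: (orbit_refl fl).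
have E := orbit_eq fl Ox; apply/seteqP; split=> //.
by rewrite E.
Qed.

Lemma orbit_line x : X_line g (orbit F x).
Proof. by apply/X_lineP; exists x. Qed.

Lemma orbit_loop_param x T : 0 < T -> F T x = x ->
  (forall t, F t x = x -> exists k : int, t = k%:~R * T) -> loop_param g (orbit F x) (fun t => F (T * t) x).
Proof.
move=> T0 Tx Tm; have Tn : T != 0 by rewrite gt_eqF.
split; [exact: X_curve_orbit|exact: orbit_range| |].
  by move=> t; rewrite mulrDr mulr1 -(fs_D fl) Tx.
move=> t u /andP[t0 t1] /andP[u0 u1] E.
have /Tm[k Hk] : F (T * t - T * u) x = x.
  by rewrite addrC -(fs_D fl) E (fs_D fl) addNr (fs_0 fl).
have {}Hk : t - u = k%:~R by apply: (mulfI Tn); rewrite mulrBr Hk mulrC.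
suff k0 : k = 0 by move: Hk; rewrite k0 => /eqP; rewrite subr_eq0 => /eqP.
have : `|k%:~R : R| < 1 by rewrite -Hk ltr_norml; apply/andP; split; lra.
by rewrite -intr_norm -[X in _ < X]/(1%:~R) ltr_int; lia.
Qed.

(** A simple loop in an orbit forces a period. Conversely the least period gives a simple loop, and
    it is essential by [periodic_orbit_essential]. *)
Lemma closed_lineP l : closed_line g l <-> exists2 x, l = orbit F x & exists2 T, 0 < T & F T x = x.
Proof.
split=> [[/X_lineP[x ->] [c [Xc cl c1 cinj] _]]|[x -> P]].
  exists (c 0).
    have : orbit F x (c 0) by rewrite -cl; exists 0.
    by move=> /(orbit_eq fl).
  apply: (closed_curve_periodic fl Xc.1.1 (X_curve_height Xc)) => //.
  by rewrite -[1]add0r c1.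
have [T [T0 Tx Tm]] := minimal_period fl P.
split; first exact: orbit_line.
exists (fun t => F (T * t) x); first exact: orbit_loop_param.
move=> [H [cH H0 Hs H1]].
by apply: (periodic_orbit_essential fl T0 Tx cH) => // t t01; rewrite H0.
Qed.

End XLines.

(** * Spin structures and spinors *)

Section SpinGroup.
Context {R : realType}.
Implicit Types (x y : R * R) (m : R).

(* [x |-> x.1 + x.2] identifies [Spin11] with the multiplicative group of [R]. *)
Definition sp x : R := x.1 + x.2.
Definition unspin m : R * R := ((m + m^-1) / 2, (m - m^-1) / 2).

Lemma Spin11_sp x : Spin11 x -> sp x != 0 /\ x.1 - x.2 = (sp x)^-1.
Proof.
rewrite /Spin11 /= => H; have E : sp x * (x.1 - x.2) = 1 by rewrite -H /sp; ring.
have n0 : sp x != 0 by apply/eqP => Z; move: E; rewrite Z mul0r => /eqP; rewrite eq_sym oner_eq0.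
by split=> //; apply: (mulfI n0); rewrite E mulfV.
Qed.

Lemma unspin_Spin11 m : m != 0 -> Spin11 (unspin m).
Proof. by move=> m0; rewrite /Spin11 /unspin /=; field. Qed.

Lemma sp_unspin m : sp (unspin m) = m.
Proof. by rewrite /sp /unspin /=; lra. Qed.

Lemma unspin_sp x : Spin11 x -> unspin (sp x) = x.
Proof.
move=> /Spin11_sp[_ E]; case: x E => a b; rewrite /unspin -/(sp _) /= => <-.
by rewrite /sp /=; congr (_, _); lra.
Qed.

Lemma spM x y : sp (spin_mul x y) = sp x * sp y.
Proof. by rewrite /sp /spin_mul /=; ring. Qed.

Lemma Spin11M x y : Spin11 x -> Spin11 y -> Spin11 (spin_mul x y).
Proof.
rewrite /Spin11 /= => Hx Hy.
have -> : (x.1 * y.1 + x.2 * y.2) ^+ 2 - (x.1 * y.2 + x.2 * y.1) ^+ 2 =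
  (x.1 ^+ 2 - x.2 ^+ 2) * (y.1 ^+ 2 - y.2 ^+ 2) by ring.
by rewrite Hx Hy mulr1.
Qed.

Lemma Spin11_1 : Spin11 ((1 : R), (0 : R)).
Proof. by rewrite /Spin11 /= expr1n expr0n subr0. Qed.

Lemma sp1 : sp ((1 : R), (0 : R)) = 1.
Proof. by rewrite /sp /= addr0. Qed.

Lemma sp_inj x y : Spin11 x -> Spin11 y -> sp x = sp y -> x = y.
Proof. by move=> Hx Hy E; rewrite -(unspin_sp Hx) -(unspin_sp Hy) E. Qed.

Lemma frame_actM (s : frame R) x y : frame_act (frame_act s x) y = frame_act s (spin_mul x y).
Proof. by rewrite /frame_act /spin_mul /=; congr (_, _); apply: row2P; rewrite !mxE; ring. Qed.

Lemma frame_act1 (s : frame R) : frame_act s (1, 0) = s.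
Proof.
case: s => s1 s2; rewrite /frame_act /=; congr (_, _); apply: row2P; rewrite !mxE; ring.
Qed.

Lemma frame_act_null (s : frame R) x : Spin11 x ->
  (frame_act s x).1 + (frame_act s x).2 = (sp x ^+ 2)^-1 *: (s.1 + s.2) /\
  - (frame_act s x).1 + (frame_act s x).2 = sp x ^+ 2 *: (- s.1 + s.2).
Proof.
move=> /Spin11_sp[n0 E].
have E2 : (sp x ^+ 2)^-1 = (x.1 - x.2) ^+ 2 by rewrite E exprVn.
rewrite E2 /frame_act /sp /=; split; apply: row2P; rewrite !mxE; ring.
Qed.
End SpinGroup.

(** * Frames and their null vectors *)

Section Frames.
Context {R : realType} {M : surface R} {g : lorentz_metric M} (T : time_orientation g).
Local Notation nX s := (s.1 + s.2).
Local Notation nY s := (- s.1 + s.2).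

Lemma frame_ext (s s' : frame R) : nX s = nX s' -> nY s = nY s' -> s = s'.
Proof.
case: s s' => [a b] [a' b'] /= E1 E2.
have e (i : 'I_2) : a 0 i + b 0 i = a' 0 i + b' 0 i by move/rowP: E1 => /(_ i); rewrite !mxE.
have f (i : 'I_2) : - a 0 i + b 0 i = - a' 0 i + b' 0 i by move/rowP: E2 => /(_ i); rewrite !mxE.
by congr (_, _); apply/rowP => i; move: (e i) (f i); lra.
Qed.

Lemma onframe_null p (s : frame R) : onframe g p s <-> null_basis (g p) (nX s) (nY s).
Proof.
case: s => a b /=; have sG := gram_sym g p.
have C := mdotC a b sG.
have N1 (x y : R) (u v : 'rV[R]_2) : mdot (g p) (x *: a + y *: b) (x *: a + y *: b) =
    x * x * mdot (g p) a a + x * y * 2 * mdot (g p) a b + y * y * mdot (g p) b b.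
  by rewrite mdotDl !mdotDr (mdotC b a sG); ring.
have EX : a + b = 1 *: a + 1 *: b by rewrite !scale1r.
have EY : - a + b = (-1) *: a + 1 *: b by rewrite scaleN1r scale1r.
have XX : mdot (g p) (a + b) (a + b) = mdot (g p) a a + 2 * mdot (g p) a b + mdot (g p) b b.
  by rewrite EX N1//; ring.
have YY : mdot (g p) (- a + b) (- a + b) = mdot (g p) a a - 2 * mdot (g p) a b + mdot (g p) b b.
  by rewrite EY N1//; ring.
have XY : mdot (g p) (a + b) (- a + b) = mdot (g p) b b - mdot (g p) a a.
  by rewrite EX EY mdotDl !mdotDr (mdotC b a sG); ring.
have D : \det (col_mx (a + b) (- a + b) : 'M[R]_2) = 2 * \det (col_mx a b : 'M[R]_2).
  by rewrite !det_rows !mxE; ring.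
split=> [[/= Haa Hbb Hab Hd]|[_ Hxx Hyy Hxy Hd]].
  split=> //; rewrite ?XX ?YY ?XY ?Haa ?Hbb ?Hab ?D; try lra.
  by rewrite mulr_gt0.
rewrite XX in Hxx; rewrite YY in Hyy; rewrite XY in Hxy; rewrite D pmulr_rgt0// in Hd.
by split=> //=; lra.
Qed.

(** For the null vectors X, Y of the frame, g(T, T) = g(T, X) g(T, Y) is negative, so the factors
    have opposite signs; the second one being positive says that the first frame vector pairs
    negatively with [T]. *)
Lemma in_P_null p (s : frame R) : in_P T p s <->
  null_basis (g p) (nX s) (nY s) /\ 0 < mdot (g p) (T p) (nY s).
Proof.
rewrite /in_P onframe_null; case: s => a b /=.
have key : null_basis (g p) (a + b) (- a + b) ->
    mdot (g p) (T p) (a + b) * mdot (g p) (T p) (- a + b) < 0 /\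
    mdot (g p) a (T p) = 2^-1 * (mdot (g p) (T p) (a + b) - mdot (g p) (T p) (- a + b)).
  move=> nb; have TT : mdot (g p) (T p) (T p) < 0 := tvf_timelike T p.
  have E := null_expand (T p) nb; split.
    move: TT; rewrite {1 2}E (null_norm _ _ nb).
    by set u := mdot _ _ (a + b); set v := mdot _ _ (- a + b) => ?; lra.
  have sG := gram_sym g p; rewrite (mdotC a (T p) sG).
  have -> : a = 2^-1 *: (a + b) + (- 2^-1) *: (- a + b).
    by apply: row2P; rewrite !mxE; lra.
  rewrite mdotDr; have -> : 2^-1 *: (a + b) + (- 2^-1) *: (- a + b) = a by apply: row2P; rewrite !mxE; lra.
  by ring.
split=> [[nb H]|[nb H]]; have [K1 K2] := key nb; split=> //.
  by rewrite ltNge; apply/negP => K; move: H; rewrite K2; nra.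
by rewrite K2; nra.
Qed.

Lemma in_P_frame_act p (s : frame R) x : Spin11 x -> in_P T p s -> in_P T p (frame_act s x).
Proof.
move=> Sx /in_P_null[nb H]; apply/in_P_null; have [-> ->] := frame_act_null s Sx.
have [n0 _] := Spin11_sp Sx; have m0 : 0 < sp x ^+ 2 by rewrite exprn_even_gt0.
set m := sp x ^+ 2 in m0 *; set U := nX s in nb *; set V := nY s in nb H *; clearbody m.
have sG := gram_sym g p; have [a [b c d]] := nb.
have mm : m^-1 * m = 1 by rewrite mulVf// gt_eqF.
have S1 (k : R) u v : mdot (g p) (k *: u) v = k * mdot (g p) u v by rewrite [k *: u]scale_comb mdotDl mul0r addr0.
have S2 (k : R) u v : mdot (g p) u (k *: v) = k * mdot (g p) u v by rewrite [k *: v]scale_comb mdotDr mul0r addr0.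
split; last by rewrite S2 mulr_gt0.
split=> //; rewrite ?S1 ?S2 ?a ?b ?c ?mulr0// ?mulrA ?mm ?mul1r//.
have -> : \det (col_mx (m^-1 *: U) (m *: V) : 'M[R]_2) = (m^-1 * m) * \det (col_mx U V : 'M[R]_2).
  by rewrite !det_rows !mxE; ring.
by rewrite mm mul1r.
Qed.
End Frames.

(** * Fibres and local sections of a Spin structure *)

Section Fibres.
Context {R : realType} {M : surface R} {g : lorentz_metric M} {T : time_orientation g}.
Variable Q : spin_structure T.
Local Notation pr := (@spin_proj _ _ _ _ Q).
Local Notation fr := (@fr _ _ _ _ Q).
Local Notation act := (@act _ _ _ _ Q).
Local Notation triv U s Phi Psi := (spin_trivialization T pr fr act U s Phi Psi).
Implicit Types (q : Q) (p : M).

Lemma fibre_coord p : exists U s Phi Psi, [/\ open U, U p & triv U s Phi Psi].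
Proof. exact: locally_trivial. Qed.

Lemma fibre_exists p : exists q, pr q = p.
Proof.
have [U [s [Phi [Psi [_ Up [_ _ H _ _]]]]]] := fibre_coord p.
by have [E _ _] := H p (1, 0) Up Spin11_1; exists (Phi (p, (1, 0))).
Qed.

Lemma fibre_in_P q : in_P T (pr q) (fr q).
Proof.
have [U [s [Phi [Psi [_ Up [[_ Hs] _ H K _]]]]]] := fibre_coord (pr q).
have [S E] := K q Up; have [_ F _] := H _ _ Up S.
by rewrite -{2}E F; apply: in_P_frame_act => //; exact: Hs.
Qed.

Lemma actP q y : Spin11 y -> pr (act q y) = pr q /\ fr (act q y) = frame_act (fr q) y.
Proof.
move=> Sy; have [U [s [Phi [Psi [_ Up [_ _ H K A]]]]]] := fibre_coord (pr q).
have [S E] := K q Up; rewrite -E A//.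
have [E1 E2 _] := H _ _ Up (Spin11M S Sy); have [E3 E4 _] := H _ _ Up S.
by rewrite E1 E2 E3 E4 frame_actM.
Qed.

Lemma act_Psi U s Phi Psi q y : triv U s Phi Psi -> U (pr q) -> Spin11 y ->
  Psi (act q y) = spin_mul (Psi q) y.
Proof.
move=> [_ _ H K A] Up Sy; have [S E] := K q Up.
by rewrite -{1}E A//; have [_ _] := H _ _ Up (Spin11M S Sy).
Qed.

Lemma actM q y z : Spin11 y -> Spin11 z -> act (act q y) z = act q (spin_mul y z).
Proof.
move=> Sy Sz; have [U [s [Phi [Psi [_ Up [_ _ H K A]]]]]] := fibre_coord (pr q).
have [S E] := K q Up; rewrite -E (A (pr q) (Psi q) y)// (A (pr q) (Psi q) (spin_mul y z))//; last exact: Spin11M.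
rewrite A//; last exact: Spin11M.
by congr (Phi (_, _)); apply: sp_inj; rewrite ?spM ?mulrA//; do !apply: Spin11M.
Qed.

Lemma act1 q : act q (1, 0) = q.
Proof.
have [U [s [Phi [Psi [_ Up [_ _ H K A]]]]]] := fibre_coord (pr q).
have [S E] := K q Up; rewrite -[in LHS]E A//; last exact: Spin11_1.
have -> : spin_mul (Psi q) (1, 0) = Psi q; last by [].
by apply: sp_inj; rewrite ?spM ?sp1 ?mulr1//; apply: Spin11M => //; exact: Spin11_1.
Qed.

(* The element of [R^*] carrying [q] to [q'] in the same fibre. *)
Definition rel q q' : R := xget 1 [set m | m != 0 /\ q' = act q (unspin m)].

Lemma act_unspin_triv U s Phi Psi q q' : triv U s Phi Psi -> U (pr q) -> pr q = pr q' ->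
  let m := sp (Psi q') / sp (Psi q) in m != 0 /\ q' = act q (unspin m).
Proof.
move=> [_ _ H K A] Up E; have [S e] := K q Up.
have Up' : U (pr q') by rewrite -E.
have [S' e'] := K q' Up'; have [n0 _] := Spin11_sp S; have [n0' _] := Spin11_sp S'.
move=> m; have mn : m != 0 by rewrite mulf_neq0// invr_eq0.
split=> //; rewrite -e A//; last exact: unspin_Spin11.
rewrite -e' E; congr (Phi (_, _)); apply: sp_inj => //; first by apply: Spin11M => //; exact: unspin_Spin11.
by rewrite spM sp_unspin /m mulrC divfK.
Qed.

Lemma relP q q' : pr q = pr q' -> rel q q' != 0 /\ q' = act q (unspin (rel q q')).
Proof.
move=> E; have [U [s [Phi [Psi [_ Up Tr]]]]] := fibre_coord (pr q).
have H := act_unspin_triv Tr Up E.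
exact: (@xgetPex _ 1 [set m | m != 0 /\ q' = act q (unspin m)] (ex_intro _ _ H)).
Qed.

Lemma rel_triv U s Phi Psi q q' : triv U s Phi Psi -> U (pr q) -> pr q = pr q' ->
  rel q q' = sp (Psi q') / sp (Psi q).
Proof.
move=> Tr Up E; have [m0 H] := relP E.
have [_ _ _ K _] := Tr; have [S _] := K q Up; have [n0 _] := Spin11_sp S.
have := act_Psi Tr Up (unspin_Spin11 m0); rewrite -H => ->.
by rewrite spM sp_unspin mulrC mulKf.
Qed.

Lemma rel_act q y : Spin11 y -> rel q (act q y) = sp y.
Proof.
move=> Sy; have [U [s [Phi [Psi [_ Up Tr]]]]] := fibre_coord (pr q).
have E : pr q = pr (act q y) by have [-> _] := actP q Sy.
rewrite (rel_triv Tr Up E) (act_Psi Tr Up Sy) spM.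
have [_ _ _ K _] := Tr; have [S _] := K q Up; have [n0 _] := Spin11_sp S.
by rewrite mulrC mulKf.
Qed.

Lemma relM q q' q'' : pr q = pr q' -> pr q = pr q'' -> rel q q'' = rel q q' * rel q' q''.
Proof.
move=> E1 E2; have [U [s [Phi [Psi [_ Up Tr]]]]] := fibre_coord (pr q).
have Up' : U (pr q') by rewrite -E1.
have E3 : pr q' = pr q'' by rewrite -E1.
rewrite (rel_triv Tr Up E1) (rel_triv Tr Up E2) (rel_triv Tr Up' E3).
have [_ _ _ K _] := Tr; have [S _] := K q' Up'; have [n0 _] := Spin11_sp S.
by rewrite [RHS]mulrC mulrA divfK.
Qed.

Lemma rel_refl q : rel q q = 1.
Proof. by rewrite -{2}(act1 q) rel_act ?sp1//; exact: Spin11_1. Qed.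

Lemma Psi_continuous U s Phi Psi q : open U -> triv U s Phi Psi -> U (pr q) -> {for q, continuous Psi}.
Proof.
move=> oU [_ [_ cP] _ _ _] Uq; move: cP; rewrite continuous_open_subspace; last first.
  by apply: open_comp => // x _; exact: spin_proj_continuous.
by apply; rewrite inE.
Qed.

Lemma sp_continuous : continuous (@sp R).
Proof. by move=> x; apply: cvgD; [exact: cvg_fst|exact: cvg_snd]. Qed.

(** In a trivialization [rel] is the quotient of the two fibre coordinates. *)
Lemma rel_continuous (Z : topologicalType) (u u' : Z -> Q) z : {for z, continuous u} ->
  {for z, continuous u'} -> (\forall y \near z, pr (u y) = pr (u' y)) ->
  {for z, continuous (fun y => rel (u y) (u' y))}.
Proof.
move=> cu cu' E; have [U [s [Phi [Psi [oU Up Tr]]]]] := fibre_coord (pr (u z)).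
have Ez := nbhs_singleton E; have Up' : U (pr (u' z)) by rewrite -Ez.
have cpr : {for z, continuous (pr \o u)} by exact: (continuous_comp cu (@spin_proj_continuous _ _ _ _ Q _)).
have NU : \forall y \near z, U (pr (u y)) by apply: (near_image cpr); exact: open_nbhs_nbhs.
have c1 : {for z, continuous (fun y => sp (Psi (u y)))}.
  exact: (continuous_comp (continuous_comp cu (Psi_continuous oU Tr Up)) (@sp_continuous _)).
have c2 : {for z, continuous (fun y => sp (Psi (u' y)))}.
  exact: (continuous_comp (continuous_comp cu' (Psi_continuous oU Tr Up')) (@sp_continuous _)).
have N : \forall y \near z, sp (Psi (u' y)) / sp (Psi (u y)) = rel (u y) (u' y).
  by apply: filterS2 NU E => y Uy Ey; rewrite (rel_triv Tr Uy Ey).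
apply: near_eq_continuous N _; apply: cvgM; first exact: c2.
apply: cvgV; last exact: c1.
by have [_ _ _ K _] := Tr; have [S _] := K _ Up; have [] := Spin11_sp S.
Qed.

Lemma near_sgr (Z : topologicalType) (f : Z -> R) z : {for z, continuous f} -> f z != 0 ->
  \forall y \near z, Num.sg (f y) = Num.sg (f z).
Proof.
move=> cf; rewrite neq_lt => /orP[fz|fz].
  have N : \forall y \near z, f y < 0 by exact: (near_image (P := fun v : R => v < 0) cf (lt_nbhsl fz)).
  by apply: filterS N => y fy; rewrite !ltr0_sg.
have N : \forall y \near z, 0 < f y by exact: (near_image (P := fun v : R => 0 < v) cf (lt_nbhsr fz)).
by apply: filterS N => y fy; rewrite !gtr0_sg.
Qed.

Lemma rel_sg_near (Z : topologicalType) (u u' : Z -> Q) z : {for z, continuous u} ->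
  {for z, continuous u'} -> (\forall y \near z, pr (u y) = pr (u' y)) ->
  \forall y \near z, Num.sg (rel (u y) (u' y)) = Num.sg (rel (u z) (u' z)).
Proof.
move=> cu cu' E; apply: near_sgr; first exact: rel_continuous.
by have [] := relP (nbhs_singleton E).
Qed.

Lemma local_section_exists p : exists U (sg : M -> Q), local_section U sg /\ U p.
Proof.
have [U [s [Phi [Psi [oU Up Tr]]]]] := fibre_coord p; exists U, (fun p => Phi (p, (1, 0))); split=> //.
have [[Ss _] [cPhi _] H _ _] := Tr; split=> //.
- apply/subspace_continuousP => x Ux; have H1 : (U `*` @Spin11 R) (x, (1, 0)) by split=> //=; exact: Spin11_1.
  move/subspace_continuousP: cPhi => /(_ _ H1) c A /c; rewrite /= nbhs_filterE /within /= => N.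
  have c1 : {for x, continuous (fun y : M => (y, ((1 : R), (0 : R))))}.
    by apply: continuous_pair_for; [exact: cvg_id|exact: cvg_cst].
  have := near_image (P := fun z => (U `*` @Spin11 R) z -> A (Phi z)) c1 N.
  by apply: filterS => y HA Uy; apply: HA; split=> //=; exact: Spin11_1.
- by move=> x Ux; have [] := H x (1, 0) Ux Spin11_1.
have E x : U x -> fr (Phi (x, (1, 0))) = s x.
  by move=> Ux; have [_ -> _] := H x (1, 0) Ux Spin11_1; exact: frame_act1.
have [S1 S2 S3] := Ss; split.
- by apply: smooth_vf_eq S1 => x Ux; rewrite E.
- by apply: smooth_vf_eq S2 => x Ux; rewrite E.
by move=> x Ux; rewrite E//; exact: S3.
Qed.

Lemma section_continuous U (sg : M -> Q) p : local_section U sg -> U p -> {for p, continuous sg}.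
Proof.
move=> [oU csg _ _] Up; move: csg; rewrite continuous_open_subspace//.
by apply; rewrite inE.
Qed.
End Fibres.

(** * The Clifford representation in coordinates *)

Section SpinorAlgebra.
Context {R : realType}.
Local Notation C := (complex R).
Implicit Types (a b c d : R) (z w : C).

Lemma complexD a b c d : Complex a b + Complex c d = Complex (a + c) (b + d) :> C.
Proof. by []. Qed.

Lemma complexM a b c d : Complex a b * Complex c d = Complex (a * c - b * d) (a * d + b * c) :> C.
Proof. by []. Qed.

Lemma complexN a b : - Complex a b = Complex (- a) (- b) :> C.
Proof. by []. Qed.

Lemma complexE z : z = Complex (complex.Re z) (complex.Im z).
Proof. by case: z. Qed.

Lemma sum2C (f : 'I_2 -> C) : \sum_i f i = f 0 + f 1.
Proof. by rewrite !big_ord_recl big_ord0 addr0; congr (f _ + f _); exact: val_inj. Qed.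

(** The product is diagonal with entries -1 and 1, so positive spinors live in the first coordinate
    and negative ones in the second. *)
Lemma e12E : e1 R *m e2 R = \matrix_(i, j) (if i == j then (if i == 0 then -1 else 1) else 0).
Proof.
apply/matrixP => i j; rewrite !mxE sum2C !mxE.
by case: i j => [[|[|i]] Hi] [[|[|j]] Hj] //=; rewrite !(mul0r, mulr0, addr0, add0r) ?complexM //=;
  apply/eqP; rewrite eq_complex /= ; apply/andP; split; apply/eqP; ring.
Qed.

Lemma e12_mul (u : 'cV[C]_2) : (e1 R *m e2 R *m u) 0 0 = - u 0 0 /\ (e1 R *m e2 R *m u) 1 0 = u 1 0.
Proof.
rewrite e12E mxE [in X in _ /\ X]mxE !sum2C !mxE /=.
by rewrite mulN1r mul0r addr0 mul0r add0r mul1r.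
Qed.

Lemma col2P (u v : 'cV[C]_2) : u 0 0 = v 0 0 -> u 1 0 = v 1 0 -> u = v.
Proof.
move=> H0 H1; apply/matrixP => i j; rewrite (ord1 j).
by case: i => [[|[|i]] Hi] //; [rewrite (_ : Ordinal Hi = 0)|rewrite (_ : Ordinal Hi = 1)] => //; exact: val_inj.
Qed.

Lemma spin_rep_mul (x : R * R) (u : 'cV[C]_2) :
  (spin_rep x *m u) 0 0 = Complex (x.1 - x.2) 0 * u 0 0 /\
  (spin_rep x *m u) 1 0 = Complex (x.1 + x.2) 0 * u 1 0.
Proof.
rewrite /spin_rep /rscale e12E mxE [in X in _ /\ X]mxE !sum2C !mxE /=.
rewrite !(mulr0, mul0r, addr0, add0r, mulr1); split; congr (_ * _); last by rewrite complexD addr0.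
by rewrite mulrN1 complexN complexD oppr0 addr0.
Qed.

(** With [u] and [v] the derivatives along [s1] and [s2], the Dirac operator differentiates the
    first coordinate along [s1 + s2] and the second along [- s1 + s2]. *)
Lemma dirac_algebra (u v : 'cV[C]_2) :
  (- (e1 R *m u) + e2 R *m v) 0 0 = Complex 0 1 * (v 1 0 - u 1 0) /\
  (- (e1 R *m u) + e2 R *m v) 1 0 = Complex 0 1 * (u 0 0 + v 0 0).
Proof.
rewrite !mxE !sum2C !mxE /= !(mul0r, add0r, addr0); split; first by rewrite mulrBr addrC.
by rewrite mulrDr -mulNr complexN opprK oppr0.
Qed.
End SpinorAlgebra.

(** * Connection forms of boosted frames *)

Section NullFrameCalculus.
#[local] Opaque dM koszul nabla mdot.
Context {R : realType} {M : surface R} {g : lorentz_metric M}.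
Variables X Y : M -> tangent R.
Hypothesis fn : flat_null_frame g X Y.

Lemma near_dcomp p (V W : M -> tangent R) u : (\forall x \near p, V x = W x) -> dcomp p V u = dcomp p W u.
Proof.
move=> N; apply/rowP => i; apply: (etrans (dcompE _ _ _ _)); apply: esym; apply: (etrans (dcompE _ _ _ _)); apply: near_eq_dM.
by apply: filterS N => x E; rewrite /comp E.
Qed.

Lemma dM_scale U (f : M -> R) p (a : R) v : open U -> U p -> smoothM (F := R^o) U f ->
  dM f p (a *: v) = a * dM f p v.
Proof.
move=> oU Up Sf; apply: (etrans (dM_linear (a *: v) oU Up Sf)).
have L := dM_linear v oU Up Sf; rewrite L mulrDr !mulrA; congr (_ * _ + _ * _); exact: mxE.
Qed.

Lemma koszul_eq U (V W : M -> tangent R) p u z : open U -> U p -> smooth_vf U V -> smooth_vf U W ->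
  (forall x, U x -> V x = W x) -> koszul g p u V z = koszul g p u W z.
Proof.
move=> oU Up SV SW E; have D : dcomp p V u = dcomp p W u.
  by apply: near_dcomp; apply: filterS (open_nbhs_nbhs (conj oU Up)) => x; exact: E.
have K := koszulE g u z oU Up SV; rewrite D (E p Up) in K.
exact: (etrans K (esym (koszulE g u z oU Up SW))).
Qed.

Lemma koszulD U (V W : M -> tangent R) p u z : open U -> U p -> smooth_vf U V -> smooth_vf U W ->
  koszul g p u (fun x => V x + W x) z = koszul g p u V z + koszul g p u W z.
Proof.
move=> oU Up SV SW.
have E := koszul_comb g u z oU Up (@smoothM_cst _ _ U (1 : R)) (@smoothM_cst _ _ U (1 : R)) SV SW.
have E1 : (fun x => V x + W x) = (fun x => cst 1 x *: V x + cst 1 x *: W x).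
  by apply/funext => x; rewrite /= !scale1r.
rewrite E1; apply: (etrans E).
by rewrite !dM_cst /=; gen_dM; ring.
Qed.

Lemma koszul_unit U (V : M -> tangent R) c p u : open U -> U p -> smooth_vf U V ->
  (forall x, U x -> mdot (g x) (V x) (V x) = c) -> koszul g p u V (V p) = 0.
Proof.
move=> oU Up SV E; have := koszul_metric g u oU Up SV SV.
have -> : dM (fun x => mdot (g x) (V x) (V x)) p u = dM (cst c) p u.
  by apply: near_eq_dM; apply: filterS (open_nbhs_nbhs (conj oU Up)) => x; exact: E.
by rewrite dM_cst; gen_dM; lra.
Qed.

(* The connection form of a frame [S] with [S.1 + S.2 = f X] evaluates to [df X] on [S.1 + S.2]. *)
Lemma boost_connection U (S : M -> frame R) (f : M -> R) p : smooth_frame g U S -> open U -> U p ->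
  smoothM (F := R^o) U f -> (forall x, U x -> (S x).1 + (S x).2 = f x *: X x) -> f p != 0 ->
  mdot (g p) (nabla g p ((S p).1 + (S p).2) (fun x => (S x).1 : tangent R)) (S p).2 = dM f p (X p).
Proof.
move=> [S1 S2 oS] oU Up Sf SX f0; have oT : open [set: M] := openT.
rewrite (nablaE g _ _ oU Up S1); set u := (S p).1 + (S p).2.
have K2 : koszul g p u (fun x => (S x).2 : tangent R) (S p).2 = 0.
  by apply: (koszul_unit (c := 1) u oU Up S2) => x Ux; have [] := oS x Ux.
have KD := koszulD u (S p).2 oU Up S1 S2; rewrite K2 addr0 in KD; rewrite -KD.
have SXU : smooth_vf U X by exact: (@smooth_vfW _ _ U setT X (fun _ _ => Logic.I) (fn_X fn)).
have SS : smooth_vf U (fun x => (S x).1 + (S x).2 : tangent R) by exact: smooth_vfD.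
have EX x : U x -> (S x).1 + (S x).2 = f x *: X x + cst 0 x *: X x :> tangent R.
  by move=> Ux; rewrite (SX x Ux) /= scale0r addr0.
have SfX : smooth_vf U (fun x => f x *: X x + cst 0 x *: X x).
  exact: (smooth_vf_eq EX SS).
have E1 : koszul g p u (fun x => (S x).1 + (S x).2 : tangent R) (S p).2 =
    koszul g p u (fun x => f x *: X x + cst 0 x *: X x) (S p).2.
  exact: (koszul_eq _ _ oU Up SS SfX EX).
have E2 := koszul_comb g u (S p).2 oU Up Sf (@smoothM_cst _ _ U (0 : R)) SXU SXU.
have uE : u = f p *: X p by rewrite /u SX.
have KX : koszul g p u X (S p).2 = 0.
  rewrite uE scale_comb; apply: (etrans (koszul_dir g _ _ _ _ _ oT Logic.I (fn_X fn))).
  by rewrite (koszul_X_X fn); gen_dM; ring.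
have G : f p * mdot (g p) (X p) (S p).2 = 1.
  have [_ n2 n12 _] := oS p Up.
  have : mdot (g p) u (S p).2 = 1.
    have -> : u = 1 *: (S p).1 + 1 *: (S p).2 by rewrite !scale1r.
    by rewrite mdotDl n2 n12; ring.
  by rewrite uE (scale_comb (f p)) mdotDl mul0r addr0.
have D : dM f p u = f p * dM f p (X p) by rewrite uE; exact: (dM_scale _ _ oU Up Sf).
rewrite E1; apply: (etrans E2).
rewrite KX dM_cst D !mulr0 mul0r !addr0.
by transitivity (f p * mdot (g p) (X p) (S p).2 * dM f p (X p)); [gen_dM; ring|rewrite G mul1r].
Qed.

Lemma dM_near_cst U (f : M -> R) c p u : open U -> U p -> (forall x, U x -> f x = c) -> dM f p u = 0.
Proof.
move=> oU Up E; rewrite -(dM_cst c p u); apply: near_eq_dM.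
by apply: filterS (open_nbhs_nbhs (conj oU Up)) => x; exact: E.
Qed.

(* [k = f^(-1/2)] *)
Lemma boost_weight U (f k v : M -> R) p : open U -> U p -> smoothM (F := R^o) U f ->
  smoothM (F := R^o) U k -> smoothM (F := R^o) U v -> (forall x, U x -> k x ^+ 2 * f x = 1) ->
  dM (fun x => k x * v x) p (f p *: X p) + 2^-1 * dM f p (X p) * (k p * v p) = f p * k p * dM v p (X p) /\
  dM (fun x => (k x)^-1 * v x) p (f p *: X p) - 2^-1 * dM f p (X p) * ((k p)^-1 * v p) = (k p)^-1 * f p * dM v p (X p).
Proof.
move=> oU Up Sf Sk Sv kf.
have k0 : k p != 0 by apply/eqP => Z; move: (kf p Up); rewrite Z expr0n mul0r => /eqP; rewrite eq_sym oner_eq0.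
have kk x : U x -> (k x)^-1 = k x * f x.
  move=> Ux; have k0' : k x != 0 by apply/eqP => Z; move: (kf x Ux); rewrite Z expr0n mul0r => /eqP; rewrite eq_sym oner_eq0.
  by apply: (mulfI k0'); rewrite mulfV// mulrA -expr2 kf.
have Skf := smoothMM oU Sk Sf.
have lin (h : M -> R) : smoothM (F := R^o) U h -> dM h p (f p *: X p) = f p * dM h p (X p).
  by move=> Sh; exact: (dM_scale _ _ oU Up Sh).
have Dkk : dM (fun x => k x * (k x * f x)) p (X p) = 0.
  by apply: (dM_near_cst (c := 1) _ oU Up) => x Ux; rewrite mulrA -expr2 kf.
have D1 := dMM (X p) oU Up Sk Skf; have D2 := dMM (X p) oU Up Sk Sf.
have D3 := dMM (X p) oU Up Sk Sv; have D4 := dMM (X p) oU Up Skf Sv.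
have L1 := lin _ (smoothMM oU Sk Sv); have L2 := lin _ (smoothMM oU Skf Sv).
have E : dM (fun x => (k x)^-1 * v x) p (f p *: X p) = dM (fun x => (k x * f x) * v x) p (f p *: X p).
  by apply: near_eq_dM; apply: filterS (open_nbhs_nbhs (conj oU Up)) => x Ux; rewrite kk.
have kp := kf p Up; rewrite (kk p Up).
move: L1 L2 E D1 D2 D3 D4 Dkk kp k0; clear.
generalize (dM (fun x => k x * v x) p (f p *: X p)) (dM (fun x => k x * f x * v x) p (f p *: X p))
  (dM (fun x => (k x)^-1 * v x) p (f p *: X p)) (dM (fun x => k x * v x) p (X p)) (dM (fun x => k x * f x * v x) p (X p))
  (dM (fun x => k x * (k x * f x)) p (X p)) (dM (fun x => k x * f x) p (X p)) (dM f p (X p)) (dM k p (X p)) (dM v p (X p)).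
move: (f p) (k p) (v p) => a b c A1 A2 A3 A4 A5 A6 A7 A8 A9 A10 -> -> -> D1 D2 -> -> E0 e b0.
rewrite D1 D2 in E0.
have K : a * A9 = - 2^-1 * b * A8.
  have : b * (2 * (a * A9) + b * A8) = 0 by rewrite -E0; ring.
  by move/eqP; rewrite mulf_eq0 (negbTE b0) /= => /eqP; lra.
rewrite D2; split.
  transitivity (a * b * A10 + c * (a * A9) + 2^-1 * A8 * (b * c)); first by ring.
  by rewrite K; field.
transitivity (b * a * a * A10 + a * c * (b * A8 + a * A9) - 2^-1 * A8 * (b * a * c)); first by ring.
by rewrite K; field.
Qed.
End NullFrameCalculus.

(** * Weighted functions on the Spin bundle *)

Section WeightedFunctions.
#[local] Opaque dM koszul nabla mdot.
Context {R : realType} {M : surface R} {g : lorentz_metric M} {T : time_orientation g}.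
Variable s : M -> frame R.

Definition nullX (p : M) : tangent R := (s p).1 + (s p).2.
Definition nullY (p : M) : tangent R := - (s p).1 + (s p).2.

Hypothesis fn : flat_null_frame g nullX nullY.
Hypothesis sP : forall p, in_P T p (s p).

Variable Q : spin_structure T.
Local Notation pr := (@spin_proj _ _ _ _ Q).
Local Notation fr := (@fr _ _ _ _ Q).
Local Notation act := (@act _ _ _ _ Q).
Implicit Types (q : Q) (p : M) (U : set M) (sg : M -> Q) (a v : Q -> R).

Definition lam q : R := 2^-1 * mdot (g (pr q)) ((fr q).1 + (fr q).2) (nullY (pr q)).
Definition kk q : R := (Num.sqrt (lam q))^-1.

Lemma lamP q : [/\ 0 < lam q, (fr q).1 + (fr q).2 = lam q *: nullX (pr q) &
  - (fr q).1 + (fr q).2 = (lam q)^-1 *: nullY (pr q)].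
Proof.
have [sO sT] := sP (pr q); have [fO fT] := fibre_in_P q.
have [l l0 [E1 E2]] := frame_boost (gram_sym g (pr q)) sO fO (tvf_timelike T (pr q)) sT fT.
suff -> : lam q = l by [].
rewrite /lam E1 -/(nullX _) (scale_comb l) mdotDl mul0r addr0 (nb_XY (fn_basis fn (pr q))).
by rewrite mulrC mulfK.
Qed.

Lemma kkP q : 0 < kk q /\ kk q ^+ 2 * lam q = 1.
Proof.
have [l0 _ _] := lamP q; have s0 : 0 < Num.sqrt (lam q) by rewrite sqrtr_gt0.
split; first by rewrite /kk invr_gt0.
by rewrite /kk exprVn sqr_sqrtr ?ltW// mulVf// gt_eqF.
Qed.

Lemma lam_act q y : Spin11 y -> lam (act q y) = (sp y ^+ 2)^-1 * lam q.
Proof.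
move=> Sy; have [E1 E2] := actP q Sy; rewrite /lam E1 E2 (frame_act_null (fr q) Sy).1.
by rewrite (scale_comb (sp y ^+ 2)^-1) mdotDl mul0r addr0 mulrCA.
Qed.

Lemma kk_act q y : Spin11 y -> kk (act q y) = `|sp y| * kk q.
Proof.
move=> Sy; have [n0 _] := Spin11_sp Sy; rewrite /kk (lam_act q Sy).
rewrite sqrtrM ?invr_ge0 ?sqr_ge0// invfM sqrtrV ?sqr_ge0// invrK sqrtr_sqr//.
Qed.

Lemma lam_smooth U sg : local_section U sg -> smoothM (F := R^o) U (lam \o sg).
Proof.
move=> [oU _ pU [S1 S2 _]].
have S : smooth_vf U (fun x => (fr (sg x)).1 + (fr (sg x)).2 : tangent R) by exact: smooth_vfD.
have SY : smooth_vf U nullY by exact: (@smooth_vfW _ _ U setT nullY (fun _ _ => Logic.I) (fn_Y fn)).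
have := smoothMM oU (@smoothM_cst _ _ U (2^-1 : R)) (smooth_metric g oU S SY).
by apply: smoothM_eq => // x Ux; rewrite /lam /= pU.
Qed.

Lemma kk_smooth U sg : local_section U sg -> smoothM (F := R^o) U (kk \o sg).
Proof.
move=> L; have [oU _ _ _] := L; apply: (smoothM_rsqrt oU _ _ (lam_smooth L)) => x Ux /=.
  by have [] := kkP (sg x).
by have [] := kkP (sg x).
Qed.

Definition spin_form sg p (u : tangent R) : R :=
  mdot (g p) (nabla g p u (fun x => (fr (sg x)).1 : tangent R)) (fr (sg p)).2.

(* [e = 1, -1] for the coordinates in [S^+] and [S^-]. *)
Definition spin_derivative (e : R) sg a p (u : tangent R) : R :=
  dM (a \o sg) p u + e * (2^-1 * spin_form sg p u) * a (sg p).

Lemma spin_derivative_comb e U sg a p (b c : R) u w : local_section U sg -> U p ->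
  smoothM (F := R^o) U (a \o sg) ->
  spin_derivative e sg a p (b *: u + c *: w) = b * spin_derivative e sg a p u + c * spin_derivative e sg a p w.
Proof.
move=> [oU _ _ [S1 _ _]] Up Sa; rewrite /spin_derivative /spin_form.
have K x := nablaE g x (fr (sg p)).2 oU Up S1.
have D := koszul_dir g b c u w (fr (sg p)).2 oU Up S1.
have L1 := dM_linear (b *: u + c *: w) oU Up Sa; have L2 := dM_linear u oU Up Sa; have L3 := dM_linear w oU Up Sa.
have C := scalar_comb2 b c u w (dM (a \o sg) p (delta_mx 0 0)) (dM (a \o sg) p (delta_mx 0 1)).
have K1 := K (b *: u + c *: w); have K2 := K u; have K3 := K w; clear K.
rewrite K1 K2 K3 D; rewrite C -L2 -L3 in L1; rewrite L1.
by move: (a (sg p)) => ?; gen_dM; ring.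
Qed.

Record real_harmonic a : Prop := RealHarmonic {
  rh_act : forall q y, Spin11 y -> a (act q y) = sp y * a q;
  rh_smooth : forall U sg, local_section U sg -> smoothM (F := R^o) U (a \o sg);
  rh_eq : forall U sg p, local_section U sg -> U p ->
    spin_derivative 1 sg a p ((fr (sg p)).1 + (fr (sg p)).2) = 0 }.

Record real_twistor a : Prop := RealTwistor {
  rt_act : forall q y, Spin11 y -> a (act q y) = (sp y)^-1 * a q;
  rt_smooth : forall U sg, local_section U sg -> smoothM (F := R^o) U (a \o sg);
  rt_eq : forall U sg p, local_section U sg -> U p ->
    spin_derivative (-1) sg a p ((fr (sg p)).1 + (fr (sg p)).2) = 0 }.

(** The functions common to both spinor spaces: the sign of [sp y] is what remains of the two
    weights once the powers of [lam] are divided out. *)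
Record parallel_fun v : Prop := ParallelFun {
  pf_act : forall q y, Spin11 y -> v (act q y) = Num.sg (sp y) * v q;
  pf_smooth : forall U sg, local_section U sg -> smoothM (F := R^o) U (v \o sg);
  pf_eq : forall U sg p, local_section U sg -> U p -> dM (v \o sg) p (nullX p) = 0 }.

(** The connection term contains half the derivative of [lam] along [X]; it cancels the derivative
    of the factor [lam^(-1/2)] or [lam^(1/2)] and leaves the derivative of [v]. *)
Lemma weighted_derivative U sg v p : local_section U sg -> U p -> smoothM (F := R^o) U (v \o sg) ->
  spin_derivative 1 sg (fun q => kk q * v q) p ((fr (sg p)).1 + (fr (sg p)).2) =
    lam (sg p) * kk (sg p) * dM (v \o sg) p (nullX p) /\
  spin_derivative (-1) sg (fun q => (kk q)^-1 * v q) p ((fr (sg p)).1 + (fr (sg p)).2) =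
    (kk (sg p))^-1 * lam (sg p) * dM (v \o sg) p (nullX p).
Proof.
move=> L Up Sv; have [oU _ pU Fr] := L.
have SX x : U x -> (fr (sg x)).1 + (fr (sg x)).2 = lam (sg x) *: nullX x.
  by move=> Ux; have [_ E _] := lamP (sg x); rewrite E pU.
have [l0 _ _] := lamP (sg p); have l0' : lam (sg p) != 0 by rewrite gt_eqF.
have B := boost_connection fn (S := fun x => fr (sg x)) (f := lam \o sg) Fr oU Up (lam_smooth L) SX l0'.
have W : forall x, U x -> (kk \o sg) x ^+ 2 * (lam \o sg) x = 1 by move=> x _; have [] := kkP (sg x).
have [W1 W2] := boost_weight nullX oU Up (lam_smooth L) (kk_smooth L) Sv W.
have E := SX p Up.
rewrite /spin_derivative /spin_form B; split.
  by rewrite -[RHS]W1 mul1r E.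
by rewrite -[RHS]W2 mulN1r mulNr E.
Qed.

Lemma real_harmonicP v : real_harmonic (fun q => kk q * v q) <-> parallel_fun v.
Proof.
have n0 q : kk q != 0 by have [k0 _] := kkP q; rewrite gt_eqF.
have sgE (y : R * R) : Spin11 y -> sp y = Num.sg (sp y) * `|sp y| by move=> _; rewrite -numEsg.
have sgN (y : R * R) : Spin11 y -> `|sp y| != 0 by move=> /Spin11_sp[n _]; rewrite normr_eq0.
split=> [] [A S E]; split.
- move=> q y Sy; apply: (mulfI (n0 (act q y))); rewrite (A q y Sy) (kk_act q Sy) {1}(sgE y Sy); ring.
- move=> U sg L; have [oU _ _ _] := L; have := S U sg L => H.
  have := smoothMM oU (smoothMM oU (kk_smooth L) (lam_smooth L)) H.
  apply: smoothM_eq => // x Ux /=; have [_ e] := kkP (sg x).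
  by transitivity (kk (sg x) ^+ 2 * lam (sg x) * v (sg x)); [ring|rewrite e mul1r].
- move=> U sg p L Up; have [oU _ _ _] := L.
  have Sv : smoothM (F := R^o) U (v \o sg).
    have := smoothMM oU (smoothMM oU (kk_smooth L) (lam_smooth L)) (S U sg L).
    apply: smoothM_eq => // x Ux /=; have [_ e] := kkP (sg x).
    by transitivity (kk (sg x) ^+ 2 * lam (sg x) * v (sg x)); [ring|rewrite e mul1r].
  have [W _] := weighted_derivative L Up Sv; have [l0 _ _] := lamP (sg p).
  by apply: (mulfI (mulf_neq0 (lt0r_neq0 l0) (n0 (sg p)))); rewrite mulr0 -W; exact: E L Up.
- move=> q y Sy; rewrite (A q y Sy) (kk_act q Sy) {3}(sgE y Sy); ring.
- by move=> U sg L; have [oU _ _ _] := L; exact: (smoothMM oU (kk_smooth L) (S U sg L)).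
by move=> U sg p L Up; have [-> _] := weighted_derivative L Up (S U sg L); rewrite (E U sg p L Up) mulr0.
Qed.

Lemma real_twistorP v : real_twistor (fun q => (kk q)^-1 * v q) <-> parallel_fun v.
Proof.
have n0 q : kk q != 0 by have [k0 _] := kkP q; rewrite gt_eqF.
have kV q : (kk q)^-1 = kk q * lam q by have [_ e] := kkP q; apply: (mulfI (n0 q)); rewrite mulfV// mulrA -expr2 e.
have SV U sg : local_section U sg -> smoothM (F := R^o) U (fun x => (kk (sg x))^-1).
  move=> L; have [oU _ _ _] := L; by apply: smoothM_eq (smoothMM oU (kk_smooth L) (lam_smooth L)).
have sgE (y : R * R) : Spin11 y -> (sp y)^-1 = Num.sg (sp y) * `|sp y|^-1.
  by move=> /Spin11_sp[n _]; rewrite {1}[sp y]numEsg invfM invr_sg.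
have sgN (y : R * R) : Spin11 y -> `|sp y| != 0 by move=> /Spin11_sp[n _]; rewrite normr_eq0.
have back U sg : local_section U sg -> smoothM (F := R^o) U (fun x => (kk (sg x))^-1 * v (sg x)) -> smoothM (F := R^o) U (v \o sg).
  move=> L H; have [oU _ _ _] := L; apply: smoothM_eq (smoothMM oU (kk_smooth L) H) => // x _ /=.
  by rewrite mulVKf.
split=> [] [A S E]; split.
- move=> q y Sy; have n1 := n0 (act q y); rewrite -invr_eq0 in n1.
  apply: (mulfI n1); rewrite (A q y Sy) (kk_act q Sy) (sgE y Sy) invfM; ring.
- by move=> U sg L; exact: (back U sg L (S U sg L)).
- move=> U sg p L Up; have [oU _ _ _] := L.
  have [_ W] := weighted_derivative L Up (back U sg L (S U sg L)); have [l0 _ _] := lamP (sg p).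
  have n1 := n0 (sg p); rewrite -invr_eq0 in n1.
  by apply: (mulfI (mulf_neq0 n1 (lt0r_neq0 l0))); rewrite mulr0 -W; exact: E L Up.
- move=> q y Sy; rewrite (A q y Sy) (kk_act q Sy) (sgE y Sy) invfM; ring.
- by move=> U sg L; have [oU _ _ _] := L; exact: (smoothMM oU (SV U sg L) (S U sg L)).
by move=> U sg p L Up; have [_ ->] := weighted_derivative L Up (S U sg L); rewrite (E U sg p L Up) mulr0.
Qed.
End WeightedFunctions.

(** * Dirac and twistor equations in coordinates *)

Section SpinorFields.
#[local] Opaque dM koszul nabla mdot.
Context {R : realType} {M : surface R} {g : lorentz_metric M} {T : time_orientation g}.
Variable Q : spin_structure T.
Local Notation C := (complex R).
Local Notation pr := (@spin_proj _ _ _ _ Q).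
Local Notation fr := (@fr _ _ _ _ Q).
Local Notation act := (@act _ _ _ _ Q).
Implicit Types (q : Q) (p : M) (U : set M) (sg : M -> Q) (phi : spinor_field Q).

Local Notation ReF phi k := (fun q => complex.Re (phi q k 0)).
Local Notation ImF phi k := (fun q => complex.Im (phi q k 0)).

Lemma scale_complex (a : R) (z : C) : Complex a 0 * z = Complex (a * complex.Re z) (a * complex.Im z).
Proof. by case: z => x y; rewrite complexM /= !mul0r subr0 addr0. Qed.

Lemma nablaSE sg phi p u k : nablaS sg phi p u k 0 =
  Complex (dM (ReF phi k \o sg) p u) (dM (ImF phi k \o sg) p u) -
  Complex (2^-1 * spin_form sg p u) 0 * (e1 R *m e2 R *m phi (sg p)) k 0.
Proof. by rewrite /nablaS /spin_form; move: (e1 R *m e2 R *m phi (sg p)) => w; rewrite !mxE. Qed.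

Lemma nablaS_coord sg phi p u :
  nablaS sg phi p u 0 0 =
     Complex (spin_derivative 1 sg (ReF phi 0) p u) (spin_derivative 1 sg (ImF phi 0) p u) /\
  nablaS sg phi p u 1 0 =
     Complex (spin_derivative (-1) sg (ReF phi 1) p u) (spin_derivative (-1) sg (ImF phi 1) p u).
Proof.
have [H0 H1] := e12_mul (phi (sg p)); rewrite !nablaSE H0 H1 /spin_derivative !mul1r !mulN1r.
rewrite mulrN opprK !scale_complex complexN !complexD !mulNr.
by split.
Qed.

Lemma positive0 phi q : positive phi -> phi q 1 0 = 0.
Proof.
move=> /(_ q) H; have [_ H1] := e12_mul (phi q); move: H1; rewrite H mxE => /eqP.
by rewrite eq_sym -subr_eq0 opprK -mulr2n mulrn_eq0 /= => /eqP.
Qed.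

Lemma negative0 phi q : negative phi -> phi q 0 0 = 0.
Proof.
move=> /(_ q) H; have [H0 _] := e12_mul (phi q); move: H0; rewrite H => /eqP.
by rewrite -subr_eq0 opprK -mulr2n mulrn_eq0 /= => /eqP.
Qed.

Lemma nablaS0 sg phi p u :
  (positive phi -> nablaS sg phi p u 1 0 = 0) /\ (negative phi -> nablaS sg phi p u 0 0 = 0).
Proof.
have [H0 H1] := e12_mul (phi (sg p)); rewrite !nablaSE H0 H1; split=> P.
  have E : (ReF phi 1 \o sg) = cst 0 /\ (ImF phi 1 \o sg) = cst 0.
    by split; apply/funext => x; rewrite /= (positive0 _ P).
  by rewrite E.1 E.2 !dM_cst (positive0 _ P) mulr0 subr0.
have E : (ReF phi 0 \o sg) = cst 0 /\ (ImF phi 0 \o sg) = cst 0.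
  by split; apply/funext => x; rewrite /= (negative0 _ P).
by rewrite E.1 E.2 !dM_cst (negative0 _ P) oppr0 mulr0 subr0.
Qed.

Lemma complex0 (a b : R) : Complex a b = 0 :> C <-> a = 0 /\ b = 0.
Proof. by split=> [[-> ->]|[-> ->]]. Qed.

Lemma imag_mul0 (z : C) : Complex 0 1 * z = 0 -> z = 0.
Proof.
move=> H; have /eqP := H; rewrite mulf_eq0 => /orP[|/eqP//].
by rewrite eq_complex /= oner_eq0 andbF.
Qed.

Section Directional.
Variables (U : set M) (sg : M -> Q) (p : M) (phi : spinor_field Q).
Hypothesis L : local_section U sg.
Hypothesis Up : U p.
Hypothesis smooth_phi : forall k,
  smoothM (F := R^o) U (fun x => complex.Re (phi (sg x) k 0)) /\
  smoothM (F := R^o) U (fun x => complex.Im (phi (sg x) k 0)).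
Let S1 := (fr (sg p)).1.
Let S2 := (fr (sg p)).2.

Lemma spin_derivative_sum e k (c : R) :
  Complex (spin_derivative e sg (ReF phi k) p (c *: S1 + S2)) (spin_derivative e sg (ImF phi k) p (c *: S1 + S2)) =
  Complex c 0 * Complex (spin_derivative e sg (ReF phi k) p S1) (spin_derivative e sg (ImF phi k) p S1) +
  Complex (spin_derivative e sg (ReF phi k) p S2) (spin_derivative e sg (ImF phi k) p S2).
Proof.
have [h1 h2] := smooth_phi k.
have D1 := spin_derivative_comb e (a := ReF phi k) c 1 S1 S2 L Up h1.
have D2 := spin_derivative_comb e (a := ImF phi k) c 1 S1 S2 L Up h2.
rewrite scale1r !mul1r in D1; rewrite scale1r !mul1r in D2.
by rewrite D1 D2 scale_complex complexD.
Qed.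

Lemma dirac_positive : positive phi -> dirac_op sg phi p = 0 <->
  spin_derivative 1 sg (ReF phi 0) p (S1 + S2) = 0 /\ spin_derivative 1 sg (ImF phi 0) p (S1 + S2) = 0.
Proof.
move=> P; have : dirac_op sg phi p 0 0 = _ /\ dirac_op sg phi p 1 0 = _ := dirac_algebra _ _.
move: ((nablaS0 sg phi p S1).1 P) ((nablaS0 sg phi p S2).1 P) (nablaS_coord sg phi p S1).1 (nablaS_coord sg phi p S2).1.
rewrite -/S1 -/S2; move: (nablaS sg phi p S1) (nablaS sg phi p S2) (dirac_op sg phi p) => w1 w2 w Z1 Z2 C1 C2 [D0 D1].
rewrite Z1 Z2 subr0 mulr0 in D0; rewrite C1 C2 in D1.
have Z := spin_derivative_sum 1 0 1; rewrite mul1r scale1r in Z; rewrite -Z in D1.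
rewrite -complex0; split=> [H|H].
  apply: imag_mul0; rewrite -D1.
  by move/matrixP: H => /(_ 1 0); rewrite [RHS]mxE.
apply: col2P; rewrite [RHS]mxE; first exact: D0.
by rewrite H mulr0 in D1; exact: D1.
Qed.

Lemma dirac_negative : negative phi -> dirac_op sg phi p 1 0 = 0 /\
  dirac_op sg phi p 0 0 = Complex 0 1 * Complex (spin_derivative (-1) sg (ReF phi 1) p (- S1 + S2))
     (spin_derivative (-1) sg (ImF phi 1) p (- S1 + S2)).
Proof.
move=> P; have : dirac_op sg phi p 0 0 = _ /\ dirac_op sg phi p 1 0 = _ := dirac_algebra _ _.
move: ((nablaS0 sg phi p S1).2 P) ((nablaS0 sg phi p S2).2 P) (nablaS_coord sg phi p S1).2 (nablaS_coord sg phi p S2).2.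
rewrite -/S1 -/S2; move: (nablaS sg phi p S1) (nablaS sg phi p S2) (dirac_op sg phi p) => w1 w2 w Z1 Z2 C1 C2 [D0 D1].
rewrite Z1 Z2 addr0 mulr0 in D1; rewrite C1 C2 in D0.
have Z := spin_derivative_sum (-1) 1 (-1); rewrite scaleN1r in Z.
split; first exact: D1.
by apply: (etrans D0); rewrite Z addrC; congr (_ * (_ + _)); rewrite scale_complex !mulN1r complexN.
Qed.
End Directional.

Lemma clifford_mul p (f : frame R) (u : tangent R) (w : 'cV[C]_2) :
  (clifford g p f u *m w) 0 0 = Complex 0 (mdot (g p) u f.2 - mdot (g p) u f.1) * w 1 0 /\
  (clifford g p f u *m w) 1 0 = Complex 0 (mdot (g p) u f.1 + mdot (g p) u f.2) * w 0 0.
Proof.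
rewrite /clifford /rscale; move: (mdot (g p) u f.1) (mdot (g p) u f.2) => a b.
rewrite mxE [in X in _ /\ X]mxE !sum2C !mxE /= !(mulr0, addr0, mul0r, add0r).
split; congr (_ * _); rewrite !complexM complexD !mul0r !mulr0 !subr0 !addr0 ?mulr1 ?mulrN1 ?opprK ?oppr0 ?addr0//.
by rewrite addrC.
Qed.

(** Writing X, Y for the null vectors of the frame, the equation for a negative spinor holds
    identically in the direction Y. In the direction X its right-hand side vanishes since X is null,
    and what remains is a zero derivative along X. *)
Lemma twistor_negative U sg p phi : local_section U sg -> U p ->
  (forall k, smoothM (F := R^o) U (fun x => complex.Re (phi (sg x) k 0)) /\
             smoothM (F := R^o) U (fun x => complex.Im (phi (sg x) k 0))) -> negative phi ->
  (forall u, nablaS sg phi p u = - rscale 2^-1 (clifford g p (fr (sg p)) u *m dirac_op sg phi p)) <->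
  spin_derivative (-1) sg (ReF phi 1) p ((fr (sg p)).1 + (fr (sg p)).2) = 0 /\
  spin_derivative (-1) sg (ImF phi 1) p ((fr (sg p)).1 + (fr (sg p)).2) = 0.
Proof.
move=> L Up S P; have [D1 D0] := dirac_negative L Up S P.
have [r i] := S 1; have [oU _ pU smooth_fr] := L; set f := fr (sg p) in D0 *.
have nb : null_basis (g p) (f.1 + f.2) (- f.1 + f.2).
  by apply/onframe_null; have [_ _] := smooth_fr; apply.
set XX := f.1 + f.2 in nb *; set YY := - f.1 + f.2 in nb D0.
have cXX (u : tangent R) : mdot (g p) u f.1 + mdot (g p) u f.2 = mdot (g p) u XX.
  have -> : XX = 1 *: f.1 + 1 *: f.2 by rewrite !scale1r.
  by rewrite mdotDr !mul1r.
have RHS u : (- rscale 2^-1 (clifford g p f u *m dirac_op sg phi p)) 1 0 =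
    Complex (2^-1 * mdot (g p) u XX * spin_derivative (-1) sg (ReF phi 1) p YY)
      (2^-1 * mdot (g p) u XX * spin_derivative (-1) sg (ImF phi 1) p YY).
  have [_ E] := clifford_mul p f u (dirac_op sg phi p); rewrite D0 cXX in E.
  rewrite /rscale [LHS]mxE [(_ *: _ : 'cV_2) _ _]mxE E.
  move: (mdot (g p) u XX) (spin_derivative _ _ _ _ _) (spin_derivative _ _ _ _ _) => c x y.
  by rewrite !complexM complexN; congr Complex; ring.
have RHS0 u : (- rscale 2^-1 (clifford g p f u *m dirac_op sg phi p)) 0 0 = 0.
  have [E _] := clifford_mul p f u (dirac_op sg phi p); rewrite D1 mulr0 in E.
  by rewrite /rscale [LHS]mxE [(_ *: _ : 'cV_2) _ _]mxE E mulr0 oppr0.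
split=> [H|[H1 H2] u].
  have := congr1 (fun w : 'cV[C]_2 => w 1 0) (H XX); rewrite /= RHS (nb_XX nb) mulr0 !mul0r.
  by rewrite (nablaS_coord sg phi p XX).2 => -[].
apply: col2P; first by rewrite RHS0; apply: (nablaS0 sg phi p u).2.
rewrite RHS (nablaS_coord sg phi p u).2.
have E := null_expand u nb.
have C1 := spin_derivative_comb (-1) (a := ReF phi 1) (2^-1 * mdot (g p) u YY) (2^-1 * mdot (g p) u XX) XX YY L Up r.
have C2 := spin_derivative_comb (-1) (a := ImF phi 1) (2^-1 * mdot (g p) u YY) (2^-1 * mdot (g p) u XX) XX YY L Up i.
rewrite -E H1 mulr0 add0r in C1; rewrite -E H2 mulr0 add0r in C2.
by rewrite C1 C2.
Qed.
End SpinorFields.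

(** * Both spinor spaces as spaces of parallel functions *)

Section Dimensions.
Context {R : realType} {M : surface R} {g : lorentz_metric M} {T : time_orientation g}.
Variable s : M -> frame R.
Hypothesis fn : flat_null_frame g (nullX s) (nullY s).
Hypothesis sP : forall p, in_P T p (s p).
Variable Q : spin_structure T.
Local Notation C := (complex R).
Local Notation act := (@act _ _ _ _ Q).
Implicit Types (q : Q) (phi : spinor_field Q) (z : Q -> C).

Lemma positive_coord phi : (forall q, phi q 1 0 = 0) -> positive phi.
Proof.
move=> H q; have [H0 H1] := e12_mul (phi q).
by apply: col2P; rewrite ?H0 ?H1 mxE// H oppr0.
Qed.

Lemma negative_coord phi : (forall q, phi q 0 0 = 0) -> negative phi.
Proof. by move=> H q; have [H0 H1] := e12_mul (phi q); apply: col2P; rewrite ?H0 ?H1 ?H ?oppr0. Qed.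

Lemma equivariantP (f : Q -> C) (h : R -> R) : (forall x, Spin11 x -> h (sp x) != 0) ->
  (forall q x, Spin11 x -> f q = Complex (h (sp x)) 0 * f (act q x)) <->
  (forall q x, Spin11 x -> complex.Re (f (act q x)) = (h (sp x))^-1 * complex.Re (f q)) /\
  (forall q x, Spin11 x -> complex.Im (f (act q x)) = (h (sp x))^-1 * complex.Im (f q)).
Proof.
move=> h0; split=> [H|[H1 H2] q x Sx].
  by split=> q x Sx; rewrite [in RHS](H q x Sx) scale_complex /= mulKf// h0.
by rewrite scale_complex (H1 q x Sx) (H2 q x Sx) !mulVKf ?h0//; exact: complexE.
Qed.

Lemma smooth_spinorP phi : smooth_spinor phi <->
  [/\ forall q x, Spin11 x -> phi q 0 0 = Complex (sp x)^-1 0 * phi (act q x) 0 0,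
      forall q x, Spin11 x -> phi q 1 0 = Complex (sp x) 0 * phi (act q x) 1 0 &
      forall U sg, local_section U sg -> forall k,
       smoothM (F := R^o) U (fun p => complex.Re (phi (sg p) k 0)) /\
       smoothM (F := R^o) U (fun p => complex.Im (phi (sg p) k 0))].
Proof.
have E x : Spin11 x -> x.1 - x.2 = (sp x)^-1 by case/Spin11_sp.
split=> [[A S]|[A0 A1 S]]; split=> // q x Sx; have [H0 H1] := spin_rep_mul x (phi (act q x)).
- by rewrite [in LHS](A q x Sx) H0 E.
- by rewrite [in LHS](A q x Sx) H1.
by apply: col2P; [rewrite H0 E// (A0 q x Sx)|rewrite H1 (A1 q x Sx)].
Qed.

Lemma smooth_zero (f : Q -> C) U sg : (forall q, f q = 0) -> local_section U sg ->
  smoothM (F := R^o) U (fun p => complex.Re (f (sg p))) /\ smoothM (F := R^o) U (fun p => complex.Im (f (sg p))).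
Proof.
move=> H _; have E1 : (fun p => complex.Re (f (sg p))) = cst 0 by apply/funext => p; rewrite H.
have E2 : (fun p => complex.Im (f (sg p))) = cst 0 by apply/funext => p; rewrite H.
by rewrite E1 E2; split; exact: smoothM_cst.
Qed.

Lemma positive_harmonicP phi : positive_harmonic phi <->
  [/\ forall q, phi q 1 0 = 0, real_harmonic (fun q => complex.Re (phi q 0 0)) &
      real_harmonic (fun q => complex.Im (phi q 0 0))].
Proof.
have spV (x : R * R) : Spin11 x -> (sp x)^-1 != 0 by move=> /Spin11_sp[]; rewrite invr_eq0.
split=> [[/smooth_spinorP[A0 A1 S] P H]|[P H1 H2]].
  have/(equivariantP (h := GRing.inv) _ spV)[R0 I0] := A0.
  split; first by move=> q; exact: positive0.
    split.
    - by move=> q y Sy; rewrite (R0 q y Sy) invrK.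
    - by move=> U sg L; exact: (S U sg L 0).1.
    - by move=> U sg p L Up; have [/(_ (H U sg p L Up))[]] := dirac_positive L Up (S U sg L) P.
  split.
  - by move=> q y Sy; rewrite (I0 q y Sy) invrK.
  - by move=> U sg L; exact: (S U sg L 0).2.
  - by move=> U sg p L Up; have [/(_ (H U sg p L Up))[]] := dirac_positive L Up (S U sg L) P.
have S U sg : local_section U sg -> forall k,
       smoothM (F := R^o) U (fun p => complex.Re (phi (sg p) k 0)) /\
       smoothM (F := R^o) U (fun p => complex.Im (phi (sg p) k 0)).
  move=> L k; case: k => [[|[|k]] Hk] //.
    rewrite (_ : Ordinal Hk = 0); last exact: val_inj.
    by split; [exact: (rh_smooth H1 L)|exact: (rh_smooth H2 L)].
  by rewrite (_ : Ordinal Hk = 1); [exact: (@smooth_zero (fun q => phi q 1 0) U sg)|exact: val_inj].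
have P' := positive_coord P; split=> //.
  apply/smooth_spinorP; split=> //; last by move=> q x Sx; rewrite !P mulr0.
  apply/(equivariantP (h := GRing.inv) _ spV); split=> q x Sx; rewrite invrK.
    exact: (rh_act H1 q Sx).
  exact: (rh_act H2 q Sx).
move=> U sg p L Up; apply/(dirac_positive L Up (S U sg L) P'); split.
  exact: (rh_eq H1 L Up).
exact: (rh_eq H2 L Up).
Qed.

Lemma negative_twistorP phi : negative_twistor phi <->
  [/\ forall q, phi q 0 0 = 0, real_twistor (fun q => complex.Re (phi q 1 0)) &
      real_twistor (fun q => complex.Im (phi q 1 0))].
Proof.
have spV (x : R * R) : Spin11 x -> id (sp x) != 0 by case/Spin11_sp.
split=> [[/smooth_spinorP[A0 A1 S] P H]|[P H1 H2]].
  have/(equivariantP (h := id) _ spV)[R0 I0] := A1.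
  split; first by move=> q; exact: negative0.
    split.
    - by move=> q y Sy; rewrite (R0 q y Sy).
    - by move=> U sg L; exact: (S U sg L 1).1.
    - by move=> U sg p L Up; have [/(_ (fun u => H U sg p u L Up))[]] := twistor_negative L Up (S U sg L) P.
  split.
  - by move=> q y Sy; rewrite (I0 q y Sy).
  - by move=> U sg L; exact: (S U sg L 1).2.
  - by move=> U sg p L Up; have [/(_ (fun u => H U sg p u L Up))[]] := twistor_negative L Up (S U sg L) P.
have S U sg : local_section U sg -> forall k,
       smoothM (F := R^o) U (fun p => complex.Re (phi (sg p) k 0)) /\
       smoothM (F := R^o) U (fun p => complex.Im (phi (sg p) k 0)).
  move=> L k; case: k => [[|[|k]] Hk] //.
    by rewrite (_ : Ordinal Hk = 0); [exact: (@smooth_zero (fun q => phi q 0 0) U sg)|exact: val_inj].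
  rewrite (_ : Ordinal Hk = 1); last exact: val_inj.
  by split; [exact: (rt_smooth H1 L)|exact: (rt_smooth H2 L)].
have P' := negative_coord P; split=> //.
  apply/smooth_spinorP; split=> //; first by move=> q x Sx; rewrite !P mulr0.
  apply/(equivariantP (h := id) _ spV); split=> q x Sx.
    exact: (rt_act H1 q Sx).
  exact: (rt_act H2 q Sx).
move=> U sg p u L Up; have [_ W] := twistor_negative L Up (S U sg L) P'; apply: W; split.
  exact: (rt_eq H1 L Up).
exact: (rt_eq H2 L Up).
Qed.

Definition parallel_complex z : Prop :=
  parallel_fun s (fun q => complex.Re (z q)) /\ parallel_fun s (fun q => complex.Im (z q)).

Definition independent n (z : 'I_n -> Q -> C) : Prop :=
  forall a : 'I_n -> C, (forall q, \sum_i a i * z i q = 0) -> forall i, a i = 0.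

Definition embed (k0 : 'I_2) (c : Q -> R) z : spinor_field Q :=
  fun q => \col_k (if k == k0 then Complex (c q) 0 * z q else 0).

Lemma dimC_embed k0 c (S : set (spinor_field Q)) : (forall q, c q != 0) ->
  (forall phi, S phi <-> exists2 z, parallel_complex z & phi = embed k0 c z) ->
  dimC S = ereal_sup [set (n%:R)%:E | n in
    [set n | exists2 z : 'I_n -> Q -> C, independent z & forall i, parallel_complex (z i)]].
Proof.
move=> c0 SP; rewrite /dimC; congr (ereal_sup (_ @` _)); apply/predeqP => n.
have E (z : 'I_n -> Q -> C) a q : \sum_i a i *: embed k0 c (z i) q =
    \col_k (if k == k0 then Complex (c q) 0 * (\sum_i a i * z i q) else 0).
  apply/matrixP => k j; rewrite summxE [RHS]mxE; case: (k =P k0) => [->|kk0].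
    by rewrite mulr_sumr; apply: eq_bigr => i _; rewrite 2!mxE eqxx mulrCA.
  by rewrite big1// => i _; rewrite 2!mxE (negbTE (introN eqP kk0)) mulr0.
have cC q : Complex (c q) 0 != 0 :> C by rewrite eq_complex /= (negbTE (c0 q)).
have I (z : 'I_n -> Q -> C) : lin_indep (fun i => embed k0 c (z i)) <-> independent z.
  split=> H a Ha i; apply: H => q.
    by rewrite E Ha; apply/matrixP => k j; rewrite !mxE mulr0 if_same.
  have := Ha q; rewrite E => /matrixP /(_ k0 0); rewrite !mxE eqxx => /eqP.
  by rewrite mulf_eq0 (negbTE (cC q)) => /eqP.
split=> [[B iB SB]|[z iz Vz]].
  have {}SB i : {z | parallel_complex z & B i = embed k0 c z} by have /SP/cid2 := SB i.
  exists (fun i => s2val (SB i)); last by move=> i; exact: (s2valP (SB i)).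
  apply/I; suff <- : B = (fun i => embed k0 c (s2val (SB i))) by [].
  by apply/funext => i; exact: (s2valP' (SB i)).
by exists (fun i => embed k0 c (z i)); [exact/I|move=> i; apply/SP; exists (z i)].
Qed.

Lemma embed_coord k0 c z q : embed k0 c z q k0 0 = Complex (c q) 0 * z q.
Proof. by rewrite mxE eqxx. Qed.

Lemma parallel_complexE (f h : Q -> C) (c : Q -> R) : (forall q, c q != 0) -> (forall q, h q = Complex (c q) 0 * f q) ->
  (fun q => complex.Re (h q)) = (fun q => c q * complex.Re (f q)) /\
  (fun q => complex.Im (h q)) = (fun q => c q * complex.Im (f q)).
Proof. by move=> c0 H; split; apply/funext => q; rewrite H scale_complex. Qed.

Lemma kk_neq0 q : kk s q != 0.
Proof. by have [k0 _] := kkP fn sP q; rewrite gt_eqF. Qed.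

Definition dim_parallel : \bar R := ereal_sup [set (n%:R)%:E | n in
    [set n | exists2 z : 'I_n -> Q -> C, independent z & forall i, parallel_complex (z i)]].

Lemma complex_scaleK (c : R) (z : C) : c != 0 -> Complex c 0 * (Complex c^-1 0 * z) = z.
Proof. by move=> c0; rewrite mulrA complexM mulfV// !mulr0 mul0r subr0 addr0; case: z => x y; rewrite complexM !mul1r !mul0r subr0 addr0. Qed.

Lemma delta_plusE : delta_plus Q = dim_parallel.
Proof.
apply: (dimC_embed kk_neq0 (k0 := 0)) => phi; rewrite positive_harmonicP; split=> [[P H1 H2]|[z [V1 V2] ->]].
  pose z q : C := Complex (kk s q)^-1 0 * phi q 0 0.
  have E q : phi q 0 0 = Complex (kk s q) 0 * z q by rewrite complex_scaleK// kk_neq0.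
  have [E1 E2] := parallel_complexE kk_neq0 E; rewrite E1 in H1; rewrite E2 in H2.
  exists z; first by split; apply/(real_harmonicP fn sP).
  by apply/funext => q; apply: col2P; rewrite mxE //= P.
split; first by move=> q; rewrite mxE.
  have [-> _] := parallel_complexE kk_neq0 (embed_coord 0 (kk s (Q:=Q)) z).
  by apply/(real_harmonicP fn sP).
have [_ ->] := parallel_complexE kk_neq0 (embed_coord 0 (kk s (Q:=Q)) z).
by apply/(real_harmonicP fn sP).
Qed.

Lemma tau_minusE : tau_minus Q = dim_parallel.
Proof.
have n0 q : (kk s q)^-1 != 0 by rewrite invr_eq0 kk_neq0.
apply: (dimC_embed n0 (k0 := 1)) => phi; rewrite negative_twistorP; split=> [[P H1 H2]|[z [V1 V2] ->]].
  pose z q : C := Complex (kk s q) 0 * phi q 1 0.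
  have E q : phi q 1 0 = Complex (kk s q)^-1 0 * z q by rewrite /z -{2}[kk s q]invrK complex_scaleK// n0.
  have [E1 E2] := parallel_complexE n0 E; rewrite E1 in H1; rewrite E2 in H2.
  exists z; first by split; apply/(real_twistorP fn sP).
  by apply/funext => q; apply: col2P; rewrite mxE //= P.
split; first by move=> q; rewrite mxE.
  have [-> _] := parallel_complexE n0 (embed_coord 1 (fun q => (kk s q)^-1) z).
  by apply/(real_twistorP fn sP).
have [_ ->] := parallel_complexE n0 (embed_coord 1 (fun q => (kk s q)^-1) z).
by apply/(real_twistorP fn sP).
Qed.
End Dimensions.

(** * Parallel functions and the dimension of their space *)

Section ParallelFunctions.
#[local] Opaque dM.
Context {R : realType} {M : surface R} {g : lorentz_metric M} {T : time_orientation g}.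
Variable s : M -> frame R.
Variable Q : spin_structure T.
Local Notation C := (complex R).
Local Notation pr := (@spin_proj _ _ _ _ Q).
Local Notation act := (@act _ _ _ _ Q).
Implicit Types (q : Q) (p : M) (v x y : Q -> R) (z : Q -> C).

Lemma parallel_funD x y : parallel_fun s x -> parallel_fun s y -> parallel_fun s (fun q => x q + y q).
Proof.
move=> [A1 S1 E1] [A2 S2 E2]; split.
- by move=> q a Sa; rewrite A1// A2// mulrDr.
- by move=> U sg L; have [oU _ _ _] := L; exact: (smoothMD oU (S1 U sg L) (S2 U sg L)).
move=> U sg p L Up; have [oU _ _ _] := L.
have H := dMD (nullX s p) oU Up (S1 U sg L) (S2 U sg L); rewrite (E1 U sg p L Up) (E2 U sg p L Up) addr0 in H.
exact: H.
Qed.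

Lemma parallel_fun0 : parallel_fun s (fun _ : Q => 0).
Proof.
split=> [q a Sa|U sg L|U sg p L Up]; first by rewrite mulr0.
  exact: (@smoothM_cst _ _ U (0 : R)).
exact: (dM_cst (0 : R) p (nullX s p)).
Qed.

Definition fibre_pt p : Q := sval (cid (fibre_exists Q p)).

Lemma fibre_ptP p : pr (fibre_pt p) = p. Proof. exact: svalP (cid (fibre_exists Q p)). Qed.

Lemma fibre_const (f : Q -> R) q q' : (forall q a, Spin11 a -> f (act q a) = f q) -> pr q = pr q' -> f q = f q'.
Proof. by move=> A E; have [m0 ->] := relP E; rewrite A//; exact: unspin_Spin11. Qed.

Lemma sg_square (a : R * R) : Spin11 a -> Num.sg (sp a) * Num.sg (sp a) = 1.
Proof. by move=> /Spin11_sp[n _]; rewrite -expr2 sqr_sg n. Qed.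

Lemma square_act v q a : parallel_fun s v -> Spin11 a -> v (act q a) ^+ 2 = v q ^+ 2.
Proof. by move=> [A _ _] Sa; rewrite A// exprMn expr2 (sg_square Sa) mul1r. Qed.

(** Along a fibre [v] changes by a sign, so its square descends to [M] and can be read at any chosen
    point of the fibre. *)
Definition square_over v p : R := v (fibre_pt p) ^+ 2.

Lemma square_overE v q : parallel_fun s v -> square_over v (pr q) = v q ^+ 2.
Proof.
move=> Pv; apply: (fibre_const (f := fun q => v q ^+ 2)); last exact: fibre_ptP.
by move=> q' a Sa; exact: square_act.
Qed.

Lemma square_over_section v U (sg : M -> Q) p : parallel_fun s v -> local_section U sg -> U p ->
  square_over v p = v (sg p) * v (sg p).
Proof. by move=> Pv [_ _ pU _] Up; rewrite -expr2 -(square_overE _ Pv) pU. Qed.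

Lemma square_over_smooth v : parallel_fun s v -> smoothM (F := R^o) setT (square_over v).
Proof.
move=> Pv; apply: smoothM_local => p _; have [U [sg [L Up]]] := local_section_exists Q p.
have [oU _ _ _] := L; exists U, p; split=> //; first exact: dom_self.
move=> n; apply: smoothM_Cn; have S := pf_smooth Pv L.
apply: smoothM_eq (smoothMM oU S S) => // x Ux.
by rewrite (square_over_section Pv L Ux).
Qed.

Lemma square_over_parallel v p : parallel_fun s v -> dM (square_over v) p (nullX s p) = 0.
Proof.
move=> Pv; have [U [sg [L Up]]] := local_section_exists Q p; have [oU _ _ _] := L.
have S := pf_smooth Pv L; have E := pf_eq Pv L Up.
have D := dMM (nullX s p) oU Up S S; rewrite E mulr0 addr0 in D; rewrite -D.
apply: near_eq_dM; apply: filterS (open_nbhs_nbhs (conj oU Up)) => x Ux.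
exact: (square_over_section Pv L Ux).
Qed.

Section ConstantSquares.
Hypothesis cs : forall v, parallel_fun s v -> forall q q', v q ^+ 2 = v q' ^+ 2.

(** Polarization of the constancy of squares. *)
Lemma constant_product x y q q' : parallel_fun s x -> parallel_fun s y -> x q * y q = x q' * y q'.
Proof.
move=> Px Py; have := cs (parallel_funD Px Py) q q'; have := cs Px q q'; have := cs Py q q'.
by rewrite !expr2; lra.
Qed.

Lemma constant_complex_product z w q q' : parallel_complex s z -> parallel_complex s w -> z q * w q = z q' * w q'.
Proof.
move=> [z1 z2] [w1 w2]; rewrite (complexE (z q)) (complexE (w q)) (complexE (z q')) (complexE (w q')) !complexM.
by rewrite (constant_product q q' z1 w1) (constant_product q q' z2 w2) (constant_product q q' z1 w2) (constant_product q q' z2 w1).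
Qed.

Lemma constant_dim n (z : 'I_n -> Q -> C) : independent z -> (forall i, parallel_complex s (z i)) -> (n <= 1)%N.
Proof.
case: n z => [|[|n]] z iz Pz //; exfalso.
have [[q0 n0]|N] := pselect (exists q, z ord0 q != 0); last first.
  have := iz (fun i => if i == ord0 then 1 else 0); rewrite /= => /(_ _ ord0) H.
  have : (1 : C) = 0.
    apply: H => q; rewrite (bigD1 ord0)//= big1 ?addr0; last by move=> i /negbTE ->; rewrite mul0r.
    by rewrite mul1r; apply/eqP/negPn/negP => h; apply: N; exists q.
  by move/eqP; rewrite oner_eq0.
pose i1 : 'I_n.+2 := lift ord0 ord0; pose z0 := z ord0; pose z1 := z i1.
(* Constancy of the products [z0 z0] and [z0 z1] gives the linear relation
   [z0(q0) z1(q0) z0 - z0(q0)^2 z1 = 0]. *)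
have := iz (fun i => if i == ord0 then z0 q0 * z1 q0 else if i == i1 then - (z0 q0 * z0 q0) else 0).
have i10 : i1 != ord0 by [].
move=> H; have {}H : - (z0 q0 * z0 q0) = 0.
  have := H _ i1; rewrite (negbTE i10) eqxx; apply=> q.
  rewrite (bigD1 ord0)//= (bigD1 i1)//= ?eqxx big1 ?addr0; last first.
    by move=> i /andP[/negbTE -> /negbTE ->]; rewrite mul0r.
  have P0 := constant_complex_product q0 q (Pz ord0) (Pz ord0).
  have P1 := constant_complex_product q0 q (Pz ord0) (Pz i1).
  rewrite -/z0 -/z1 in P0 P1 *; rewrite P0 P1; ring.
by move/eqP: H; rewrite oppr_eq0 mulf_eq0 orbb (negbTE n0).
Qed.
End ConstantSquares.

Lemma parallel_real v : parallel_fun s v -> parallel_complex s (fun q => Complex (v q) 0).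
Proof. by move=> Pv; split=> //=; exact: parallel_fun0. Qed.

Lemma dim_parallel_ub b : (forall n (z : 'I_n -> Q -> C), independent z ->
  (forall i, parallel_complex s (z i)) -> (n <= b)%N) -> (dim_parallel s Q <= (b%:R)%:E)%E.
Proof.
move=> H; apply: ge_ereal_sup => _ [n [z iz Pz] <-]; rewrite lee_fin ler_nat; exact: H iz Pz.
Qed.

Lemma dim_parallel_lb n (z : 'I_n -> Q -> C) : independent z -> (forall i, parallel_complex s (z i)) ->
  ((n%:R)%:E <= dim_parallel s Q)%E.
Proof. by move=> iz Pz; apply: ereal_sup_ubound; exists n => //; exists z. Qed.

Lemma dim_parallel_ge0 : (0 <= dim_parallel s Q)%E.
Proof.
have := @dim_parallel_lb 0 (fun i _ => 0); apply; first by move=> a _ [].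
by move=> [].
Qed.

Lemma dim_parallel_ge1 v q : parallel_fun s v -> v q != 0 -> (1 <= dim_parallel s Q)%E.
Proof.
move=> Pv v0; have := @dim_parallel_lb 1 (fun i q => Complex (v q) 0); apply; last by move=> _; exact: parallel_real.
move=> a H i; have := H q; rewrite big_ord1 (ord1 i) => /eqP; rewrite mulf_eq0 => /orP[/eqP//|].
by rewrite eq_complex /= (negbTE v0).
Qed.

Lemma dim_parallel_oo : (forall n, exists2 z : 'I_n -> Q -> C, independent z & forall i, parallel_complex s (z i)) ->
  dim_parallel s Q = +oo%E.
Proof.
move=> H; apply: eq_infty => r; have [n rn] : exists n : nat, r <= n%:R.
  by exists (Num.bound `|r|); apply: le_trans (ler_norm r) (ltW _); exact: archi_boundP.
have [z iz Pz] := H n; apply: le_trans (dim_parallel_lb iz Pz).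
by rewrite lee_fin.
Qed.

Lemma dim_parallel_le1 : (forall v, parallel_fun s v -> forall q q', v q ^+ 2 = v q' ^+ 2) ->
  dim_parallel s Q = 0%E \/ dim_parallel s Q = 1%E /\ exists v q, parallel_fun s v /\ v q != 0.
Proof.
move=> cs; have le1 : (dim_parallel s Q <= 1)%E by apply: (@dim_parallel_ub 1) => n z; exact: constant_dim.
have [[v [q [Pv v0]]]|N] := pselect (exists v q, parallel_fun s v /\ v q != 0).
  right; split; last by exists v, q.
  by apply/eqP; rewrite eq_le le1 (dim_parallel_ge1 Pv v0).
left; apply/eqP; rewrite eq_le dim_parallel_ge0 andbT; apply: (@dim_parallel_ub 0) => n z iz Pz.
case: n z iz Pz => // n z iz Pz; exfalso.
have Z q : z ord0 q = 0.
  have [P1 P2] := Pz ord0; rewrite (complexE (z ord0 q)).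
  have E1 : complex.Re (z ord0 q) = 0.
    by apply/eqP/negPn/negP => h; apply: N; exists (fun q => complex.Re (z ord0 q)), q.
  have E2 : complex.Im (z ord0 q) = 0.
    by apply/eqP/negPn/negP => h; apply: N; exists (fun q => complex.Im (z ord0 q)), q.
  by rewrite E1 E2.
have := iz (fun i => if i == ord0 then 1 else 0); rewrite /= => /(_ _ ord0) H.
have : (1 : C) = 0.
  by apply: H => q; rewrite (bigD1 ord0)//= big1 ?addr0 ?Z ?mulr0// => i /negbTE ->; rewrite mul0r.
by move/eqP; rewrite oner_eq0.
Qed.

End ParallelFunctions.

(** * Parallel transport and resonant cylinders *)

Section ParallelTransport.
#[local] Opaque dM koszul nabla mdot.
Context {R : realType} {M : surface R} {g : lorentz_metric M}.
Local Notation V2 := 'rV[R]_2.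
Local Notation e_ i := (delta_mx 0 i : V2).

Section Fields.
Variables X Y : M -> tangent R.
Hypothesis fn : flat_null_frame g X Y.
Let oT : open [set: M] := openT.

(** The products g(X, Y) and g(Y, Y) are constant and [X] is parallel along itself, so both null
    components of the derivative of [Y] along [X] vanish. *)
Lemma koszul_X_Y p z : koszul g p (X p) Y z = 0.
Proof.
have nb := fn_basis fn p; have SX := fn_X fn; have SY := fn_Y fn.
have N := nablaE g (X p) _ oT Logic.I SY (p := p).
suff Z : nabla g p (X p) Y = 0 by have := N z; rewrite Z (mdot0 _ _).1 => <-.
apply: (null_eq0 nb).
  rewrite N; have := koszul_metric g (X p) oT Logic.I SX SY (p := p).
  have -> : (fun x => mdot (g x) (X x) (Y x)) = cst 2 by apply/funext => x; exact: nb_XY (fn_basis fn x).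
  by rewrite dM_cst (koszul_X_X fn) add0r.
rewrite N; exact: (koszul_unit (c := 0) _ oT Logic.I SY (fun x _ => nb_YY (fn_basis fn x))).
Qed.
End Fields.

Section Curves.
Variable c : R -> M.
Hypothesis sc : smooth_curve c.

Lemma curve_velocity (t : R) : is_derive (t : R^o) 1 (fun u : R^o => chart (c t) (c u) : V2) (velocity c t).
Proof. by have [_ dv] := sc.2 (c t) [::] t (dom_self (c t)); exact: derivableP (dv 1). Qed.

Lemma function_along_curve (t : R) (W : set M) (f : M -> R) : open W -> W (c t) -> smoothM (F := R^o) W f ->
  is_derive (t : R^o) 1 (fun u : R^o => f (c u) : R^o) (dM f (c t) (velocity c t)).
Proof.
move=> oW Wc Sf; have := curve_derivative (@sc.1 t) (dom_self (c t)) (curve_velocity t) oW Wc Sf.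
by rewrite ext_self.
Qed.

Lemma koszul_ext_linear p u (w : V2) z : koszul g p u (ext p w) z =
  w 0 0 * koszul g p u (ext p (e_ 0)) z + w 0 1 * koszul g p u (ext p (e_ 1)) z.
Proof.
have Se := @ext_smooth R M p; have oD := dom_open p; have pD := dom_self p.
have C (a : R) := @smoothM_cst _ _ (dom p) a.
have K := koszul_comb g u z oD pD (C (w 0 0)) (C (w 0 1)) (Se (e_ 0)) (Se (e_ 1)).
have E x : dom p x -> ext p w x = cst (w 0 0) x *: ext p (e_ 0) x + cst (w 0 1) x *: ext p (e_ 1) x.
  by move=> px; apply: trans_linear => //; exact: dom_self.
have S : smooth_vf (dom p) (fun x => cst (w 0 0) x *: ext p (e_ 0) x + cst (w 0 1) x *: ext p (e_ 1) x).
  exact: (smooth_vf_eq E (Se w)).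
apply: (etrans (koszul_eq u z oD pD (Se w) S E)); apply: (etrans K).
have D0 := dM_cst (w 0 0) p u; have D1 := dM_cst (w 0 1) p u.
by move: D0 D1; clear; gen_dM; subst; rewrite /=; ring.
Qed.

Section Field.
Variables X Y : M -> tangent R.
Hypothesis fn : flat_null_frame g X Y.
Variable V : M -> tangent R.
Hypothesis SV : smooth_vf setT V.
Hypothesis DV : forall t z, koszul g (c t) (velocity c t) V z = 0.
Let oT : open [set: M] := openT.

Lemma mdot_inj p (u w : V2) : (forall z, mdot (g p) u z = mdot (g p) w z) -> u = w.
Proof.
move=> E; apply/eqP; rewrite -subr_eq0; apply/eqP; apply: (null_eq0 (fn_basis fn p)).
  by rewrite -[u - w]/(u + (- w)) -[u]scale1r -scaleN1r mdotDl mul1r mulN1r E subrr.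
by rewrite -[u - w]/(u + (- w)) -[u]scale1r -scaleN1r mdotDl mul1r mulN1r E subrr.
Qed.

Lemma parallel_field : parallel_along g c (fun t => V (c t)).
Proof.
move=> t; set p := c t; set vel := velocity c t.
have D : is_derive (t : R^o) 1 (fun u : R^o => comp p V (c u) : V2) (dcomp p V vel).
  apply: is_derive_row => i; rewrite dcompE.
  have S : smoothM (F := R^o) ([set: M] `&` dom p) (fun x => comp p V x 0 i) by exact: comp_smooth.
  exact: (function_along_curve (t := t) (openI oT (dom_open p)) (conj Logic.I (dom_self p)) S).
suff -> : - nabla g p vel (ext p (V p)) = dcomp p V vel by [].
apply: mdot_inj (p) _ _ _ => z.
have K1 := koszulE g vel z oT Logic.I SV (p := p).
have K2 := koszulE g vel z (dom_open p) (dom_self p) (@ext_smooth R M p (V p)).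
rewrite dcomp_ext (mdot0 _ _).1 add0r ext_self in K2.
have N := nablaE g vel z (dom_open p) (dom_self p) (@ext_smooth R M p (V p)).
rewrite -scaleN1r (scale_comb (-1)) mdotDl mul0r addr0 N K2.
have /eqP := etrans (esym K1) (DV t z); rewrite addr_eq0 => /eqP H.
by apply: (etrans _ (esym H)); rewrite mulN1r.
Qed.

(** Metric compatibility for a vector and a field that are both parallel along the curve. The vector
    exists along the curve alone, so it is expanded on fields constant in the chart. *)
Lemma parallel_pairing (w : R -> V2) (t : R) : parallel_along g c w ->
  is_derive (t : R^o) 1 (fun u : R^o => mdot (g (c u)) (w u) (V (c u)) : R^o) 0.
Proof.
move=> /(_ t); set p := c t; set vel := velocity c t => Dw.
have pD := dom_self p; have oD := dom_open p; have Se := @ext_smooth R M p.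
pose W (u : R^o) : V2 := trans (c u) p (c u) (w u).
have Wt : W t = w t by exact: transK.
have SVp : smooth_vf (dom p) V by exact: (@smooth_vfW _ _ (dom p) setT V (fun _ _ => Logic.I) SV).
pose G i x := mdot (g x) (ext p (e_ i) x) (V x).
have SG i : smoothM (F := R^o) (dom p) (G i) by exact: (smooth_metric g oD (Se (e_ i)) SVp).
have DG i : is_derive (t : R^o) 1 (fun u : R^o => G i (c u) : R^o) (koszul g p vel (ext p (e_ i)) (V p)).
  have H := function_along_curve (t := t) oD pD (SG i).
  have K := koszul_metric g vel oD pD (Se (e_ i)) SVp; rewrite ext_self DV addr0 in K.
  by rewrite K; exact: H.
have Gp i : G i p = mdot (g p) (e_ i) (V p) by rewrite /G ext_self.
have N : \forall u \near t, W u 0 0 * G 0 (c u) + W u 0 1 * G 1 (c u) = mdot (g (c u)) (w u) (V (c u)).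
  apply: filterS (near_image (@sc.1 t) (near_dom pD)) => u pu.
  have -> : w u = ext p (W u) (c u) by rewrite /ext /W trans_trans ?transK//; exact: dom_self.
  have -> : ext p (W u) (c u) = W u 0 0 *: ext p (e_ 0) (c u) + W u 0 1 *: ext p (e_ 1) (c u).
    by apply: trans_linear => //; exact: dom_self.
  by rewrite mdotDl.
have D := is_deriveD (is_deriveM (is_derive_coord 0 Dw) (DG 0)) (is_deriveM (is_derive_coord 1 Dw) (DG 1)).
apply: (near_eq_is_derive N); move: D; rewrite /= -/(W t) Wt !Gp => -[d D]; apply: (DeriveDef d); rewrite D.
have NE := nablaE g vel (V p) oD pD (Se (w t)); have KE := koszul_ext_linear p vel (w t) (V p).
set n := nabla g p vel (ext p (w t)) in NE *.
have EN : mdot (g p) n (V p) = n 0 0 * mdot (g p) (e_ 0) (V p) + n 0 1 * mdot (g p) (e_ 1) (V p).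
  by rewrite {1}[n]rV2E mdotDl.
have n0 i : (- n) 0 i = - n 0 i by rewrite mxE.
rewrite !n0; move: NE; rewrite KE EN; clear; rewrite /GRing.scale /=; gen_dM; lra.
Qed.
End Field.
End Curves.
End ParallelTransport.

(** * Parallel functions along the lines *)

Section FlowOfX.
#[local] Opaque dM koszul nabla mdot.
Context {R : realType} {M : surface R} {g : lorentz_metric M} {T : time_orientation g}.
Variable s : M -> frame R.
Hypothesis fn : flat_null_frame g (nullX s) (nullY s).
Hypothesis sP : forall p, in_P T p (s p).
Variable bx : M -> @box R M.
Hypothesis fb : forall p, flow_box_at g (nullX s) (nullY s) p (bx p).
Variable F : R -> M -> M.
Hypothesis fl : flow_structure bx F.

Lemma derive0_const (f : R -> R) : (forall t : R, is_derive (t : R^o) 1 (f : R^o -> R^o) 0) -> forall t u, f t = f u.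
Proof.
move=> D t u; have := @constant_derive1 _ f u (`|t - u| + 1) 0 (fun v _ => D (v + u)) (t - u).
by rewrite subrK mulr0 ltrDl ltr01 => /(_ isT)/eqP; rewrite subr_eq0 => /eqP.
Qed.

Lemma locally_const (f : R -> R) : (forall t, \forall u \near t, f u = f t) -> forall t u, f t = f u.
Proof.
move=> L; apply: derive0_const => t.
have N : \forall u \near (t : R^o), cst (f t) u = f u by apply: filterS (L t) => u ->.
exact: near_eq_is_derive N (is_derive_cst (f t : R^o) (t : R^o) (1 : R^o)).
Qed.

(** A continuous function without zeros keeps its sign, and its absolute value is fixed by the
    square. *)
Lemma square_const (f : R -> R) (a : R) : continuous f -> a != 0 -> (forall t, f t ^+ 2 = a) -> forall t u, f t = f u.
Proof.
move=> cf a0 E; apply: locally_const => t.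
have f0 u : f u != 0 by apply/eqP => Z; move: (E u) a0; rewrite Z expr0n => <-; rewrite eqxx.
apply: filterS (near_sgr (@cf t) (f0 t)) => u Su.
rewrite [f u]numEsg [f t]numEsg Su; congr (_ * _).
by apply/eqP; rewrite -(@eqrXn2 _ 2)// -!normrX !E.
Qed.

Lemma flow_curve y : X_curve g (fun t => F (1 * t) y).
Proof. exact: (X_curve_orbit fn fb fl y (oner_neq0 R)). Qed.

Lemma velocity_scale c t : X_curve g c -> exists l : R, velocity c t = l *: nullX s (c t).
Proof. by move=> [_ V]; have [l _ ->] := (in_XP fn (c t) (velocity c t)).1 (V t); exists l. Qed.

Lemma curve_invariant c (h : M -> R) : X_curve g c -> smoothM (F := R^o) setT h ->
  (forall p, dM h p (nullX s p) = 0) -> forall t u, h (c t) = h (c u).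
Proof.
move=> Xc Sh Dh; apply: (@derive0_const (h \o c)) => t.
have D := function_along_curve Xc.1 (t := t) openT Logic.I Sh.
have [l E] := velocity_scale t Xc.
have Z : dM h (c t) (velocity c t) = 0 by rewrite E (dM_scale l (nullX s (c t)) openT Logic.I Sh) Dh mulr0.
by rewrite Z in D; exact: D.
Qed.

Lemma flow_invariant (h : M -> R) t y : smoothM (F := R^o) setT h ->
  (forall p, dM h p (nullX s p) = 0) -> h (F t y) = h y.
Proof.
move=> Sh Dh; have := curve_invariant (flow_curve y) Sh Dh t 0.
by rewrite mul1r mulr0 (fs_0 fl).
Qed.

Lemma koszul_scale p (l : R) (W : M -> tangent R) z : smooth_vf setT W ->
  koszul g p (nullX s p) W z = 0 -> koszul g p (l *: nullX s p) W z = 0.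
Proof.
move=> SW Z; rewrite scale_comb; apply: (etrans (koszul_dir g _ _ _ _ _ openT Logic.I SW)).
by rewrite Z mulr0 mul0r addr0.
Qed.

Section SpinBundle.
Variable Q : spin_structure T.
Local Notation pr := (@spin_proj _ _ _ _ Q).
Local Notation fr := (@fr _ _ _ _ Q).
Local Notation act := (@act _ _ _ _ Q).

(** Smoothness of [v] is given along sections. Near [q] the points of [Q] come from a section by
    group elements of locally constant sign, and [v] depends on these elements through their
    sign. *)
Lemma parallel_fun_continuous (v : Q -> R) : parallel_fun s v -> continuous v.
Proof.
move=> Pv q; have [U [sg [L Up]]] := local_section_exists Q (pr q); have [oU _ pU _] := L.
have cp : {for q, continuous pr} by exact: spin_proj_continuous.
have csg := section_continuous L Up.
have c1 : {for q, continuous (sg \o pr)} by exact: (continuous_comp cp csg).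
have c2 : {for q, continuous (v \o sg \o pr)}.
  exact: (continuous_comp cp (smoothM_continuous oU Up (pf_smooth Pv L))).
have NU : \forall q' \near q, U (pr q') by apply: (near_image cp); exact: open_nbhs_nbhs.
have NE : \forall q' \near q, pr ((sg \o pr) q') = pr (id q') by apply: filterS NU => q' /pU.
have cq : {for q, continuous (id : Q -> Q)} by exact: cvg_id.
have NS := rel_sg_near c1 cq NE.
set e := Num.sg _ in NS.
have N : \forall q' \near q, e * v (sg (pr q')) = v q'.
  near=> q'; have E : pr (sg (pr q')) = pr q' by near: q'.
  have [m0 Eq] := relP E; have Ev : v q' = Num.sg (rel (sg (pr q')) q') * v (sg (pr q')).
    by rewrite {1}Eq (pf_act Pv _ (unspin_Spin11 m0)) sp_unspin.
  by rewrite Ev; congr (_ * _); apply/esym; near: q'.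
apply: near_eq_continuous N _; apply: cvgM; [exact: cvg_cst|exact: c2].
Unshelve. all: by end_near.
Qed.

(** [lam] is half the pairing of a frame vector with [Y]; the frame is parallel along the lift and
    [Y] is parallel along the lines. *)
Lemma horizontal_lam c (q : R -> Q) : X_curve g c -> horizontal_lift c q -> forall t u, lam s (q t) = lam s (q u).
Proof.
move=> Xc [cq pq P1 P2]; pose w i t := mdot (g (c t)) (if i then (fr (q t)).1 else (fr (q t)).2) (nullY s (c t)).
have DY t z : koszul g (c t) (velocity c t) (nullY s) z = 0.
  have [l ->] := velocity_scale t Xc; apply: koszul_scale; first exact: (fn_Y fn).
  exact: koszul_X_Y.
have D1 t := parallel_pairing Xc.1 (fn_Y fn) DY t P1; have D2 t := parallel_pairing Xc.1 (fn_Y fn) DY t P2.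
have E1 := derive0_const D1; have E2 := derive0_const D2.
move=> t u; rewrite /lam !pq; congr (_ * _).
have e r : mdot (g (c r)) ((fr (q r)).1 + (fr (q r)).2) (nullY s (c r)) =
   mdot (g (c r)) (fr (q r)).1 (nullY s (c r)) + mdot (g (c r)) (fr (q r)).2 (nullY s (c r)).
  by rewrite -[in LHS](scale1r (fr (q r)).1) -[in LHS](scale1r (fr (q r)).2) mdotDl !mul1r.
by rewrite !e (E1 t u) (E2 t u).
Qed.

(** The group element [m] from [q] to [q'] satisfies [m^2 = 1] by [lam] and is positive by the sign
    of [v]. *)
Lemma fibre_unique (q q' : Q) (v : Q -> R) : parallel_fun s v -> pr q = pr q' -> lam s q = lam s q' ->
  Num.sg (v q) = Num.sg (v q') -> v q != 0 -> q = q'.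
Proof.
move=> Pv E El Ev v0; have [m0 Eq] := relP E; set m := rel q q' in m0 Eq.
have Sm := unspin_Spin11 m0.
have l0 : lam s q != 0 by have [l0 _ _] := lamP fn sP q; rewrite gt_eqF.
have m2 : m ^+ 2 = 1.
  move: El; rewrite Eq (lam_act s q Sm) sp_unspin => El.
  by apply: invr_inj; apply: (mulIf l0); rewrite -El invr1 mul1r.
have sm : Num.sg m = 1.
  move: Ev; rewrite Eq (pf_act Pv _ Sm) sp_unspin sgrM sgr_id => Ev.
  have s0 : Num.sg (v q) != 0 by rewrite sgr_eq0.
  by apply: (mulIf s0); rewrite -Ev mul1r.
have m1 : m = 1.
  have/eqP := m2; rewrite sqrf_eq1 => /orP[/eqP//|/eqP mN].
  by move: sm; rewrite mN sgrN sgr1 => /eqP; rewrite eqNr oner_eq0.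
by rewrite Eq m1 -[X in unspin X](@sp1 R) unspin_sp ?act1//; exact: Spin11_1.
Qed.

(** Along a horizontal lift [v] keeps its nonzero value and [lam] is constant, so the two endpoints,
    lying over one point, coincide. *)
Lemma parallel_trivial_along (v : Q -> R) l : parallel_fun s v -> (forall p, l p -> square_over v p != 0) ->
  X_trivial_along Q l.
Proof.
move=> Pv n0 c q [Xc cl c1 _] H; have [cq pq _ _] := H.
have E t : v (q t) ^+ 2 = square_over v (c 0).
  rewrite -(square_overE _ Pv) pq; apply: (curve_invariant Xc (square_over_smooth Pv)) => p.
  exact: square_over_parallel.
have c0 : square_over v (c 0) != 0 by apply: n0; rewrite -cl; exists 0.
have cv : continuous (v \o q) by move=> t; apply: continuous_comp; [exact: cq|exact: parallel_fun_continuous].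
have Ev := square_const cv c0 E.
apply: (fibre_unique Pv); rewrite ?pq.
- by rewrite -[1]add0r c1.
- exact: (horizontal_lam Xc H).
- by have /= -> := Ev 1 0.
by apply/eqP => Z; move: (E 1) c0; rewrite Z expr0n => <-; rewrite eqxx.
Qed.
End SpinBundle.
End FlowOfX.

(** * Resonant cylinders *)

Section ResonantCylinders.
#[local] Opaque dM koszul nabla mdot.
Context {R : realType} {M : surface R} {g : lorentz_metric M} {T : time_orientation g}.
Variable s : M -> frame R.
Hypothesis fn : flat_null_frame g (nullX s) (nullY s).
Hypothesis sP : forall p, in_P T p (s p).
Variable bx : M -> @box R M.
Hypothesis fb : forall p, flow_box_at g (nullX s) (nullY s) p (bx p).
Variable F : R -> M -> M.
Hypothesis fl : flow_structure bx F.
Local Notation slice := (slice bx).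
Local Notation sheet := (sheet bx F).

Lemma connected_constant (h : M -> R) : (forall x, \forall y \near x, h y = h x) -> forall x y, h x = h y.
Proof.
move=> L x y; have E : [set z | h z = h x] = setT.
  apply: (@surface_connected _ M); first by exists x.
    exists [set z | h z = h x]; last by rewrite setTI.
    by rewrite openE => z /= zx; apply: filterS (L z) => w /= ->.
  exists [set z | h z = h x]; last by rewrite setTI.
  rewrite -[X in closed X]setCK; apply: open_closedC; rewrite openE => z zx.
  by apply: filterS (L z) => w wz; rewrite /= wz.
by have : [set z | h z = h x] y by rewrite E.
Qed.

Section Tubes.
Variables (x : M) (e : R) (tau : R -> R).
Hypothesis tb : tube bx F x e tau.

Lemma tube_orbit_closed r : `|r| < e -> closed_line g (orbit F (slice x r)).
Proof.
move=> re; apply/(closed_lineP fn fb fl); exists (slice x r) => //; exists (tau r).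
  exact: (tube_per_gt0 tb).
exact: (tube_per tb).
Qed.

Lemma tube_core_orbit d t r l : d < e -> `|r| <= d -> X_line g l -> l (sheet x t r) -> l = orbit F (slice x r).
Proof.
move=> de rd /(X_lineP fn fb fl)[y ->] ly.
by rewrite -(orbit_eq fl ly) (orbit_eq fl (orbit_sheet bx F x t r)).
Qed.

(** The boundary orbits lie at heights [- d] and [d]. The core is not a single line, since it
    contains orbits of different heights. *)
Lemma tube_core_resonant d : 0 < d -> d < e -> resonant_cylinder g (tube_core bx F x d).
Proof.
move=> d0 de; have dn : `|d| < e by rewrite gtr0_norm.
have Z : `|0 : R| <= d by rewrite normr0 ltW.
have core0 : tube_core bx F x d x by exists 0, 0; split=> //; rewrite /sheet (fs_0 fl) (slice0 fl).
split.
- exists (orbit F (slice x (- d))), (orbit F (slice x d)), (tube_set bx F x d); split; last first.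
    by rewrite (tube_core_closure fl tb).
  split; [by apply: tube_orbit_closed; rewrite normrN|exact: tube_orbit_closed|].
  have E := tube_component fl tb d0 de; exists x; last exact: E.
  apply: (@connected_component_sub _ (~` (orbit F (slice x (- d)) `|` orbit F (slice x d))) x).
  by rewrite -E; exists 0, 0; rewrite normr0; split=> //; rewrite /sheet (fs_0 fl) (slice0 fl).
- move=> L; have lx : tube_core bx F x d (sheet x 0 0) by exists 0, 0.
  have E := tube_core_orbit de Z L lx.
  have : tube_core bx F x d (sheet x 0 d) by exists 0, d; rewrite gtr0_norm.
  rewrite E => -[t _ /=]; rewrite -/(sheet x t 0) => H.
  have [H1 _] := sheet_inj fl tb (le_lt_trans Z de) dn H.
  by move: d0; rewrite -H1 ltxx.
move=> p l [t [r [rd ->]]] L lp; rewrite (tube_core_orbit de rd L lp).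
by apply: tube_orbit_closed; exact: le_lt_trans de.
Qed.
End Tubes.

Section SpinBundle.
Variable Q : spin_structure T.
Local Notation pr := (@spin_proj _ _ _ _ Q).

Lemma square_over_critical (v : Q -> R) p u : parallel_fun s v -> square_over v p = 0 -> dM (square_over v) p u = 0.
Proof.
move=> Pv Z; have [U [sg [L Up]]] := local_section_exists Q p; have [oU _ _ _] := L.
have S := pf_smooth Pv L; have D := dMM u oU Up S S.
have v0 : (v \o sg) p = 0.
  by move: Z; rewrite (square_over_section Pv L Up) => /eqP; rewrite mulf_eq0 orbb => /eqP.
rewrite v0 mul0r addr0 in D; rewrite -D.
apply: near_eq_dM; apply: filterS (open_nbhs_nbhs (conj oU Up)) => y Uy.
exact: (square_over_section Pv L Uy).
Qed.

Lemma nonconstant_resonant (v : Q -> R) q q' : parallel_fun s v -> v q ^+ 2 != v q' ^+ 2 ->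
  exists A, X_trivial_resonant Q A.
Proof.
move=> Pv ne; pose h := square_over v; have Sh : smoothM (F := R^o) setT h := square_over_smooth Pv.
have Xh p : dM h p (nullX s p) = 0 := square_over_parallel p Pv.
pose f p := 2^-1 * dM h p (nullY s p).
have cont (k : M -> R) : smoothM (F := R^o) setT k -> continuous k.
  by move=> Sk p; exact: (smoothM_continuous openT Logic.I Sk).
have SYh : smoothM (F := R^o) setT (fun p => dM h p (nullY s p)) := fn_Y fn openT (fun _ _ => Logic.I) Sh.
have cf : continuous f by apply: cont; exact: (smoothMM openT (@smoothM_cst _ _ setT (2^-1 : R)) SYh).
have ih t y : h (F t y) = h y by exact: (flow_invariant fn fb fl t y Sh Xh).
have sl p : is_derive (0 : R) 1 (fun r => h (slice p r)) (f p) := fb_slice (fb p) Sh.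
(* As [X h = 0], the vanishing of [Y h] everywhere would make [h] constant on the connected
   surface. *)
have [x fx] : exists x, f x != 0.
  apply: contrapT => N; move/eqP: ne; apply; rewrite -!(square_overE _ Pv).
  apply: connected_constant => p; apply: (locally_constant openT Logic.I Sh) => z u _.
  have fz : dM h z (nullY s z) = 0.
    have : f z = 0 by apply/eqP/negPn/negP => H; apply: N; exists z.
    by move/eqP; rewrite mulf_eq0 invr_eq0 pnatr_eq0 /= => /eqP.
  have E := null_expand u (fn_basis fn z).
  set a := 2^-1 * _ in E; set b := 2^-1 * _ in E.
  have D := dM_linear u openT Logic.I Sh (x := z).
  have C := scalar_comb2 a b (nullX s z) (nullY s z) (dM h z (delta_mx 0 0)) (dM h z (delta_mx 0 1)).
  rewrite -E -(dM_linear (nullX s z) openT Logic.I Sh) -(dM_linear (nullY s z) openT Logic.I Sh) Xh fz !mulr0 addr0 in C.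
  by rewrite D.
have [e [tau tb]] := periodic_tube fl (recurrent_periodic fl (cont _ Sh) cf ih sl fx).
(* A zero of a square is critical, so [f x <> 0] excludes [h x = 0]. By invariance [h] then has no
   zero on a thin enough tube. *)
have hx : h x != 0.
  by apply: contraNneq fx => Z; rewrite /f (square_over_critical _ Pv Z) mulr0.
have e0 := tube_gt0 tb; have er := tube_rad tb.
have Z0 : `|0 : R| < brad (bx x) by rewrite normr0 (lt_trans e0).
have cs : {for (0 : R), continuous (fun r => h (slice x r))}.
  exact: (continuous_comp (f := slice x) (g := h) (slice_continuous fl Z0) (cont _ Sh _)).
have N : \forall r \near (0 : R), h (slice x r) != 0.
  apply: (near_image (P := fun a : R => a != 0) cs); rewrite (slice0 fl).
  by apply: open_nbhs_nbhs; split=> //; apply: open_neq.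
have [d /= d0 Hd] := N.
pose d' := Num.min (d / 2) (e / 2).
have d'0 : 0 < d' by rewrite lt_min !divr_gt0.
have d'd : d' < d by rewrite gt_min ltr_pdivrMr// ltr_pMr// ltr1n.
have d'e : d' < e by rewrite gt_min orbC ltr_pdivrMr// ltr_pMr// ltr1n.
exists (tube_core bx F x d'); split; first exact: (tube_core_resonant tb).
move=> l _ sub; apply: (parallel_trivial_along fn sP Pv) => p /sub[t [r [rd ->]]].
rewrite -/h /sheet ih; apply: Hd => /=; rewrite sub0r normrN; exact: le_lt_trans d'd.
Qed.
End SpinBundle.

(** The orbit is the core of radius 0 of its tube, hence compact. *)
Lemma orbit_closed x : (exists2 t, 0 < t & F t x = x) -> closed (orbit F x).
Proof.
move=> /(periodic_tube fl)[e [tau tb]]; have e0 := tube_gt0 tb.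
suff -> : orbit F x = tube_core bx F x 0 by exact: (core_closed fl tb).
apply/seteqP; split=> [_ [t _ <-]|y [t [r [r0 ->]]]].
  by exists t, 0; rewrite normr0; split=> //; rewrite /sheet (slice0 fl).
have -> : r = 0 by apply/eqP; rewrite -normr_le0.
by exists t => //; rewrite /sheet (slice0 fl).
Qed.

Lemma closed_line_closed l : closed_line g l -> closed l.
Proof. by move=> /(closed_lineP fn fb fl)[x -> P]; exact: orbit_closed. Qed.

Lemma cylinder_open l1 l2 C : cylinder g l1 l2 C -> open C.
Proof.
move=> [c1 c2 [x _ ->]]; apply: (component_open fl); apply: closed_openC.
by apply: closedU; exact: closed_line_closed.
Qed.

Lemma line_eq l l' x : X_line g l -> X_line g l' -> l x -> l' x -> l = l'.
Proof.
move=> /(X_lineP fn fb fl)[y ->] /(X_lineP fn fb fl)[z ->] lx l'x.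
by rewrite -(orbit_eq fl lx) (orbit_eq fl l'x).
Qed.

Lemma cylinder_orbit l1 l2 C x : cylinder g l1 l2 C -> C x -> orbit F x `<=` C.
Proof.
move=> cy Cx; have [c1 c2 [y _ E]] := cy; move: Cx; rewrite {1}E => Cx.
have xN := connected_component_sub Cx.
rewrite E (same_connected_component Cx); apply: connected_component_max.
- exact: (orbit_refl fl).
- move=> z oz [l1z|l2z]; apply: xN.
    by left; rewrite -(line_eq (orbit_line fn fb fl x) c1.1 oz l1z); exact: (orbit_refl fl).
  by right; rewrite -(line_eq (orbit_line fn fb fl x) c2.1 oz l2z); exact: (orbit_refl fl).
exact: (orbit_connected fl).
Qed.

Lemma cylinder_nonempty l1 l2 C : cylinder g l1 l2 C -> C !=set0.
Proof. by move=> [_ _ [x nx ->]]; exists x; exact: connected_component_refl. Qed.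

(** A dense line enters the open cylinder, where all lines are closed, so it would be the whole
    surface and coincide with the boundary line [l1]. *)
Lemma dense_no_resonant l A : dense_line g l -> resonant_cylinder g A -> False.
Proof.
move=> [Xl dl] [[l1 [l2 [C [cy AE]]]] _ H].
have [x Cx] := cylinder_nonempty cy; have oC := cylinder_open cy.
have [y [ly Cy]] : l `&` C !=set0.
  have : closure l x by rewrite dl.
  by apply; apply: open_nbhs_nbhs.
have cl : closed_line g l by apply: (H y) => //; rewrite AE; exact: subset_closure.
have lT : l = setT by rewrite -dl -((closure_id _).1 (closed_line_closed cl)).
have [c1 _ [z nz E]] := cy; have /(X_lineP fn fb fl)[w E1] := c1.1.
have l1w : l1 w by rewrite E1; exact: (orbit_refl fl).
have := line_eq Xl c1.1 (_ : l w) l1w; rewrite lT => /(_ Logic.I) T1.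
by apply: nz; left; rewrite -T1.
Qed.

(** Non-resonance applied to the cylinder itself provides an asymptotic line in it, which is not
    closed. *)
Lemma nonresonant_no_resonant A : nonresonant_surface g -> resonant_cylinder g A -> False.
Proof.
move=> nr [[l1 [l2 [C [cy AE]]]] _ H]; have [c1 c2 _] := cy.
have T1 (B : set M) : B `<=` closure [set: M] by move=> y _; apply: subset_closure.
have [l [Xl ncl _] lC] := nr l1 l2 C c1 c2 (T1 _) (T1 _) cy (fun _ _ => Logic.I).
have /(X_lineP fn fb fl)[x lE] := Xl.
have lx : l x by rewrite lE; exact: (orbit_refl fl).
by apply: ncl; apply: (H x) => //; rewrite AE; apply: subset_closure; exact: lC.
Qed.
End ResonantCylinders.

(** * Continuity of the group action *)

Section ActionContinuity.
#[local] Opaque dM koszul nabla mdot.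
Context {R : realType} {M : surface R} {g : lorentz_metric M} {T : time_orientation g}.
Variable Q : spin_structure T.
Local Notation pr := (@spin_proj _ _ _ _ Q).
Local Notation act := (@act _ _ _ _ Q).

Lemma spin_mul_continuous (Z : topologicalType) (x y : Z -> R * R) z : {for z, continuous x} ->
  {for z, continuous y} -> {for z, continuous (fun w => spin_mul (x w) (y w))}.
Proof.
move=> cx cy.
have x1 : {for z, continuous (fun w => (x w).1)} by apply: (continuous_comp cx); exact: cvg_fst.
have x2 : {for z, continuous (fun w => (x w).2)} by apply: (continuous_comp cx); exact: cvg_snd.
have y1 : {for z, continuous (fun w => (y w).1)} by apply: (continuous_comp cy); exact: cvg_fst.
have y2 : {for z, continuous (fun w => (y w).2)} by apply: (continuous_comp cy); exact: cvg_snd.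
by apply: continuous_pair_for; apply: cvgD; apply: cvgM.
Qed.

Lemma unspin_continuous (m : R) : m != 0 -> {for m, continuous (@unspin R)}.
Proof.
move=> m0; have cV : {for m, continuous (fun u : R => u^-1)} by exact: inv_continuous.
have ci : {for m, continuous (fun u : R => u)} by exact: cvg_id.
apply: continuous_pair_for; apply: cvgM; try exact: cvg_cst.
  exact: cvgD.
exact: cvgB.
Qed.

(** Continuity is relative to the subset [Spin11] of the plane; it is read in a trivialization,
    where the action is the multiplication of the group. *)
Lemma act_continuous q y (N : set Q) : Spin11 y -> nbhs (act q y) N ->
  \forall z \near (q, y), Spin11 z.2 -> N (act z.1 z.2).
Proof.
move=> Sy; have [U [s' [Phi [Psi [oU Up Tr]]]]] := fibre_coord Q (pr q).
have [[_ _] [cPhi _] _ K A] := Tr; have [S E] := K q Up.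
rewrite -[in X in X -> _]E (A _ _ _ Up S Sy) => NN.
have H1 : (U `*` @Spin11 R) (pr q, spin_mul (Psi q) y) by split=> //; exact: Spin11M.
move/subspace_continuousP: cPhi => /(_ _ H1) /(_ _ NN); rewrite /= nbhs_filterE /within /= => N1.
have cf : {for (q, y), continuous (fun z : Q * (R * R) => z.1)} by exact: cvg_fst.
have cs : {for (q, y), continuous (fun z : Q * (R * R) => z.2)} by exact: cvg_snd.
have cp : {for (q, y), continuous (fun z : Q * (R * R) => pr z.1)}.
  by apply: (continuous_comp cf); exact: spin_proj_continuous.
have cP : {for (q, y), continuous (fun z : Q * (R * R) => Psi z.1)}.
  by apply: (continuous_comp cf); exact: (Psi_continuous oU Tr Up).
have cm := spin_mul_continuous cP cs.
have NN2 := near_image (continuous_pair_for cp cm) N1.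
have NU : \forall z \near (q, y), U (pr z.1) by apply: (near_image cp); exact: open_nbhs_nbhs.
apply: filterS2 NN2 NU => -[q' y'] /= H Uq' Sy'; have [S' E'] := K q' Uq'.
by rewrite -E' A//; apply: H; split=> //; exact: Spin11M.
Qed.

Lemma act_continuous_for (Z : topologicalType) (u : Z -> Q) (y : Z -> R * R) z : {for z, continuous u} ->
  {for z, continuous y} -> (\forall w \near z, Spin11 (y w)) -> {for z, continuous (fun w => act (u w) (y w))}.
Proof.
move=> cu cy NS N /= /(act_continuous (nbhs_singleton NS)) H.
have := near_image (P := fun z => Spin11 z.2 -> N (act z.1 z.2)) (continuous_pair_for cu cy) H.
by apply: filterS2 NS => w Sw /(_ Sw).
Qed.
End ActionContinuity.

(** * Lifts of the global frame to the Spin bundle *)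

Section FrameLifts.
#[local] Opaque dM koszul nabla mdot.
Context {R : realType} {M : surface R} {g : lorentz_metric M} {T : time_orientation g}.
Variable s : M -> frame R.
Hypothesis fn : flat_null_frame g (nullX s) (nullY s).
Hypothesis sP : forall p, in_P T p (s p).
Variable Q : spin_structure T.
Local Notation pr := (@spin_proj _ _ _ _ Q).
Local Notation fr := (@fr _ _ _ _ Q).
Local Notation act := (@act _ _ _ _ Q).

Lemma lam1 (q : Q) : lam s q = 1 -> fr q = s (pr q).
Proof.
move=> E; have [_ E1 E2] := lamP fn sP q; rewrite E scale1r in E1; rewrite E invr1 scale1r in E2.
exact: frame_ext.
Qed.

Lemma normalize (q : Q) : let m := Num.sqrt (lam s q) in
  [/\ m != 0, pr (act q (unspin m)) = pr q & lam s (act q (unspin m)) = 1].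
Proof.
move=> m; have [l0 _ _] := lamP fn sP q; have m0 : m != 0 by rewrite gt_eqF// sqrtr_gt0.
have S := unspin_Spin11 m0; have [E _] := actP q S.
by split=> //; rewrite (lam_act s q S) sp_unspin sqr_sqrtr ?ltW// mulVf// gt_eqF.
Qed.

Lemma normal_section p : exists U (n : M -> Q), [/\ open U, U p &
  forall x, U x -> [/\ pr (n x) = x, lam s (n x) = 1 & {for x, continuous n}]].
Proof.
have [U [sg [L Up]]] := local_section_exists Q p; have [oU _ pU _] := L.
exists U, (fun x => act (sg x) (unspin (Num.sqrt (lam s (sg x))))); split=> // x Ux.
have [m0 E1 E2] := normalize (sg x); rewrite E1 E2 pU//; split=> //.
apply: act_continuous_for; first exact: (section_continuous L Ux).
- have cl : {for x, continuous (fun y => lam s (sg y))} := smoothM_continuous oU Ux (lam_smooth fn L).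
  have cq : {for x, continuous (fun x => Num.sqrt (lam s (sg x)))}.
    by apply: (continuous_comp cl); exact: sqrt_continuous.
  by apply: (continuous_comp cq); exact: unspin_continuous.
by apply: filterE => w; apply: unspin_Spin11; have [] := normalize (sg w).
Qed.

(** [lam] is multiplied by [m^-2] under the action, so two points of a fibre with [lam = 1] differ
    by a sign. *)
Lemma rel_lam1 (q q' : Q) : pr q = pr q' -> lam s q = 1 -> lam s q' = 1 ->
  rel q q' = Num.sg (rel q q') /\ (rel q q' = 1 -> q = q').
Proof.
move=> E l1 l2; have [m0 Eq] := relP E; set m := rel q q' in m0 Eq *.
have Sm := unspin_Spin11 m0; split; last first.
  by move=> m1; rewrite Eq m1 -[X in unspin X](@sp1 R) unspin_sp ?act1//; exact: Spin11_1.
have : m ^+ 2 = 1.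
  by move: l2; rewrite Eq (lam_act s q Sm) sp_unspin l1 mulr1 => /(congr1 GRing.inv); rewrite invrK invr1.
by move/eqP; rewrite sqrf_eq1 => /orP[/eqP ->|/eqP ->]; rewrite ?sgrN sgr1.
Qed.

Lemma path_unique (u u' : R -> Q) : continuous u -> continuous u' -> (forall t, pr (u t) = pr (u' t)) ->
  (forall t, lam s (u t) = 1) -> (forall t, lam s (u' t) = 1) -> u 0 = u' 0 -> forall t, u t = u' t.
Proof.
move=> cu cu' E l1 l2 E0 t; have [S H] := rel_lam1 (E t) (l1 t) (l2 t); apply: H; rewrite S.
have N a : \forall b \near a, Num.sg (rel (u b) (u' b)) = Num.sg (rel (u a) (u' a)).
  by apply: rel_sg_near; [exact: cu|exact: cu'|exact: filterE].
by rewrite (@locally_const _ (fun a => Num.sg (rel (u a) (u' a))) N t 0) -E0 rel_refl sgr1.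
Qed.

Section Lift.
Variable H : R * R -> M.
Hypothesis cH : continuous H.

Definition is_lift (L : R * R -> Q) z := {for z, continuous L} /\
  \forall w \near z, pr (L w) = H w /\ lam s (L w) = 1.

(** The points with [lam = 1] are the two lifts of the frame [s]; over the plane the lifting scheme
    chooses one of them continuously. *)
Lemma lift_exists : exists L : R * R -> Q, [/\ continuous L, forall z, pr (L z) = H z & forall z, lam s (L z) = 1].
Proof.
suff [L SL] : exists L, forall z, is_lift L z.
  exists L; split=> [z|z|z]; first by have [] := SL z.
    by have [_ /nbhs_singleton[]] := SL z.
  by have [_ /nbhs_singleton[]] := SL z.
have near_lift f h z : (\forall w \near z, f w = h w) -> is_lift f z -> is_lift h z.
  move=> N [cf Nf]; split; first exact: near_eq_continuous N cf.
  by apply: filterS2 N Nf => w ->.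
have rigid f h z : is_lift f z -> is_lift h z ->
    (\forall w \near z, f w = h w) \/ (\forall w \near z, f w <> h w).
  move=> [cf Nf] [ch Nh].
  have E : \forall w \near z, pr (f w) = pr (h w) by apply: filterS2 Nf Nh => w [-> _] [-> _].
  have N := rel_sg_near cf ch E.
  have [Ez|Ez] := pselect (f z = h z); [left|right].
    near=> w; have [p1 l1] : pr (f w) = H w /\ lam s (f w) = 1 by near: w.
    have [p2 l2] : pr (h w) = H w /\ lam s (h w) = 1 by near: w.
    have [S K] := rel_lam1 (etrans p1 (esym p2)) l1 l2; apply: K; rewrite S.
    have -> : Num.sg (rel (f w) (h w)) = Num.sg (rel (f z) (h z)) by near: w.
    by rewrite -Ez rel_refl sgr1.
  near=> w; move=> Ew; apply: Ez; have [p1 l1] := nbhs_singleton Nf; have [p2 l2] := nbhs_singleton Nh.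
  have [S K] := rel_lam1 (etrans p1 (esym p2)) l1 l2; apply: K; rewrite S.
  have <- : Num.sg (rel (f w) (h w)) = Num.sg (rel (f z) (h z)) by near: w.
  by rewrite Ew rel_refl sgr1.
have local z0 : exists2 e : R, 0 < e &
    extends_germs is_lift (rect (z0.1 - e) (z0.1 + e) (z0.2 - e) (z0.2 + e)).
  have [U [n [oU Up nP]]] := normal_section (H z0).
  have [e e0 He] : exists2 e : R, 0 < e & forall w,
      rect (z0.1 - e) (z0.1 + e) (z0.2 - e) (z0.2 + e) w -> U (H w).
    by apply: open_rect; apply: (near_image (@cH z0)); exact: open_nbhs_nbhs.
  exists e => // z f zr [_ /nbhs_singleton[pf lf]].
  have [pn ln _] := nP _ (He _ zr).
  have En : pr (n (H z)) = pr (f z) by rewrite pn pf.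
  have [m0 Eq] := relP En; set m := rel _ _ in m0 Eq.
  have Sm := unspin_Spin11 m0; have [mS _] := rel_lam1 En ln lf; rewrite -/m in mS.
  exists (fun w => act (n (H w)) (unspin m)); split; last exact: esym.
  move=> w wr; split.
    apply: act_continuous_for; [|exact: cvg_cst|exact: filterE].
    by have [_ _ cn] := nP _ (He _ wr); apply: continuous_comp cn; exact: cH.
  have NU : \forall w' \near w, U (H w').
    by apply: (near_image (@cH w)); apply: open_nbhs_nbhs; split=> //; exact: He.
  apply: filterS NU => w' Uw'; have [p1 l1 _] := nP _ Uw'; have [p2 _] := actP (n (H w')) Sm.
  rewrite p2 p1 (lam_act s _ Sm) l1 sp_unspin mulr1; split=> //.
  by rewrite mS sqr_sg m0 invr1.
have [U [n [oU U0 nP]]] := normal_section (H (0, 0)).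
have S0 : is_lift (n \o H) (0, 0).
  split; first by have [_ _ cn] := nP _ U0; apply: continuous_comp cn; exact: cH.
  have NU : \forall w \near (0, 0), U (H w) by apply: (near_image (@cH _)); exact: open_nbhs_nbhs.
  by apply: filterS NU => w /nP[].
by have [L [SL _]] := global_solution near_lift rigid local S0; exists L.
Unshelve. all: by end_near.
Qed.
End Lift.
End FrameLifts.

(** * Parallel functions supported in a trivial tube *)

Section TubeFunctions.
#[local] Opaque dM koszul nabla mdot.
Context {R : realType} {M : surface R} {g : lorentz_metric M} {T : time_orientation g}.
Variable s : M -> frame R.
Hypothesis Ss : smooth_frame g setT s.
Hypothesis fn : flat_null_frame g (nullX s) (nullY s).
Hypothesis sP : forall p, in_P T p (s p).
Variable bx : M -> @box R M.
Hypothesis fb : forall p, flow_box_at g (nullX s) (nullY s) p (bx p).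
Variable F : R -> M -> M.
Hypothesis fl : flow_structure bx F.
Local Notation slice := (slice bx).
Local Notation sheet := (sheet bx F).
Variable Q : spin_structure T.
Local Notation pr := (@spin_proj _ _ _ _ Q).
Local Notation fr := (@fr _ _ _ _ Q).
Local Notation act := (@act _ _ _ _ Q).

Lemma smoothM_germ W (f : M -> R) : (forall x, W x -> exists O f', [/\ open O, O x,
    smoothM (F := R^o) O f' & \forall y \near x, f' y = f y]) -> smoothM (F := R^o) W f.
Proof.
move=> H; apply: smoothM_local => x /H[B [f' [oB Bx Sf N]]].
have oI : open (B `&` interior [set y | f' y = f y]) by apply: openI => //; exact: open_interior.
exists (B `&` interior [set y | f' y = f y]), x; split=> //; first exact: dom_self.
move=> n; apply: smoothM_Cn; apply: (smoothM_eq (f := f')) => //; last exact: (smoothMW _ Sf).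
by move=> y [_ /interior_subset].
Qed.

Lemma koszul_frame p z : koszul g p (nullX s p) (fun x => (s x).1 : tangent R) z = 0 /\
  koszul g p (nullX s p) (fun x => (s x).2 : tangent R) z = 0.
Proof.
have SX := fn_X fn; have SY := fn_Y fn; have oT : open [set: M] := openT.
have C (a : R) := @smoothM_cst _ M setT a.
have K (a b : R) (V : M -> tangent R) : (fun x => cst a x *: nullX s x + cst b x *: nullY s x) = V ->
    koszul g p (nullX s p) V z = 0.
  move=> <-; apply: (etrans (koszul_comb g _ z oT Logic.I (C a) (C b) SX SY)).
  by rewrite !dM_cst (koszul_X_X fn) (koszul_X_Y fn); gen_dM; ring.
split; [apply: (K 2^-1 (- 2^-1))|apply: (K 2^-1 2^-1)]; apply/funext => x; apply: row2P;
  rewrite /nullX /nullY !mxE /=; lra.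
Qed.

(* [s] is parallel along the [X]-lines. *)
Lemma horizontal_frame_lift c (q : R -> Q) : X_curve g c -> continuous q -> (forall t, pr (q t) = c t) ->
  (forall t, lam s (q t) = 1) -> horizontal_lift c q.
Proof.
move=> Xc cq pq lq; have [S1 S2 _] := Ss.
have E t : fr (q t) = s (c t) by rewrite (lam1 fn sP (lq t)) pq.
have D1 t z : koszul g (c t) (velocity c t) (fun x => (s x).1 : tangent R) z = 0.
  by have [l ->] := velocity_scale fn t Xc; apply: koszul_scale => //; have [] := koszul_frame (c t) z.
have D2 t z : koszul g (c t) (velocity c t) (fun x => (s x).2 : tangent R) z = 0.
  by have [l ->] := velocity_scale fn t Xc; apply: koszul_scale => //; have [] := koszul_frame (c t) z.
split=> //.
  have -> : (fun t => (fr (q t)).1) = (fun t => (s (c t)).1) by apply/funext => t; rewrite E.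
  exact: (parallel_field Xc.1 fn S1 D1).
have -> : (fun t => (fr (q t)).2) = (fun t => (s (c t)).2) by apply/funext => t; rewrite E.
exact: (parallel_field Xc.1 fn S2 D2).
Qed.

Section Tube.
Variables (x : M) (e : R) (tau : R -> R).
Hypothesis tb : tube bx F x e tau.
Hypothesis triv : forall r, `|r| < e -> X_trivial_along Q (orbit F (slice x r)).
Variable d : R.
Hypothesis d0 : 0 < d.
Hypothesis de : d < e.

(** Clamping the height extends the covering of the tube to the whole plane, where [lift_exists]
    applies. *)
Definition clamped_sheet (z : R * R) : M := sheet x z.1 (clamp (- d) d z.2).

Lemma clamp_small (r : R) : `|clamp (- d) d r| <= d.
Proof.
have d0' : 0 < d := d0; have := @clamp_itv _ (- d) d r; rewrite ler_norml; apply; lra.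
Qed.

Lemma clamped_sheetE t r : `|r| < d -> clamped_sheet (t, r) = sheet x t r.
Proof. by move=> rd; rewrite /clamped_sheet /= clamp_id//; move: rd; rewrite ltr_norml => /andP[/ltW -> /ltW ->]. Qed.

Lemma small_rad (r : R) : `|r| <= d -> `|r| < brad (bx x).
Proof. by move=> rd; apply: le_lt_trans rd (lt_trans de (tube_rad tb)). Qed.

Lemma clamped_sheet_continuous : continuous clamped_sheet.
Proof.
move=> z; have c1 : {for z, continuous (fun w : R * R => w.1)} by exact: cvg_fst.
have c2 : {for z, continuous (fun w : R * R => clamp (- d) d w.2)}.
  by apply: clamp_continuous_for; [exact: cvg_cst|exact: cvg_cst|exact: cvg_snd].
apply: (continuous_comp2_for c1 c2); apply: (sheet_continuous fl).
exact/small_rad/clamp_small.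
Qed.

Variable L : R * R -> Q.
Hypothesis cL : continuous L.
Hypothesis pL : forall z, pr (L z) = clamped_sheet z.
Hypothesis lL : forall z, lam s (L z) = 1.

Lemma line_lift_continuous (a b r : R) : continuous (fun t => L (a * t + b, r)).
Proof.
move=> t; apply: continuous_comp; last exact: cL.
apply: continuous_pair_for; last exact: cvg_cst.
apply: cvgD; last exact: cvg_cst.
by apply: cvgM; [exact: cvg_cst|exact: cvg_id].
Qed.

(** Over one period the lift is horizontal, because [s] is parallel along the lines, so triviality
    closes it up. Uniqueness of lifts carries the identity to every [t]. *)
Lemma lift_period t r : `|r| < d -> L (t + tau r, r) = L (t, r).
Proof.
move=> rd; have re : `|r| < e by exact: lt_trans de.
have t0 := tube_per_gt0 tb re.
have P u : pr (L (u, r)) = sheet x u r by rewrite pL clamped_sheetE.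
have Loop : L (tau r, r) = L (0, r).
  have LP : loop_param g (orbit F (slice x r)) (fun t => F (tau r * t) (slice x r)).
    apply: (orbit_loop_param fn fb fl t0 (tube_per tb re)) => u E.
    by have [_] := tube_inj tb re re E.
  have cq : continuous (fun t => L (tau r * t, r)).
    by move=> u; have := @line_lift_continuous (tau r) 0 r u; under eq_fun do rewrite addr0.
  have H : horizontal_lift (fun t => F (tau r * t) (slice x r)) (fun t => L (tau r * t, r)).
    by apply: horizontal_frame_lift => //; have [] := LP.
  by have := triv re LP H; rewrite mulr1 mulr0.
pose u1 u := L (1 * u + tau r, r); pose u2 u := L (1 * u + 0, r).
have c1 : continuous u1 by exact: line_lift_continuous.
have c2 : continuous u2 by exact: line_lift_continuous.
have pE u : pr (u1 u) = pr (u2 u) by rewrite !P addr0 (sheet_period fl tb).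
have E0 : u1 0 = u2 0 by rewrite /u1 /u2 mulr0 !add0r.
have := path_unique c1 c2 pE (fun _ => lL _) (fun _ => lL _) E0 t.
by rewrite /u1 /u2 mul1r addr0.
Qed.

Lemma lift_unique t t' r r' : `|r| < d -> `|r'| < d -> sheet x t r = sheet x t' r' -> r = r' /\ L (t, r) = L (t', r').
Proof.
move=> rd rd' E; have [rr [k ->]] := sheet_inj fl tb (lt_trans rd de) (lt_trans rd' de) E.
split=> //; rewrite -rr; have nat_per (n : nat) u : L (u + n%:R * tau r, r) = L (u, r).
  elim: n u => [|n IH] u; first by rewrite mul0r addr0.
  by rewrite -(IH u) -(lift_period (u + n%:R * tau r) rd) -natr1 mulrDl mul1r addrA.
case: k => n; first exact: nat_per.
by rewrite -(nat_per n.+1 (t' + _)) NegzE mulrNz mulNr subrK.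
Qed.

Section Profile.
Variables (a w : R).
Hypothesis w0 : 0 < w.
Variable d' : R.
Hypothesis d'd : d' < d.
Hypothesis aw : `|a| + w <= d'.

(** By [lift_unique], [L] descends to a section of [Q] over the tube; the sign compares [q] with it,
    and the bump depends on the height alone. The default 0 is the value off the tube. *)
Definition tube_fun (q : Q) : R := xget 0 [set m | exists t r,
  [/\ `|r| < d, pr q = sheet x t r & m = Num.sg (rel (L (t, r)) q) * bump a w r]].

Lemma tube_funE q t r : `|r| < d -> pr q = sheet x t r -> tube_fun q = Num.sg (rel (L (t, r)) q) * bump a w r.
Proof.
move=> rd E; rewrite /tube_fun; case: xgetP => [m _ [t' [r' [rd' E' ->]]]|N].
  by have [-> ->] := lift_unique rd' rd (etrans (esym E') E).
by exfalso; apply: (N _); exists t, r.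
Qed.

Lemma tube_fun0 q : ~ tube_set bx F x d (pr q) -> tube_fun q = 0.
Proof.
move=> N; rewrite /tube_fun; case: xgetP => // m _ [t [r [rd E _]]].
by exfalso; apply: N; exists t, r.
Qed.

Lemma bump0 r : d' <= `|r| -> bump a w r = 0.
Proof.
move=> H; apply: bump_out; have := lerB_dist r a; have aw' : `|a| + w <= d' := aw; lra.
Qed.

Lemma tube_fun_germ U (sg : M -> Q) p : local_section U sg -> U p -> exists O f', [/\ open O, O p,
  smoothM (F := R^o) O f', dM f' p (nullX s p) = 0 & \forall y \near p, f' y = tube_fun (sg y)].
Proof.
move=> LS Up; have [oU _ pU _] := LS; have csg := section_continuous LS Up.
have NU : \forall y \near p, U y by exact: open_nbhs_nbhs.
(* A point off the tube has a neighbourhood avoiding the closed core of radius [d'], outside which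
   the function vanishes. *)
have [tp|tp] := pselect (tube_set bx F x d p); last first.
  exists setT, (cst 0); split=> //; [exact: openT|exact: smoothM_cst|exact: dM_cst|].
  have oC : open (~` tube_core bx F x d') by apply/closed_openC/(core_closed fl tb); exact: lt_trans de.
  have NC : \forall y \near p, (~` tube_core bx F x d') y.
    apply: open_nbhs_nbhs; split=> // -[t [r [rd E]]]; apply: tp; exists t, r; split=> //.
    exact: le_lt_trans d'd.
  apply: filterS2 NU NC => y Uy Cy; apply/esym.
  have [[t [r [rd E]]]|N] := pselect (tube_set bx F x d y); last by apply: tube_fun0; rewrite pU.
  rewrite (tube_funE rd (etrans (pU y Uy) E)) bump0 ?mulr0//.
  by rewrite leNgt; apply/negP => rd'; apply: Cy; exists t, r; split=> //; exact: ltW.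
have [t [r [rd E]]] := tp; have rr := small_rad (ltW rd).
have pp := center_dom fl p.
have ch : {for p, continuous (bheight (bx p))} by exact: (bheight_continuous (fb_box (fb p)) pp).
have hp : bheight (bx p) p = 0 := center_height fl p.
pose r' y := r + bheight (bx p) y.
pose t' y := t + (btime (bx p) y - btime (bx p) (sheet x t (r' y))).
have cr : {for p, continuous r'} by apply: cvgD; [exact: cvg_cst|exact: ch].
have rp : r' p = r by rewrite /r' hp addr0.
have ct : {for p, continuous t'}.
  apply: cvgD; first exact: cvg_cst.
  apply: cvgB; first exact: (btime_continuous (fb_box (fb p)) pp).
  have c1 : {for p, continuous (fun y => sheet x t (r' y))}.
    apply: (continuous_comp2_for (f := fun=> t) (g := r')); [exact: cvg_cst|exact: cr|].
    by rewrite rp; exact: (sheet_continuous fl).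
  apply: (continuous_comp c1); rewrite rp -E; exact: (btime_continuous (fb_box (fb p)) pp).
have tp' : t' p = t by rewrite /t' rp -E subrr addr0.
have NI : \forall y \near p, y = sheet x (t' y) (r' y).
  by have := sheet_inverse fl t rr; rewrite /= -E.
have Nr : \forall y \near p, `|r' y| < d by apply: near_norm_lt; rewrite ?rp.
have cL' : {for p, continuous (fun y => L (t' y, r' y))}.
  by apply: (continuous_comp (continuous_pair_for ct cr)); exact: cL.
have NE : \forall y \near p, pr (L (t' y, r' y)) = pr (sg y).
  near=> y; have yr : `|r' y| < d by near: y.
  rewrite pL (clamped_sheetE _ yr) pU; last by near: y.
  by apply/esym; near: y.
have NS := rel_sg_near cL' csg NE; set eps := Num.sg (rel (L (t' p, r' p)) _) in NS.
(* Near [p] the tube height is [r] plus the height of the box at [p], hence the shifted centre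
   [a - r]. *)
exists (bdom (bx p)), (fun y => eps * bump (a - r) w (bheight (bx p) y)).
have oB : open (bdom (bx p)) by exact: (bdom_open (fb_box (fb p))).
have Sh := fb_height (fb p).
have Sb : smoothM (F := R^o) (bdom (bx p)) (bump (a - r) w \o bheight (bx p)).
  by apply: (smoothM_comp1 oB Sh) => n; exact: bump_Cn.
have Sf := smoothMM oB (@smoothM_cst _ _ (bdom (bx p)) eps) Sb.
split=> //.
  have Db : dM (bump (a - r) w \o bheight (bx p)) p (nullX s p) = 0.
    have Dh := is_derive_dM (nullX s p) oB pp Sh.
    rewrite (fb_alpha (fb p) _ pp) (nb_XX (fn_basis fn p)) in Dh.
    have Cb := @bump_Cn R 1 (a - r) w.
    have D1 : is_derive ((bheight (bx p) \o chart_inv p) (chart p p)) 1 (bump (a - r) w : R -> R)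
       ('D_1 (bump (a - r) w : R^o -> R^o) ((bheight (bx p) \o chart_inv p) (chart p p))).
      by apply: derivableP; apply: (Cn_derivable Cb).
    have DD := is_derive_comp1 Dh D1; rewrite mulr0 in DD.
    exact: (dM_eq (f := bump (a - r) w \o bheight (bx p)) DD).
  have D := dMM (nullX s p) oB pp (@smoothM_cst _ _ (bdom (bx p)) eps) Sb.
  by apply: (etrans D); rewrite Db dM_cst !mulr0 addr0.
near=> y; have yr : `|r' y| < d by near: y.
have Uy : U y by near: y.
have Ey : pr (sg y) = sheet x (t' y) (r' y) by rewrite pU//; near: y.
rewrite (tube_funE yr Ey); congr (_ * _); first by apply/esym; near: y.
by rewrite /bump /r'; congr (flat 0 _ * flat 0 _); ring.
Unshelve. all: by end_near.
Qed.

Lemma tube_fun_parallel : parallel_fun s tube_fun.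
Proof.
split.
- move=> q y Sy; have [Ey _] := actP q Sy.
  have [[t [r [rd E]]]|N] := pselect (tube_set bx F x d (pr q)); last first.
    by rewrite !tube_fun0 ?mulr0// Ey.
  rewrite (tube_funE rd E) (tube_funE rd (etrans Ey E)) mulrA; congr (_ * _).
  have EL : pr (L (t, r)) = pr q by rewrite pL clamped_sheetE.
  by rewrite (relM EL (etrans EL (esym Ey))) (rel_act _ Sy) sgrM mulrC.
- move=> U sg LS; apply: smoothM_germ => p Up.
  by have [B [f' [oB Bp Sf _ N]]] := tube_fun_germ LS Up; exists B, f'.
move=> U sg p LS Up; have [B [f' [oB Bp Sf D N]]] := tube_fun_germ LS Up.
by rewrite -D; apply: near_eq_dM; apply: filterS N => y ->.
Qed.

Lemma tube_fun_value r : `|r| < d -> tube_fun (L (0, r)) = bump a w r.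
Proof.
move=> rd; rewrite (tube_funE (t := 0) rd); first by rewrite rel_refl sgr1 mul1r.
by rewrite pL clamped_sheetE.
Qed.
End Profile.
End Tube.
End TubeFunctions.

(** * Infinite dimension over a trivial resonant cylinder *)

Section InfiniteDimension.
#[local] Opaque dM koszul nabla mdot.
Context {R : realType} {M : surface R} {g : lorentz_metric M} {T : time_orientation g}.
Variable s : M -> frame R.
Hypothesis Ss : smooth_frame g setT s.
Hypothesis fn : flat_null_frame g (nullX s) (nullY s).
Hypothesis sP : forall p, in_P T p (s p).
Variable bx : M -> @box R M.
Hypothesis fb : forall p, flow_box_at g (nullX s) (nullY s) p (bx p).
Variable F : R -> M -> M.
Hypothesis fl : flow_structure bx F.
Variable Q : spin_structure T.

(** The open cylinder consists of closed lines, and a thin enough tube around one of its points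
    stays in it. *)
Lemma resonant_tube A : X_trivial_resonant Q A -> exists x e tau, tube bx F x e tau /\
  forall r, `|r| < e -> X_trivial_along Q (orbit F (slice bx x r)).
Proof.
move=> [[[l1 [l2 [C [cy AE]]]] _ HA] tA].
have [x Cx] := cylinder_nonempty cy; have oC := cylinder_open fn fb fl cy.
have CA : C `<=` A by rewrite AE; exact: subset_closure.
have cl y : C y -> closed_line g (orbit F y).
  by move=> Cy; apply: (HA y) => //; [exact: CA|exact: (orbit_line fn fb fl)|exact: (orbit_refl fl)].
have [e [tau tb]] : exists e tau, tube bx F x e tau.
  apply: (periodic_tube fl); have /(closed_lineP fn fb fl)[y E [t t0 ty]] := cl x Cx.
  have : orbit F y x by rewrite -E; exact: (orbit_refl fl).
  by move=> [u _ <-]; exists t => //; rewrite !(fs_D fl) addrC -(fs_D fl) ty.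
have e0 := tube_gt0 tb.
have Z0 : `|0 : R| < brad (bx x) by rewrite normr0; exact: lt_trans (tube_rad tb).
have [d /= dp Hd] : \forall r \near (0 : R), C (slice bx x r).
  apply: (near_image (slice_continuous fl Z0)); rewrite (slice0 fl).
  exact: open_nbhs_nbhs.
have m0 : 0 < Num.min d e by rewrite lt_min dp.
exists x, (Num.min d e), tau; split; first by apply: (tubeS tb) => //; rewrite ge_min lexx orbT.
move=> r; rewrite lt_min => /andP[rd re].
have Cr : C (slice bx x r) by apply: Hd; rewrite /= sub0r normrN.
apply: tA; first exact: cl.
by apply: subset_trans CA; exact: (cylinder_orbit fn fb fl cy).
Qed.

Lemma resonant_dim A : X_trivial_resonant Q A -> dim_parallel s Q = +oo%E.
Proof.
move=> /resonant_tube[x [e [tau [tb triv]]]]; have e0 := tube_gt0 tb.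
apply: dim_parallel_oo => n.
pose d := e / 2; have d0 : 0 < d by rewrite divr_gt0.
have de : d < e by rewrite ltr_pdivrMr// ltr_pMr// ltr1n.
have [L [cL pL lL]] := lift_exists fn sP Q (clamped_sheet_continuous fl tb d0 de).
(* The centres [i w], for [i < n], are at least [w] apart, so each bump vanishes at the other
   centres. Dividing by [n + 2] leaves room for the supports within [d' = (n + 1) w < d]. *)
pose w := d / n.+2%:R; have n0 : 0 < n.+2%:R :> R by rewrite ltr0n.
have w0 : 0 < w by rewrite divr_gt0.
have dw : d = n.+2%:R * w by rewrite /w mulrC divfK// gt_eqF.
pose a (i : 'I_n) : R := i%:R * w; pose d' := n.+1%:R * w.
have d'd : d' < d by rewrite dw ltr_pM2r// ltr_nat.
have aw i : `|a i| + w <= d'.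
  rewrite ger0_norm; last by rewrite mulr_ge0// ltW.
  by rewrite /a /d' -{2}[w]mul1r -mulrDl ler_pM2r// natr1 ler_nat; have := ltn_ord i; lia.
have ad i : `|a i| < d by apply: lt_trans d'd; have := aw i; lra.
pose v i := tube_fun bx F x d L (a i) w.
exists (fun i q => Complex (v i q) 0); last first.
  by move=> i; apply: parallel_real; exact: (tube_fun_parallel Ss fn sP fb fl tb triv de cL pL lL d'd (aw i)).
move=> c H j; have := H (L (0, a j)); rewrite (bigD1 j)//= big1 ?addr0; last first.
  move=> i ij; suff -> : v i (L (0, a j)) = 0 by rewrite mulr0.
  rewrite /v (tube_fun_value Ss fn sP fb fl tb triv de cL pL lL)//.
  apply: bump_out; rewrite -mulrBl normrM (gtr0_norm w0) ler_peMl ?(ltW w0)//.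
  have : (i != j :> nat) by []; rewrite neq_ltn => /orP[ij'|ij'].
    have H1 : i%:R + 1 <= j%:R :> R by rewrite natr1 ler_nat.
    by rewrite ler_normr; apply/orP; left; lra.
  have H1 : j%:R + 1 <= i%:R :> R by rewrite natr1 ler_nat.
  by rewrite ler_normr; apply/orP; right; lra.
move/eqP; rewrite mulf_eq0 => /orP[/eqP//|].
rewrite /v (tube_fun_value Ss fn sP fb fl tb triv de cL pL lL)// eq_complex /=.
by rewrite (negbTE (bump_center _ w0)).
Qed.
End InfiniteDimension.

(** * Trivial Spin structures and parallel functions without zeros *)

Section TrivialSpinStructures.
#[local] Opaque dM koszul nabla mdot.
Context {R : realType} {M : surface R} {g : lorentz_metric M} {T : time_orientation g}.
Variable s : M -> frame R.
Variable Q : spin_structure T.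
Local Notation pr := (@spin_proj _ _ _ _ Q).
Local Notation fr := (@fr _ _ _ _ Q).
Local Notation act := (@act _ _ _ _ Q).

(** In a global trivialization the sign of the fibre coordinate is locally constant on sections,
    hence parallel. *)
Lemma spin_trivial_parallel : spin_trivial Q -> exists (v : Q -> R) q, parallel_fun s v /\ v q != 0.
Proof.
move=> [s' [Phi [Psi Tr]]]; have [_ _ _ K _] := Tr.
pose v q := Num.sg (sp (Psi q)).
have Psi0 q : sp (Psi q) != 0 by have [/Spin11_sp[]] := K q Logic.I.
have [p0 _] := @surface_nonempty _ M; have [q _] := fibre_exists Q p0.
exists v, q; split; last by rewrite sgr_eq0.
have cP q' : {for q', continuous (fun q => sp (Psi q))}.
  by apply: (continuous_comp (Psi_continuous openT Tr Logic.I)); exact: sp_continuous.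
have lc U (sg : M -> Q) p : local_section U sg -> U p -> \forall y \near p, v (sg p) = v (sg y).
  move=> L Up; have c : {for p, continuous (fun y => sp (Psi (sg y)))}.
    exact: (continuous_comp (section_continuous L Up) (cP (sg p))).
  by apply: filterS (near_sgr c (Psi0 _)) => y E; exact: esym E.
split.
- by move=> q' y Sy; rewrite /v (act_Psi Tr Logic.I Sy) spM sgrM mulrC.
- move=> U sg L; apply: smoothM_germ => p Up; exists setT, (cst (v (sg p))).
  by split=> //; [exact: openT|exact: smoothM_cst|exact: lc L Up].
move=> U sg p L Up; rewrite -(dM_cst (v (sg p)) p (nullX s p)); apply: near_eq_dM.
by apply: filterS (lc U sg p L Up) => y ->.
Qed.

Hypothesis Ss : smooth_frame g setT s.
Hypothesis fn : flat_null_frame g (nullX s) (nullY s).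
Hypothesis sP : forall p, in_P T p (s p).

Lemma constant_spin_trivial (v : Q -> R) : parallel_fun s v -> (forall q, v q != 0) -> spin_trivial Q.
Proof.
move=> Pv v0.
(* The unit lift of [s] on which [v] is positive. *)
have ex p : exists q, [/\ pr q = p, lam s q = 1 & Num.sg (v q) = 1].
  have [q0 E0] := fibre_exists Q p; have [m0 E1 E2] := normalize fn sP q0.
  set q := act q0 _ in E1 E2; have S := unspin_Spin11 (_ : Num.sg (v q) != 0).
  have s0 : Num.sg (v q) != 0 by rewrite sgr_eq0.
  have [E3 _] := actP q (S s0); exists (act q (unspin (Num.sg (v q)))).
  rewrite E3 E1 E0 (lam_act s q (S s0)) sp_unspin sqr_sg v0 invr1 mul1r E2; split=> //.
  by rewrite (pf_act Pv q (S s0)) sp_unspin sgr_id sgrM sgr_id -expr2 sqr_sg v0.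
have [sigma sP'] := choice ex.
have uniq q q' : pr q = pr q' -> lam s q = lam s q' -> Num.sg (v q) = Num.sg (v q') -> q = q'.
  by move=> E1 E2 E3; apply: (fibre_unique fn sP Pv).
(* Locally [sigma] is a continuous lift of [s] corrected by the sign of [v] on it, which is locally
   constant. *)
have csigma : continuous sigma.
  move=> p; have [U [n [oU Up nP]]] := normal_section fn sP Q p; have [pn ln cn] := nP p Up.
  have cvn : {for p, continuous (fun y => v (n y))}.
    by apply: (continuous_comp cn); exact: (parallel_fun_continuous Pv).
  have Nv := near_sgr cvn (v0 _); set eps := Num.sg (v (n p)) in Nv.
  have e0 : eps != 0 by rewrite sgr_eq0.
  have S := unspin_Spin11 e0.
  have se : Num.sg eps = eps by rewrite /eps sgr_id.
  have ee : eps * eps = 1 by rewrite -expr2 /eps sqr_sg v0.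
  have N : \forall y \near p, act (n y) (unspin eps) = sigma y.
    near=> y; have Uy : U y by near: y; exact: open_nbhs_nbhs.
    have vy : Num.sg (v (n y)) = eps by near: y.
    have [py ly _] := nP y Uy; have [E3 _] := actP (n y) S; have [E4 E5 E6] := sP' y.
    apply: uniq; first by rewrite E3 py E4.
      by rewrite (lam_act s _ S) sp_unspin ly E5 mulr1 -vy sqr_sg v0 invr1.
    by rewrite E6 (pf_act Pv _ S) sp_unspin sgrM vy !se.
  apply: near_eq_continuous N _; apply: act_continuous_for => //; first exact: cvg_cst.
  exact: filterE.
have Es p : pr (sigma p) = p by have [] := sP' p.
have EQ q : pr (sigma (pr q)) = pr q by [].
exists s, (fun z => act (sigma z.1) z.2), (fun q => unspin (rel (sigma (pr q)) q)); split.
- by split.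
- split.
    apply/subspace_continuousP => -[p x] [_ /= Sx] N /= NN.
    have H := act_continuous Sx NN.
    have cz : {for (p, x), continuous (fun z : M * (R * R) => (sigma z.1, z.2))}.
      apply: continuous_pair_for; last exact: cvg_snd.
      by apply: (continuous_comp (f := fst)); [exact: cvg_fst|exact: csigma].
    have := near_image (P := fun z => Spin11 z.2 -> N (act z.1 z.2)) cz H.
    by rewrite /= nbhs_filterE /within /=; apply: filterS => z Hz [_ /= Sz]; exact: Hz.
  apply: continuous_subspaceT => q.
  have cs : {for q, continuous (fun q => sigma (pr q))}.
    by apply: continuous_comp; [exact: spin_proj_continuous|exact: csigma].
  have ci : {for q, continuous (id : Q -> Q)} by exact: cvg_id.
  have cr := rel_continuous cs ci (filterE _ EQ).
  have [m0 _] := relP (EQ q).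
  apply: (@continuous_comp _ _ _ (fun q0 => rel (sigma (pr q0)) q0) (@unspin R)); first exact: cr.
  exact: unspin_continuous.
- move=> p x _ Sx; have [E1 E2] := actP (sigma p) Sx; have [E3 E4 _] := sP' p.
  by rewrite /= E1 E2 E3 (lam1 fn sP E4) E3 (rel_act _ Sx) unspin_sp.
- by move=> q _; have [m0 E] := relP (EQ q); split; [exact: unspin_Spin11|exact: esym].
by move=> p x y _ Sx Sy; rewrite /= actM.
Unshelve. all: by end_near.
Qed.
End TrivialSpinStructures.

(** * The dimension theorem *)

Section MainTheorem.
#[local] Opaque dM koszul mdot.
Context {R : realType} {M : surface R} (g : lorentz_metric M) (T : time_orientation g).

Lemma divergenceN (V : M -> tangent R) p : smooth_vf setT V -> divergence g (fun x => - V x) p = - divergence g V p.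
Proof.
move=> SV; have oT : open [set: M] := openT.
have K u z : koszul g p u (fun x => - V x) z = - koszul g p u V z.
  have C (a : R) := @smoothM_cst _ M setT a.
  have H := koszul_comb g u z oT Logic.I (C (-1)) (C 0) SV SV (p := p).
  have E x : - V x = cst (-1) x *: V x + cst 0 x *: V x by rewrite /= scaleN1r scale0r addr0.
  have SN := smooth_vf_eq (fun x _ => E x) (smooth_vfN SV).
  have KE := koszul_eq (g := g) (p := p) u z oT Logic.I (smooth_vfN SV) SN (fun x _ => E x).
  apply: (etrans KE); apply: (etrans H).
  by have D0 := dM_cst (-1) p u; have D1 := dM_cst 0 p u; move: D0 D1; clear; gen_dM; subst; rewrite /=; ring.
have N u : nabla g p u (fun x => - V x) = - nabla g p u V.
  rewrite /nabla -mulNmx; congr (_ *m _); apply/rowP => j.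
  rewrite [RHS]mxE [X in _ = - X]mxE [LHS]mxE; exact: K.
rewrite /divergence -sumrN; apply: eq_bigr => i _; rewrite N; exact: mxE.
Qed.

Lemma mdotNN (G : 'M[R]_2) (u v : 'rV[R]_2) : mdot G (- u) (- v) = mdot G u v.
Proof. by rewrite !mdotE !mxE; ring. Qed.

Lemma mdotN (G : 'M[R]_2) (u v : 'rV[R]_2) : mdot G (- u) v = - mdot G u v.
Proof. by rewrite !mdotE !mxE; ring. Qed.

Lemma onframeN p (f : frame R) : onframe g p f -> onframe g p (- f.1, - f.2).
Proof.
case=> [n1 n2 n12 o]; split=> /=; rewrite ?mdotNN//.
by move: o; rewrite /oriented_basis !det_rows !mxE !mulrNN.
Qed.

Lemma onframe_timelike p (f : frame R) : onframe g p f -> mdot (g p) f.1 (T p) != 0.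
Proof.
case=> [n1 n2 n12 o]; apply/eqP => Z; have := tvf_timelike T p; rewrite /timelike; move: (T p) Z => w Z.
have [a [b E]] := det_basis w (lt0r_neq0 o); move: Z; rewrite E mdotDl !mdotDr (mdotC f.2 f.1 (gram_sym g p)).
by rewrite n1 n2 n12; nra.
Qed.

(** The sign of g(s1, T) is constant by connectedness. If it is positive, [- s] is still an oriented
    orthonormal frame whose null field has zero divergence. *)
Lemma oriented_flat_frame : X_conformally_flat g -> exists s : M -> frame R,
  [/\ smooth_frame g setT s, flat_null_frame g (nullX s) (nullY s) & forall p, in_P T p (s p)].
Proof.
move=> [s [S1 S2 oS] dS].
have Sh : smoothM (F := R^o) setT (fun p => mdot (g p) (s p).1 (T p)).
  exact: (smooth_metric g openT S1 (tvf_smooth T)).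
have flat s' : smooth_frame g setT s' -> (forall p, divergence g (nullX s') p = 0) ->
    flat_null_frame g (nullX s') (nullY s').
  move=> [S1' S2' oS'] D.
  have HX : smooth_vf setT (fun p => (s' p).1 + (s' p).2 : tangent R) := smooth_vfD S1' S2'.
  have HY : smooth_vf setT (fun p => - (s' p).1 + (s' p).2 : tangent R) := smooth_vfD (smooth_vfN S1') S2'.
  apply: FlatNullFrame; [exact: HX|exact: HY| |exact: D].
  by move=> p; apply/onframe_null; exact: oS'.
have sgc := @connected_constant _ M (fun p => Num.sg (mdot (g p) (s p).1 (T p))).
have {}sgc x y : Num.sg (mdot (g x) (s x).1 (T x)) = Num.sg (mdot (g y) (s y).1 (T y)).
  apply: sgc => z; apply: near_sgr; first exact: (smoothM_continuous openT Logic.I Sh).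
  by apply: onframe_timelike; exact: oS.
have [p0 _] := @surface_nonempty _ M.
have := onframe_timelike (oS p0 Logic.I); rewrite neq_lt => /orP[neg|pos].
  exists s; split; [by []|exact: flat|] => p; split; first exact: oS.
  by rewrite -sgr_lt0 (sgc p p0) sgr_lt0.
pose s' p := (- (s p).1, - (s p).2) : frame R; exists s'.
have Ss' : smooth_frame g setT s'.
  by split; [exact: smooth_vfN|exact: smooth_vfN|move=> p _; apply: onframeN; exact: oS].
split; [exact: Ss'| |].
  apply: (flat s' Ss') => p; have SX : smooth_vf setT (nullX s) by exact: smooth_vfD.
  have -> : nullX s' = (fun x => - nullX s x) by apply/funext => x; rewrite /nullX opprD.
  by rewrite (divergenceN _ SX) dS oppr0.
move=> p; split; first by apply: onframeN; exact: oS.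
by rewrite /= mdotN oppr_lt0 -sgr_gt0 (sgc p p0) sgr_gt0.
Qed.

Lemma flow_exists (X Y : M -> tangent R) : compact [set: M] -> flat_null_frame g X Y -> exists bx F,
  (forall p, flow_box_at g X Y p (bx p)) /\ flow_structure bx F.
Proof.
move=> cM fn; have [bx fb] := choice (flow_box_exists fn).
have [F [F0 FD Fc FL]] := global_flow (X_atlas fb) (@surface_hausdorff _ M) cM.
by exists bx, F; split=> //; split=> //; [exact: X_atlas fb|exact: surface_hausdorff].
Qed.

(** If all squares are constant, a nonzero [v] has no zero and trivializes [Q], and a trivialization
    conversely gives such a [v]. Without a trivial resonant cylinder, dimension 1 thus occurs
    exactly for the trivial structure. *)
Lemma dimension_dichotomy (Q : spin_structure T) (s : M -> frame R) :
  compact [set: M] -> smooth_frame g setT s -> flat_null_frame g (nullX s) (nullY s) -> (forall p, in_P T p (s p)) ->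
  ((exists A, X_trivial_resonant Q A) -> delta_plus Q = +oo%E) /\
  (~ (exists A, X_trivial_resonant Q A) -> delta_plus Q = 0%E /\ ~ spin_trivial Q \/
     delta_plus Q = 1%E /\ spin_trivial Q).
Proof.
move=> cM Ss fn sP; have [bx [F [fb fl]]] := flow_exists cM fn; rewrite (delta_plusE fn sP Q); split.
  by move=> [A HA]; exact: (resonant_dim Ss fn sP fb fl HA).
move=> N; have cs (v : Q -> R) : parallel_fun s v -> forall q q', v q ^+ 2 = v q' ^+ 2.
  by move=> Pv q q'; apply/eqP/negPn/negP => ne; apply: N; exact: (nonconstant_resonant fn sP fb fl Pv ne).
have [D|[D [v [q [Pv v0]]]]] := dim_parallel_le1 cs; rewrite D; [left|right]; split=> //.
  move=> /(spin_trivial_parallel s)[v [q [Pv v0]]]; have := dim_parallel_ge1 Pv v0.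
  by rewrite D lee_fin ler10.
apply: (constant_spin_trivial Ss fn sP Pv) => q'; apply/eqP => Z.
by move: (cs v Pv q q') v0; rewrite Z expr0n => /eqP; rewrite expf_eq0 /= => /eqP ->; rewrite eqxx.
Qed.
End MainTheorem.

Theorem theorem4p48 (R : realType) (M : surface R) (g : lorentz_metric M)
    (T : time_orientation g) (Q : spin_structure T) :
  compact [set: M] -> X_conformally_flat g ->
  [/\ delta_plus Q = tau_minus Q,
      [\/ delta_plus Q = 0%E, delta_plus Q = 1%E | delta_plus Q = +oo%E],
      [/\ (delta_plus Q <= 1)%E <->
            [\/ exists l, dense_line g l,
                nonresonant_surface g
              | ~ exists A, X_trivial_resonant Q A],
          (exists l, dense_line g l) ->
            forall Q' : spin_structure T,
              ~ spin_trivial Q' -> delta_plus Q' = 0%E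
        & forall Q' : spin_structure T,
            spin_trivial Q' -> (delta_plus Q' <= 1)%E -> delta_plus Q' = 1%E]
    & (delta_plus Q = +oo%E <-> exists A, X_trivial_resonant Q A) /\
      forall Q' : spin_structure T,
        (exists A, X_trivial_resonant Q' A) -> delta_plus Q' = +oo%E].
Proof.
move=> cM /(oriented_flat_frame T)[s [Ss fn sP]].
have dich (Q' : spin_structure T) := dimension_dichotomy Q' cM Ss fn sP.
have res_oo (Q' : spin_structure T) := (dich Q').1.
have no_res (Q' : spin_structure T) := (dich Q').2.
have [bx [F [fb fl]]] := flow_exists cM fn.
(* Conditions (a) and (b) exclude every resonant cylinder, for any Spin structure; each therefore
   implies (c), and the disjunction amounts to (c). *)
have dense_no (Q' : spin_structure T) : (exists l, dense_line g l) -> ~ exists A, X_trivial_resonant Q' A.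
  by move=> [l dl] [A [rA _]]; exact: (dense_no_resonant fn fb fl dl rA).
have nonres_no (Q' : spin_structure T) : nonresonant_surface g -> ~ exists A, X_trivial_resonant Q' A.
  by move=> nr [A [rA _]]; exact: (nonresonant_no_resonant fn fb fl nr rA).
have le1_no (Q' : spin_structure T) : (delta_plus Q' <= 1)%E -> ~ exists A, X_trivial_resonant Q' A.
  by move=> le1 /res_oo E; move: le1; rewrite E leye_eq.
split.
- by rewrite (delta_plusE fn sP) (tau_minusE fn sP).
- have [/res_oo ->|/no_res[[-> _]|[-> _]]] := pselect (exists A, X_trivial_resonant Q A).
  + exact: Or33.
  + exact: Or31.
  + exact: Or32.
- split.
  + split=> [/le1_no|H]; first exact: Or33.
    have/no_res[[-> _]|[-> _]] : ~ exists A, X_trivial_resonant Q A.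
      by case: H => //; [exact: dense_no|exact: nonres_no].
    * exact: lee01.
    * exact: lexx.
  + by move=> dl Q' nt; have [[]|[_]] := no_res Q' (dense_no Q' dl).
  + by move=> Q' t le1; have [[_]|[]] := no_res Q' (le1_no Q' le1).
split; last exact: res_oo.
split=> [E|]; last exact: res_oo.
apply: contrapT => /no_res[[]|[]]; by rewrite E.
Qed.
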